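(* Let $f(0)=0$ and let conditions (B), (C), (D) stated in the context be fulfilled, with $N\ge N^*$. Let the operator $B(0)$ have a bounded inverse. Then the equation $$\int_0^tK(t,s)x(s)\,ds=f(t),\qquad 0\le t\le T'\le T,$$ has in $\mathbb C_{([0,T'];E_1)}$ a solution $$x(t)=\hat x(t)+t^{N^*}u(t)$$ which depends on $\sum_{i=1}^{\nu}r_ik_i$ arbitrary constants. Moreover, $\hat x$ can be constructed as a logarithm-power sum $\hat x(t)=\sum_{j=0}^Nx_j(\ln t)\,t^j$, where the $x_j$ are polynomials in $\ln t$ with coefficients in $E_1$, and, given $\hat x$, the continuous function $u$ is uniquely determined and computed by successive approximations. The asymptotic estimate $\|x(t)-\hat x(t)\|_{E_1}=\mathcal O(t^{N^*})$ holds as $t\to+0$.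
   Context: $E_1,E_2$ are Banach spaces, $T>0$, $n\ge1$; $\mathbb C_{([0,T'];E_1)}$ is the space of continuous functions $[0,T']\to E_1$; $\mathcal L(X\to Y)$ denotes bounded linear operators. Functions $\alpha_1,\dots,\alpha_{n-1}$ are continuously differentiable on $[0,T]$, with $\alpha_i(0)=0$, $0<\alpha_1(t)<\dots<\alpha_{n-1}(t)<t$ for $t\in(0,T)$, and $0<\alpha_1'(0)<\dots<\alpha_{n-1}'(0)<1$. Put $\alpha_0(t)=0$, $\alpha_n(t)=t$. The regions are $D_i=\{(t,s):0<t<T,\ \alpha_{i-1}(t)<s<\alpha_i(t)\}$, $i=1,\dots,n$. For each $i$, $K_i:\overline{D_i}\to\mathcal L(E_1\to E_2)$ and $K_i^{(1)}=\partial K_i/\partial t:\overline{D_i}\to\mathcal L(E_1\to E_2)$ are continuous in operator norm. $K_n(t,t)$ has a bounded inverse for $t\in[0,T]$. The function $f:[0,T]\to E_2$ is continuous with continuous derivative. $K(t,s)=K_i(t,s)$ on $D_i$, and $$\int_0^tK(t,s)x(s)\,ds:=\sum_{i=1}^n\int_{\alpha_{i-1}(t)}^{\alpha_i(t)}K_i(t,s)x(s)\,ds.$$ Condition (B): there are operator polynomials $\mathcal P_i(t,s)=\sum_{\nu+\mu=0}^NK_{i\nu\mu}t^\nu s^\mu$, $i=1,\dots,n$, with $K_{i\nu\mu}\in\mathcal L(E_1\to E_2)$, a vector-function $f^N(t)=\sum_{\nu=1}^Nf_\nu t^\nu$ with $f_\nu\in E_2$, and polynomials $\alpha_i^N(t)=\sum_{\nu=1}^N\alpha_{i\nu}t^\nu$,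 $i=1,\dots,n-1$, with $0<\alpha_{11}<\alpha_{21}<\dots<\alpha_{n-1,1}<1$, such that as $t\to+0$, $s\to+0$: $\|K_i(t,s)-\mathcal P_i(t,s)\|_{\mathcal L(E_1\to E_2)}=\mathcal O((t+s)^{N+1})$, $\|f(t)-f^N(t)\|_{E_2}=\mathcal O(t^{N+1})$, $|\alpha_i(t)-\alpha_i^N(t)|=\mathcal O(t^{N+1})$. Characteristic operator: for $j\in[0,\infty)$, $$B(j)=K_n(0,0)+\sum_{i=1}^{n-1}(\alpha_i'(0))^{1+j}\bigl(K_i(0,0)-K_{i+1}(0,0)\bigr)\in\mathcal L(E_1\to E_2),$$ and $B^{(m)}(j)$ is its $m$-th derivative in $j$. A point $j^*$ is regular if $B(j^* )$ has a bounded inverse. Let $N(\cdot)$ denote the null space and $B'(j^* )$ the conjugate (adjoint) operator. ''Fredholm operator'' means Fredholm of index zero. For $p\ge1$, $j^*$ is a singular Fredholm point of index $p$ if $B(j^* )$ is a Fredholm operator with non-trivial null space, $N(B(j^* ))\subset\bigcap_{m=1}^{p-1}N(B^{(m)}(j^* ))$ (no condition when $p=1$), and $\det[\langle B^{(p)}(j^* )\phi_i,\psi_k\rangle]_{i,k=1}^r\ne0$, where $\{\phi_i\}_1^r$ is a basis of $N(B(j^* ))$ and $\{\psi_i\}_1^r$ a basis of $N(B'(j^* ))$. Condition (C): every point of $\{0,1,\dots,N\}$ is either a regular point of $B(j)$ or one of singular Fredholm points $j_1,\dots,j_\nu$, where $j_i$ has index $k_i$ and $\dim N(B(j_i))=r_i$,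 $i=1,\dots,\nu$ (if there are only regular points, $\nu=0$). Condition (D): numbers $\varepsilon\in(0,1)$, $T'\in(0,T]$ are such that $\max_{1\le i\le n-1,\,t\in[0,T']}|\alpha_i'(t)|\le\varepsilon$ and $\sup_{1\le i\le n-1,\,t\in(0,T']}\alpha_i(t)/t\le\varepsilon$; $K_n(t,t)$ has a bounded inverse for $t\in[0,T']$; and the non-negative integer $N^*$ satisfies, for some $q<1$, $$\sup_{t\in(0,T')}\varepsilon^{N^*}\sum_{i=1}^{n-1}|\alpha_i'(t)|\,\bigl\|K_n^{-1}(t,t)\bigl(K_i(t,\alpha_i(t))-K_{i+1}(t,\alpha_i(t))\bigr)\bigr\|_{\mathcal L(E_1\to E_1)}\le q<1.$$ Successive approximations for $u$: with $$F(x)(t)=K_n(t,t)x(t)+\sum_{i=1}^{n-1}\alpha_i'(t)\{K_i(t,\alpha_i(t))-K_{i+1}(t,\alpha_i(t))\}x(\alpha_i(t))+\sum_{i=1}^n\int_{\alpha_{i-1}(t)}^{\alpha_i(t)}K_i^{(1)}(t,s)x(s)\,ds-f'(t),$$ $$(Lu)(t)=K_n^{-1}(t,t)\sum_{i=1}^{n-1}\alpha_i'(t)\Bigl(\tfrac{\alpha_i(t)}t\Bigr)^{N^*}\{K_i(t,\alpha_i(t))-K_{i+1}(t,\alpha_i(t))\}u(\alpha_i(t)),$$ $$(\mathcal Ku)(t)=\sum_{i=1}^n\int_{\alpha_{i-1}(t)}^{\alpha_i(t)}K_n^{-1}(t,t)K_i^{(1)}(t,s)\Bigl(\tfrac st\Bigr)^{N^*}u(s)\,ds,\qquad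 \gamma(t)=-K_n^{-1}(t,t)F(\hat x)(t)/t^{N^*},$$ $u$ is the limit of $u_m=-(L+\mathcal K)u_{m-1}+\gamma$, $u_0=\gamma$. ''Depends on $m$ arbitrary constants'' means that there is a family of such solutions parametrized injectively by $m$ free scalar parameters (entering $\hat x$ through its coefficients).
   Formalization: False for merely C^1 data; condition (B) is strengthened so its expansions may be differentiated in t: the t-derivative of K_i-P_i is O((t+s)^N), and (f-f^N)', (alpha_i-alpha_i^N)' have the form c t^N+o(t^N) as t->+0 (automatic for C^{N+1} data). *)

(* Defs.v *)
From Stdlib Require Import Reals.
From Coquelicot Require Import Coquelicot.

Set Implicit Arguments.
Unset Strict Implicit.

Open Scope R_scope.

(** * Real and complex Banach spaces

    A Banach space is a [CompleteNormedModule (scalars k)].  Linearity, bases,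
    functionals and determinants use [scalars k]; derivatives and integrals in
    the real variable use the underlying real Banach space [realify E]. *)

Inductive scalar_field : Set := real_scalars | complex_scalars.

Definition scalars (k : scalar_field) : AbsRing :=
  match k with real_scalars => R_AbsRing | complex_scalars => C_AbsRing end.

Definition of_real (k : scalar_field) : R -> scalars k :=
  match k return R -> scalars k with
  | real_scalars => fun r => r
  | complex_scalars => RtoC
  end.

Lemma of_real_one k : of_real k 1 = one.
Proof. destruct k; reflexivity. Qed.

Lemma of_real_mult k (a b : R) :
  of_real k (a * b) = mult (of_real k a) (of_real k b).
Proof. destruct k; [reflexivity | apply RtoC_mult]. Qed.

Lemma of_real_plus k (a b : R) :
  of_real k (a + b) = plus (of_real k a) (of_real k b).
Proof. destruct k; [reflexivity | apply RtoC_plus]. Qed.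

Lemma abs_of_real k (a : R) : abs (of_real k a) = Rabs a.
Proof. destruct k; [reflexivity | apply Cmod_R]. Qed.

Section Realification.

Context {k : scalar_field}.

Definition rscal {V : ModuleSpace (scalars k)} (r : R) (x : V) : V :=
  scal (of_real k r) x.

Section RealScalars.

Variable V : ModuleSpace (scalars k).

Lemma rscal_assoc (a b : R) (x : V) : rscal a (rscal b x) = rscal (a * b) x.
Proof. unfold rscal; rewrite scal_assoc, of_real_mult; reflexivity. Qed.

Lemma rscal_one (x : V) : rscal 1 x = x.
Proof. unfold rscal; rewrite of_real_one; apply scal_one. Qed.

Lemma rscal_distr_l (a : R) (x y : V) :
  rscal a (plus x y) = plus (rscal a x) (rscal a y).
Proof. unfold rscal; apply scal_distr_l. Qed.

Lemma rscal_distr_r (a b : R) (x : V) :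
  rscal (a + b) x = plus (rscal a x) (rscal b x).
Proof. unfold rscal; rewrite of_real_plus; exact (scal_distr_r (of_real k a) (of_real k b) x). Qed.

End RealScalars.

Variable E : CompleteNormedModule (scalars k).

Lemma norm_rscal (a : R) (x : E) : norm (rscal a x) <= Rabs a * norm x.
Proof. unfold rscal; rewrite <- (abs_of_real k); exact (norm_scal (of_real k a) x). Qed.

Definition realify_ModuleSpace_class : ModuleSpace.class_of R_Ring E :=
  @ModuleSpace.Class R_Ring E (AbelianGroup.class E)
    (@ModuleSpace.Mixin R_Ring E rscal
       (@rscal_assoc E) (@rscal_one E) (@rscal_distr_l E) (@rscal_distr_r E)).

Definition realify_NormedModuleAux_class : NormedModuleAux.class_of R_AbsRing E :=
  @NormedModuleAux.Class R_AbsRing E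
    realify_ModuleSpace_class (UniformSpace.class E).

Definition realify_NormedModule_class : NormedModule.class_of R_AbsRing E :=
  @NormedModule.Class R_AbsRing E realify_NormedModuleAux_class
    (@NormedModule.Mixin R_AbsRing
       (NormedModuleAux.Pack R_AbsRing E realify_NormedModuleAux_class E)
       (@norm _ E) (@norm_factor _ E) (@norm_triangle _ E) norm_rscal
       (@norm_compat1 _ E) (@norm_compat2 _ E) (@norm_eq_zero _ E)).

Definition realify : CompleteNormedModule R_AbsRing :=
  CompleteNormedModule.Pack R_AbsRing E
    (@CompleteNormedModule.Class R_AbsRing E realify_NormedModule_class
       (CompleteNormedModule.mixin _ _ (CompleteNormedModule.class _ E))) E.

End Realification.

(** * Calculus *)

Definition closure {X : UniformSpace} (D : X -> Prop) (p : X) : Prop :=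
  forall P : X -> Prop, locally p P -> exists q, D q /\ P q.

Definition is_C1_on {V : NormedModule R_AbsRing} (a b : R) (f df : R -> V) : Prop :=
  (forall t, a <= t <= b ->
     filterdiff f (within (fun s => a <= s <= b) (locally t))
       (fun h => scal h (df t))) /\
  continuous_on (fun t => a <= t <= b) df.

Definition vderive {V : CompleteNormedModule R_AbsRing} (f : R -> V) (t : R) : V :=
  iota (fun l => is_derive f t l).

Fixpoint vderive_n {V : CompleteNormedModule R_AbsRing} (f : R -> V) (m : nat) :
  R -> V :=
  match m with O => f | S m => vderive (vderive_n f m) end.

Definition uniform_limit_on {K : AbsRing} {V : NormedModule K}
  (D : R -> Prop) (u_ : nat -> R -> V) (u : R -> V) : Prop :=
  forall eps : posreal, exists M : nat, forall m, (M <= m)%nat ->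
  forall t, D t -> norm (minus (u_ m t) (u t)) < eps.

(** * Bounded operators: maps satisfying [is_linear], which includes boundedness *)

Section Operators.

Context {K : AbsRing} {U V : NormedModule K}.

Definition opnorm (A : U -> V) : R :=
  real (Lub_Rbar (fun r => exists x, norm x <= 1 /\ r = norm (A x))).

Definition op_minus (A B : U -> V) : U -> V := fun x => minus (A x) (B x).

Definition op_continuous_on (D : R * R -> Prop) (A : R -> R -> U -> V) : Prop :=
  forall p, D p ->
  filterlim (fun q => opnorm (op_minus (A (fst q) (snd q)) (A (fst p) (snd p))))
    (within D (locally p)) (locally 0).

Definition is_bounded_inverse (A : U -> V) (A' : V -> U) : Prop :=
  is_linear A' /\ (forall x, A' (A x) = x) /\ (forall y, A (A' y) = y).

Definition has_bounded_inverse (A : U -> V) : Prop :=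
  exists A', is_bounded_inverse A A'.

Definition null_space (A : U -> V) (x : U) : Prop := A x = zero.

Definition range (A : U -> V) (y : V) : Prop := exists x, y = A x.

(** [psi] is in the null space of the conjugate operator, which maps a bounded
    functional [psi] to [fun x => psi (A x)]. *)
Definition conj_null_space (A : U -> V) (psi : V -> AbsRing_NormedModule K) : Prop :=
  is_linear psi /\ forall x, psi (A x) = zero.

End Operators.

(** Finite families are indexed from 1; [sum_n_m a 1 0 = zero]. *)

Section Bases.

Context {K : AbsRing} {V : NormedModule K}.

Definition is_basis (S : V -> Prop) (r : nat) (e : nat -> V) : Prop :=
  (forall i, (1 <= i <= r)%nat -> S (e i)) /\
  (forall c : nat -> K, sum_n_m (fun i => scal (c i) (e i)) 1 r = zero ->
     forall i, (1 <= i <= r)%nat -> c i = zero) /\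
  (forall x, S x ->
     exists c : nat -> K, x = sum_n_m (fun i => scal (c i) (e i)) 1 r).

Definition is_functional_basis (S : (V -> AbsRing_NormedModule K) -> Prop)
  (r : nat) (psi : nat -> V -> AbsRing_NormedModule K) : Prop :=
  (forall i, (1 <= i <= r)%nat -> S (psi i)) /\
  (forall c : nat -> K,
     (forall y, sum_n_m (fun i => scal (c i) (psi i y)) 1 r = zero) ->
     forall i, (1 <= i <= r)%nat -> c i = zero) /\
  (forall p, S p -> exists c : nat -> K, forall y,
     p y = sum_n_m (fun i => scal (c i) (psi i y)) 1 r).

Definition has_dim (S : V -> Prop) (r : nat) : Prop :=
  exists e, is_basis S r e.

(** [z_1, ..., z_r] induce a basis of the quotient of [V] by [S]. *)
Definition has_codim (S : V -> Prop) (r : nat) : Prop :=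
  exists z : nat -> V,
  (forall c : nat -> K, S (sum_n_m (fun i => scal (c i) (z i)) 1 r) ->
     forall i, (1 <= i <= r)%nat -> c i = zero) /\
  (forall y, exists (s : V) (c : nat -> K),
     S s /\ y = plus s (sum_n_m (fun i => scal (c i) (z i)) 1 r)).

End Bases.

Definition fredholm_index_zero {K : AbsRing} {U V : NormedModule K}
  (A : U -> V) : Prop :=
  is_linear A /\ closed (range A) /\
  exists r, has_dim (null_space A) r /\ has_codim (range A) r.

(** Determinant of [(A i l)], [1 <= i, l <= r], by expansion along the first row. *)
Fixpoint det {K : Ring} (r : nat) (A : nat -> nat -> K) : K :=
  match r with
  | O => one
  | S r' =>
      sum_n_m (fun l =>
        mult (mult (pow_n (opp one) (S l)) (A 1%nat l))
          (det r' (fun i m => A (S i) (if Nat.ltb m l then m else S m)))) 1 r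
  end.

(** * The Volterra equation *)

(** [lo < a 1 < ... < a m < hi] *)
Definition chain (lo : R) (a : nat -> R) (m : nat) (hi : R) : Prop :=
  (forall i, (1 <= i <= m)%nat -> lo < a i < hi) /\
  (forall i, (1 <= i < m)%nat -> a i < a (S i)).

Definition log_power_sum {k} {E : ModuleSpace (scalars k)}
  (N d : nat) (X : nat -> nat -> E) (t : R) : E :=
  sum_n_m (fun j =>
    rscal (t ^ j) (sum_n_m (fun l => rscal (ln t ^ l) (X j l)) 0 d)) 0 N.

Section Volterra.

Context {k : scalar_field} {E1 E2 : CompleteNormedModule (scalars k)}.

Variables (T : R) (n : nat).

(** [alpha 0 t = 0] and [alpha n t = t] are part of the family; [dalpha] is the
    family of derivatives. *)
Variables alpha dalpha : nat -> R -> R.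

Definition curves_ok : Prop :=
  (forall t, alpha 0%nat t = 0) /\ (forall t, alpha n t = t) /\
  (forall i, (1 <= i <= n - 1)%nat ->
     is_C1_on 0 T (alpha i) (dalpha i) /\ alpha i 0 = 0) /\
  (forall t, 0 < t < T -> chain 0 (fun i => alpha i t) (n - 1) t) /\
  chain 0 (fun i => dalpha i 0) (n - 1) 1.

Definition region (i : nat) (p : R * R) : Prop :=
  0 < fst p < T /\ alpha (i - 1) (fst p) < snd p < alpha i (fst p).

(** The kernels only matter on [closure (region i)]; [K1 i] is the derivative of
    [K i] in its first variable on [region i], extended continuously to the
    closure. *)
Variables K K1 : nat -> R -> R -> E1 -> E2.

Definition kernels_ok : Prop :=
  forall i, (1 <= i <= n)%nat ->
  (forall p, closure (region i) p ->
     is_linear (K i (fst p) (snd p)) /\ is_linear (K1 i (fst p) (snd p))) /\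
  op_continuous_on (closure (region i)) (K i) /\
  op_continuous_on (closure (region i)) (K1 i) /\
  (forall t s, region i (t, s) ->
     filterlim (fun h => opnorm (fun y =>
         minus (rscal (/ h) (minus (K i (t + h) s y) (K i t s y))) (K1 i t s y)))
       (locally' 0) (locally 0)).

Variables f df : R -> E2.

Definition volterra (x : R -> E1) (t : R) : E2 :=
  sum_n_m (fun i => RInt (V := realify E2) (fun s => K i t s (x s))
                      (alpha (i - 1) t) (alpha i t)) 1 n.

Definition is_solution (T' : R) (x : R -> E1) : Prop :=
  continuous_on (fun t => 0 <= t <= T') x /\
  forall t, 0 <= t <= T' -> volterra x t = f t.

Definition jump (i : nat) (t : R) : E1 -> E2 :=
  op_minus (K i t (alpha i t)) (K (S i) t (alpha i t)).

(** ** Asymptotic expansions at 0 *)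

Section Expansions.

Variables (N : nat) (Kc : nat -> nat -> nat -> E1 -> E2)
  (fc : nat -> E2) (ac : nat -> nat -> R).

Definition kernel_poly (i : nat) (t s : R) (y : E1) : E2 :=
  sum_n_m (fun nu => sum_n_m (fun mu =>
    rscal (t ^ nu * s ^ mu) (Kc i nu mu y)) 0 (N - nu)) 0 N.

Definition kernel_poly_dt (i : nat) (t s : R) (y : E1) : E2 :=
  sum_n_m (fun nu => sum_n_m (fun mu =>
    rscal (INR nu * t ^ (nu - 1) * s ^ mu) (Kc i nu mu y)) 0 (N - nu)) 0 N.

Definition f_poly (t : R) : E2 := sum_n_m (fun nu => rscal (t ^ nu) (fc nu)) 1 N.

Definition f_poly_dt (t : R) : E2 :=
  sum_n_m (fun nu => rscal (INR nu * t ^ (nu - 1)) (fc nu)) 1 N.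

Definition alpha_poly (i : nat) (t : R) : R :=
  sum_n_m (fun nu => ac i nu * t ^ nu) 1 N.

Definition alpha_poly_dt (i : nat) (t : R) : R :=
  sum_n_m (fun nu => ac i nu * (INR nu * t ^ (nu - 1))) 1 N.

Definition condition_B : Prop :=
  (forall i nu mu, (1 <= i <= n)%nat -> (nu + mu <= N)%nat ->
     is_linear (Kc i nu mu)) /\
  chain 0 (fun i => ac i 1%nat) (n - 1) 1 /\
  (forall i, (1 <= i <= n)%nat -> exists M,
     within (region i) (locally (0, 0)) (fun p =>
       opnorm (op_minus (K i (fst p) (snd p)) (kernel_poly i (fst p) (snd p)))
         <= M * (fst p + snd p) ^ (N + 1))) /\
  (exists M, at_right 0 (fun t =>
     norm (minus (f t) (f_poly t)) <= M * t ^ (N + 1))) /\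
  (forall i, (1 <= i <= n - 1)%nat -> exists M, at_right 0 (fun t =>
     Rabs (alpha i t - alpha_poly i t) <= M * t ^ (N + 1))).

(** The expansions of [condition_B] may be differentiated in [t]: the remainder
    of [K i] has [t]-derivative [O((t + s) ^ N)], and those of [f] and [alpha i]
    have derivative [c * t ^ N + o(t ^ N)].  By Taylor's formula this holds for
    data of class [C^(N+1)], but it does not follow from [condition_B] for data
    of class [C^1]. *)
Definition condition_B_differentiable : Prop :=
  (forall i, (1 <= i <= n)%nat -> exists M,
     within (region i) (locally (0, 0)) (fun p =>
       opnorm (op_minus (K1 i (fst p) (snd p)) (kernel_poly_dt i (fst p) (snd p)))
         <= M * (fst p + snd p) ^ N)) /\
  (exists c : E2, filterlim
     (fun t => rscal (/ t ^ N) (minus (df t) (f_poly_dt t)))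
     (at_right 0) (locally c)) /\
  (forall i, (1 <= i <= n - 1)%nat -> exists c : R, filterlim
     (fun t => (dalpha i t - alpha_poly_dt i t) / t ^ N)
     (at_right 0) (locally c)).

End Expansions.

(** ** The characteristic operator *)

Definition B (j : R) (y : E1) : E2 :=
  plus (K n 0 0 y)
    (sum_n_m (fun i => rscal (Rpower (dalpha i 0) (1 + j))
                         (minus (K i 0 0 y) (K (S i) 0 0 y))) 1 (n - 1)).

Definition B_deriv (m : nat) (j : R) (y : E1) : E2 :=
  vderive_n (V := realify E2) (fun j => B j y) m j.

Definition regular_point (j : R) : Prop := has_bounded_inverse (B j).

Definition singular_fredholm_point (j : R) (p : nat) : Prop :=
  (1 <= p)%nat /\
  fredholm_index_zero (B j) /\
  (exists y, null_space (B j) y /\ y <> zero) /\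
  (forall m, (1 <= m <= p - 1)%nat ->
     forall y, null_space (B j) y -> null_space (B_deriv m j) y) /\
  exists (r : nat) (phi : nat -> E1) (psi : nat -> E2 -> AbsRing_NormedModule (scalars k)),
    is_basis (null_space (B j)) r phi /\
    is_functional_basis (conj_null_space (B j)) r psi /\
    det (K := scalars k) r (fun i l => psi l (B_deriv p j (phi i))) <> zero.

(** [js 1, ..., js nu] are the singular points in [{0, ..., N}], with indices
    [ks i] and null spaces of dimension [rs i]. *)
Definition condition_C (N nu : nat) (js ks rs : nat -> nat) : Prop :=
  (forall i, (1 <= i <= nu)%nat ->
     (js i <= N)%nat /\
     singular_fredholm_point (INR (js i)) (ks i) /\
     has_dim (null_space (B (INR (js i)))) (rs i)) /\
  (forall i l, (1 <= i <= nu)%nat -> (1 <= l <= nu)%nat -> js i = js l -> i = l) /\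
  (forall j, (j <= N)%nat ->
     regular_point (INR j) \/ exists i, (1 <= i <= nu)%nat /\ js i = j).

(** ** Successive approximations; [Kninv t] is the inverse of [K n t t] *)

Variable Kninv : R -> E2 -> E1.

Definition condition_D (eps T' : R) (Ns : nat) : Prop :=
  0 < eps < 1 /\ 0 < T' <= T /\
  (forall i t, (1 <= i <= n - 1)%nat -> 0 <= t <= T' -> Rabs (dalpha i t) <= eps) /\
  (forall i t, (1 <= i <= n - 1)%nat -> 0 < t <= T' -> alpha i t / t <= eps) /\
  (forall t, 0 <= t <= T' -> is_bounded_inverse (K n t t) (Kninv t)) /\
  exists q, q < 1 /\ forall t, 0 < t < T' ->
    eps ^ Ns *
    sum_n_m (fun i => Rabs (dalpha i t) * opnorm (fun y => Kninv t (jump i t y)))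
      1 (n - 1) <= q.

Definition F (x : R -> E1) (t : R) : E2 :=
  minus
    (plus
      (plus (K n t t (x t))
        (sum_n_m (fun i => rscal (dalpha i t) (jump i t (x (alpha i t)))) 1 (n - 1)))
      (sum_n_m (fun i => RInt (V := realify E2) (fun s => K1 i t s (x s))
                           (alpha (i - 1) t) (alpha i t)) 1 n))
    (df t).

Definition L_op (Ns : nat) (u : R -> E1) (t : R) : E1 :=
  Kninv t
    (sum_n_m (fun i => rscal (dalpha i t * (alpha i t / t) ^ Ns)
                         (jump i t (u (alpha i t)))) 1 (n - 1)).

Definition K_op (Ns : nat) (u : R -> E1) (t : R) : E1 :=
  sum_n_m (fun i => RInt (V := realify E1)
      (fun s => rscal ((s / t) ^ Ns) (Kninv t (K1 i t s (u s))))
      (alpha (i - 1) t) (alpha i t)) 1 n.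

Definition gamma (Ns : nat) (xhat : R -> E1) (t : R) : E1 :=
  rscal (/ t ^ Ns) (opp (Kninv t (F xhat t))).

(** The formulas for [L_op], [K_op] and [gamma] are meaningful for [0 < t]; the
    values at [0] of the iterates are the continuous ones. *)
Definition successive_approximations (T' : R) (Ns : nat) (xhat : R -> E1)
  (u_ : nat -> R -> E1) : Prop :=
  (forall m, continuous_on (fun t => 0 <= t <= T') (u_ m)) /\
  (forall t, 0 < t <= T' -> u_ 0%nat t = gamma Ns xhat t) /\
  (forall m t, 0 < t <= T' ->
     u_ (S m) t =
       plus (opp (plus (L_op Ns (u_ m) t) (K_op Ns (u_ m) t))) (gamma Ns xhat t)).

End Volterra.

(* Main.v *)
(** Differentiation turns the equation into [A x = f'], where [A x = F x + f'].
    Applied to [t^j (ln t)^l v], [A] has the leading term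
    [t^j sum_m C(l, m) (ln t)^(l - m) B^(m)(j) v], that is, [B(j + d/dz)] acting on
    the polynomial [z^l v] at [z = ln t].  This operator on polynomials is onto if
    [B(j)] is.  It is also onto at a singular point of index [p], because the
    determinant condition says that [B^(p)(j)] maps the null space of [B(j)] onto
    a complement of its range; and there its kernel contains [z^l phi] for [l < p]
    and [phi] in the null space.  Hence [A xhat - f' = o(t^N)] is solved
    coefficient by coefficient, and each [t^j (ln t)^l phi] is the leading term of
    a sum annihilated by [A] up to [o(t^N)]; these sums carry the parameters.

    The remainder satisfies [u + L u + K u = gamma], where [gamma] is continuous
    with value [0] at [0].  By (D), [L] is a contraction for the sup norm on every
    [[0, t]], and the integral part [K] is small for a weight [exp (lam t)] with
    large [lam].

    (D) also makes [B(j)] injective for [j >= Ns].  All singular points are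
    therefore below [Ns], so that the parameters occur in coefficients which are
    determined by the solution modulo [O(t^Ns)]. *)

(* The kernels live only on closed sectors with moving boundaries. Integrals are therefore
   transported to [[0, 1]] by [node], and the equation is differentiated by a Leibniz rule that
   never extends a kernel across a boundary curve. No logarithm may stand at [t^0], since [xhat] has
   to be continuous at 0; the invertibility of [B(0)] makes this possible. It also keeps every
   expanded function bounded near 0, on which products of expansions rely. In the leading term of
   [A] the integrals are absent, because integration gains a power of [t], and a curve enters only
   through its slope [a] at 0. There [(ln t + ln a)^l] is expanded binomially, and the factors
   [a^(1+j) (ln a)^m] are the derivatives of [a^(1+j)] in [j]; this is the origin of [B^(m)(j)]. The
   parameters are independent for a triangular reason: the annihilated sums are built from [Ns]
   downwards in [j], and for fixed [j] upwards in the power of [ln t], so each new leading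
   coefficient sits where all earlier sums have none. The analysis is carried out over the reals in
   [realify E]; only bases, determinants and parameters use [scalars k]. *)
Require Import Defs.
From Stdlib Require Import Reals List Arith Lra Lia Classical ClassicalEpsilon FunctionalExtensionality.
From Coquelicot Require Import Coquelicot.

Open Scope R_scope.
Set Implicit Arguments.
Unset Strict Implicit.


(** * Equations in real vector spaces *)

(** Reflection of module identities: two expressions agree as soon as the real coefficients of each
    atom agree, and that is a goal for [ring] or [field]. *)
Inductive vexpr : Type :=
| Vatom (n : nat) | Vplus (a b : vexpr) | Vopp (a : vexpr) | Vminus (a b : vexpr)
| Vzero | Vscal (r : R) (a : vexpr).

Fixpoint vcoef (e : vexpr) (n : nat) : R :=
  match e with
  | Vatom m => if Nat.eqb n m then 1 else 0
  | Vplus a b => vcoef a n + vcoef b n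
  | Vopp a => - vcoef a n
  | Vminus a b => vcoef a n - vcoef b n
  | Vzero => 0
  | Vscal r a => r * vcoef a n
  end.

Fixpoint veval {V : ModuleSpace R_Ring} (l : list V) (e : vexpr) : V :=
  match e with
  | Vatom m => nth m l zero
  | Vplus a b => plus (veval l a) (veval l b)
  | Vopp a => opp (veval l a)
  | Vminus a b => minus (veval l a) (veval l b)
  | Vzero => zero
  | Vscal r a => scal r (veval l a)
  end.

Fixpoint vcheck (e1 e2 : vexpr) (n : nat) : Prop :=
  match n with
  | O => True
  | S n => vcoef e1 n = vcoef e2 n /\ vcheck e1 e2 n
  end.

Fixpoint vlin {V : ModuleSpace R_Ring} (l : list V) (c : nat -> R) (n : nat) : V :=
  match n with
  | O => zero
  | S n => plus (vlin l c n) (scal (c n) (nth n l zero))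
  end.

Lemma plus_swap {G : AbelianMonoid} (a b c d : G) :
  plus (plus a b) (plus c d) = plus (plus a c) (plus b d).
Proof.
rewrite <- !plus_assoc; f_equal; rewrite !plus_assoc; f_equal; apply plus_comm.
Qed.

Section Vlin.
Variables (V : ModuleSpace R_Ring) (l : list V).

Lemma vlin_plus c d n :
  vlin l (fun i => c i + d i) n = plus (vlin l c n) (vlin l d n).
Proof.
induction n as [|n IH]; simpl; [now rewrite plus_zero_l|].
rewrite IH, (scal_distr_r (c n) (d n) (nth n l zero) : scal (c n + d n) _ = _).
apply plus_swap.
Qed.

Lemma vlin_scal r c n : vlin l (fun i => r * c i) n = scal r (vlin l c n).
Proof.
induction n as [|n IH]; simpl; [now rewrite scal_zero_r|].
rewrite IH, scal_distr_l, scal_assoc; reflexivity.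
Qed.

Lemma vlin_ext c d n : (forall i, (i < n)%nat -> c i = d i) -> vlin l c n = vlin l d n.
Proof.
induction n as [|n IH]; intros H; simpl; [easy|].
rewrite IH by (intros; apply H; lia). now rewrite H by lia.
Qed.

Lemma vlin_zero n : vlin l (fun _ => 0) n = zero.
Proof.
induction n as [|n IH]; simpl; [easy|]. rewrite IH, plus_zero_l. exact (scal_zero_l (K := R_Ring) _).
Qed.

Lemma vlin_atom m n :
  vlin l (fun i => if Nat.eqb i m then 1 else 0) n =
  if Nat.ltb m n then nth m l zero else zero.
Proof.
induction n as [|n IH]; simpl; [easy|]. rewrite IH.
destruct (Nat.eqb_spec n m) as [->|Hn].
- rewrite (proj2 (Nat.ltb_ge m m)), (proj2 (Nat.ltb_lt m (S m))) by lia.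
  rewrite plus_zero_l. exact (scal_one (K := R_Ring) _).
- assert (scal (K := R_Ring) 0 (nth n l zero) = zero) as -> by exact (scal_zero_l (K := R_Ring) _).
  rewrite plus_zero_r.
  destruct (Nat.ltb_spec m n), (Nat.ltb_spec m (S n)); try lia; easy.
Qed.

(** Linear normal form. Any bound beyond the number of atoms will do, since [nth] defaults to [zero]
    there on both sides. *)
Lemma veval_vlin e n : (length l <= n)%nat -> veval l e = vlin l (vcoef e) n.
Proof.
intros Hn; induction e as [m|a IHa b IHb|a IHa|a IHa b IHb| |r a IHa]; simpl.
- rewrite vlin_atom. destruct (Nat.ltb_spec m n); [easy|]. apply nth_overflow; lia.
- rewrite IHa, IHb. symmetry; apply vlin_plus.
- rewrite IHa, <- (scal_opp_one (K := R_Ring)).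
  transitivity (vlin l (fun i => -1 * vcoef a i) n); [symmetry; apply (vlin_scal (-1))|].
  apply vlin_ext; intros; ring.
- rewrite IHa, IHb. unfold minus. rewrite <- (scal_opp_one (K := R_Ring)).
  transitivity (plus (vlin l (vcoef a) n) (vlin l (fun i => -1 * vcoef b i) n)).
  + f_equal. symmetry; apply (vlin_scal (-1)).
  + rewrite <- vlin_plus. apply vlin_ext; intros; ring.
- now rewrite vlin_zero.
- rewrite IHa. symmetry; apply vlin_scal.
Qed.

Lemma vcheck_sound e1 e2 : vcheck e1 e2 (length l) -> veval l e1 = veval l e2.
Proof.
intros H. rewrite !(veval_vlin _ (le_n _)).
apply vlin_ext; revert H; generalize (length l).
induction n as [|n IH]; [lia|]. intros [H1 H2] i Hi.
destruct (Nat.eq_dec i n) as [->|]; [easy|apply IH; [easy|lia]].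
Qed.
End Vlin.

Ltac vec_head t := match t with ?f _ => vec_head f | _ => t end.
(* The same sum or integral may carry different paths to the vector space structure. *)
Ltac vec_same x y :=
  first [constr_eq x y
        | let f := vec_head x in let g := vec_head y in constr_eq f g; unify x y].
Ltac vec_index x l :=
  match l with
  | ?y :: ?l' => match constr:(Set) with
               | _ => let _ := match constr:(Set) with _ => vec_same x y end in constr:(O)
               | _ => let n := vec_index x l' in constr:(S n)
               end
  end.
Ltac vec_add x l :=
  match constr:(Set) with
  | _ => let _ := vec_index x l in l
  | _ => constr:(x :: l)
  end.
Ltac vec_atoms t l :=
  match t with
  | @plus _ ?a ?b => let l1 := vec_atoms a l in vec_atoms b l1
  | @minus _ ?a ?b => let l1 := vec_atoms a l in vec_atoms b l1
  | @opp _ ?a => vec_atoms a l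
  | @zero _ => l
  | @scal _ _ ?r ?a => vec_atoms a l
  | _ => vec_add t l
  end.
Ltac vec_reify t l :=
  match t with
  | @plus _ ?a ?b => let x := vec_reify a l in let y := vec_reify b l in constr:(Vplus x y)
  | @minus _ ?a ?b => let x := vec_reify a l in let y := vec_reify b l in constr:(Vminus x y)
  | @opp _ ?a => let x := vec_reify a l in constr:(Vopp x)
  | @zero _ => constr:(Vzero)
  | @scal _ _ ?r ?a => let x := vec_reify a l in constr:(Vscal r x)
  | _ => let n := vec_index t l in constr:(Vatom n)
  end.

(** Naming [V] lets [change] reread the operations of the goal up to conversion; a goal over [E] can
    thus be settled in [realify E]. *)
Ltac vec_core V :=
  match goal with
  | |- ?a = ?b =>
    let l0 := constr:(@nil (ModuleSpace.sort R_Ring V)) in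
    let l1 := vec_atoms a l0 in
    let l := vec_atoms b l1 in
    let e1 := vec_reify a l in
    let e2 := vec_reify b l in
    change (@veval V l e1 = @veval V l e2);
    apply vcheck_sound;
    cbv beta iota delta [vcheck vcoef length Nat.eqb]; repeat split
  end.
Ltac vscal_simp := unfold one, zero, plus, mult, opp; simpl.
Ltac vec V := vec_core V; try (vscal_simp; first [ring | field]).

(** * Limits in normed modules *)

Lemma lim_norm {T} {F : (T -> Prop) -> Prop} {FF : Filter F} {K : AbsRing} {V : NormedModule K}
  (f : T -> V) (y : V) :
  filterlim f F (locally y) <->
  (forall eps, 0 < eps -> F (fun x => norm (minus (f x) y) < eps)).
Proof.
rewrite filterlim_locally_ball_norm. split.
- intros H eps He. exact (H (mkposreal eps He)).
- intros H eps. exact (H eps (cond_pos eps)).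
Qed.

Lemma locally_R (x : R) (P : R -> Prop) :
  locally x P <-> exists d, 0 < d /\ forall y, Rabs (y - x) < d -> P y.
Proof.
split.
- intros [d Hd]. exists d; split; [apply cond_pos|]. intros y Hy; apply Hd; exact Hy.
- intros [d [Hd H]]. exists (mkposreal d Hd). intros y Hy; apply H; exact Hy.
Qed.

Lemma locally_R2 (x y : R) (P : R * R -> Prop) :
  locally (x, y) P <->
  exists d, 0 < d /\ forall u v, Rabs (u - x) < d -> Rabs (v - y) < d -> P (u, v).
Proof.
split.
- intros [d Hd]. exists d; split; [apply cond_pos|]. intros u v Hu Hv; apply Hd; split; assumption.
- intros [d [Hd H]]. exists (mkposreal d Hd). intros [u v] [Hu Hv]; apply H; assumption.
Qed.

Lemma at_right_R (x : R) (P : R -> Prop) :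
  at_right x P <-> exists d, 0 < d /\ forall y, x < y < x + d -> P y.
Proof.
unfold at_right, within. rewrite locally_R. split; intros [d [Hd H]]; exists d; split; trivial.
- intros y Hy; apply H; [|lra]. apply Rabs_def1; lra.
- intros y Hy Hy'. apply H. apply Rabs_def2 in Hy; lra.
Qed.

Lemma lim_plus {T} {F : (T -> Prop) -> Prop} {FF : Filter F} {K : AbsRing} {V : NormedModule K}
  (f g : T -> V) a b :
  filterlim f F (locally a) -> filterlim g F (locally b) ->
  filterlim (fun t => plus (f t) (g t)) F (locally (plus a b)).
Proof. intros Hf Hg. exact (filterlim_comp_2 f g plus Hf Hg (filterlim_plus a b)). Qed.

Lemma lim_scal {T} {F : (T -> Prop) -> Prop} {FF : Filter F} {V : NormedModule R_AbsRing}
  (f : T -> R) (g : T -> V) (a : R) b :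
  filterlim f F (locally a) -> filterlim g F (locally b) ->
  filterlim (fun t => scal (f t) (g t)) F (locally (scal a b)).
Proof. intros Hf Hg. exact (filterlim_comp_2 f g scal Hf Hg (@filterlim_scal R_AbsRing V a b)). Qed.

Lemma lim_opp {T} {F : (T -> Prop) -> Prop} {FF : Filter F} {K : AbsRing} {V : NormedModule K}
  (f : T -> V) a :
  filterlim f F (locally a) -> filterlim (fun t => opp (f t)) F (locally (opp a)).
Proof. intros Hf. exact (filterlim_comp _ _ _ f opp F _ _ Hf (filterlim_opp a)). Qed.

Lemma lim_minus {T} {F : (T -> Prop) -> Prop} {FF : Filter F} {K : AbsRing} {V : NormedModule K}
  (f g : T -> V) a b :
  filterlim f F (locally a) -> filterlim g F (locally b) ->
  filterlim (fun t => minus (f t) (g t)) F (locally (minus a b)).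
Proof. intros Hf Hg. apply lim_plus; [easy|now apply lim_opp]. Qed.

Lemma lim_sum {T} {F : (T -> Prop) -> Prop} {FF : Filter F} {K : AbsRing} {V : NormedModule K}
  (f : nat -> T -> V) a n m :
  (forall i, (n <= i <= m)%nat -> filterlim (f i) F (locally (a i))) ->
  filterlim (fun t => sum_n_m (fun i => f i t) n m) F (locally (sum_n_m a n m)).
Proof.
intros H. induction m as [|m IH].
- destruct n as [|n].
  + rewrite sum_n_n. apply (filterlim_ext (f 0%nat)); [intros; now rewrite sum_n_n|apply H; lia].
  + rewrite sum_n_m_zero by lia. apply (filterlim_ext (fun _ => zero)); [intros; now rewrite sum_n_m_zero by lia|apply filterlim_const].
- destruct (le_lt_dec n (S m)) as [L|L].
  + rewrite sum_n_Sm by easy.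
    apply (filterlim_ext (fun t => plus (sum_n_m (fun i => f i t) n m) (f (S m) t))); [intros; now rewrite sum_n_Sm|].
    apply lim_plus; [apply IH; intros; apply H; lia|apply H; lia].
  + rewrite sum_n_m_zero by lia. apply (filterlim_ext (fun _ => zero)); [intros; now rewrite sum_n_m_zero by lia|apply filterlim_const].
Qed.

Lemma lim_Rplus {T} {F : (T -> Prop) -> Prop} {FF : Filter F} (f g : T -> R) (a b : R) :
  filterlim f F (locally a) -> filterlim g F (locally b) ->
  filterlim (fun t => f t + g t) F (locally (a + b)).
Proof. intros Hf Hg. exact (lim_plus (V := R_NormedModule) Hf Hg). Qed.

Lemma lim_Rminus {T} {F : (T -> Prop) -> Prop} {FF : Filter F} (f g : T -> R) (a b : R) :
  filterlim f F (locally a) -> filterlim g F (locally b) ->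
  filterlim (fun t => f t - g t) F (locally (a - b)).
Proof. intros Hf Hg. exact (lim_minus (V := R_NormedModule) Hf Hg). Qed.

Lemma lim_Rmult {T} {F : (T -> Prop) -> Prop} {FF : Filter F} (f g : T -> R) (a b : R) :
  filterlim f F (locally a) -> filterlim g F (locally b) ->
  filterlim (fun t => f t * g t) F (locally (a * b)).
Proof. intros Hf Hg. exact (lim_scal (V := R_NormedModule) Hf Hg). Qed.

Lemma lim_pow {T} {F : (T -> Prop) -> Prop} {FF : Filter F} (f : T -> R) (a : R) n :
  filterlim f F (locally a) -> filterlim (fun t => f t ^ n) F (locally (a ^ n)).
Proof.
intros Hf. induction n as [|n IH]; simpl; [apply filterlim_const|now apply lim_Rmult].
Qed.

Lemma lim_pair {T} {F : (T -> Prop) -> Prop} {FF : Filter F} {U V : UniformSpace}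
  (f : T -> U) (g : T -> V) a b :
  filterlim f F (locally a) -> filterlim g F (locally b) ->
  filterlim (fun t => (f t, g t)) F (locally (a, b)).
Proof.
intros Hf Hg. apply filterlim_locally. intros eps.
apply (filter_and _ _ (proj1 (filterlim_locally f a) Hf eps) (proj1 (filterlim_locally g b) Hg eps)).
Qed.

Lemma continuous_comp_lim {T} {F : (T -> Prop) -> Prop} {U V : UniformSpace}
  (f : T -> U) (g : U -> V) a :
  filterlim f F (locally a) -> continuous g a -> filterlim (fun t => g (f t)) F (locally (g a)).
Proof. intros Hf Hg. exact (filterlim_comp _ _ _ f g F _ _ Hf Hg). Qed.

(** Serves functions that are continuous only relative to [D]: kernels on closed sectors, unknowns
    on a closed interval. *)
Lemma within_comp_lim {T} {F : (T -> Prop) -> Prop} {FF : Filter F} {U V : UniformSpace} (D : U -> Prop)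
  (f : T -> U) (g : U -> V) a :
  filterlim f F (locally a) -> F (fun t => D (f t)) -> filterlim g (within D (locally a)) (locally (g a)) ->
  filterlim (fun t => g (f t)) F (locally (g a)).
Proof.
intros Hf HD Hg P HP. specialize (Hg P HP). unfold filtermap, within in *.
generalize (filter_and (F := F) _ _ HD (Hf _ Hg)). apply filter_imp. intros x [H1 H2]. now apply H2.
Qed.

(** * Compactness of intervals *)

(** Precomposition with this retraction turns continuity on [[a, b]] into continuity on the whole
    line, so that results about everywhere continuous functions apply. *)
Definition clamp (a b x : R) : R := Rmax a (Rmin b x).

Lemma clamp_in a b x : a <= b -> a <= clamp a b x <= b.
Proof. unfold clamp, Rmax, Rmin; intros; repeat destruct Rle_dec; lra. Qed.

Lemma clamp_id a b x : a <= x <= b -> clamp a b x = x.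
Proof. unfold clamp, Rmax, Rmin; intros; repeat destruct Rle_dec; lra. Qed.

Lemma clamp_lip a b x y : Rabs (clamp a b x - clamp a b y) <= Rabs (x - y).
Proof.
unfold clamp, Rmax, Rmin; repeat destruct Rle_dec; unfold Rabs; repeat destruct Rcase_abs; lra.
Qed.

Lemma clamp_cont a b x : continuous (clamp a b) x.
Proof.
intros P [d Hd]. exists d. intros y Hy. apply Hd.
change (Rabs (clamp a b y - clamp a b x) < d). eapply Rle_lt_trans; [apply clamp_lip|exact Hy].
Qed.

Lemma clamp_comp_cont {V : UniformSpace} a b (f : R -> V) : a <= b ->
  continuous_on (fun t => a <= t <= b) f -> forall x, continuous (fun t => f (clamp a b t)) x.
Proof.
intros Hab Hf x.
apply (within_comp_lim (D := fun t => a <= t <= b) (f := clamp a b) (g := f)).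
- apply clamp_cont.
- apply filter_forall. intros; now apply clamp_in.
- apply Hf. now apply clamp_in.
Qed.

(** Compactness of [[a, b]] by a supremum argument. Monotonicity in the bound is what allows two
    local bounds to be merged into one. *)
Lemma interval_bound (P : R -> R -> Prop) a b :
  (forall t M M', P t M -> M <= M' -> P t M') ->
  (forall t0, a <= t0 <= b -> exists d M, 0 < d /\
     forall t, a <= t <= b -> Rabs (t - t0) < d -> P t M) ->
  exists M, forall t, a <= t <= b -> P t M.
Proof.
intros Hmono Hloc.
destruct (Rlt_le_dec b a) as [Hba|Hab]; [exists 0; intros; lra|].
pose (S x := a <= x <= b /\ exists M, forall t, a <= t <= x -> P t M).
assert (Sa : S a).
{ split; [lra|]. destruct (Hloc a) as [d [M [Hd H]]]; [lra|]. exists M. intros t Ht.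
  apply H; [lra|]. replace (t - a) with 0 by lra. now rewrite Rabs_R0. }
destruct (completeness S) as [c [Hc1 Hc2]].
{ exists b. intros x [Hx _]; lra. }
{ now exists a. }
assert (Hac : a <= c) by (apply Hc1, Sa).
assert (Hcb : c <= b) by (apply Hc2; intros x [Hx _]; lra).
destruct (Hloc c) as [d [M [Hd H]]]; [lra|].
assert (exists x, S x /\ c - d < x) as [x [[Hx [M1 HM1]] Hxc]].
{ apply NNPP. intros Hn. assert (c <= c - d); [|lra]. apply Hc2. intros x Hx.
  apply Rnot_lt_le. intros Hl. apply Hn. now exists x. }
(* This point lies in [S], hence not beyond the supremum [c], which forces [y = b]. *)
pose (y := Rmin b (c + d / 2)).
assert (Hy : S y).
{ split; [unfold y, Rmin; destruct Rle_dec; lra|]. exists (Rmax M1 M). intros t Ht.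
  assert (y <= b /\ y <= c + d / 2) by (unfold y, Rmin; destruct Rle_dec; lra).
  destruct (Rle_lt_dec t x) as [L|L].
  - apply (Hmono t M1); [apply HM1; lra|apply Rmax_l].
  - apply (Hmono t M); [|apply Rmax_r]. apply H; [lra|]. apply Rabs_def1; lra. }
assert (y <= c) by now apply Hc1.
assert (y = b) as Hyb by (unfold y, Rmin in *; destruct Rle_dec; lra).
destruct Hy as [_ [M2 HM2]]. exists M2. intros t Ht. apply HM2. lra.
Qed.

(** The bound [M] encodes a neighbourhood [|t - t0| < 1/M]. *)
Lemma interval_tube (Q : R -> R -> R -> Prop) t0 :
  (forall t th M M', Q t th M -> M <= M' -> Q t th M') ->
  (forall th0, 0 <= th0 <= 1 -> exists d M, 0 < d /\ forall t th, Rabs (t - t0) < d ->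
     0 <= th <= 1 -> Rabs (th - th0) < d -> Q t th M) ->
  exists d M, 0 < d /\ forall t th, Rabs (t - t0) < d -> 0 <= th <= 1 -> Q t th M.
Proof.
intros Hmono Hloc.
destruct (@interval_bound (fun th M => 0 < M /\ forall t, Rabs (t - t0) * M < 1 -> Q t th M) 0 1)
  as [M HM].
- intros th M M' [H1 H2] H. split; [lra|]. intros t Ht. apply (Hmono t th M); [|easy].
  apply H2. eapply Rle_lt_trans; [|exact Ht]. apply Rmult_le_compat_l; [apply Rabs_pos|easy].
- intros th0 Hth0. destruct (Hloc th0 Hth0) as [d [M [Hd H]]].
  exists d, (Rmax M (/ d)). split; [easy|]. intros th Hth Hth'.
  assert (0 < / d) by now apply Rinv_0_lt_compat.
  split; [eapply Rlt_le_trans; [eassumption|apply Rmax_r]|].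
  intros t Ht. apply (Hmono t th M); [|apply Rmax_l]. apply H; trivial.
  apply Rnot_le_lt. intros Hle.
  assert (d * / d <= Rabs (t - t0) * Rmax M (/ d)).
  { apply Rmult_le_compat; try lra. apply Rmax_r. }
  rewrite Rinv_r in H1; lra.
- assert (0 < M) by (apply (HM 0); lra).
  exists (/ M), M. split; [now apply Rinv_0_lt_compat|]. intros t th Ht Hth.
  apply HM; [easy|]. apply (Rmult_lt_compat_r M) in Ht; [|easy]. rewrite Rinv_l in Ht; lra.
Qed.

(** A tube around each segment over [t0] reduces the rectangle to two one-dimensional compactness
    arguments. *)
Lemma rectangle_bound (Q : R -> R -> R -> Prop) a b :
  (forall t th M M', Q t th M -> M <= M' -> Q t th M') ->
  (forall t0 th0, a <= t0 <= b -> 0 <= th0 <= 1 -> exists d M, 0 < d /\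
     forall t th, Rabs (t - t0) < d -> Rabs (th - th0) < d ->
       a <= t <= b -> 0 <= th <= 1 -> Q t th M) ->
  exists M, forall t th, a <= t <= b -> 0 <= th <= 1 -> Q t th M.
Proof.
intros Hmono Hloc.
destruct (@interval_bound (fun t M => forall th, 0 <= th <= 1 -> Q t th M) a b) as [M HM].
- intros t M M' H1 H2 th Hth. eapply Hmono; [now apply H1|easy].
- intros t0 Ht0.
  destruct (@interval_tube (fun t th M => a <= t <= b -> Q t th M) t0) as [d [M [Hd H]]].
  + intros t th M M' H1 H2 Ht. eapply Hmono; [now apply H1|easy].
  + intros th0 Hth0. destruct (Hloc t0 th0 Ht0 Hth0) as [d [M [Hd H]]].
    exists d, M. split; [easy|]. intros; now apply H.
  + exists d, M. split; [easy|]. intros; now apply H.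
- exists M. intros; now apply HM.
Qed.

(** * Integrals depending on a parameter *)

(** Demanded on the whole plane; functions given on a sector meet it after both variables have been
    clamped. *)
Definition jcont {V : UniformSpace} (h : R -> R -> V) : Prop :=
  forall t th, continuous (fun q : R * R => h (fst q) (snd q)) (t, th).

Section NormTriangle.
Variable V : NormedModule R_AbsRing.

Lemma norm_plus_le (x y : V) a b c : norm x <= a -> norm y <= b -> a + b <= c -> norm (plus x y) <= c.
Proof. intros. eapply Rle_trans; [apply norm_triangle|lra]. Qed.

Lemma norm_plus_lt (x y : V) a b c : norm x < a -> norm y <= b -> a + b <= c -> norm (plus x y) < c.
Proof. intros. eapply Rle_lt_trans; [apply norm_triangle|lra]. Qed.

Lemma norm_minus_le (x y : V) a b c : norm x <= a -> norm y <= b -> a + b <= c -> norm (minus x y) <= c.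
Proof. intros. apply (norm_plus_le (a := a) (b := b)); trivial. now rewrite norm_opp. Qed.

Lemma norm_minus_sym (x y : V) : norm (minus x y) = norm (minus y x).
Proof. rewrite <- norm_opp. f_equal. vec V. Qed.

Lemma norm_dist_lt (y x z : V) a b c : norm (minus x y) < a -> norm (minus y z) <= b -> a + b <= c ->
  norm (minus x z) < c.
Proof.
intros. replace (minus x z) with (plus (minus x y) (minus y z)) by vec V.
now apply (norm_plus_lt (a := a) (b := b)).
Qed.

Lemma norm_dist_le (y x z : V) a b c : norm (minus x y) <= a -> norm (minus y z) <= b -> a + b <= c ->
  norm (minus x z) <= c.
Proof.
intros. replace (minus x z) with (plus (minus x y) (minus y z)) by vec V.
now apply (norm_plus_le (a := a) (b := b)).
Qed.

Lemma norm_near (x y : V) a b : norm (minus x y) <= a -> norm y <= b -> norm x <= a + b.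
Proof.
intros. replace x with (plus (minus x y) y) by vec V. now apply (norm_plus_le (a := a) (b := b)); [| |lra].
Qed.

(** The norm axiom gives only one inequality; the other one is the same axiom for the inverse
    scalar. *)
Lemma norm_scal_eq (r : R) (x : V) : norm (scal r x) = Rabs r * norm x.
Proof.
apply Rle_antisym; [apply (norm_scal (K := R_AbsRing))|].
destruct (Req_dec r 0) as [->|Hr].
- rewrite Rabs_R0, Rmult_0_l. apply norm_ge_0.
- replace x with (scal (/ r) (scal r x)) at 1 by (vec V; easy).
  pose proof (norm_scal (/ r) (scal r x) : _ <= Rabs (/ r) * _) as H.
  apply (Rmult_le_compat_l (Rabs r)) in H; [|apply Rabs_pos].
  rewrite <- Rmult_assoc, <- Rabs_mult, Rinv_r, Rabs_R1, Rmult_1_l in H by easy. exact H.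
Qed.

End NormTriangle.

Section ParamIntegral.
Variable V : CompleteNormedModule R_AbsRing.

Lemma jcont_section (h : R -> R -> V) t th : jcont h -> continuous (h t) th.
Proof.
intros H.
apply (continuous_comp_lim (f := fun th' => (t, th')) (g := fun q : R * R => h (fst q) (snd q))
  (a := (t, th))); [|apply H].
apply lim_pair; [apply filterlim_const|apply filterlim_id].
Qed.

(** Compactness of [[0, 1]] makes the continuity in [t] uniform in [th], which lets limits pass
    under the integral. *)
Lemma jcont_tube (h : R -> R -> V) t0 eps : jcont h -> 0 < eps ->
  exists d, 0 < d /\ forall t th, Rabs (t - t0) < d -> 0 <= th <= 1 ->
    norm (minus (h t th) (h t0 th)) < eps.
Proof.
intros H He.
destruct (@interval_tube (fun t th _ => norm (minus (h t th) (h t0 th)) < eps) t0) as [d [M [Hd HH]]].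
- easy.
- intros th0 _. pose proof (proj1 (lim_norm _ _) (H t0 th0) (eps / 2) ltac:(lra)) as Hl.
  apply locally_R2 in Hl. destruct Hl as [d [Hd Hl]]. exists d, 0. split; [easy|].
  intros t th Ht Hth1 Hth. simpl in Hl.
  specialize (Hl t th Ht Hth) as H1. specialize (Hl t0 th) as H2.
  rewrite Rminus_diag, Rabs_R0 in H2. specialize (H2 Hd Hth).
  apply (norm_dist_lt (V := V) (y := h t0 th0) (a := eps / 2) (b := eps / 2)); [exact H1| |lra].
  rewrite (@norm_minus_sym V). left; exact H2.
- exists d. split; [easy|]. intros; now apply HH.
Qed.

Lemma jcont_ex_RInt (h : R -> R -> V) t a b : jcont h -> ex_RInt (h t) a b.
Proof. intros H. apply (ex_RInt_continuous (V := V)). intros; now apply jcont_section. Qed.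

Lemma RInt01_continuous (h : R -> R -> V) t0 :
  jcont h -> continuous (fun t => RInt (h t) 0 1) t0.
Proof.
intros H. unfold continuous. apply (lim_norm (V := V)). intros eps He.
destruct (@jcont_tube h t0 (eps / 2) H) as [d [Hd HH]]; [lra|].
apply locally_R. exists d; split; [easy|]. intros t Ht.
apply Rle_lt_trans with ((1 - 0) * (eps / 2)); [|lra].
apply (norm_RInt_le_const (fun th => minus (h t th) (h t0 th)) 0 1).
- lra.
- intros th Hth. left. now apply HH.
- apply (is_RInt_minus (V := V)); apply (RInt_correct (V := V)); now apply jcont_ex_RInt.
Qed.

(** Riemann sums commute with a linear map, and boundedness carries the limit over. *)
Lemma is_RInt_linear {W : NormedModule R_AbsRing} (A : V -> W) (f : R -> V) a b l :
  is_linear A -> is_RInt f a b l -> is_RInt (fun s => A (f s)) a b (A l).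
Proof.
intros HA Hf. unfold is_RInt in *.
apply (filterlim_ext (fun ptd => A (scal (sign (b - a)) (Riemann_sum f ptd)))).
- intros ptd. rewrite (linear_scal _ HA). f_equal.
  pattern ptd; apply SF_cons_ind; clear ptd.
  + intros x0. unfold Riemann_sum; simpl. exact (linear_zero _ HA).
  + intros h s IH. rewrite !Riemann_sum_cons, (linear_plus _ HA), IH. f_equal.
    apply (linear_scal _ HA).
- apply (continuous_comp_lim Hf). now apply linear_cont.
Qed.

Lemma RInt_linear {W : CompleteNormedModule R_AbsRing} (A : V -> W) (f : R -> V) a b :
  is_linear A -> ex_RInt f a b -> RInt (fun s => A (f s)) a b = A (RInt f a b).
Proof.
intros HA Hf. apply (is_RInt_unique (V := W)). apply is_RInt_linear; [easy|].
now apply (RInt_correct (V := V)).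
Qed.

Lemma continuous_on_ex_RInt (f : R -> V) a b : a <= b ->
  continuous_on (fun t => a <= t <= b) f -> ex_RInt f a b.
Proof.
intros Hab Hf. apply (ex_RInt_ext (fun t => f (clamp a b t))).
- rewrite Rmin_left, Rmax_right by easy. intros t Ht. rewrite clamp_id; [easy|lra].
- apply (ex_RInt_continuous (V := V)). intros; now apply clamp_comp_cont.
Qed.

Lemma norm_RInt_bound (f : R -> V) a b M : a <= b -> ex_RInt f a b ->
  (forall t, a <= t <= b -> norm (f t) <= M) -> norm (RInt f a b) <= (b - a) * M.
Proof.
intros Hab Hf H. apply (norm_RInt_le_const f a b); trivial. now apply (RInt_correct (V := V)).
Qed.

(** No intermediate point exists for vector-valued functions; the bound comes from integrating the
    derivative, whence the continuity of [df]. *)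
Lemma mean_value_bound (f df : R -> V) a b M : a <= b ->
  (forall t, a <= t <= b -> is_derive f t (df t)) ->
  (forall t, a <= t <= b -> continuous df t) ->
  (forall t, a <= t <= b -> norm (df t) <= M) ->
  norm (minus (f b) (f a)) <= (b - a) * M.
Proof.
intros Hab Hd Hc HM. apply (norm_RInt_le_const df a b); trivial.
apply is_RInt_derive; rewrite Rmin_left, Rmax_right by easy; trivial.
Qed.

End ParamIntegral.

(** * Bounded operators *)

Section BoundedOps.
Variables V W : NormedModule R_AbsRing.

(** [opnorm] converts an extended supremum to a real number, which is meaningful only if the
    supremum is finite; any bound on [A] ensures this. *)
Lemma opnorm_lub (A : V -> W) M : (forall x, norm (A x) <= M * norm x) ->
  is_finite (Lub_Rbar (fun r => exists x, norm x <= 1 /\ r = norm (A x))) /\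
  is_lub_Rbar (fun r => exists x, norm x <= 1 /\ r = norm (A x)) (opnorm A).
Proof.
intros HM. unfold opnorm. set (E := fun r : R => _).
pose proof (Lub_Rbar_correct E) as HL.
assert (HE : E (norm (A zero))). { exists zero. split; [rewrite norm_zero; lra|easy]. }
assert (HF : is_finite (Lub_Rbar E)).
{ destruct HL as [H1 H2]. destruct (Lub_Rbar E) as [r| |]; [easy| |].
  - exfalso. apply (H2 (Rabs M)). intros r [x [Hx ->]]. simpl.
    eapply Rle_trans; [apply HM|].
    apply Rle_trans with (Rabs M * norm x).
    + apply Rmult_le_compat_r; [apply norm_ge_0|apply Rle_abs].
    + rewrite <- (Rmult_1_r (Rabs M)) at 2. apply Rmult_le_compat_l; [apply Rabs_pos|easy].
  - exfalso. exact (H1 _ HE). }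
split; [easy|]. now rewrite HF.
Qed.

Lemma opnorm_bound (A : V -> W) : is_linear A -> forall x, norm (A x) <= opnorm A * norm x.
Proof.
intros HA x. destruct (linear_norm _ HA) as [M [_ HM]].
destruct (opnorm_lub HM) as [_ [H _]].
destruct (Req_dec (norm x) 0) as [H0|H0].
- apply norm_eq_zero in H0. subst x. rewrite (linear_zero _ HA), !norm_zero. lra.
- assert (Hx : 0 < norm x) by (pose proof (norm_ge_0 x); lra).
  assert (H1 : norm (A (scal (/ norm x) x)) <= opnorm A).
  { apply (H (norm (A (scal (/ norm x) x)))). exists (scal (/ norm x) x). split; [|easy].
    rewrite norm_scal_eq, Rabs_right by (left; now apply Rinv_0_lt_compat).
    right; now field. }
  rewrite (linear_scal _ HA) in H1.
  assert (E : A x = scal (norm x) (scal (/ norm x) (A x))) by (vec W; easy).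
  rewrite E at 1. rewrite (norm_scal_eq (V := W)), Rabs_right by lra.
  rewrite Rmult_comm. apply Rmult_le_compat_r; [lra|exact H1].
Qed.

Lemma opnorm_ge_0 (A : V -> W) : is_linear A -> 0 <= opnorm A.
Proof.
intros HA. destruct (linear_norm _ HA) as [M [_ HM]].
destruct (opnorm_lub HM) as [_ [H _]].
apply (H 0). exists zero. split; [rewrite norm_zero; lra|]. now rewrite (linear_zero _ HA), norm_zero.
Qed.

Lemma linear_minus_fun (A B : V -> W) : is_linear A -> is_linear B ->
  is_linear (fun x => minus (A x) (B x)).
Proof.
intros HA HB. split.
- intros x y. rewrite (linear_plus _ HA), (linear_plus _ HB). vec W.
- intros r x. rewrite (linear_scal _ HA), (linear_scal _ HB). vec W.
- destruct (linear_norm _ HA) as [M1 [HM1 H1]], (linear_norm _ HB) as [M2 [HM2 H2]].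
  exists (M1 + M2). split; [lra|]. intros x. unfold minus.
  eapply Rle_trans; [apply (@norm_triangle R_AbsRing W)|]. rewrite (@norm_opp R_AbsRing W).
  rewrite Rmult_plus_distr_r. apply Rplus_le_compat; easy.
Qed.

Lemma linear_plus_fun (A B : V -> W) : is_linear A -> is_linear B ->
  is_linear (fun x => plus (A x) (B x)).
Proof.
intros HA HB. split.
- intros x y. rewrite (linear_plus _ HA), (linear_plus _ HB). vec W.
- intros r x. rewrite (linear_scal _ HA), (linear_scal _ HB). vec W.
- destruct (linear_norm _ HA) as [M1 [HM1 H1]], (linear_norm _ HB) as [M2 [HM2 H2]].
  exists (M1 + M2). split; [lra|]. intros x.
  eapply Rle_trans; [apply (@norm_triangle R_AbsRing W)|].
  rewrite Rmult_plus_distr_r. apply Rplus_le_compat; easy.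
Qed.

Lemma linear_scal_fun (r : R) (A : V -> W) : is_linear A -> is_linear (fun x => scal r (A x)).
Proof.
intros HA. apply (is_linear_comp A (fun y => scal r y)); [easy|].
exact (is_linear_scal_r (K := R_AbsRing) (V := W) r (fun n m => Rmult_comm n m)).
Qed.

Lemma linear_sum_fun (A : nat -> V -> W) n m : (forall i, (n <= i <= m)%nat -> is_linear (A i)) ->
  is_linear (fun x => sum_n_m (fun i => A i x) n m).
Proof.
intros H. induction m as [|m IH].
- destruct n as [|n].
  + apply (is_linear_ext (A 0%nat)); [intros; now rewrite sum_n_n|apply H; lia].
  + apply (is_linear_ext (fun _ => zero)); [intros; now rewrite sum_n_m_zero by lia|apply is_linear_zero].
- destruct (le_lt_dec n (S m)).
  + apply (is_linear_ext (fun x => plus (sum_n_m (fun i => A i x) n m) (A (S m) x))).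
    * intros; now rewrite sum_n_Sm.
    * apply linear_plus_fun; [apply IH; intros; apply H; lia|apply H; lia].
  + apply (is_linear_ext (fun _ => zero)); [intros; now rewrite sum_n_m_zero by lia|apply is_linear_zero].
Qed.

(** Continuity in operator norm along [p], stated without the norm itself. *)
Definition opcont (D : R * R -> Prop) (A : R -> R -> V -> W) : Prop :=
  forall p, D p -> forall eps, 0 < eps ->
  exists d, 0 < d /\ forall q, D q -> Rabs (fst q - fst p) < d -> Rabs (snd q - snd p) < d ->
  forall x, norm (minus (A (fst q) (snd q) x) (A (fst p) (snd p) x)) <= eps * norm x.

Lemma op_continuous_on_opcont D A : (forall p, D p -> is_linear (A (fst p) (snd p))) ->
  op_continuous_on D A -> opcont D A.
Proof.
intros HL H p Dp eps He. specialize (H p Dp).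
destruct p as [t s].
pose proof (proj1 (lim_norm (V := R_NormedModule) _ _) H eps He) as H1.
unfold within in H1. apply locally_R2 in H1. destruct H1 as [d [Hd H1]].
exists d. split; [easy|]. intros [t' s'] Dq Ht Hs x. simpl in *.
specialize (H1 t' s' Ht Hs Dq).
assert (LL : is_linear (op_minus (A t' s') (A t s))).
{ apply linear_minus_fun; [exact (HL _ Dq)|exact (HL _ Dp)]. }
eapply Rle_trans; [exact (opnorm_bound LL x)|].
apply Rmult_le_compat_r; [apply norm_ge_0|].
change (Rabs (opnorm (op_minus (A t' s') (A t s)) - 0) < eps) in H1.
apply Rabs_def2 in H1. lra.
Qed.

(** Joint continuity of evaluation, from [A_t x_t - A_0 x_0 = (A_t - A_0) x_t + A_0 (x_t - x_0)].
    Continuity in operator norm controls the first term because [x_t] stays bounded. *)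
Lemma opcont_lim {T} {F : (T -> Prop) -> Prop} {FF : Filter F} D A (p : T -> R * R) (x : T -> V) p0 x0 :
  (forall p, D p -> is_linear (A (fst p) (snd p))) -> opcont D A -> D p0 ->
  F (fun t => D (p t)) -> filterlim p F (locally p0) -> filterlim x F (locally x0) ->
  filterlim (fun t => A (fst (p t)) (snd (p t)) (x t)) F (locally (A (fst p0) (snd p0) x0)).
Proof.
intros HL HA Dp0 HD Hp Hx. apply lim_norm. intros eps He.
pose proof (norm_ge_0 x0) as Hx0.
destruct (linear_norm _ (HL p0 Dp0)) as [M [HM HM1]].
pose (e1 := eps / 2 / (norm x0 + 1)).
assert (He1 : 0 < e1) by (apply Rdiv_lt_0_compat; lra).
destruct (HA p0 Dp0 e1 He1) as [d [Hd H]].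
assert (F1 : F (fun t => Rabs (fst (p t) - fst p0) < d /\ Rabs (snd (p t) - snd p0) < d)).
{ apply (Hp (fun q => Rabs (fst q - fst p0) < d /\ Rabs (snd q - snd p0) < d)).
  destruct p0 as [t0 s0]. apply locally_R2. exists d; split; [easy|]. intros; now split. }
(* The first bound keeps [x t] within distance 1 of [x0], as the choice of [e1] presupposes; the
   second makes the error through [A0] less than [eps / 2]. *)
pose (e2 := Rmin 1 (eps / 2 / (M + 1))).
assert (He2 : 0 < e2).
{ apply Rmin_glb_lt; [lra|]. apply Rdiv_lt_0_compat; lra. }
pose proof (proj1 (lim_norm _ _) Hx e2 He2) as F2.
generalize (filter_and _ _ HD (filter_and _ _ F1 F2)). apply filter_imp.
intros t [Dt [[H1 H2] H3]].
specialize (H (p t) Dt H1 H2 (x t)).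
set (At := A (fst (p t)) (snd (p t))) in *. set (A0 := A (fst p0) (snd p0)) in *.
replace (minus (At (x t)) (A0 x0)) with (plus (minus (At (x t)) (A0 (x t))) (A0 (minus (x t) x0))).
2:{ rewrite (linear_minus _ _ _ (HL p0 Dp0)). fold A0. vec W. }
eapply Rle_lt_trans; [apply (@norm_triangle R_AbsRing W)|].
assert (N1 : norm (x t) <= 1 + norm x0).
{ apply (norm_near (V := V) (y := x0)); [|lra]. pose proof (Rmin_l 1 (eps / 2 / (M + 1))). unfold e2 in H3. lra. }
assert (B1 : norm (minus (At (x t)) (A0 (x t))) <= eps / 2).
{ eapply Rle_trans; [exact H|]. apply Rle_trans with (e1 * (norm x0 + 1)).
  - apply Rmult_le_compat_l; lra.
  - right. unfold e1. field. lra. }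
assert (B2 : norm (A0 (minus (x t) x0)) < eps / 2).
{ eapply Rle_lt_trans; [apply HM1|].
  apply Rle_lt_trans with (M * (eps / 2 / (M + 1))).
  - apply Rmult_le_compat_l; [lra|]. pose proof (Rmin_r 1 (eps / 2 / (M + 1))). unfold e2 in H3. lra.
  - apply Rlt_le_trans with ((M + 1) * (eps / 2 / (M + 1))).
    + apply Rmult_lt_compat_r; [apply Rdiv_lt_0_compat; lra|lra].
    + right. field. lra. }
lra.
Qed.

End BoundedOps.

(** * Sums and derivatives *)

Lemma is_derive_intro {V : NormedModule R_AbsRing} (f : R -> V) t l :
  (forall eps, 0 < eps -> exists d, 0 < d /\ forall t', Rabs (t' - t) < d ->
     norm (minus (minus (f t') (f t)) (scal (t' - t) l)) <= eps * Rabs (t' - t)) ->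
  is_derive f t l.
Proof.
intros H. split; [apply is_linear_scal_l|].
intros t1 Ht1. pose proof (is_filter_lim_locally_unique (K := R_AbsRing) (V := AbsRing_NormedModule R_AbsRing) t t1 Ht1) as E; subst t1.
intros eps. destruct (H eps (cond_pos eps)) as [d [Hd Hd']].
apply locally_R. exists d. split; [easy|]. intros t' Ht'. exact (Hd' t' Ht').
Qed.

Lemma is_derive_elim {V : NormedModule R_AbsRing} (f : R -> V) t l : is_derive f t l ->
  forall eps, 0 < eps -> exists d, 0 < d /\ forall t', Rabs (t' - t) < d ->
     norm (minus (minus (f t') (f t)) (scal (t' - t) l)) <= eps * Rabs (t' - t).
Proof.
intros [_ H] eps He. specialize (H t (fun P HP => HP) (mkposreal eps He)).
apply locally_R in H. destruct H as [d [Hd H]]. exists d. split; [easy|]. intros t' Ht'. exact (H t' Ht').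
Qed.

Lemma continuous_on_bound {V : NormedModule R_AbsRing} (x : R -> V) a b :
  continuous_on (fun t => a <= t <= b) x -> exists M, forall t, a <= t <= b -> norm (x t) <= M.
Proof.
intros Hx. apply interval_bound.
- intros t M M' H1 H2. lra.
- intros t0 Ht0. pose proof (proj1 (lim_norm _ _) (Hx t0 Ht0) 1 Rlt_0_1) as H.
  unfold within in H. apply locally_R in H. destruct H as [d [Hd H]].
  exists d, (1 + norm (x t0)). split; [easy|]. intros t Ht Ht'.
  apply (norm_near (V := V) (y := x t0)); [|lra]. left. now apply H.
Qed.

Lemma RInt_const_approx {V : CompleteNormedModule R_AbsRing} (g : R -> V) c d v e :
  c <= d -> ex_RInt g c d -> (forall s, c <= s <= d -> norm (minus (g s) v) <= e) ->
  norm (minus (RInt g c d) (scal (d - c) v)) <= (d - c) * e.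
Proof.
intros Hcd Hg H. apply (norm_RInt_le_const (fun s => minus (g s) v) c d); trivial.
apply (is_RInt_minus (V := V)); [now apply (RInt_correct (V := V))|]. apply (is_RInt_const (V := V)).
Qed.

Lemma RInt_three {V : CompleteNormedModule R_AbsRing} (g : R -> V) a c d b :
  a <= c -> c <= d -> d <= b -> ex_RInt g a b ->
  ex_RInt g a c /\ ex_RInt g c d /\ ex_RInt g d b /\
  RInt g a b = plus (plus (RInt g a c) (RInt g c d)) (RInt g d b).
Proof.
intros Hac Hcd Hdb H.
assert (H1 : ex_RInt g a d) by (apply (@ex_RInt_Chasles_1 V g a d b); [lra|easy]).
assert (H2 : ex_RInt g d b) by (apply (@ex_RInt_Chasles_2 V g a d b); [lra|easy]).
assert (H3 : ex_RInt g a c) by (apply (@ex_RInt_Chasles_1 V g a c d); [lra|easy]).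
assert (H4 : ex_RInt g c d) by (apply (@ex_RInt_Chasles_2 V g a c d); [lra|easy]).
repeat split; trivial. now rewrite !(RInt_Chasles (V := V)).
Qed.

(** Abel summation. Each inner curve bounds two neighbouring sectors, and grouping the boundary
    terms by curves instead of sectors produces the jumps of the kernel. *)
Lemma sum_by_parts {V : NormedModule R_AbsRing} (d : nat -> R) (P Q : nat -> V) m :
  sum_n_m (fun i => minus (scal (d i) (P i)) (scal (d (i - 1)%nat) (Q i))) 1 (S m) =
  minus (plus (scal (d (S m)) (P (S m))) (sum_n_m (fun i => scal (d i) (minus (P i) (Q (S i)))) 1 m))
    (scal (d 0%nat) (Q 1%nat)).
Proof.
induction m as [|m IH].
- rewrite sum_n_n, sum_n_m_zero by lia. simpl. vec V.
- rewrite sum_n_Sm, IH by lia.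
  rewrite (sum_n_Sm (fun i => scal (d i) (minus (P i) (Q (S i))))) by lia.
  replace (S (S m) - 1)%nat with (S m) by lia. vec V.
Qed.

Lemma is_derive_sum {V : NormedModule R_AbsRing} (f : nat -> R -> V) l t m k :
  (forall i, (m <= i <= k)%nat -> is_derive (f i) t (l i)) ->
  is_derive (fun t => sum_n_m (fun i => f i t) m k) t (sum_n_m l m k).
Proof.
intros H. induction k as [|k IH].
- destruct m as [|m].
  + rewrite sum_n_n. apply (is_derive_ext (f 0%nat)); [intros; now rewrite sum_n_n|apply H; lia].
  + rewrite sum_n_m_zero by lia. apply (is_derive_ext (fun _ => zero)); [intros; now rewrite sum_n_m_zero by lia|].
    apply (is_derive_const (V := V)).
- destruct (le_lt_dec m (S k)) as [L|L].
  + rewrite sum_n_Sm by easy.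
    apply (is_derive_ext (fun t => plus (sum_n_m (fun i => f i t) m k) (f (S k) t))); [intros; now rewrite sum_n_Sm|].
    apply (is_derive_plus (V := V)); [apply IH; intros; apply H; lia|apply H; lia].
  + rewrite sum_n_m_zero by lia. apply (is_derive_ext (fun _ => zero)); [intros; now rewrite sum_n_m_zero by lia|].
    apply (is_derive_const (V := V)).
Qed.

Lemma continuous_on_pointwise {U V : UniformSpace} (D : U -> Prop) (f : U -> V) :
  (forall t, D t -> continuous f t) -> continuous_on D f.
Proof.
intros H t Ht. eapply filterlim_filter_le_1; [|exact (H t Ht)]. apply filter_le_within.
Qed.

Lemma is_derive_uniq {V : NormedModule R_AbsRing} (f : R -> V) t l1 l2 :
  is_derive f t l1 -> is_derive f t l2 -> l1 = l2.
Proof.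
intros H1 H2.
assert (E : norm (minus l1 l2) <= 0).
{ apply le_epsilon. intros eps He. rewrite Rplus_0_l.
  destruct (is_derive_elim H1 (eps := eps / 2)) as [d1 [Hd1 D1]]; [lra|].
  destruct (is_derive_elim H2 (eps := eps / 2)) as [d2 [Hd2 D2]]; [lra|].
  pose (h := Rmin d1 d2 / 2).
  assert (Hh : 0 < h /\ h < d1 /\ h < d2).
  { unfold h. pose proof (Rmin_l d1 d2). pose proof (Rmin_r d1 d2).
    assert (0 < Rmin d1 d2) by now apply Rmin_glb_lt. lra. }
  specialize (D1 (t + h)). specialize (D2 (t + h)). replace (t + h - t) with h in * by ring.
  rewrite Rabs_right in D1, D2 by lra. specialize (D1 ltac:(lra)). specialize (D2 ltac:(lra)).
  apply Rmult_le_reg_l with h; [easy|].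
  replace (h * norm (minus l1 l2)) with (norm (scal h (minus l1 l2))) by (rewrite norm_scal_eq, Rabs_right; lra).
  replace (scal h (minus l1 l2)) with (minus (minus (minus (f (t + h)) (f t)) (scal h l2))
     (minus (minus (f (t + h)) (f t)) (scal h l1))) by vec V.
  apply (norm_minus_le D2 D1). lra. }
assert (E0 : minus l1 l2 = zero) by (apply norm_eq_zero; pose proof (norm_ge_0 (minus l1 l2)); lra).
replace l1 with (plus (minus l1 l2) l2) by vec V. rewrite E0. vec V.
Qed.

Lemma linear_sum_n_m {U W : NormedModule R_AbsRing} (A : U -> W) (f : nat -> U) m k : is_linear A ->
  A (sum_n_m f m k) = sum_n_m (fun i => A (f i)) m k.
Proof.
intros HA. induction k as [|k IH].
- destruct m as [|m]; [now rewrite !sum_n_n|]. rewrite !sum_n_m_zero by lia. now apply linear_zero.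
- destruct (le_lt_dec m (S k)) as [L|L].
  + rewrite !sum_n_Sm by easy. now rewrite (linear_plus _ HA), IH.
  + rewrite !sum_n_m_zero by lia. now apply linear_zero.
Qed.

Lemma scal_sum_n_m {W : NormedModule R_AbsRing} (r : R) (f : nat -> W) m k :
  scal r (sum_n_m f m k) = sum_n_m (fun i => scal r (f i)) m k.
Proof.
apply (linear_sum_n_m (A := fun w => scal r w)). exact (is_linear_scal_r (K := R_AbsRing) (V := W) r (fun n m => Rmult_comm n m)).
Qed.

Lemma sum_n_m_minus {W : NormedModule R_AbsRing} (f g : nat -> W) m k :
  minus (sum_n_m f m k) (sum_n_m g m k) = sum_n_m (fun i => minus (f i) (g i)) m k.
Proof.
unfold minus. rewrite sum_n_m_plus. f_equal.
symmetry. transitivity (sum_n_m (fun i => scal (-1) (g i)) m k).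
- apply sum_n_m_ext. intros i. vec W.
- rewrite <- (scal_sum_n_m (W := W)). vec W.
Qed.

Lemma sum_n_m_Rle (a b : nat -> R) m k : (forall i, (m <= i <= k)%nat -> a i <= b i) -> sum_n_m a m k <= sum_n_m b m k.
Proof.
intros H. induction k as [|k IH].
- destruct m as [|m]; [rewrite !sum_n_n; apply H; lia|]. rewrite !sum_n_m_zero by lia. apply Rle_refl.
- destruct (le_lt_dec m (S k)) as [L|L].
  + rewrite !sum_n_Sm by easy. apply Rplus_le_compat; [apply IH; intros; apply H; lia|apply H; lia].
  + rewrite !sum_n_m_zero by lia. apply Rle_refl.
Qed.

Lemma exp_RInt C lam a b : lam <> 0 ->
  is_RInt (fun s => C * exp (lam * s)) a b (C / lam * exp (lam * b) - C / lam * exp (lam * a)).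
Proof.
intros Hl. apply (is_RInt_derive (fun s => C / lam * exp (lam * s))).
- intros s _. auto_derive; [easy|]. field. easy.
- intros s _. apply (ex_derive_continuous (V := R_NormedModule)). auto_derive. easy.
Qed.

(** * Volterra operators with piecewise continuous kernels *)

Section Geometry.
Variables (T : R) (n : nat) (al be : nat -> R -> R).
Hypothesis hT : 0 < T.
Hypothesis al0 : forall t, al 0%nat t = 0.
Hypothesis aln : forall t, al n t = t.
Hypothesis al_cont : forall i, (i <= n)%nat -> continuous_on (fun t => 0 <= t <= T) (al i).
Hypothesis al_chain : forall i t, (i < n)%nat -> 0 <= t <= T -> al i t <= al (S i) t.

(** Closed counterpart of [region]; for ordered curves its slice at [t = 0] is the origin alone. *)
Definition sector (i : nat) (p : R * R) : Prop :=
  0 <= fst p <= T /\ al (i - 1) (fst p) <= snd p <= al i (fst p).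

Lemma al_mono i j t : (i <= j)%nat -> (j <= n)%nat -> 0 <= t <= T -> al i t <= al j t.
Proof.
intros Hij Hj Ht. induction Hij as [|j Hij IH]; [lra|].
apply Rle_trans with (al j t); [apply IH; lia|apply al_chain; [lia|easy]].
Qed.

Lemma al_range i t : (i <= n)%nat -> 0 <= t <= T -> 0 <= al i t <= t.
Proof.
intros Hi Ht. split.
- rewrite <- (al0 t). apply al_mono; [lia|easy|easy].
- rewrite <- (aln t) at 2. apply al_mono; [easy|lia|easy].
Qed.

(** Coordinate in which the slice of sector [i] at [t] becomes [[0, 1]]. The clamps keep the point
    inside the sector for all real arguments, so that continuity holds on the whole plane. *)
Definition node (i : nat) (t th : R) : R :=
  let t' := clamp 0 T t in
  al (i - 1) t' + clamp 0 1 th * (al i t' - al (i - 1) t').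

Lemma node_sector i t th : (1 <= i <= n)%nat -> sector i (clamp 0 T t, node i t th).
Proof.
intros Hi. pose proof (@clamp_in 0 T t ltac:(lra)) as Ht. pose proof (@clamp_in 0 1 th ltac:(lra)) as Hth.
split; simpl; [easy|]. unfold node.
set (t' := clamp 0 T t) in *. set (h := clamp 0 1 th) in *.
assert (al (i - 1) t' <= al i t') by (apply al_mono; [lia|lia|easy]).
split; nra.
Qed.

Lemma sector_range i t s : (1 <= i <= n)%nat -> sector i (t, s) -> 0 <= s <= t /\ 0 <= t <= T.
Proof.
intros Hi [Ht Hs]; simpl in *. pose proof (@al_range (i - 1) t ltac:(lia) Ht).
pose proof (@al_range i t ltac:(lia) Ht). lra.
Qed.

Lemma node_range i t th : (1 <= i <= n)%nat -> 0 <= node i t th <= T.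
Proof. intros Hi. pose proof (sector_range Hi (@node_sector i t th Hi)). lra. Qed.

Lemma node_eq i t th : 0 <= t <= T -> 0 <= th <= 1 ->
  node i t th = (al i t - al (i - 1) t) * th + al (i - 1) t.
Proof. intros Ht Hth. unfold node. rewrite !clamp_id by easy. ring. Qed.

Lemma al_clamp_cont i t : (i <= n)%nat -> continuous (fun t => al i (clamp 0 T t)) t.
Proof. intros Hi. apply clamp_comp_cont; [lra|now apply al_cont]. Qed.

Lemma fst_lim (t th : R) : filterlim (fun q : R * R => fst q) (locally (t, th)) (locally t).
Proof. exact (continuous_fst t th). Qed.
Lemma snd_lim (t th : R) : filterlim (fun q : R * R => snd q) (locally (t, th)) (locally th).
Proof. exact (continuous_snd t th). Qed.

Lemma node_jcont i : (1 <= i <= n)%nat -> jcont (node i).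
Proof.
intros Hi t th. unfold continuous, node.
assert (H : forall j, (j <= n)%nat ->
  filterlim (fun q : R * R => al j (clamp 0 T (fst q))) (locally (t, th)) (locally (al j (clamp 0 T t)))).
{ intros j Hj. apply (continuous_comp_lim (f := fun q : R * R => fst q) (g := fun t => al j (clamp 0 T t)) (a := t)).
  - apply fst_lim.
  - now apply al_clamp_cont. }
apply lim_Rplus; [apply H; lia|]. apply lim_Rmult; [|apply lim_Rminus; apply H; lia].
apply (continuous_comp_lim (f := fun q : R * R => snd q) (g := clamp 0 1) (a := th));
  [apply snd_lim|apply clamp_cont].
Qed.

(** * Evaluation, integrability and uniform bound of a kernel on the sectors *)

Section Kernel.
Variables (V1 V2 : CompleteNormedModule R_AbsRing) (A : nat -> R -> R -> V1 -> V2).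
Hypothesis A_lin : forall i p, (1 <= i <= n)%nat -> sector i p -> is_linear (A i (fst p) (snd p)).
Hypothesis A_cont : forall i, (1 <= i <= n)%nat -> opcont (sector i) (A i).

Lemma kernel_lim {S} {F : (S -> Prop) -> Prop} {FF : Filter F} i (t s : S -> R) (x : S -> V1) t0 s0 x0 :
  (1 <= i <= n)%nat -> sector i (t0, s0) -> F (fun q => sector i (t q, s q)) ->
  filterlim t F (locally t0) -> filterlim s F (locally s0) -> filterlim x F (locally x0) ->
  filterlim (fun q => A i (t q) (s q) (x q)) F (locally (A i t0 s0 x0)).
Proof.
intros Hi H0 HD Ht Hs Hx.
apply (opcont_lim (V := V1) (W := V2) (D := sector i) (A := A i) (p := fun q => (t q, s q)) (x := x)
  (p0 := (t0, s0)) (x0 := x0)); trivial.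
- intros; now apply A_lin.
- now apply A_cont.
- now apply lim_pair.
Qed.

Definition slice (x : R -> V1) (i : nat) (t th : R) : V2 :=
  A i (clamp 0 T t) (node i t th) (x (node i t th)).

Lemma slice_jcont x i : (1 <= i <= n)%nat -> continuous_on (fun t => 0 <= t <= T) x -> jcont (slice x i).
Proof.
intros Hi Hx t th. unfold continuous, slice.
apply kernel_lim; trivial.
- now apply node_sector.
- apply filter_forall. intros q. now apply node_sector.
- apply (continuous_comp_lim (f := fun q : R * R => fst q) (g := clamp 0 T) (a := t));
  [apply fst_lim|apply clamp_cont].
- now apply node_jcont.
- apply (within_comp_lim (D := fun t => 0 <= t <= T) (f := fun q : R * R => node i (fst q) (snd q)) (g := x) (a := node i t th)).
  + now apply node_jcont.
  + apply filter_forall. intros q. now apply node_range.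
  + apply Hx. now apply node_range.
Qed.

Lemma kernel_section_continuous x i t : (1 <= i <= n)%nat -> continuous_on (fun t => 0 <= t <= T) x ->
  0 <= t <= T -> continuous_on (fun s => al (i - 1) t <= s <= al i t) (fun s => A i t s (x s)).
Proof.
intros Hi Hx Ht s Hs. apply kernel_lim; trivial.
- now split.
- unfold within. apply filter_forall. intros s' Hs'. now split.
- apply filterlim_const.
- intros P HP. unfold filtermap, within. revert HP. apply filter_imp. easy.
- apply (within_comp_lim (D := fun t => 0 <= t <= T) (f := fun s => s) (g := x) (a := s)).
  + intros P HP. unfold filtermap, within. revert HP. apply filter_imp. easy.
  + unfold within. apply filter_forall. intros s' Hs'. assert (sector i (t, s')) as HS by now split.
    pose proof (sector_range Hi HS). lra.
  + apply Hx. assert (sector i (t, s)) as HS by now split. pose proof (sector_range Hi HS). lra.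
Qed.

Lemma ex_RInt_kernel x i t : (1 <= i <= n)%nat -> continuous_on (fun t => 0 <= t <= T) x ->
  0 <= t <= T -> ex_RInt (fun s => A i t s (x s)) (al (i - 1) t) (al i t).
Proof.
intros Hi Hx Ht. apply continuous_on_ex_RInt.
- apply al_mono; [lia|lia|easy].
- now apply kernel_section_continuous.
Qed.

(** Compactness is used for the rectangle of coordinates [(t, th)], which stays a rectangle although
    the slices of the sector may degenerate. *)
Lemma kernel_bound : exists M, 0 < M /\ forall i t s x, (1 <= i <= n)%nat -> sector i (t, s) ->
  norm (A i t s x) <= M * norm x.
Proof.
assert (H : forall i, (1 <= i <= n)%nat -> exists M, forall t s x, sector i (t, s) -> norm (A i t s x) <= M * norm x).
{ intros i Hi.
  destruct (@rectangle_bound (fun t th M => forall x, norm (A i t (node i t th) x) <= M * norm x) 0 T) as [M HM].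
  - intros t th M M' H1 H2 x. eapply Rle_trans; [apply H1|].
    apply Rmult_le_compat_r; [apply norm_ge_0|easy].
  - intros t0 th0 Ht0 Hth0. pose proof (@node_sector i t0 th0 Hi) as HS. rewrite (clamp_id Ht0) in HS.
    destruct (@A_cont i Hi _ HS 1 Rlt_0_1) as [d [Hd H]].
    destruct (linear_norm _ (A_lin Hi HS)) as [M [_ HM]]. simpl in *.
    pose proof (proj1 (lim_norm (V := R_NormedModule) _ _) (@node_jcont i Hi t0 th0) d Hd) as HN.
    apply locally_R2 in HN. destruct HN as [d' [Hd' HN]].
    exists (Rmin d d'), (1 + M). split; [now apply Rmin_glb_lt|].
    intros t th Ht Hth Ht' Hth' x.
    pose proof (@node_sector i t th Hi) as HS'. rewrite (clamp_id Ht') in HS'.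
    assert (E : norm (minus (A i t (node i t th) x) (A i t0 (node i t0 th0) x)) <= 1 * norm x).
    { apply (H (t, node i t th) HS').
      - eapply Rlt_le_trans; [exact Ht|apply Rmin_l].
      - apply (HN t th); eapply Rlt_le_trans; try eassumption; apply Rmin_r. }
    rewrite Rmult_plus_distr_r. exact (norm_near E (HM x)).
  - exists M. intros t s x HS. destruct HS as [Ht Hs]; simpl in *.
    (* A slice reduced to one point is reached with [th = 0]; otherwise [th] is the affine
       coordinate of [s]. *)
    destruct (Req_dec (al (i - 1) t) (al i t)) as [E|E].
    + replace s with (node i t 0); [apply HM; lra|]. rewrite node_eq by lra. lra.
    + replace s with (node i t ((s - al (i - 1) t) / (al i t - al (i - 1) t))).
      * apply HM; [easy|]. assert (0 < al i t - al (i - 1) t) by lra. split.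
        -- apply Rdiv_le_0_compat; lra.
        -- apply Rle_div_l; lra.
      * rewrite node_eq; [field; lra|easy|]. assert (0 < al i t - al (i - 1) t) by lra. split.
        -- apply Rdiv_le_0_compat; lra.
        -- apply Rle_div_l; lra. }
assert (H2 : forall m, (m <= n)%nat -> exists M, 0 < M /\ forall i t s x, (1 <= i <= m)%nat -> sector i (t, s) ->
  norm (A i t s x) <= M * norm x).
{ induction m as [|m IH]; intros Hm.
  - exists 1. split; [lra|]. intros; lia.
  - destruct IH as [M [HM IH]]; [lia|]. destruct (H (S m)) as [M' HM']; [lia|].
    exists (Rmax M M'). split; [eapply Rlt_le_trans; [exact HM|apply Rmax_l]|].
    intros i t s x Hi HS. pose proof (norm_ge_0 x).
    destruct (Nat.eq_dec i (S m)) as [->|].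
    + eapply Rle_trans; [now apply HM'|]. apply Rmult_le_compat_r; [easy|apply Rmax_r].
    + eapply Rle_trans; [apply IH; [lia|easy]|]. apply Rmult_le_compat_r; [easy|apply Rmax_l]. }
destruct (H2 n (le_n n)) as [M HM]. now exists M.
Qed.

End Kernel.

(** The substitution [s = node i t th] turns the moving interval into [[0, 1]]. *)
Lemma RInt_node {V : CompleteNormedModule R_AbsRing} (g : R -> V) i t :
  (1 <= i <= n)%nat -> 0 <= t <= T -> ex_RInt g (al (i - 1) t) (al i t) ->
  RInt g (al (i - 1) t) (al i t) =
  RInt (fun th => scal (al i t - al (i - 1) t) (g (node i t th))) 0 1.
Proof.
intros Hi Ht Hg.
transitivity (RInt (fun th => scal (al i t - al (i - 1) t) (g ((al i t - al (i - 1) t) * th + al (i - 1) t))) 0 1).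
- symmetry.
  pose proof (RInt_comp_lin (V := V) g (al i t - al (i - 1) t) (al (i - 1) t) 0 1) as E.
  replace ((al i t - al (i - 1) t) * 0 + al (i - 1) t) with (al (i - 1) t) in E by ring.
  replace ((al i t - al (i - 1) t) * 1 + al (i - 1) t) with (al i t) in E by ring.
  now apply E.
- apply (RInt_ext (V := V)). rewrite Rmin_left, Rmax_right by lra. intros th Hth.
  rewrite node_eq; [easy|easy|lra].
Qed.

Section NearSector.
Variables (V1 V2 : CompleteNormedModule R_AbsRing) (A : nat -> R -> R -> V1 -> V2).
Hypothesis A_lin : forall i p, (1 <= i <= n)%nat -> sector i p -> is_linear (A i (fst p) (snd p)).
Hypothesis A_cont : forall i, (1 <= i <= n)%nat -> opcont (sector i) (A i).

Lemma kernel_near x i t0 s0 eps : (1 <= i <= n)%nat -> continuous_on (fun t => 0 <= t <= T) x ->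
  sector i (t0, s0) -> 0 < eps -> exists d, 0 < d /\ forall t s, sector i (t, s) ->
  Rabs (t - t0) < d -> Rabs (s - s0) < d ->
  norm (minus (A i t s (x s)) (A i t0 s0 (x s0))) < eps.
Proof.
intros Hi Hx H0 He.
assert (H : filterlim (fun q : R * R => A i (fst q) (snd q) (x (snd q)))
  (within (sector i) (locally (t0, s0))) (locally (A i t0 s0 (x s0)))).
{ assert (W : forall (f : R * R -> R) a, filterlim f (locally (t0, s0)) (locally a) ->
    filterlim f (within (sector i) (locally (t0, s0))) (locally a)).
  { intros f a Hf. eapply filterlim_filter_le_1; [|exact Hf]. apply filter_le_within. }
  apply (kernel_lim A_lin A_cont (t := fun q : R * R => fst q) (s := fun q : R * R => snd q)); trivial.
  - unfold within. apply filter_forall. now intros [t s].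
  - apply W, fst_lim.
  - apply W, snd_lim.
  - apply (within_comp_lim (D := fun t => 0 <= t <= T) (f := fun q : R * R => snd q) (g := x) (a := s0)).
    + apply W, snd_lim.
    + unfold within. apply filter_forall. intros [t s] HS. pose proof (sector_range Hi HS). simpl; lra.
    + apply Hx. pose proof (sector_range Hi H0). lra. }
pose proof (proj1 (lim_norm _ _) H eps He) as HN. unfold within in HN.
apply locally_R2 in HN. destruct HN as [d [Hd HN]]. exists d. split; [easy|].
intros t s HS Ht Hs. exact (HN t s Ht Hs HS).
Qed.

End NearSector.

(** * Leibniz rule for integrals between moving curves *)

Variables (V1 V2 : CompleteNormedModule R_AbsRing) (da : nat -> R -> R) (K K1 : nat -> R -> R -> V1 -> V2).
Hypothesis al_strict : forall i t, (i < n)%nat -> 0 < t < T -> al i t < al (S i) t.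
Hypothesis al_der : forall i t, (i <= n)%nat -> 0 < t < T -> is_derive (al i) t (da i t).
Hypothesis K_lin : forall i p, (1 <= i <= n)%nat -> sector i p -> is_linear (K i (fst p) (snd p)).
Hypothesis K_cont : forall i, (1 <= i <= n)%nat -> opcont (sector i) (K i).
Hypothesis K1_lin : forall i p, (1 <= i <= n)%nat -> sector i p -> is_linear (K1 i (fst p) (snd p)).
Hypothesis K1_cont : forall i, (1 <= i <= n)%nat -> opcont (sector i) (K1 i).
Hypothesis K_der : forall i t s x, (1 <= i <= n)%nat -> 0 < t < T ->
  al (i - 1) t < s < al i t -> is_derive (fun t => K i t s x) t (K1 i t s x).

(** Mean value inequality for [K i r s x - r K1 i t0 s x] as a function of [r]: its derivative is
    the deviation of [K1] from its value at [t0]. The whole segment must stay inside the open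
    slices, where [K_der] applies. *)
Lemma K_increment i t0 t s x e : (1 <= i <= n)%nat ->
  (forall r, Rabs (r - t0) <= Rabs (t - t0) -> 0 < r < T /\ al (i - 1) r < s < al i r /\
     norm (minus (K1 i r s x) (K1 i t0 s x)) <= e) ->
  norm (minus (minus (K i t s x) (K i t0 s x)) (scal (t - t0) (K1 i t0 s x))) <= e * Rabs (t - t0).
Proof.
intros Hi H.
pose (phi := fun r => minus (K i r s x) (scal r (K1 i t0 s x))).
assert (Hc : forall r, Rabs (r - t0) <= Rabs (t - t0) ->
  continuous (fun r => minus (K1 i r s x) (K1 i t0 s x)) r).
{ intros r Hr. destruct (H r Hr) as [H1 [H2 _]]. apply (lim_minus (V := V2)); [|apply filterlim_const].
  apply (kernel_lim K1_lin K1_cont); trivial.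
  - split; simpl; lra.
  - assert (C : forall j, (j <= n)%nat -> continuous (al j) r).
    { intros j Hj. apply (ex_derive_continuous (V := R_NormedModule)). exists (da j r). now apply al_der. }
    assert (F1 : locally r (fun r' => 0 < r' < T)).
    { apply locally_R. exists (Rmin r (T - r)). split; [apply Rmin_glb_lt; lra|].
      intros y Hy. apply Rabs_def2 in Hy. pose proof (Rmin_l r (T - r)). pose proof (Rmin_r r (T - r)). lra. }
    assert (F2 : locally r (fun r' => al (i - 1) r' < s)).
    { apply (C (i - 1)%nat ltac:(lia) (fun y => y < s)). apply open_lt. lra. }
    assert (F3 : locally r (fun r' => s < al i r')).
    { apply (C i ltac:(lia) (fun y => s < y)). apply open_gt. lra. }
    generalize (filter_and _ _ F1 (filter_and _ _ F2 F3)). apply filter_imp.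
    intros r' [? [? ?]]. split; simpl; lra.
  - apply filterlim_id.
  - apply filterlim_const.
  - apply filterlim_const. }
assert (Hd : forall r, Rabs (r - t0) <= Rabs (t - t0) ->
  is_derive phi r (minus (K1 i r s x) (K1 i t0 s x))).
{ intros r Hr. destruct (H r Hr) as [H1 [H2 _]].
  apply (is_derive_minus (V := V2)); [now apply K_der|].
  pose proof (is_derive_scal_l (fun r : R => r) r one (K1 i t0 s x) (is_derive_id r)) as D.
  rewrite scal_one in D. exact D. }
replace (minus (minus (K i t s x) (K i t0 s x)) (scal (t - t0) (K1 i t0 s x))) with (minus (phi t) (phi t0))
  by (unfold phi; vec V2).
destruct (Rle_lt_dec t0 t) as [L|L].
- rewrite (Rabs_right (t - t0)), Rmult_comm by lra.
  rewrite (Rabs_right (t - t0)) in * by lra.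
  apply (mean_value_bound (V := V2) (df := fun r => minus (K1 i r s x) (K1 i t0 s x))); [easy| | |];
   intros r Hr; assert (Hr' : Rabs (r - t0) <= t - t0) by (rewrite Rabs_right; lra); auto.
  now apply H.
- rewrite (Rabs_left (t - t0)), Rmult_comm by lra.
  rewrite (Rabs_left (t - t0)) in * by lra.
  rewrite (@norm_minus_sym V2). replace (- (t - t0)) with (t0 - t) by ring.
  apply (mean_value_bound (V := V2) (df := fun r => minus (K1 i r s x) (K1 i t0 s x))); [lra| | |];
   intros r Hr; assert (Hr' : Rabs (r - t0) <= - (t - t0)) by (unfold Rabs; destruct Rcase_abs; lra); auto.
  now apply H.
Qed.

Lemma node_surj i t s : (1 <= i <= n)%nat -> 0 <= t <= T -> al (i - 1) t < al i t ->
  al (i - 1) t <= s <= al i t -> exists th, 0 <= th <= 1 /\ s = node i t th.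
Proof.
intros Hi Ht Hl Hs. exists ((s - al (i - 1) t) / (al i t - al (i - 1) t)).
assert (H : 0 <= (s - al (i - 1) t) / (al i t - al (i - 1) t) <= 1).
{ split; [apply Rdiv_le_0_compat; lra|apply Rle_div_l; lra]. }
split; [easy|]. rewrite node_eq by easy. field; lra.
Qed.

(** Tube argument along the slice at [t0]. The point [s] has to lie in both slices, because the
    kernel is controlled on its sector only. *)
Lemma K1_uniform i x t0 e : (1 <= i <= n)%nat -> continuous_on (fun t => 0 <= t <= T) x ->
  0 < t0 < T -> 0 < e -> exists d, 0 < d /\ forall t s, Rabs (t - t0) < d ->
  sector i (t0, s) -> sector i (t, s) ->
  norm (minus (K1 i t s (x s)) (K1 i t0 s (x s))) <= e.
Proof.
intros Hi Hx Ht0 He.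
destruct (@interval_tube (fun t th _ => sector i (t, node i t0 th) ->
   norm (minus (K1 i t (node i t0 th) (x (node i t0 th))) (K1 i t0 (node i t0 th) (x (node i t0 th)))) <= e) t0)
  as [d [M [Hd H]]].
- easy.
- intros th0 Hth0.
  pose proof (@node_sector i t0 th0 Hi) as HS0. rewrite clamp_id in HS0 by lra.
  destruct (@kernel_near _ _ K1 K1_lin K1_cont x i t0 (node i t0 th0) (e / 2) Hi Hx HS0 ltac:(lra)) as [d [Hd H]].
  pose proof (proj1 (lim_norm (V := R_NormedModule) _ _) (@jcont_section R_CompleteNormedModule (node i) t0 th0 (node_jcont Hi)) d Hd) as HN.
  apply locally_R in HN. destruct HN as [d' [Hd' HN]].
  exists (Rmin d d'), 0. split; [now apply Rmin_glb_lt|].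
  intros t th Ht Hth Hth' HS.
  pose proof (@node_sector i t0 th Hi) as HS1. rewrite clamp_id in HS1 by lra.
  assert (N : Rabs (node i t0 th - node i t0 th0) < d).
  { apply (HN th). eapply Rlt_le_trans; [exact Hth'|apply Rmin_r]. }
  apply (norm_dist_le (V := V2) (y := K1 i t0 (node i t0 th0) (x (node i t0 th0))) (a := e / 2) (b := e / 2)).
  + left. apply H; [easy| |easy]. eapply Rlt_le_trans; [exact Ht|apply Rmin_l].
  + rewrite (@norm_minus_sym V2). left. apply H; [easy| |easy]. now rewrite Rminus_diag, Rabs_R0.
  + lra.
- exists d. split; [easy|]. intros t s Ht HS0 HS.
  destruct (@node_surj i t0 s Hi) as [th [Hth Es]].
  + lra.
  + replace i with (S (i - 1)) at 2 by lia. apply al_strict; [lia|easy].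
  + apply HS0.
  + rewrite Es in HS |- *. now apply H.
Qed.

(** The integrals at [t] and [t0] are compared on a common interval [[A, B]] lying in both slices.
    On the two short end pieces the integrand is replaced by its boundary value [ca] or [cb]; there
    the motion of the curves produces the boundary terms of the formula. *)
Lemma leibniz i x t0 : (1 <= i <= n)%nat -> continuous_on (fun t => 0 <= t <= T) x -> 0 < t0 < T ->
  is_derive (fun t => RInt (fun s => K i t s (x s)) (al (i - 1) t) (al i t)) t0
   (plus (minus (scal (da i t0) (K i t0 (al i t0) (x (al i t0))))
                (scal (da (i - 1) t0) (K i t0 (al (i - 1) t0) (x (al (i - 1) t0)))))
         (RInt (fun s => K1 i t0 s (x s)) (al (i - 1) t0) (al i t0))).
Proof.
intros Hi Hx Ht0. apply is_derive_intro. intros eps Heps.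
assert (Hlt : al (i - 1) t0 < al i t0).
{ replace i with (S (i - 1)) at 2 by lia. apply al_strict; [lia|easy]. }
pose (ca := K i t0 (al (i - 1) t0) (x (al (i - 1) t0))).
pose (cb := K i t0 (al i t0) (x (al i t0))). fold ca cb.
(* Exceeds the local Lipschitz constants of both curves at [t0]: for small [h] they move by less
   than [L * Rabs h]. *)
pose (L := Rabs (da i t0) + Rabs (da (i - 1) t0) + 2).
assert (HL : 2 <= L) by (unfold L; pose proof (Rabs_pos (da i t0)); pose proof (Rabs_pos (da (i - 1) t0)); lra).
destruct (continuous_on_bound Hx) as [Mx HMx].
destruct (kernel_bound K1_lin K1_cont) as [Mk [HMk HMk']].
pose (M1 := Mk * Mx).
assert (HMx0 : 0 <= Mx) by (eapply Rle_trans; [apply (@norm_ge_0 R_AbsRing V1)|apply (HMx t0); lra]).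
assert (HM1 : 0 <= M1) by (apply Rmult_le_pos; lra).
(* Collects the factors of [e * Rabs h] in the final estimate: [6 * L] from the four end pieces, the
   norms of [ca] and [cb] from linearising the curves, [T] from the middle, and room for the end
   pieces of the [K1] integral. *)
pose (C := 6 * L + (@norm R_AbsRing V2 ca) + (@norm R_AbsRing V2 cb) + T + 2).
pose proof (@norm_ge_0 R_AbsRing V2 ca) as Nca. pose proof (@norm_ge_0 R_AbsRing V2 cb) as Ncb.
assert (HC : 0 < C) by (unfold C; lra).
pose (e := Rmin 1 (eps / C)).
assert (He : 0 < e) by (apply Rmin_glb_lt; [lra|now apply Rdiv_lt_0_compat]).
assert (He1 : e <= 1) by apply Rmin_l.
assert (HeC : e * C <= eps).
{ apply Rle_trans with (eps / C * C); [|right; field; lra].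
  apply Rmult_le_compat_r; [lra|apply Rmin_r]. }
assert (Sa : sector i (t0, al (i - 1) t0)) by (split; simpl; lra).
assert (Sb : sector i (t0, al i t0)) by (split; simpl; lra).
destruct (is_derive_elim (@al_der (i - 1)%nat t0 ltac:(lia) Ht0) He) as [d1 [Hd1 D1]].
destruct (is_derive_elim (@al_der i t0 ltac:(lia) Ht0) He) as [d2 [Hd2 D2]].
destruct (@kernel_near _ _ K K_lin K_cont x i _ _ e Hi Hx Sa He) as [d3 [Hd3 D3]].
destruct (@kernel_near _ _ K K_lin K_cont x i _ _ e Hi Hx Sb He) as [d4 [Hd4 D4]].
destruct (@K1_uniform i x t0 e Hi Hx Ht0 He) as [d5 [Hd5 D5]].
(* Besides respecting the radii found above, [d] must keep the end pieces within reach of [D3] and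
   [D4], leave [A < B], and make the [K1] integral over the end pieces at most [e]. *)
assert (exists d, 0 < d /\ d <= d1 /\ d <= d2 /\ L * d <= d3 /\ L * d <= d4 /\ d <= d5 /\ d <= t0 /\ d <= T - t0 /\
   2 * L * d < al i t0 - al (i - 1) t0 /\ 2 * L * d * M1 <= e) as
   [d [Hd [E1 [E2 [E3 [E4 [E5 [E6 [E7 [E8 E9]]]]]]]]]].
{ assert (Sm : forall c m, 0 < c -> 0 <= m -> exists d0, 0 < d0 /\ forall d, d <= d0 -> 0 < d -> d * m < c).
  { intros c m Hc Hm. exists (c / (m + 1)). split; [apply Rdiv_lt_0_compat; lra|]. intros d Hd Hd0.
    apply Rle_lt_trans with (c / (m + 1) * m); [now apply Rmult_le_compat_r|].
    apply Rlt_le_trans with (c / (m + 1) * (m + 1)); [|right; field; lra].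
    apply Rmult_lt_compat_l; [apply Rdiv_lt_0_compat; lra|lra]. }
  destruct (Sm d3 L) as [x3 [X3 Y3]]; [lra|lra|]. destruct (Sm d4 L) as [x4 [X4 Y4]]; [lra|lra|].
  destruct (Sm (al i t0 - al (i - 1) t0) (2 * L)) as [x8 [X8 Y8]]; [lra|lra|].
  destruct (Sm e (2 * L * M1)) as [x9 [X9 Y9]]; [lra|apply Rmult_le_pos; lra|].
  pose (l := d1 :: d2 :: x3 :: x4 :: d5 :: t0 :: (T - t0) :: x8 :: x9 :: nil).
  assert (exists d, 0 < d /\ forall y, In y l -> d <= y) as [d [Hd Hl]].
  { assert (Hl : forall y, In y l -> 0 < y) by (simpl; intuition (subst; lra)).
    clearbody l. clear - Hl. induction l as [|y l IH].
    - exists 1. split; [lra|easy].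
    - destruct IH as [d [Hd H]]; [intros; apply Hl; now right|].
      exists (Rmin y d). split; [apply Rmin_glb_lt; [apply Hl; now left|easy]|].
      intros z [->|Hz]; [apply Rmin_l|]. eapply Rle_trans; [apply Rmin_r|now apply H]. }
  exists d. split; [easy|].
  assert (d <= x3 /\ d <= x4 /\ d <= x8 /\ d <= x9) as [Z3 [Z4 [Z8 Z9]]] by (repeat split; apply Hl; simpl; tauto).
  specialize (Y3 d Z3 Hd). specialize (Y4 d Z4 Hd). specialize (Y8 d Z8 Hd). specialize (Y9 d Z9 Hd).
  repeat split; try (apply Hl; simpl; tauto); lra. }
assert (HdL : d <= L * d) by nra.
exists d. split; [easy|]. intros t Hth. pose (h := t - t0). fold h. fold h in Hth.
destruct (Req_dec h 0) as [H0|H0].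
{ assert (t = t0) as -> by (unfold h in H0; lra). rewrite H0.
  match goal with |- norm ?v <= _ => replace v with (@zero V2) by (vec V2) end.
  rewrite Rabs_R0, Rmult_0_r. right. exact (@norm_zero R_AbsRing V2). }
assert (Hh : 0 < Rabs h) by now apply Rabs_pos_lt.
(* Cut points out of reach of the moving curves, hence inside the slices at [t0], at [t] and at all
   times between them. *)
pose (A := al (i - 1) t0 + L * Rabs h). pose (B := al i t0 - L * Rabs h).
assert (Hnear : forall r, Rabs (r - t0) <= Rabs h ->
  0 < r < T /\ Rabs (al (i - 1) r - al (i - 1) t0) < L * Rabs h /\ Rabs (al i r - al i t0) < L * Rabs h).
{ intros r Hr. split.
  - assert (Rabs (r - t0) < d) as Q by lra. apply Rabs_def2 in Q. lra.
  - assert (Z : forall dd j, Rabs (al j r - al j t0 - (r - t0) * dd) <= e * Rabs (r - t0) -> Rabs dd + 2 <= L ->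
      Rabs (al j r - al j t0) < L * Rabs h).
    { intros dd j H1 H2. replace (al j r - al j t0) with ((al j r - al j t0 - (r - t0) * dd) + (r - t0) * dd) by ring.
      eapply Rle_lt_trans; [apply Rabs_triang|]. rewrite Rabs_mult.
      apply Rle_lt_trans with (1 * Rabs (r - t0) + Rabs (r - t0) * Rabs dd).
      - apply Rplus_le_compat_r. eapply Rle_trans; [exact H1|]. apply Rmult_le_compat_r; [apply Rabs_pos|easy].
      - pose proof (Rabs_pos dd). pose proof (Rabs_pos (r - t0)). nra. }
    split.
    + apply (Z (da (i - 1) t0)); [apply (D1 r); lra|]. unfold L. pose proof (Rabs_pos (da i t0)); lra.
    + apply (Z (da i t0)); [apply (D2 r); lra|]. unfold L. pose proof (Rabs_pos (da (i - 1) t0)); lra. }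
assert (HLh : L * Rabs h < L * d) by (apply Rmult_lt_compat_l; lra).
assert (HAB : A < B) by (unfold A, B; lra).
destruct (Hnear t (Rle_refl _)) as [Ht [Ha Hb]]. apply Rabs_def2 in Ha. apply Rabs_def2 in Hb.
assert (aA : al (i - 1) t <= A) by (unfold A; lra). assert (Bb : B <= al i t) by (unfold B; lra).
assert (a0A : al (i - 1) t0 <= A) by (unfold A; nra). assert (Bb0 : B <= al i t0) by (unfold B; nra).
destruct (RInt_three aA (Rlt_le _ _ HAB) Bb (@ex_RInt_kernel _ _ K K_lin K_cont x i t Hi Hx ltac:(lra)))
  as [X1 [X2 [X3 ->]]].
destruct (RInt_three a0A (Rlt_le _ _ HAB) Bb0 (@ex_RInt_kernel _ _ K K_lin K_cont x i t0 Hi Hx ltac:(lra)))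
  as [Y1 [Y2 [Y3 ->]]].
destruct (RInt_three a0A (Rlt_le _ _ HAB) Bb0 (@ex_RInt_kernel _ _ K1 K1_lin K1_cont x i t0 Hi Hx ltac:(lra)))
  as [Z1 [Z2 [Z3 ->]]].
set (I1 := RInt _ (al (i - 1) t) A) in *. set (I2 := RInt (fun s => K i t s (x s)) A B) in *. set (I3 := RInt _ B (al i t)) in *.
set (J1 := RInt (fun s => K i t0 s (x s)) (al (i - 1) t0) A) in *. set (J2 := RInt (fun s => K i t0 s (x s)) A B) in *.
set (J3 := RInt (fun s => K i t0 s (x s)) B (al i t0)) in *.
set (N1 := RInt (fun s => K1 i t0 s (x s)) (al (i - 1) t0) A) in *. set (N2 := RInt (fun s => K1 i t0 s (x s)) A B) in *.
set (N3 := RInt (fun s => K1 i t0 s (x s)) B (al i t0)) in *.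
assert (Q1 : norm (minus I1 (scal (A - al (i - 1) t) ca)) <= (2 * L * Rabs h) * e).
{ eapply Rle_trans; [apply (RInt_const_approx (V := V2) (e := e)); trivial|].
  - intros s Hs. left. apply D3; [split; simpl; lra|fold h; lra|]. apply Rabs_def1; unfold A in *; lra.
  - apply Rmult_le_compat_r; [lra|]. unfold A; lra. }
assert (Q2 : norm (minus J1 (scal (A - al (i - 1) t0) ca)) <= (L * Rabs h) * e).
{ eapply Rle_trans; [apply (RInt_const_approx (V := V2) (e := e)); trivial|].
  - intros s Hs. left. apply D3; [split; simpl; lra| |].
    + rewrite Rminus_diag, Rabs_R0; lra.
    + apply Rabs_def1; unfold A in *; lra.
  - apply Rmult_le_compat_r; [lra|]. unfold A; lra. }
assert (Q3 : norm (minus I3 (scal (al i t - B) cb)) <= (2 * L * Rabs h) * e).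
{ eapply Rle_trans; [apply (RInt_const_approx (V := V2) (e := e)); trivial|].
  - intros s Hs. left. apply D4; [split; simpl; lra|fold h; lra|]. apply Rabs_def1; unfold B in *; lra.
  - apply Rmult_le_compat_r; [lra|]. unfold B; lra. }
assert (Q4 : norm (minus J3 (scal (al i t0 - B) cb)) <= (L * Rabs h) * e).
{ eapply Rle_trans; [apply (RInt_const_approx (V := V2) (e := e)); trivial|].
  - intros s Hs. left. apply D4; [split; simpl; lra| |].
    + rewrite Rminus_diag, Rabs_R0; lra.
    + apply Rabs_def1; unfold B in *; lra.
  - apply Rmult_le_compat_r; [lra|]. unfold B; lra. }
(* Middle part: [K_increment] applies for each [s], since [[A, B]] lies in the slices at all times
   between [t0] and [t]. *)
assert (Q5 : norm (minus (minus I2 J2) (scal h N2)) <= T * (e * Rabs h)).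
{ apply Rle_trans with ((B - A) * (e * Rabs h)).
  - apply (norm_RInt_le_const (fun s => minus (minus (K i t s (x s)) (K i t0 s (x s))) (scal h (K1 i t0 s (x s)))) A B).
    + lra.
    + intros s Hs. apply K_increment; [easy|]. intros r Hr. fold h in Hr.
      destruct (Hnear r Hr) as [Hr0 [Hra Hrb]]. apply Rabs_def2 in Hra. apply Rabs_def2 in Hrb.
      assert (al (i - 1) r < s < al i r) by (unfold A, B in *; lra).
      repeat split; try lra. apply D5; [lra| |]; split; simpl; unfold A, B in *; lra.
    + repeat apply (is_RInt_minus (V := V2)); [| |apply (is_RInt_scal (V := V2))]; now apply (RInt_correct (V := V2)).
  - apply Rmult_le_compat_r; [apply Rmult_le_pos; lra|].
    pose proof (@al_range i t0 ltac:(lia) ltac:(lra)). pose proof (@al_range (i - 1) t0 ltac:(lia) ltac:(lra)). lra. }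
assert (HK1 : forall s, al (i - 1) t0 <= s <= al i t0 -> norm (K1 i t0 s (x s)) <= M1).
{ intros s Hs. assert (sector i (t0, s)) as HS by (split; simpl; lra). pose proof (sector_range Hi HS).
  eapply Rle_trans; [now apply HMk'|]. apply Rmult_le_compat_l; [lra|]. apply HMx; lra. }
assert (Q6 : norm N1 <= L * Rabs h * M1).
{ replace (L * Rabs h) with (A - al (i - 1) t0) by (unfold A; ring).
  apply norm_RInt_bound; trivial. intros s Hs. apply HK1. lra. }
assert (Q7 : norm N3 <= L * Rabs h * M1).
{ replace (L * Rabs h) with (al i t0 - B) by (unfold B; ring).
  apply norm_RInt_bound; trivial. intros s Hs. apply HK1. lra. }
assert (Q8 : norm (scal (al (i - 1) t0 - al (i - 1) t + h * da (i - 1) t0) ca) <= e * Rabs h * (@norm R_AbsRing V2 ca)).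
{ rewrite (@norm_scal_eq V2). apply Rmult_le_compat_r; [easy|].
  replace (al (i - 1) t0 - al (i - 1) t + h * da (i - 1) t0) with (- (al (i - 1) t - al (i - 1) t0 - h * da (i - 1) t0)) by ring.
  rewrite Rabs_Ropp. apply (D1 t). fold h; lra. }
assert (Q9 : norm (scal (al i t - al i t0 - h * da i t0) cb) <= e * Rabs h * (@norm R_AbsRing V2 cb)).
{ rewrite (@norm_scal_eq V2). apply Rmult_le_compat_r; [easy|]. apply (D2 t). fold h; lra. }
assert (Q10 : norm (scal h (plus N1 N3)) <= Rabs h * e).
{ rewrite (@norm_scal_eq V2). apply Rmult_le_compat_l; [lra|].
  apply (norm_plus_le Q6 Q7). apply Rle_trans with (2 * L * d * M1); [|easy].
  apply Rle_trans with ((2 * L * Rabs h) * M1); [right; ring|]. apply Rmult_le_compat_r; lra. }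
(* Splitting of the increment into left end, right end and middle, each already compared with its
   linear part. *)
match goal with |- norm ?v <= _ => replace v with
  (plus (plus (plus (minus (minus I1 (scal (A - al (i - 1) t) ca)) (minus J1 (scal (A - al (i - 1) t0) ca)))
                    (scal (al (i - 1) t0 - al (i - 1) t + h * da (i - 1) t0) ca))
              (plus (minus (minus I3 (scal (al i t - B) cb)) (minus J3 (scal (al i t0 - B) cb)))
                    (scal (al i t - al i t0 - h * da i t0) cb)))
        (minus (minus (minus I2 J2) (scal h N2)) (scal h (plus N1 N3)))) by (vec V2) end.
eapply (@norm_plus_le V2).
- eapply (@norm_plus_le V2); [| |apply Rle_refl].
  + eapply (@norm_plus_le V2); [exact (norm_minus_le Q1 Q2 (Rle_refl _))|exact Q8|apply Rle_refl].
  + eapply (@norm_plus_le V2); [exact (norm_minus_le Q3 Q4 (Rle_refl _))|exact Q9|apply Rle_refl].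
- exact (norm_minus_le Q5 Q10 (Rle_refl _)).
- apply Rle_trans with ((e * C) * Rabs h).
  + unfold C. assert (0 <= e * Rabs h) by (apply Rmult_le_pos; lra). nra.
  + apply Rmult_le_compat_r; lra.
Qed.

(** * The differentiated equation and its equivalence with the original one *)

Definition volt (x : R -> V1) (t : R) : V2 :=
  sum_n_m (fun i => RInt (fun s => K i t s (x s)) (al (i - 1) t) (al i t)) 1 n.

(** The operator [A] of the overview, for an abstract family of curves. *)
Definition dvolt (x : R -> V1) (t : R) : V2 :=
  plus (plus (K n t t (x t))
     (sum_n_m (fun i => scal (da i t)
        (minus (K i t (al i t) (x (al i t))) (K (S i) t (al i t) (x (al i t))))) 1 (n - 1)))
   (sum_n_m (fun i => RInt (fun s => K1 i t s (x s)) (al (i - 1) t) (al i t)) 1 n).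

Hypothesis hn : (1 <= n)%nat.
Hypothesis da0 : forall t, da 0%nat t = 0.
Hypothesis dan : forall t, da n t = 1.

(** Summation by parts leaves nothing of the fixed curve, as [da 0 = 0]; the diagonal gives
    [K n t t], as [da n = 1], and the inner curves give the jumps. *)
Lemma volt_derive x t : continuous_on (fun t => 0 <= t <= T) x -> 0 < t < T ->
  is_derive (volt x) t (dvolt x t).
Proof.
intros Hx Ht.
pose proof (@is_derive_sum V2 _ _ t 1 n (fun i Hi => @leibniz i x t Hi Hx Ht)) as H.
rewrite sum_n_m_plus in H.
match type of H with is_derive _ _ ?l => replace (dvolt x t) with l; [exact H|] end.
unfold dvolt. f_equal. replace n with (S (n - 1)) at 1 by lia.
etransitivity; [apply (@sum_by_parts V2 (fun i => da i t) (fun i => K i t (al i t) (x (al i t)))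
  (fun i => K i t (al (i - 1) t) (x (al (i - 1) t))) (n - 1))|].
replace (S (n - 1)) with n by lia. rewrite da0, dan, aln.
rewrite (sum_n_m_ext_loc (G := V2) (fun i => scal (da i t) (minus (K i t (al i t) (x (al i t)))
   (K (S i) t (al (S i - 1) t) (x (al (S i - 1) t)))))
  (fun i => scal (da i t) (minus (K i t (al i t) (x (al i t))) (K (S i) t (al i t) (x (al i t)))))).
- vec V2.
- intros i Hi. now replace (S i - 1)%nat with i by lia.
Qed.

Lemma scal_slice_jcont (A : nat -> R -> R -> V1 -> V2) x i :
  (forall i p, (1 <= i <= n)%nat -> sector i p -> is_linear (A i (fst p) (snd p))) ->
  (forall i, (1 <= i <= n)%nat -> opcont (sector i) (A i)) ->
  (1 <= i <= n)%nat -> continuous_on (fun t => 0 <= t <= T) x ->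
  jcont (fun t th => scal (al i (clamp 0 T t) - al (i - 1) (clamp 0 T t)) (slice A x i t th)).
Proof.
intros HA1 HA2 Hi Hx t th. unfold continuous. apply (lim_scal (V := V2)); [|now apply slice_jcont].
assert (H : forall j, (j <= n)%nat ->
  filterlim (fun q : R * R => al j (clamp 0 T (fst q))) (locally (t, th)) (locally (al j (clamp 0 T t)))).
{ intros j Hj. apply (continuous_comp_lim (f := fun q : R * R => fst q) (g := fun t => al j (clamp 0 T t)) (a := t)).
  - apply fst_lim.
  - now apply al_clamp_cont. }
apply lim_Rminus; apply H; lia.
Qed.

Lemma volt_continuous x : continuous_on (fun t => 0 <= t <= T) x ->
  continuous_on (fun t => 0 <= t <= T) (volt x).
Proof.
intros Hx.
(* The derivative is known only inside the interval; continuity up to the end points comes from the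
   integrals transported to [[0, 1]]. *)
pose (g := fun t => sum_n_m (fun i =>
  RInt (fun th => scal (al i (clamp 0 T t) - al (i - 1) (clamp 0 T t)) (slice K x i t th)) 0 1) 1 n).
assert (Hg : forall t, 0 <= t <= T -> volt x t = g t).
{ intros t Ht. unfold volt, g. apply sum_n_m_ext_loc. intros i Hi.
  rewrite RInt_node; trivial; [|now apply (ex_RInt_kernel K_lin K_cont)].
  apply (RInt_ext (V := V2)). intros th _. unfold slice. now rewrite clamp_id. }
intros t Ht. rewrite (Hg t Ht).
apply (filterlim_within_ext _ g); [intros; now rewrite Hg|].
assert (C : continuous g t).
{ unfold continuous, g. apply (lim_sum (V := V2)). intros i Hi. apply RInt01_continuous.
  now apply scal_slice_jcont. }
eapply filterlim_filter_le_1; [|exact C]. apply filter_le_within.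
Qed.

Lemma volt_0 x : volt x 0 = zero.
Proof.
unfold volt. rewrite <- (sum_n_m_const_zero (G := V2) 1 n). apply sum_n_m_ext_loc.
intros i Hi. pose proof (@al_range i 0 ltac:(lia) ltac:(lra)). pose proof (@al_range (i - 1) 0 ltac:(lia) ltac:(lra)).
replace (al i 0) with 0 by lra. replace (al (i - 1) 0) with 0 by lra. apply (RInt_point (V := V2)).
Qed.

Lemma continuous_on_approx {V : NormedModule R_AbsRing} (g : R -> V) t eps :
  continuous_on (fun t => 0 <= t <= T) g -> 0 <= t <= T -> 0 < eps ->
  exists d, 0 < d /\ forall t', 0 <= t' <= T -> Rabs (t' - t) < d -> norm (minus (g t') (g t)) < eps.
Proof.
intros Hg Ht He. pose proof (proj1 (lim_norm _ _) (Hg t Ht) eps He) as H.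
unfold within in H. apply locally_R in H. destruct H as [d [Hd H]]. exists d. split; [easy|].
intros t' Ht' Hd'. now apply H.
Qed.

Lemma interior_point t d : 0 <= t <= T -> 0 < d -> exists t', 0 < t' < T /\ Rabs (t' - t) < d.
Proof.
intros Ht Hd. destruct (Rle_lt_dec t (T / 2)).
- exists (t + Rmin (T / 4) (d / 2)). pose proof (Rmin_l (T / 4) (d / 2)). pose proof (Rmin_r (T / 4) (d / 2)).
  assert (0 < Rmin (T / 4) (d / 2)) by (apply Rmin_glb_lt; lra). split; [lra|]. apply Rabs_def1; lra.
- exists (t - Rmin (T / 4) (d / 2)). pose proof (Rmin_l (T / 4) (d / 2)). pose proof (Rmin_r (T / 4) (d / 2)).
  assert (0 < Rmin (T / 4) (d / 2)) by (apply Rmin_glb_lt; lra). split; [lra|]. apply Rabs_def1; lra.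
Qed.

(** Estimates are often available only for [0 < t < T], as in condition (D); continuity carries them
    to the end points. *)
Lemma norm_le_closure {V : NormedModule R_AbsRing} (g : R -> V) (h : R -> R) :
  continuous_on (fun t => 0 <= t <= T) g -> continuous_on (fun t => 0 <= t <= T) h ->
  (forall t, 0 < t < T -> norm (g t) <= h t) -> forall t, 0 <= t <= T -> norm (g t) <= h t.
Proof.
intros Hg Hh H t Ht. apply Rnot_lt_le. intros Hl.
pose (e := (norm (g t) - h t) / 2).
destruct (@continuous_on_approx V g t e Hg Ht ltac:(unfold e; lra)) as [d1 [Hd1 H1]].
destruct (@continuous_on_approx R_NormedModule h t e Hh Ht ltac:(unfold e; lra)) as [d2 [Hd2 H2]].
destruct (@interior_point t (Rmin d1 d2) Ht) as [t' [Ht' Hd']]; [now apply Rmin_glb_lt|].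
specialize (H1 t' ltac:(lra) (Rlt_le_trans _ _ _ Hd' (Rmin_l _ _))).
specialize (H2 t' ltac:(lra) (Rlt_le_trans _ _ _ Hd' (Rmin_r _ _))).
change (Rabs (h t' - h t) < e) in H2. apply Rabs_def2 in H2.
specialize (H t' Ht').
assert (norm (g t) <= e + norm (g t')); [|unfold e in *; lra].
apply (@norm_near V _ (g t')); [|lra]. rewrite norm_minus_sym. lra.
Qed.

Lemma eq_closure {V : NormedModule R_AbsRing} (g h : R -> V) :
  continuous_on (fun t => 0 <= t <= T) g -> continuous_on (fun t => 0 <= t <= T) h ->
  (forall t, 0 < t < T -> g t = h t) -> forall t, 0 <= t <= T -> g t = h t.
Proof.
intros Hg Hh H t Ht.
assert (E : norm (minus (g t) (h t)) <= 0).
{ apply (norm_le_closure (g := fun t => minus (g t) (h t)) (h := fun _ => 0)); trivial.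
  - intros t1 Ht1. apply lim_minus; [now apply Hg|now apply Hh].
  - intros t1 Ht1. apply filterlim_const.
  - intros t1 Ht1. rewrite H by easy. replace (minus (h t1) (h t1)) with (@zero V) by vec V. rewrite norm_zero. lra. }
assert (E0 : minus (g t) (h t) = zero) by (apply norm_eq_zero; pose proof (norm_ge_0 (minus (g t) (h t))); lra).
replace (g t) with (plus (minus (g t) (h t)) (h t)) by vec V. rewrite E0. vec V.
Qed.

(** The derivative is known only inside the interval, so the mean value bound starts at a point [a]
    close to 0, and continuity at 0 accounts for the rest. *)
Lemma zero_derive_eq {V : CompleteNormedModule R_AbsRing} (g : R -> V) :
  continuous_on (fun t => 0 <= t <= T) g -> (forall t, 0 < t < T -> is_derive g t zero) ->
  g 0 = zero -> forall t, 0 <= t <= T -> g t = zero.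
Proof.
intros Hg Hd H0.
apply (eq_closure (V := V)); [easy|intros t Ht; apply filterlim_const|].
intros t Ht. apply (@norm_eq_zero R_AbsRing V). apply Rle_antisym; [|apply (@norm_ge_0 R_AbsRing V)].
apply le_epsilon. intros eps He. rewrite Rplus_0_l.
destruct (@continuous_on_approx V g 0 eps Hg ltac:(lra) He) as [d [Hd1 H1]].
pose (a := Rmin t (d / 2)).
assert (Ha : 0 < a /\ a <= t /\ a < d).
{ unfold a. repeat split; [apply Rmin_glb_lt; lra|apply Rmin_l|]. eapply Rle_lt_trans; [apply Rmin_r|lra]. }
assert (E1 : norm (minus (g t) (g a)) <= (t - a) * 0).
{ apply (mean_value_bound (V := V) (df := fun _ => zero)); [easy| | |].
  - intros r Hr. apply Hd. lra.
  - intros r Hr. apply filterlim_const.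
  - intros r Hr. right. apply (@norm_zero R_AbsRing V). }
specialize (H1 a ltac:(lra)). rewrite Rminus_0_r in H1. specialize (H1 ltac:(rewrite Rabs_right; lra)).
replace (g t) with (minus (g t) (g 0)) by (rewrite H0; vec V).
apply (norm_dist_le (V := V) (y := g a) (a := (t - a) * 0) (b := eps)); [exact E1|left; exact H1|lra].
Qed.

Section RightHandSide.
Variables (f df : R -> V2).
Hypothesis f_cont : continuous_on (fun t => 0 <= t <= T) f.
Hypothesis f_der : forall t, 0 < t < T -> is_derive f t (df t).
Hypothesis f_0 : f 0 = zero.

(** Differentiation loses a constant; it is recovered at [t = 0], where the integrals vanish and
    [f 0 = zero]. *)
Lemma volt_solves x : continuous_on (fun t => 0 <= t <= T) x ->
  (forall t, 0 < t < T -> dvolt x t = df t) -> forall t, 0 <= t <= T -> volt x t = f t.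
Proof.
intros Hx H t Ht.
assert (E : minus (volt x t) (f t) = zero).
{ apply (zero_derive_eq (V := V2) (g := fun t => minus (volt x t) (f t))); trivial.
  - intros r Hr. apply (lim_minus (V := V2)); [now apply volt_continuous|now apply f_cont].
  - intros r Hr.
    pose proof (is_derive_minus (V := V2) _ _ _ _ _ (volt_derive Hx Hr) (f_der Hr)) as D.
    rewrite (H r Hr) in D. rewrite minus_eq_zero in D. exact D.
  - rewrite volt_0, f_0. vec V2. }
replace (volt x t) with (plus (minus (volt x t) (f t)) (f t)) by vec V2. rewrite E. vec V2.
Qed.

Lemma volt_solution_derive x : continuous_on (fun t => 0 <= t <= T) x ->
  (forall t, 0 <= t <= T -> volt x t = f t) -> forall t, 0 < t < T -> dvolt x t = df t.
Proof.
intros Hx H t Ht. apply (is_derive_uniq (f := f) (t := t)); [|now apply f_der].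
apply (is_derive_ext_loc (volt x)); [|now apply volt_derive].
apply locally_R. exists (Rmin t (T - t)). split; [apply Rmin_glb_lt; lra|].
intros r Hr. apply H. apply Rabs_def2 in Hr. pose proof (Rmin_l t (T - t)). pose proof (Rmin_r t (T - t)). lra.
Qed.

End RightHandSide.

(** * Inverse of the diagonal kernel and the operators weighted by [t^Ns] *)

Variable Kn : R -> V2 -> V1.
Hypothesis Kn_inv : forall t, 0 <= t <= T -> is_bounded_inverse (K n t t) (Kn t).
Hypothesis be_cont : forall i, (i <= n)%nat -> continuous_on (fun t => 0 <= t <= T) (be i).
Hypothesis al_be : forall i t, (i <= n)%nat -> 0 <= t <= T -> al i t = t * be i t.
Hypothesis da_cont : forall i, (i <= n)%nat -> continuous_on (fun t => 0 <= t <= T) (da i).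

Lemma diag_sector t : 0 <= t <= T -> sector n (t, t).
Proof.
intros Ht. split; simpl; [easy|]. rewrite aln. pose proof (@al_range (n - 1) t ltac:(lia) Ht). lra.
Qed.

(** Resolvent identity [Kn t - Kn t0 = - Kn t0 (K t - K t0) Kn t], with [K] the diagonal kernel. A
    bound for [Kn t] near [t0] is extracted from the identity itself. *)
Lemma Kn_opcont : opcont (V := V2) (W := V1) (fun p => 0 <= fst p <= T) (fun t _ => Kn t).
Proof.
intros [t0 s0] Ht0 eps He; simpl in *.
destruct (Kn_inv Ht0) as [L0 [H0 H0']].
destruct (linear_norm _ L0) as [M [HM HM']].
(* The first bound yields [norm (Kn t y) <= 2 * M * norm y] by absorption; with it the second one
   yields the required [eps]. *)
pose (e1 := Rmin (/ (2 * M)) (eps / (2 * M * M))).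
assert (He1 : 0 < e1).
{ apply Rmin_glb_lt; [apply Rinv_0_lt_compat; lra|apply Rdiv_lt_0_compat; [easy|nra]]. }
destruct (@K_cont n ltac:(lia) (t0, t0) (diag_sector Ht0) e1 He1) as [d [Hd H]].
exists d. split; [easy|]. intros [t s] Ht Htd _ y; simpl in *.
destruct (Kn_inv Ht) as [Lt [Ht1 Ht2]].
specialize (H (t, t) (diag_sector Ht) Htd Htd (Kn t y)); simpl in H.
assert (E : minus (Kn t y) (Kn t0 y) = opp (Kn t0 (minus (K n t t (Kn t y)) (K n t0 t0 (Kn t y))))).
{ rewrite (linear_minus _ _ _ L0), H0, Ht2. vec V1. }
assert (B : norm (minus (Kn t y) (Kn t0 y)) <= M * (e1 * norm (Kn t y))).
{ rewrite E. rewrite (@norm_opp R_AbsRing V1). eapply Rle_trans; [apply HM'|]. apply Rmult_le_compat_l; [lra|exact H]. }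
pose proof (@norm_ge_0 R_AbsRing V1 (Kn t y)) as Ny. pose proof (@norm_ge_0 R_AbsRing V2 y) as Ny2.
assert (M1 : M * e1 <= 1 / 2).
{ apply Rle_trans with (M * / (2 * M)); [|right; field; lra]. apply Rmult_le_compat_l; [lra|apply Rmin_l]. }
assert (M2 : (2 * M * M) * e1 <= eps).
{ apply Rle_trans with ((2 * M * M) * (eps / (2 * M * M))); [|right; field; lra].
  apply Rmult_le_compat_l; [nra|apply Rmin_r]. }
assert (C : norm (Kn t y) <= 2 * M * norm y).
{ pose proof (norm_near B (HM' y)) as Q.
  change (@norm R_AbsRing V1 (Kn t y) <= 2 * M * @norm R_AbsRing V2 y).
  change (@norm R_AbsRing V1 (Kn t y) <= M * (e1 * @norm R_AbsRing V1 (Kn t y)) + M * @norm R_AbsRing V2 y) in Q. nra. }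
eapply Rle_trans; [exact B|].
change (M * (e1 * @norm R_AbsRing V1 (Kn t y)) <= eps * @norm R_AbsRing V2 y).
apply Rle_trans with (M * (e1 * (2 * M * @norm R_AbsRing V2 y))).
- apply Rmult_le_compat_l; [lra|]. apply Rmult_le_compat_l; [lra|exact C].
- replace (M * (e1 * (2 * M * @norm R_AbsRing V2 y))) with ((2 * M * M * e1) * @norm R_AbsRing V2 y) by ring.
  now apply Rmult_le_compat_r.
Qed.

Lemma Kn_lim {S} {F : (S -> Prop) -> Prop} {FF : Filter F} (t : S -> R) (y : S -> V2) t0 y0 :
  0 <= t0 <= T -> F (fun q => 0 <= t q <= T) ->
  filterlim t F (locally t0) -> filterlim y F (locally y0) ->
  filterlim (fun q => Kn (t q) (y q)) F (locally (Kn t0 y0)).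
Proof.
intros H0 HD Ht Hy.
apply (opcont_lim (V := V2) (W := V1) (D := fun p => 0 <= fst p <= T) (A := fun t _ => Kn t)
  (p := fun q => (t q, 0)) (x := y) (p0 := (t0, 0)) (x0 := y0)); trivial.
- intros p Hp. apply (Kn_inv Hp).
- exact Kn_opcont.
- apply lim_pair; [easy|apply filterlim_const].
Qed.

Lemma Kn_bound : exists M, 0 < M /\ forall t y, 0 <= t <= T -> norm (Kn t y) <= M * norm y.
Proof.
destruct (@interval_bound (fun t M => forall y, norm (Kn t y) <= M * norm y) 0 T) as [M HM].
- intros t M M' H1 H2 y. eapply Rle_trans; [apply H1|]. apply Rmult_le_compat_r; [apply (@norm_ge_0 R_AbsRing V2)|easy].
- intros t0 Ht0. destruct (Kn_opcont (p := (t0, 0)) Ht0 Rlt_0_1) as [d [Hd H]].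
  destruct (Kn_inv Ht0) as [L0 _]. destruct (linear_norm _ L0) as [M [_ HM]].
  exists d, (1 + M). split; [easy|]. intros t Ht Htd y.
  specialize (H (t, 0) Ht Htd ltac:(simpl; rewrite Rminus_diag, Rabs_R0; easy) y).
  rewrite Rmult_plus_distr_r. exact (norm_near H (HM y)).
- exists (Rmax M 1). split; [eapply Rlt_le_trans; [apply Rlt_0_1|apply Rmax_r]|].
  intros t y Ht. eapply Rle_trans; [now apply HM|]. apply Rmult_le_compat_r; [apply (@norm_ge_0 R_AbsRing V2)|apply Rmax_l].
Qed.

Notation cont0T := (continuous_on (fun t => 0 <= t <= T)).

Section WeightedOperator.
Variable Ns : nat.

(** [L_op] with [be i t] in place of [alpha i t / t], so that the formula is meaningful and
    continuous at [t = 0]. *)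
Definition Lw (u : R -> V1) (t : R) : V1 :=
  Kn t (sum_n_m (fun i => scal (da i t * be i t ^ Ns)
    (minus (K i t (al i t) (u (al i t))) (K (S i) t (al i t) (u (al i t))))) 1 (n - 1)).

(** Integrand of [K_op] after the substitution by [node]: the ratio [s / t] becomes an interpolation
    between [be (i - 1)] and [be i], free of division by [t]. *)
Definition Kw_slice (u : R -> V1) (i : nat) (t th : R) : V1 :=
  let t' := clamp 0 T t in
  scal ((al i t' - al (i - 1) t') * (be (i - 1) t' + clamp 0 1 th * (be i t' - be (i - 1) t')) ^ Ns)
    (Kn t' (slice K1 u i t th)).

Definition Kw (u : R -> V1) (t : R) : V1 := sum_n_m (fun i => RInt (Kw_slice u i t) 0 1) 1 n.

Definition Zw (u : R -> V1) (t : R) : V1 := plus (Lw u (clamp 0 T t)) (Kw u t).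

Lemma clamp_fst_lim (t th : R) (g : R -> R) : continuous_on (fun t => 0 <= t <= T) g ->
  filterlim (fun q : R * R => g (clamp 0 T (fst q))) (locally (t, th)) (locally (g (clamp 0 T t))).
Proof.
intros Hg.
apply (continuous_comp_lim (f := fun q : R * R => fst q) (g := fun t => g (clamp 0 T t)) (a := t)).
- apply fst_lim.
- apply clamp_comp_cont; [lra|easy].
Qed.

Lemma Kw_slice_jcont u i : (1 <= i <= n)%nat -> continuous_on (fun t => 0 <= t <= T) u -> jcont (Kw_slice u i).
Proof.
intros Hi Hu t th. unfold continuous, Kw_slice. apply (lim_scal (V := V1)).
- apply lim_Rmult; [apply lim_Rminus; apply clamp_fst_lim, al_cont; lia|].
  apply lim_pow. apply lim_Rplus; [apply clamp_fst_lim, be_cont; lia|].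
  apply lim_Rmult; [|apply lim_Rminus; apply clamp_fst_lim, be_cont; lia].
  apply (continuous_comp_lim (f := fun q : R * R => snd q) (g := clamp 0 1) (a := th));
    [apply snd_lim|apply clamp_cont].
- apply Kn_lim.
  + apply clamp_in; lra.
  + apply filter_forall. intros q. apply clamp_in; lra.
  + apply (continuous_comp_lim (f := fun q : R * R => fst q) (g := clamp 0 T) (a := t));
    [apply fst_lim|apply clamp_cont].
  + apply slice_jcont; trivial.
Qed.

Lemma jump_sector i t : (1 <= i <= n - 1)%nat -> 0 <= t <= T ->
  sector i (t, al i t) /\ sector (S i) (t, al i t) /\ 0 <= al i t <= T.
Proof.
intros Hi Ht. pose proof (@al_range i t ltac:(lia) Ht).
assert (al (i - 1) t <= al i t) by (apply al_mono; [lia|lia|easy]).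
assert (al i t <= al (S i) t) by (apply al_mono; [lia|lia|easy]).
unfold sector; simpl. rewrite Nat.sub_0_r. repeat split; lra.
Qed.

Lemma Lw_cont u : continuous_on (fun t => 0 <= t <= T) u -> continuous_on (fun t => 0 <= t <= T) (Lw u).
Proof.
intros Hu t Ht.
assert (I : filterlim (fun s : R => s) (within (fun t => 0 <= t <= T) (locally t)) (locally t)).
{ eapply filterlim_filter_le_1; [apply filter_le_within|apply filterlim_id]. }
assert (D : within (fun t => 0 <= t <= T) (locally t) (fun s => 0 <= s <= T)).
{ unfold within. now apply filter_forall. }
apply Kn_lim; trivial. apply (lim_sum (V := V2)). intros i Hi.
destruct (jump_sector Hi Ht) as [H1 [H2 H3]].
apply (lim_scal (V := V2)).
- apply lim_Rmult; [apply da_cont; [lia|easy]|]. apply lim_pow. apply be_cont; [lia|easy].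
- apply (lim_minus (V := V2)).
  + apply (kernel_lim K_lin K_cont); trivial; try lia.
    * unfold within. apply filter_forall. intros s Hs. now apply jump_sector.
    * apply al_cont; [lia|easy].
    * apply (within_comp_lim (D := fun t => 0 <= t <= T) (f := al i) (g := u)); [apply al_cont; [lia|easy]| |now apply Hu].
      unfold within. apply filter_forall. intros s Hs. now apply jump_sector.
  + apply (kernel_lim K_lin K_cont); trivial; try lia.
    * unfold within. apply filter_forall. intros s Hs. now apply jump_sector.
    * apply al_cont; [lia|easy].
    * apply (within_comp_lim (D := fun t => 0 <= t <= T) (f := al i) (g := u)); [apply al_cont; [lia|easy]| |now apply Hu].
      unfold within. apply filter_forall. intros s Hs. now apply jump_sector.
Qed.

Lemma Zw_cont u t : continuous_on (fun t => 0 <= t <= T) u -> continuous (Zw u) t.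
Proof.
intros Hu. apply (lim_plus (V := V1)).
- apply clamp_comp_cont; [lra|now apply Lw_cont].
- apply (lim_sum (V := V1)). intros i Hi. apply RInt01_continuous. now apply Kw_slice_jcont.
Qed.

Lemma Kw_eq u t : continuous_on (fun t => 0 <= t <= T) u -> 0 < t <= T ->
  (forall i, (1 <= i <= n)%nat ->
    ex_RInt (fun s => scal ((s / t) ^ Ns) (Kn t (K1 i t s (u s)))) (al (i - 1) t) (al i t)) /\
  Kw u t = sum_n_m (fun i => RInt (fun s => scal ((s / t) ^ Ns) (Kn t (K1 i t s (u s)))) (al (i - 1) t) (al i t)) 1 n.
Proof.
intros Hu Ht.
assert (X : forall i, (1 <= i <= n)%nat ->
  ex_RInt (fun s => scal ((s / t) ^ Ns) (Kn t (K1 i t s (u s)))) (al (i - 1) t) (al i t)).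
{ intros i Hi. apply continuous_on_ex_RInt; [apply al_mono; [lia|lia|lra]|].
  intros s Hs. apply (lim_scal (V := V1)).
  - apply lim_pow. apply lim_Rmult; [|apply filterlim_const].
    eapply filterlim_filter_le_1; [apply filter_le_within|apply filterlim_id].
  - apply Kn_lim; [lra|apply filter_forall; intros; lra|apply filterlim_const|].
    apply (kernel_section_continuous K1_lin K1_cont); trivial. lra. }
split; [easy|]. unfold Kw. apply sum_n_m_ext_loc. intros i Hi.
rewrite RInt_node; [|easy|lra|now apply X].
apply (RInt_ext (V := V1)). rewrite Rmin_left, Rmax_right by lra. intros th Hth.
unfold Kw_slice, slice. rewrite !clamp_id by lra. rewrite scal_assoc. f_equal.
unfold mult; simpl. f_equal. f_equal. rewrite node_eq by lra.
rewrite (@al_be i t), (@al_be (i - 1) t); [field; lra|lia|lra|lia|lra].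
Qed.

Lemma Lw_eq u t : 0 < t <= T ->
  Lw u t = Kn t (sum_n_m (fun i => scal (da i t * (al i t / t) ^ Ns)
    (minus (K i t (al i t) (u (al i t))) (K (S i) t (al i t) (u (al i t))))) 1 (n - 1)).
Proof.
intros Ht. unfold Lw. f_equal. apply sum_n_m_ext_loc. intros i Hi.
replace (al i t / t) with (be i t); [easy|].
rewrite (@al_be i t); [field; lra|lia|lra].
Qed.

Lemma scal_on_cont (u : R -> V1) : continuous_on (fun t => 0 <= t <= T) u ->
  continuous_on (fun t => 0 <= t <= T) (fun t => scal (t ^ Ns) (u t)).
Proof.
intros Hu t Ht. apply (lim_scal (V := V1)); [|now apply Hu].
apply lim_pow. eapply filterlim_filter_le_1; [apply filter_le_within|apply filterlim_id].
Qed.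

(** Conjugation by [t^Ns]: each value [s^Ns u(s)] is written as [t^Ns (s/t)^Ns u(s)], and the factor
    [t^Ns] leaves all operators. The remaining ratios are the weights in [Lw] and [Kw]. *)
Lemma dvolt_weighted (u : R -> V1) t : continuous_on (fun t => 0 <= t <= T) u -> 0 < t <= T ->
  Kn t (dvolt (fun t => scal (t ^ Ns) (u t)) t) = scal (t ^ Ns) (plus (u t) (Zw u t)).
Proof.
intros Hu Ht. assert (Ht' : 0 <= t <= T) by lra.
pose proof (@Kn_inv t Ht') as [L1 [I1 I2]].
unfold dvolt, Zw. rewrite clamp_id by lra.
rewrite !(linear_plus _ L1), I1.
rewrite (proj2 (Kw_eq Hu Ht)), Lw_eq by easy.
assert (E1 : Kn t (sum_n_m (fun i => scal (da i t) (minus (K i t (al i t) (scal (al i t ^ Ns) (u (al i t))))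
      (K (S i) t (al i t) (scal (al i t ^ Ns) (u (al i t)))))) 1 (n - 1)) =
  scal (t ^ Ns) (Kn t (sum_n_m (fun i => scal (da i t * (al i t / t) ^ Ns)
    (minus (K i t (al i t) (u (al i t))) (K (S i) t (al i t) (u (al i t))))) 1 (n - 1)))).
{ rewrite <- (linear_scal _ L1), (scal_sum_n_m (W := V2)). f_equal. apply sum_n_m_ext_loc. intros i Hi.
  destruct (jump_sector Hi Ht') as [S1 [S2 _]].
  assert (F1 : K i t (al i t) (scal (al i t ^ Ns) (u (al i t))) = scal (al i t ^ Ns) (K i t (al i t) (u (al i t))))
    by exact (linear_scal _ (@K_lin i (t, al i t) ltac:(lia) S1) (al i t ^ Ns) (u (al i t))).
  assert (F2 : K (S i) t (al i t) (scal (al i t ^ Ns) (u (al i t))) = scal (al i t ^ Ns) (K (S i) t (al i t) (u (al i t))))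
    by exact (linear_scal _ (@K_lin (S i) (t, al i t) ltac:(lia) S2) (al i t ^ Ns) (u (al i t))).
  rewrite F1, F2.
  assert (E0 : al i t ^ Ns = t ^ Ns * (al i t / t) ^ Ns) by (rewrite <- Rpow_mult_distr; f_equal; field; lra).
  rewrite E0. vec V2. }
rewrite E1.
assert (E2 : Kn t (sum_n_m (fun i => RInt (fun s => K1 i t s (scal (s ^ Ns) (u s))) (al (i - 1) t) (al i t)) 1 n) =
  scal (t ^ Ns) (sum_n_m (fun i => RInt (fun s => scal ((s / t) ^ Ns) (Kn t (K1 i t s (u s)))) (al (i - 1) t) (al i t)) 1 n)).
{ rewrite (linear_sum_n_m (U := V2) (W := V1) _ _ _ L1), (scal_sum_n_m (W := V1)). apply sum_n_m_ext_loc. intros i Hi.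
  rewrite <- (RInt_linear (V := V2) (W := V1) L1).
  2:{ apply (ex_RInt_kernel K1_lin K1_cont (x := fun s => scal (s ^ Ns) (u s))); trivial. now apply scal_on_cont. }
  rewrite <- (RInt_scal (V := V1)) by (now apply (proj1 (Kw_eq Hu Ht))).
  apply (RInt_ext (V := V1)). rewrite Rmin_left, Rmax_right by (apply al_mono; [lia|lia|easy]).
  intros s Hs. assert (SS : sector i (t, s)) by (split; simpl; lra).
  assert (F1 : K1 i t s (scal (s ^ Ns) (u s)) = scal (s ^ Ns) (K1 i t s (u s)))
    by exact (linear_scal _ (K1_lin Hi SS) (s ^ Ns) (u s)).
  assert (F2 : forall r (y : V2), Kn t (scal r y) = scal r (Kn t y)) by (intros; exact (linear_scal _ L1 r y)).
  rewrite F1, F2.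
  replace (s ^ Ns) with (t ^ Ns * (s / t) ^ Ns) by (rewrite <- Rpow_mult_distr; f_equal; field; lra).
  vec V1. }
rewrite E2. vec V1.
Qed.

Lemma Zw_minus (u v : R -> V1) t : cont0T u -> cont0T v -> 0 <= t <= T ->
  Zw (fun s => minus (u s) (v s)) t = minus (Zw u t) (Zw v t).
Proof.
intros Hu Hv Ht. destruct (Kn_inv Ht) as [L1 _]. unfold Zw. rewrite clamp_id by easy.
assert (E1 : Lw (fun s => minus (u s) (v s)) t = minus (Lw u t) (Lw v t)).
{ unfold Lw. rewrite !(linear_sum_n_m (U := V2) (W := V1) _ _ _ L1).
  rewrite (sum_n_m_minus (W := V1)). apply sum_n_m_ext_loc. intros i Hi.
  destruct (jump_sector Hi Ht) as [S1 [S2 _]].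
  assert (F : forall r (y z : V2), Kn t (scal r y) = scal r (Kn t y)) by (intros; exact (linear_scal _ L1 r y)).
  rewrite <- (linear_minus _ _ _ L1). f_equal.
  assert (F1 : K i t (al i t) (minus (u (al i t)) (v (al i t))) = minus (K i t (al i t) (u (al i t))) (K i t (al i t) (v (al i t))))
    by exact (linear_minus _ _ _ (@K_lin i (t, al i t) ltac:(lia) S1)).
  assert (F2 : K (S i) t (al i t) (minus (u (al i t)) (v (al i t))) = minus (K (S i) t (al i t) (u (al i t))) (K (S i) t (al i t) (v (al i t))))
    by exact (linear_minus _ _ _ (@K_lin (S i) (t, al i t) ltac:(lia) S2)).
  rewrite F1, F2. vec V2. }
assert (E2 : Kw (fun s => minus (u s) (v s)) t = minus (Kw u t) (Kw v t)).
{ unfold Kw.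
  rewrite (sum_n_m_minus (W := V1)). apply sum_n_m_ext_loc. intros i Hi.
  rewrite <- (RInt_minus (V := V1)) by (apply jcont_ex_RInt; now apply Kw_slice_jcont).
  apply (RInt_ext (V := V1)). intros th _. unfold Kw_slice, slice. rewrite clamp_id by easy.
  pose proof (@node_sector i t th Hi) as S1. rewrite clamp_id in S1 by easy.
  set (s := node i t th) in *.
  assert (F1 : K1 i t s (minus (u s) (v s)) = minus (K1 i t s (u s)) (K1 i t s (v s)))
    by exact (linear_minus _ _ _ (K1_lin Hi S1)).
  rewrite F1, (linear_minus _ _ _ L1). vec V1. }
rewrite E1, E2. vec V1.
Qed.

End WeightedOperator.

(** Case of exponent 0: through this identity [dvolt] inherits additivity and continuity from
    [Zw]. *)
Lemma dvolt_Zw (x : R -> V1) t : cont0T x -> 0 < t <= T -> dvolt x t = K n t t (plus (x t) (Zw 0 x t)).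
Proof.
intros Hx Ht. assert (Ht' : 0 <= t <= T) by lra. pose proof (@Kn_inv t Ht') as [L1 [I1 I2]].
  rewrite <- (I2 (dvolt x t)). f_equal.
  pose proof (@dvolt_weighted 0 x t Hx Ht) as H. simpl pow in H.
  replace (scal 1 (plus (x t) (Zw 0 x t))) with (plus (x t) (Zw 0 x t)) in H by (vec V1). rewrite <- H.
  assert (Ex : forall s, x s = scal 1 (x s)) by (intros s; vec V1).
  f_equal. unfold dvolt. rewrite <- Ex. f_equal; [f_equal|].
  - apply sum_n_m_ext. intros i. now rewrite <- Ex.
  - apply sum_n_m_ext. intros i. apply (RInt_ext (V := V2)). intros s _. now rewrite <- Ex.
Qed.

Lemma dvolt_minus (x y : R -> V1) t : cont0T x -> cont0T y -> 0 < t <= T ->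
  dvolt (fun s => minus (x s) (y s)) t = minus (dvolt x t) (dvolt y t).
Proof.
intros Hx Hy Ht.
assert (Hxy : cont0T (fun s => minus (x s) (y s))).
{ intros s Hs. apply (lim_minus (V := V1)); [now apply Hx|now apply Hy]. }
rewrite !dvolt_Zw, Zw_minus by (trivial; lra).
pose proof (@K_lin n (t, t) ltac:(lia) (@diag_sector t ltac:(lra))) as LK. simpl in LK.
rewrite <- (linear_minus _ _ _ LK). f_equal. vec V1.
Qed.

Lemma dvolt_cont x : continuous_on (fun t => 0 <= t <= T) x ->
  continuous_on (fun t => 0 < t <= T) (dvolt x).
Proof.
intros Hx.
pose proof (fun t Ht => @dvolt_Zw x t Hx Ht) as E.
intros t Ht. rewrite (E t Ht).
apply (filterlim_within_ext _ (fun t => K n t t (plus (x t) (Zw 0 x t)))); [intros; now rewrite E|].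
assert (I : filterlim (fun s : R => s) (within (fun t => 0 < t <= T) (locally t)) (locally t)).
{ eapply filterlim_filter_le_1; [apply filter_le_within|apply filterlim_id]. }
apply (kernel_lim K_lin K_cont); trivial; try lia.
- apply diag_sector; lra.
- unfold within. apply filter_forall. intros s Hs. apply diag_sector; lra.
- apply (lim_plus (V := V1)).
  + apply (within_comp_lim (D := fun t => 0 <= t <= T) (f := fun s => s) (g := x)); [easy| |apply Hx; lra].
    unfold within. apply filter_forall. intros; lra.
  + eapply filterlim_filter_le_1; [apply filter_le_within|now apply Zw_cont].
Qed.

(** * Contraction in an exponentially weighted norm *)

Section FixedPoint.
Variable Ns : nat.
Variable q : R.
Hypothesis Hq : 0 <= q < 1.
Hypothesis contraction : forall t, 0 < t < T -> exists c : nat -> R,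
  (forall i y, (1 <= i <= n - 1)%nat -> 0 <= c i /\
     norm (Kn t (minus (K i t (al i t) y) (K (S i) t (al i t) y))) <= c i * norm y) /\
  sum_n_m (fun i => Rabs (da i t) * be i t ^ Ns * c i) 1 (n - 1) <= q.

Lemma be_range i t : (i <= n)%nat -> 0 < t <= T -> 0 <= be i t <= 1.
Proof.
intros Hi Ht. pose proof (@al_range i t Hi ltac:(lra)) as H. rewrite (@al_be i t) in H by (trivial; lra).
split; [apply Rmult_le_reg_l with t; lra|apply Rmult_le_reg_l with t; lra].
Qed.

(** Since [al i t <= t], only values of [u] on [[0, t]] enter, which makes the estimate compatible
    with an increasing weight. *)
Lemma Lw_bound (u : R -> V1) t B : 0 < t < T -> (forall s, 0 <= s <= t -> norm (u s) <= B) ->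
  norm (Lw Ns u t) <= q * B.
Proof.
intros Ht Hu. assert (HB : 0 <= B).
{ eapply Rle_trans; [apply (@norm_ge_0 R_AbsRing V1 (u t))|apply Hu; lra]. }
destruct (contraction Ht) as [c [Hc1 Hc2]]. destruct (@Kn_inv t ltac:(lra)) as [L1 _].
unfold Lw. rewrite (linear_sum_n_m (U := V2) (W := V1) _ _ _ L1).
eapply Rle_trans; [apply (@norm_sum_n_m R_AbsRing V1)|].
apply Rle_trans with (sum_n_m (fun i => mult (K := R_Ring) (Rabs (da i t) * be i t ^ Ns * c i) B) 1 (n - 1)).
- apply sum_n_m_Rle. intros i Hi.
  rewrite (linear_scal _ L1). rewrite (@norm_scal_eq V1).
  destruct (Hc1 i (u (al i t)) Hi) as [C1 C2].
  pose proof (@be_range i t ltac:(lia) ltac:(lra)) as Hb.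
  rewrite Rabs_mult, (Rabs_right (be i t ^ Ns)) by (apply Rle_ge, pow_le; lra).
  change (mult (K := R_Ring) (Rabs (da i t) * be i t ^ Ns * c i) B) with (Rabs (da i t) * be i t ^ Ns * c i * B).
  rewrite (Rmult_assoc _ (c i)). apply Rmult_le_compat_l.
  + apply Rmult_le_pos; [apply Rabs_pos|apply pow_le; lra].
  + eapply Rle_trans; [exact C2|]. apply Rmult_le_compat_l; [easy|]. apply Hu.
    apply (@al_range i t); [lia|lra].
- rewrite (sum_n_m_mult_r (K := R_Ring) B). apply Rmult_le_compat_r; [easy|exact Hc2].
Qed.

(** Integrating [exp (lam * s)] gains a factor [/ lam]. The powers of [s / t] are at most 1, and the
    bounds over the sectors telescope to one over [[0, t]]; the constant is a bound for [Kn] times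
    one for [K1]. *)
Lemma Kw_exp_bound : exists M, 0 < M /\ forall (u : R -> V1) t C lam, 0 < t < T -> 0 < lam -> 0 <= C -> cont0T u ->
  (forall s, 0 <= s <= T -> norm (u s) <= C * exp (lam * s)) ->
  norm (Kw Ns u t) <= M / lam * (C * exp (lam * t)).
Proof.
destruct Kn_bound as [M1 [HM1 HK]]. destruct (kernel_bound K1_lin K1_cont) as [M2 [HM2 HK1]].
exists (M1 * M2). split; [now apply Rmult_lt_0_compat|]. intros u t C lam Ht Hl HC Hu Hb.
destruct (@Kw_eq Ns u t Hu ltac:(lra)) as [HX ->].
eapply Rle_trans; [apply (@norm_sum_n_m R_AbsRing V1)|].
apply Rle_trans with (sum_n_m (fun i => minus (M1 * M2 * C / lam * exp (lam * al i t)) (M1 * M2 * C / lam * exp (lam * al (i - 1)%nat t))) 1 n).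
- apply sum_n_m_Rle. intros i Hi.
  apply (norm_RInt_le (fun s => scal ((s / t) ^ Ns) (Kn t (K1 i t s (u s)))) (fun s => M1 * M2 * C * exp (lam * s)) (al (i - 1) t) (al i t)).
  + apply al_mono; [lia|lia|lra].
  + intros s Hs. assert (HS : sector i (t, s)) by (split; simpl; lra).
    pose proof (sector_range Hi HS) as HSr.
    rewrite (@norm_scal_eq V1).
    assert (Hw : 0 <= (s / t) ^ Ns <= 1).
    { assert (0 <= s / t <= 1) by (split; [apply Rdiv_le_0_compat; lra|apply Rle_div_l; lra]).
      split; [now apply pow_le|]. rewrite <- (pow1 Ns). now apply pow_incr. }
    rewrite Rabs_right by lra.
    apply Rle_trans with (1 * norm (Kn t (K1 i t s (u s)))).
    * apply Rmult_le_compat_r; [apply (@norm_ge_0 R_AbsRing V1)|easy].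
    * rewrite Rmult_1_l. eapply Rle_trans; [apply HK; lra|]. rewrite !Rmult_assoc. apply Rmult_le_compat_l; [lra|].
      eapply Rle_trans; [now apply HK1|]. apply Rmult_le_compat_l; [lra|]. apply Hb. lra.
  + apply (RInt_correct (V := V1)). now apply HX.
  + apply exp_RInt. lra.
- assert (E : forall m, sum_n_m (fun i => minus (M1 * M2 * C / lam * exp (lam * al i t)) (M1 * M2 * C / lam * exp (lam * al (i - 1)%nat t))) 1 m =
    M1 * M2 * C / lam * exp (lam * al m t) - M1 * M2 * C / lam * exp (lam * al 0%nat t)).
  { induction m as [|m IH]; [rewrite sum_n_m_zero by lia; unfold zero; simpl; ring|].
    rewrite sum_n_Sm by lia. rewrite IH. replace (S m - 1)%nat with m by lia. unfold plus, minus, opp; simpl. unfold plus, opp; simpl. ring. }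
  rewrite E, aln.
  assert (0 <= M1 * M2 * C / lam * exp (lam * al 0%nat t)).
  { apply Rmult_le_pos; [|left; apply exp_pos]. apply Rdiv_le_0_compat; [|easy]. apply Rmult_le_pos; [nra|easy]. }
  replace (M1 * M2 / lam * (C * exp (lam * t))) with (M1 * M2 * C / lam * exp (lam * t)) by (field; lra). lra.
Qed.

Lemma Zw_contracts : exists lam kap, 0 < lam /\ 0 <= kap < 1 /\ forall (u : R -> V1) C, 0 <= C -> cont0T u ->
  (forall s, 0 <= s <= T -> norm (u s) <= C * exp (lam * s)) ->
  forall t, 0 <= t <= T -> norm (Zw Ns u t) <= kap * C * exp (lam * t).
Proof.
destruct Kw_exp_bound as [M [HM HK]].
(* With this [lam] the integral part contributes [(1 - q) / 2], half of the gap that [q] leaves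
   below 1. *)
exists (2 * M / (1 - q)), ((1 + q) / 2).
assert (Hl : 0 < 2 * M / (1 - q)) by (apply Rdiv_lt_0_compat; lra).
split; [easy|]. split; [lra|]. intros u C HC Hu Hb.
set (lam := 2 * M / (1 - q)) in *.
(* The hypothesis [contraction] speaks of [0 < t < T] only, while the bound is wanted on the closed
   interval. *)
apply (norm_le_closure (V := V1)).
- apply continuous_on_pointwise. intros t _. now apply Zw_cont.
- apply continuous_on_pointwise. intros t _. apply (ex_derive_continuous (V := R_NormedModule)). auto_derive. easy.
- intros t Ht. unfold Zw. rewrite clamp_id by lra.
  apply (norm_plus_le (V := V1) (a := q * (C * exp (lam * t))) (b := M / lam * (C * exp (lam * t)))).
  + apply Lw_bound; [easy|]. intros s Hs. eapply Rle_trans; [apply Hb; lra|].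
    apply Rmult_le_compat_l; [easy|]. destruct (Req_dec s t) as [->|]; [lra|]. left. apply exp_increasing.
    apply Rmult_lt_compat_l; lra.
  + now apply HK.
  + assert (EM : M / lam = (1 - q) / 2) by (unfold lam; field; split; lra). rewrite EM.
    right. field.
Qed.

(** A fixed point [w = - Zw w] vanishes, being bounded by [C kap^m exp (lam t)] for every [m]. *)
Lemma Zw_fixed_zero (w : R -> V1) : cont0T w -> (forall t, 0 < t < T -> w t = opp (Zw Ns w t)) ->
  forall t, 0 <= t <= T -> w t = zero.
Proof.
intros Hw H. destruct Zw_contracts as [lam [kap [Hl [Hk HZ]]]].
assert (H' : forall t, 0 <= t <= T -> w t = opp (Zw Ns w t)).
{ apply (eq_closure (V := V1)); trivial. intros t Ht. apply (lim_opp (V := V1)).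
  apply continuous_on_pointwise; [|easy]. intros. now apply Zw_cont. }
destruct (continuous_on_bound Hw) as [C HC].
assert (C0 : 0 <= C) by (eapply Rle_trans; [apply (@norm_ge_0 R_AbsRing V1 (w 0))|apply HC; lra]).
assert (Hm : forall m s, 0 <= s <= T -> norm (w s) <= (kap ^ m * C) * exp (lam * s)).
{ induction m as [|m IH]; intros s Hs.
  - simpl. rewrite Rmult_1_l. eapply Rle_trans; [now apply HC|]. rewrite <- (Rmult_1_r C) at 1.
    apply Rmult_le_compat_l; [easy|]. rewrite <- exp_0. destruct (Req_dec s 0) as [->|]; [rewrite Rmult_0_r; lra|].
    left. apply exp_increasing. apply Rmult_lt_0_compat; lra.
  - rewrite (H' s Hs), (@norm_opp R_AbsRing V1). simpl. rewrite (Rmult_assoc kap).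
    apply HZ; trivial. apply Rmult_le_pos; [apply pow_le; lra|easy]. }
intros t Ht. apply (@norm_eq_zero R_AbsRing V1). apply Rle_antisym; [|apply (@norm_ge_0 R_AbsRing V1)].
apply le_epsilon. intros eps He. rewrite Rplus_0_l.
destruct (pow_lt_1_zero kap ltac:(rewrite Rabs_right; lra) (eps / (C * exp (lam * t) + 1))) as [m Hmm].
{ apply Rdiv_lt_0_compat; [easy|]. assert (0 <= C * exp (lam * t)); [|lra]. apply Rmult_le_pos; [easy|left; apply exp_pos]. }
specialize (Hmm m (le_n m)). rewrite Rabs_right in Hmm by (apply Rle_ge, pow_le; lra).
eapply Rle_trans; [exact (Hm m t Ht)|].
assert (P : 0 <= C * exp (lam * t)) by (apply Rmult_le_pos; [easy|left; apply exp_pos]).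
rewrite Rmult_assoc.
apply Rle_trans with (eps / (C * exp (lam * t) + 1) * (C * exp (lam * t) + 1)); [|right; field; lra].
apply Rmult_le_compat; try lra. apply pow_le; lra.
Qed.

Fixpoint iterate (g : R -> V1) (m : nat) : R -> V1 :=
  match m with
  | O => g
  | S m => fun t => plus (opp (Zw Ns (iterate g m) t)) (g t)
  end.

Lemma iterate_cont g m : (forall t, continuous g t) -> forall t, continuous (iterate g m) t.
Proof.
intros Hg. induction m as [|m IH]; intros t; simpl; [apply Hg|].
apply (lim_plus (V := V1)); [|apply Hg]. apply (lim_opp (V := V1)). apply Zw_cont.
now apply continuous_on_pointwise.
Qed.

Lemma iterate_converges g : (forall t, continuous g t) -> exists u, cont0T u /\
  uniform_limit_on (fun t => 0 <= t <= T) (iterate g) u /\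
  forall t, 0 <= t <= T -> u t = plus (opp (Zw Ns u t)) (g t).
Proof.
intros Hg. destruct Zw_contracts as [lam [kap [Hl [Hk HZ]]]].
pose proof (fun m => @continuous_on_pointwise _ _ (fun t => 0 <= t <= T) _ (fun t _ => @iterate_cont g m Hg t)) as Hi.
destruct (continuous_on_bound (x := fun t => minus (iterate g 1 t) (iterate g 0 t)) (a := 0) (b := T)) as [C HC].
{ intros t Ht. apply (lim_minus (V := V1)); [now apply (Hi 1%nat)|now apply (Hi 0%nat)]. }
assert (C0 : 0 <= C) by (eapply Rle_trans; [apply (@norm_ge_0 R_AbsRing V1)|apply (HC 0); lra]).
assert (exp1 : forall s, 0 <= s -> 1 <= exp (lam * s)).
{ intros s Hs. rewrite <- exp_0. destruct (Req_dec s 0) as [->|]; [rewrite Rmult_0_r; lra|].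
  left. apply exp_increasing. apply Rmult_lt_0_compat; lra. }
assert (Hd : forall m s, 0 <= s <= T ->
  norm (minus (iterate g (S m) s) (iterate g m s)) <= (kap ^ m * C) * exp (lam * s)).
{ induction m as [|m IH]; intros s Hs.
  - simpl pow. rewrite Rmult_1_l. eapply Rle_trans; [now apply HC|]. rewrite <- (Rmult_1_r C) at 1.
    apply Rmult_le_compat_l; [easy|]. apply exp1; lra.
  - replace (minus (iterate g (S (S m)) s) (iterate g (S m) s)) with
      (opp (Zw Ns (fun s => minus (iterate g (S m) s) (iterate g m s)) s)).
    2:{ rewrite Zw_minus by (apply Hi || easy). simpl. vec V1. }
    rewrite (@norm_opp R_AbsRing V1). simpl pow. rewrite (Rmult_assoc kap).
    apply HZ; trivial; [apply Rmult_le_pos; [apply pow_le; lra|easy]|].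
    intros r Hr. apply (lim_minus (V := V1)); now apply Hi. }
(* Sum of the geometric series that majorises all increments, with the weight replaced by its
   maximum. *)
pose (D := C * exp (lam * T) / (1 - kap)).
assert (D0 : 0 <= D).
{ apply Rdiv_le_0_compat; [|lra]. apply Rmult_le_pos; [easy|left; apply exp_pos]. }
(* The factor [1 - kap ^ p] is the exact partial geometric sum, with which the induction on [p]
   closes. *)
assert (Hp : forall p m s, 0 <= s <= T ->
  norm (minus (iterate g (m + p) s) (iterate g m s)) <= D * kap ^ m * (1 - kap ^ p)).
{ induction p as [|p IH]; intros m s Hs.
  - rewrite Nat.add_0_r. simpl pow. rewrite minus_eq_zero. right.
    rewrite Rminus_diag, Rmult_0_r. apply (@norm_zero R_AbsRing V1).
  - replace (m + S p)%nat with (S (m + p)) by lia.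
    apply (norm_dist_le (V := V1) (y := iterate g (m + p) s) (a := kap ^ (m + p) * C * exp (lam * T)) (b := D * kap ^ m * (1 - kap ^ p))).
    + eapply Rle_trans; [now apply Hd|]. apply Rmult_le_compat_l; [apply Rmult_le_pos; [apply pow_le; lra|easy]|].
      destruct (Req_dec s T) as [->|]; [lra|]. left. apply exp_increasing. apply Rmult_lt_compat_l; lra.
    + now apply IH.
    + rewrite pow_add. simpl pow. right. unfold D. field. lra. }
assert (Hp' : forall m m' s, (m <= m')%nat -> 0 <= s <= T ->
  norm (minus (iterate g m' s) (iterate g m s)) <= D * kap ^ m).
{ intros m m' s Hm Hs. replace m' with (m + (m' - m))%nat by lia. eapply Rle_trans; [now apply Hp|].
  rewrite <- (Rmult_1_r (D * kap ^ m)) at 2. apply Rmult_le_compat_l.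
  - apply Rmult_le_pos; [easy|apply pow_le; lra].
  - assert (0 <= kap ^ (m' - m)) by (apply pow_le; lra). lra. }
assert (Hsmall : forall eps, 0 < eps -> exists m, D * kap ^ m < eps).
{ intros eps He. destruct (pow_lt_1_zero kap ltac:(rewrite Rabs_right; lra) (eps / (D + 1))) as [m Hmm].
  { apply Rdiv_lt_0_compat; lra. }
  exists m. specialize (Hmm m (le_n m)). rewrite Rabs_right in Hmm by (apply Rle_ge, pow_le; lra).
  apply Rle_lt_trans with ((D + 1) * kap ^ m).
  - apply Rmult_le_compat_r; [apply pow_le; lra|lra].
  - apply Rlt_le_trans with ((D + 1) * (eps / (D + 1))); [apply Rmult_lt_compat_l; lra|right; field; lra]. }
(* Completeness gives pointwise limits on [[0, T]]; outside, an arbitrary value is taken. *)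
assert (HL : forall s, exists y, 0 <= s <= T -> filterlim (fun m => iterate g m s) eventually (locally y)).
{ intros s. destruct (classic (0 <= s <= T)) as [Hs|Hs]; [|now exists zero].
  destruct (proj1 (filterlim_locally_cauchy (U := V1) (F := eventually) (fun m => iterate g m s))) as [y Hy]; [|now exists y].
  intros eps. destruct (Hsmall (eps / 2)) as [m Hm]; [destruct eps; simpl; lra|].
  exists (fun m' => (m <= m')%nat). split; [now exists m|]. intros m1 m2 H1 H2.
  apply (@norm_compat1 R_AbsRing V1).
  apply (norm_dist_lt (V := V1) (y := iterate g m s) (a := eps / 2) (b := eps / 2)).
  - eapply Rle_lt_trans; [now apply Hp'|exact Hm].
  - rewrite (@norm_minus_sym V1). left. eapply Rle_lt_trans; [now apply Hp'|exact Hm].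
  - lra. }
destruct (choice (fun s y => 0 <= s <= T -> filterlim (fun m => iterate g m s) eventually (locally y)) HL) as [u Hu].
assert (HU : forall m s, 0 <= s <= T -> norm (minus (iterate g m s) (u s)) <= D * kap ^ m).
{ intros m s Hs. apply le_epsilon. intros eps He.
  destruct (proj1 (lim_norm (V := V1) _ _) (Hu s Hs) eps He) as [m' Hm'].
  apply (norm_dist_le (V := V1) (y := iterate g (max m m') s) (a := D * kap ^ m) (b := eps)); [| |lra].
  - rewrite (@norm_minus_sym V1). apply Hp'; [lia|easy].
  - left. apply Hm'. lia. }
assert (HuU : uniform_limit_on (V := V1) (fun t => 0 <= t <= T) (iterate g) u).
{ intros eps. destruct (Hsmall eps (cond_pos eps)) as [M HM]. exists M. intros m Hm t Ht.
  eapply Rle_lt_trans; [now apply HU|]. eapply Rle_lt_trans; [|exact HM].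
  apply Rmult_le_compat_l; [easy|]. replace m with (M + (m - M))%nat by lia. rewrite pow_add.
  rewrite <- (Rmult_1_r (kap ^ M)) at 2. apply Rmult_le_compat_l; [apply pow_le; lra|].
  rewrite <- (pow1 (m - M)). apply pow_incr. lra. }
assert (Hc : cont0T u).
{ intros t Ht. apply (lim_norm (V := V1)). intros eps He. destruct (Hsmall (eps / 3)) as [m Hm]; [lra|].
  pose proof (proj1 (lim_norm (V := V1) _ _) (Hi m t Ht) (eps / 3) ltac:(lra)) as HH.
  unfold within in *. revert HH. apply filter_imp. intros s HH Hs.
  apply (norm_dist_lt (V := V1) (y := iterate g m t) (a := eps / 3 + eps / 3) (b := eps / 3)); [| |lra].
  - apply (norm_dist_lt (V := V1) (y := iterate g m s) (a := eps / 3) (b := eps / 3)); [| |lra].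
    + rewrite (@norm_minus_sym V1). eapply Rle_lt_trans; [now apply HU|exact Hm].
    + left. now apply HH.
  - left. eapply Rle_lt_trans; [now apply HU|exact Hm]. }
exists u. split; [easy|]. split; [easy|]. intros t Ht.
(* The recursion passes to the limit because [Zw] contracts the distance between the iterate and
   [u]. *)
assert (E : norm (minus (u t) (plus (opp (Zw Ns u t)) (g t))) <= 0).
{ apply le_epsilon. intros eps He. rewrite Rplus_0_l.
  destruct (Hsmall (eps / (2 * exp (lam * T)))) as [m Hm].
  { apply Rdiv_lt_0_compat; [easy|]. pose proof (exp_pos (lam * T)); lra. }
  pose proof (exp1 T ltac:(lra)) as ET.
  assert (EH : D * kap ^ m * exp (lam * T) <= eps / 2).
  { apply Rle_trans with (eps / (2 * exp (lam * T)) * exp (lam * T)); [|right; field; lra].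
    apply Rmult_le_compat_r; lra. }
  assert (E1 : D * kap ^ m <= eps / 2).
  { eapply Rle_trans; [|exact EH]. rewrite <- (Rmult_1_r (D * kap ^ m)) at 1. apply Rmult_le_compat_l; [|easy].
    apply Rmult_le_pos; [easy|apply pow_le; lra]. }
  apply (norm_dist_le (V := V1) (y := iterate g (S m) t) (a := eps / 2) (b := eps / 2)); [| |lra].
  - rewrite (@norm_minus_sym V1). eapply Rle_trans; [now apply HU|]. eapply Rle_trans; [|exact E1].
    apply Rmult_le_compat_l; [easy|]. simpl. rewrite <- (Rmult_1_l (kap ^ m)) at 2.
    apply Rmult_le_compat_r; [apply pow_le; lra|lra].
  - apply Rle_trans with (norm (opp (Zw Ns (fun s => minus (iterate g m s) (u s)) t))).
    { right. apply (f_equal (@norm R_AbsRing V1)). rewrite Zw_minus by (apply Hi || easy). simpl. vec V1. }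
    eapply Rle_trans; [right; exact (@norm_opp R_AbsRing V1 _)|]. eapply Rle_trans.
    + apply (HZ _ (D * kap ^ m)); trivial.
      * apply Rmult_le_pos; [easy|apply pow_le; lra].
      * intros r Hr. apply (lim_minus (V := V1)); [now apply Hi|now apply Hc].
      * intros s Hs. eapply Rle_trans; [now apply HU|]. rewrite <- (Rmult_1_r (D * kap ^ m)) at 1.
        apply Rmult_le_compat_l; [apply Rmult_le_pos; [easy|apply pow_le; lra]|apply exp1; lra].
    + eapply Rle_trans; [|exact EH]. apply Rmult_le_compat.
      * apply Rmult_le_pos; [lra|]. apply Rmult_le_pos; [easy|apply pow_le; lra].
      * left; apply exp_pos.
      * rewrite <- (Rmult_1_l (D * kap ^ m)) at 2. apply Rmult_le_compat_r; [|lra].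
        apply Rmult_le_pos; [easy|apply pow_le; lra].
      * destruct (Req_dec t T) as [->|]; [lra|]. left. apply exp_increasing. apply Rmult_lt_compat_l; lra. }
assert (E0 : minus (u t) (plus (opp (Zw Ns u t)) (g t)) = zero).
{ apply (@norm_eq_zero R_AbsRing V1). apply Rle_antisym; [exact E|apply (@norm_ge_0 R_AbsRing V1)]. }
replace (u t) with (plus (minus (u t) (plus (opp (Zw Ns u t)) (g t))) (plus (opp (Zw Ns u t)) (g t))) at 1 by (vec V1).
rewrite E0. vec V1.
Qed.

(** * Solutions with a prescribed logarithm-power part *)

Section Solution.
Variables (f df : R -> V2) (xh : R -> V1).
Hypothesis f_cont : cont0T f.
Hypothesis f_der : forall t, 0 < t < T -> is_derive f t (df t).
Hypothesis f_0 : f 0 = zero.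
Hypothesis df_cont : cont0T df.
Hypothesis xh_cont : cont0T xh.
Hypothesis xh_residual : forall eps, 0 < eps -> exists d, 0 < d /\
  forall t, 0 < t < d -> t <= T -> norm (minus (dvolt xh t) (df t)) <= eps * t ^ Ns.

Definition gam (t : R) : V1 := scal (/ t ^ Ns) (opp (Kn t (minus (dvolt xh t) (df t)))).
(** The value [zero] at 0 is the limit of [gam], because [xh_residual] makes the residual negligible
    against [t^Ns]. *)
Definition gam0 (t : R) : V1 := if Req_EM_T t 0 then zero else gam t.

Lemma gam0_cont : cont0T gam0.
Proof.
intros t Ht. unfold gam0 at 2. destruct (Req_EM_T t 0) as [->|H0].
- apply (lim_norm (V := V1)). intros eps He. destruct Kn_bound as [M [HM HK]].
  destruct (xh_residual (eps := eps / (M + 1))) as [d [Hd H]]; [apply Rdiv_lt_0_compat; lra|].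
  apply locally_R. exists d. split; [easy|]. intros s Hs Hs'. unfold gam0.
  destruct (Req_EM_T s 0) as [->|Hs0].
  + rewrite minus_eq_zero. eapply Rle_lt_trans; [right; apply (@norm_zero R_AbsRing V1)|easy].
  + assert (E : norm (gam s) < eps).
    { unfold gam. rewrite Rminus_0_r in Hs. rewrite Rabs_right in Hs by lra.
      specialize (H s ltac:(lra) ltac:(lra)).
      assert (Hp : 0 < s ^ Ns) by (apply pow_lt; lra).
      rewrite (@norm_scal_eq V1), (@norm_opp R_AbsRing V1), Rabs_right by (left; now apply Rinv_0_lt_compat).
      apply Rmult_lt_reg_l with (s ^ Ns); [easy|]. rewrite <- Rmult_assoc, Rinv_r, Rmult_1_l by lra.
      eapply Rle_lt_trans; [apply HK; lra|].
      apply Rle_lt_trans with (M * (eps / (M + 1) * s ^ Ns)); [apply Rmult_le_compat_l; [lra|exact H]|].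
      replace (M * (eps / (M + 1) * s ^ Ns)) with (s ^ Ns * (M * (eps / (M + 1)))) by ring.
      apply Rmult_lt_compat_l; [easy|]. apply Rlt_le_trans with ((M + 1) * (eps / (M + 1))).
      - apply Rmult_lt_compat_r; [apply Rdiv_lt_0_compat; lra|lra].
      - right; field; lra. }
    eapply Rle_lt_trans; [|exact E]. right. apply (f_equal (@norm R_AbsRing V1)). vec V1.
- assert (Ht' : 0 < t <= T) by lra.
  assert (Loc : within (fun t => 0 <= t <= T) (locally t) (fun s => 0 < s <= T)).
  { apply locally_R. exists t. split; [lra|]. intros s Hs Hs'. apply Rabs_def2 in Hs. lra. }
  assert (W : filter_le (within (fun t => 0 <= t <= T) (locally t)) (within (fun t => 0 < t <= T) (locally t))).
  { intros P HP. unfold within in *. generalize (filter_and _ _ HP Loc). apply filter_imp. intros s [H1 H2] H3. auto. }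
  assert (I : filterlim (fun s : R => s) (within (fun t => 0 <= t <= T) (locally t)) (locally t)).
  { eapply filterlim_filter_le_1; [apply filter_le_within|apply filterlim_id]. }
  apply (filterlim_ext_loc gam).
  { revert Loc. unfold within. apply filter_imp. intros s Hs Hs'. specialize (Hs Hs'). unfold gam0.
    destruct (Req_EM_T s 0); [lra|easy]. }
  unfold gam. apply (lim_scal (V := V1)).
  + apply (continuous_comp_lim (f := fun s => s ^ Ns) (g := Rinv)); [now apply lim_pow|].
    apply continuous_Rinv. apply pow_nonzero. easy.
  + apply (lim_opp (V := V1)). apply Kn_lim; trivial.
    { unfold within. now apply filter_forall. }
    apply (lim_minus (V := V2)); [|now apply df_cont].
    eapply filterlim_filter_le_1; [exact W|]. now apply dvolt_cont.
Qed.

Lemma power_part_cont (u : R -> V1) : cont0T u -> cont0T (fun t => plus (xh t) (scal (t ^ Ns) (u t))).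
Proof.
intros Hu t Ht. apply (lim_plus (V := V1)); [now apply xh_cont|now apply scal_on_cont].
Qed.

(** By additivity of [dvolt] the fixed part [xh] enters only through [gam]. *)
Lemma residual_weighted (u : R -> V1) t : cont0T u -> 0 < t <= T ->
  Kn t (minus (dvolt (fun t => plus (xh t) (scal (t ^ Ns) (u t))) t) (df t)) =
  scal (t ^ Ns) (minus (plus (u t) (Zw Ns u t)) (gam t)).
Proof.
intros Hu Ht. destruct (@Kn_inv t ltac:(lra)) as [L1 _].
set (x := fun t => plus (xh t) (scal (t ^ Ns) (u t))).
assert (Hx : cont0T x) by now apply power_part_cont.
assert (E : dvolt (fun t => scal (t ^ Ns) (u t)) t = minus (dvolt x t) (dvolt xh t)).
{ rewrite <- dvolt_minus by easy.
  assert (Ex : forall s, scal (s ^ Ns) (u s) = minus (x s) (xh s)) by (intros s; unfold x; vec V1).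
  unfold dvolt. rewrite Ex. f_equal; [f_equal|].
  - apply sum_n_m_ext. intros i. now rewrite Ex.
  - apply sum_n_m_ext. intros i. apply (RInt_ext (V := V2)). intros s _. now rewrite Ex. }
pose proof (dvolt_weighted Ns Hu Ht) as HW. rewrite E, (linear_minus _ _ _ L1) in HW.
rewrite (linear_minus _ _ _ L1). unfold gam. rewrite (linear_minus _ _ _ L1).
assert (Hp : t ^ Ns <> 0) by (apply pow_nonzero; lra).
assert (E2 : Kn t (dvolt x t) = plus (scal (t ^ Ns) (plus (u t) (Zw Ns u t))) (Kn t (dvolt xh t)))
  by (rewrite <- HW; vec V1).
rewrite E2. vec V1. all: easy.
Qed.

Lemma Kn_inj t y : 0 <= t <= T -> Kn t y = zero -> y = zero.
Proof.
intros Ht H. destruct (Kn_inv Ht) as [_ [_ I2]]. rewrite <- (I2 y), H.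
exact (linear_zero _ (@K_lin n (t, t) ltac:(lia) (diag_sector Ht))).
Qed.

(** Inverting the diagonal and dividing by [t^Ns] turns the differentiated equation into a
    fixed-point equation; both steps are reversible for [t > 0]. *)
Lemma weighted_solution_equation (u : R -> V1) t : cont0T u -> 0 < t <= T ->
  dvolt (fun t => plus (xh t) (scal (t ^ Ns) (u t))) t = df t <->
  u t = plus (opp (Zw Ns u t)) (gam t).
Proof.
intros Hu Ht. pose proof (residual_weighted Hu Ht) as HR. destruct (@Kn_inv t ltac:(lra)) as [L1 _].
assert (Hp : t ^ Ns <> 0) by (apply pow_nonzero; lra).
split; intros H.
- rewrite H, minus_eq_zero in HR.
  assert (E : minus (plus (u t) (Zw Ns u t)) (gam t) = zero).
  { transitivity (scal (/ t ^ Ns) (scal (t ^ Ns) (minus (plus (u t) (Zw Ns u t)) (gam t)))).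
    - vec V1; easy.
    - rewrite <- HR. transitivity (scal (/ t ^ Ns) (@zero V1)); [|vec V1].
      apply (f_equal (fun z : V1 => scal (/ t ^ Ns) z)). exact (linear_zero _ L1). }
  replace (u t) with (plus (minus (plus (u t) (Zw Ns u t)) (gam t)) (minus (gam t) (Zw Ns u t))) by (vec V1).
  rewrite E. vec V1.
- set (A := dvolt _ t) in *.
  assert (E : minus A (df t) = zero).
  { apply (Kn_inj (t := t)); [lra|]. rewrite HR. rewrite H at 1. vec V1. }
  replace A with (plus (minus A (df t)) (df t)) by (vec V2). rewrite E. vec V2.
Qed.

Theorem weighted_solution : exists u : R -> V1,
  cont0T u /\
  (forall t, 0 <= t <= T -> volt (fun t => plus (xh t) (scal (t ^ Ns) (u t))) t = f t) /\
  (forall v y : R -> V1, cont0T v -> cont0T y -> (forall t, 0 <= t <= T -> volt y t = f t) ->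
     (forall t, 0 < t <= T -> y t = plus (xh t) (scal (t ^ Ns) (v t))) ->
     forall t, 0 <= t <= T -> v t = u t) /\
  exists u_ : nat -> R -> V1,
    (forall m, cont0T (u_ m)) /\
    (forall t, 0 < t <= T -> u_ 0%nat t = gam t) /\
    (forall m t, 0 < t <= T -> u_ (S m) t = plus (opp (Zw Ns (u_ m) t)) (gam t)) /\
    uniform_limit_on (fun t => 0 <= t <= T) u_ u.
Proof.
pose (g := fun t => gam0 (clamp 0 T t)).
assert (Hg : forall t, continuous g t) by (apply clamp_comp_cont; [lra|apply gam0_cont]).
assert (Eg : forall t, 0 < t <= T -> g t = gam t).
{ intros t Ht. unfold g, gam0. rewrite clamp_id by lra. destruct (Req_EM_T t 0); [lra|easy]. }
destruct (iterate_converges Hg) as [u [Hu [Hlim Heq]]].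
exists u. split; [easy|]. split; [|split].
- apply (volt_solves f_cont f_der f_0); [now apply power_part_cont|].
  intros t Ht. apply weighted_solution_equation; [easy|lra|]. rewrite <- Eg by lra. apply Heq. lra.
- intros v y Hv Hy Hsol Hyv t Ht.
  pose (yv := fun t => plus (xh t) (scal (t ^ Ns) (v t))).
  (* [y] and [yv] agree on [[0, T]] but need not be equal as functions on the line, so their images
     are compared through [Zw] of the difference. *)
  assert (Hyv' : forall t, 0 < t <= T -> dvolt y t = dvolt yv t).
  { assert (Hyv'' : forall t, 0 <= t <= T -> y t = yv t).
    { apply (eq_closure (V := V1)); [easy|now apply power_part_cont|]. intros; apply Hyv; lra. }
    intros s Hs. rewrite !dvolt_Zw; trivial; [|now apply power_part_cont].
    assert (Z0 : Zw 0 (fun r => minus (y r) (yv r)) s = zero).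
    { unfold Zw. assert (forall r, 0 <= r <= T -> minus (y r) (yv r) = @zero V1) as E0.
      { intros r Hr. rewrite Hyv'' by easy. vec V1. }
      rewrite clamp_id by lra. destruct (@Kn_inv s ltac:(lra)) as [L1 _].
      assert (E1 : Lw 0 (fun r => minus (y r) (yv r)) s = zero).
      { unfold Lw. transitivity (Kn s zero); [|exact (linear_zero _ L1)]. f_equal.
        rewrite <- (sum_n_m_const_zero (G := V2) 1 (n - 1)). apply sum_n_m_ext_loc. intros i Hi.
        destruct (@jump_sector i s Hi ltac:(lra)) as [S1 [S2 S3]]. rewrite E0 by easy.
        assert (F1 : K i s (al i s) (@zero V1) = @zero V2) by exact (linear_zero _ (@K_lin i (s, al i s) ltac:(lia) S1)).
        assert (F2 : K (S i) s (al i s) (@zero V1) = @zero V2) by exact (linear_zero _ (@K_lin (S i) (s, al i s) ltac:(lia) S2)).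
        rewrite F1, F2. vec V2. }
      assert (E2 : Kw 0 (fun r => minus (y r) (yv r)) s = zero).
      { unfold Kw. rewrite <- (sum_n_m_const_zero (G := V1) 1 n). apply sum_n_m_ext_loc. intros i Hi.
        transitivity (RInt (fun _ : R => @zero V1) 0 1).
        - apply (RInt_ext (V := V1)). intros th _. unfold Kw_slice, slice. rewrite clamp_id by lra.
          rewrite E0 by (now apply node_range).
          pose proof (@node_sector i s th Hi) as S1. rewrite clamp_id in S1 by lra.
          assert (F1 : K1 i s (node i s th) (@zero V1) = @zero V2) by exact (linear_zero _ (K1_lin Hi S1)).
          rewrite F1. assert (F2 : Kn s (@zero V2) = zero) by exact (linear_zero _ L1). rewrite F2. vec V1.
        - rewrite (RInt_const (V := V1)). vec V1. }
      rewrite E1, E2. vec V1. }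
    rewrite Zw_minus in Z0; [|easy|now apply power_part_cont|lra].
    rewrite Hyv'' by lra. f_equal. f_equal.
    replace (Zw 0 y s) with (plus (minus (Zw 0 y s) (Zw 0 yv s)) (Zw 0 yv s)) by (vec V1). rewrite Z0. vec V1. }
  pose proof (volt_solution_derive f_der Hy Hsol) as HD.
  (* The difference of two remainders solves the homogeneous fixed-point equation. *)
  assert (Hw : forall t, 0 <= t <= T -> minus (v t) (u t) = zero).
  { apply (Zw_fixed_zero (w := fun t => minus (v t) (u t))).
    - intros s Hs. apply (lim_minus (V := V1)); [now apply Hv|now apply Hu].
    - intros s Hs. rewrite Zw_minus by (trivial; lra).
      assert (Ev : v s = plus (opp (Zw Ns v s)) (gam s)).
      { apply weighted_solution_equation; [easy|lra|]. fold yv. rewrite <- Hyv' by lra. now apply HD. }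
      rewrite Ev, (Heq s), Eg by lra. vec V1. }
  replace (v t) with (plus (minus (v t) (u t)) (u t)) by (vec V1). rewrite Hw by easy. vec V1.
- exists (iterate g). repeat split; trivial.
  + intros m. apply continuous_on_pointwise. intros t _. now apply iterate_cont.
  + intros m t Ht. simpl. now rewrite Eg.
Qed.

End Solution.

End FixedPoint.
End Geometry.

(** * Logarithm-power expansions at [0] *)

(** [exp y] is the [k]-th power of [exp (y / k)], which exceeds [y / k]. *)
Lemma exp_ge_pow y k : 0 <= y -> (0 < k)%nat -> (y / INR k) ^ k <= exp y.
Proof.
intros Hy Hk. assert (0 < INR k) by now apply lt_0_INR.
replace (exp y) with (exp (y / INR k) ^ k).
- apply pow_incr. split; [apply Rdiv_le_0_compat; lra|]. pose proof (exp_ineq1_le (y / INR k)). lra.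
- assert (E : forall m, exp (y / INR k) ^ m = exp (INR m * (y / INR k))).
  { induction m as [|m IH]; [now rewrite Rmult_0_l, exp_0|].
    rewrite S_INR. simpl pow. rewrite IH, <- exp_plus. f_equal. ring. }
  rewrite E. f_equal. field. lra.
Qed.

(** With [y = - ln t] the claim is that [exp y] outgrows [y^l]; the spare power in [k = l + 1]
    provides the smallness. *)
Lemma t_ln_small l eps : 0 < eps -> exists d, 0 < d <= 1 /\ forall t, 0 < t < d -> t * Rabs (ln t) ^ l <= eps.
Proof.
intros He. set (k := S l). assert (Hk : 0 < INR k) by (apply lt_0_INR; unfold k; lia).
assert (Hkk : 0 < INR k ^ k) by now apply pow_lt.
(* Chosen so that [y > k^k / eps], which gives [y^l <= eps (y / k)^k]. *)
exists (exp (- (INR k ^ k / eps))).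
assert (Hp : 0 < INR k ^ k / eps) by now apply Rdiv_lt_0_compat.
split.
{ split; [apply exp_pos|]. rewrite <- exp_0. left. apply exp_increasing. lra. }
intros t Ht. set (y := - ln t).
assert (Hy : INR k ^ k / eps < y).
{ unfold y. assert (ln t < - (INR k ^ k / eps)); [|lra]. rewrite <- (ln_exp (- (INR k ^ k / eps))). apply ln_increasing; lra. }
assert (Ey : Rabs (ln t) = y) by (unfold y; rewrite Rabs_left; [easy|unfold y in Hy; lra]).
assert (Et : t = / exp y) by (unfold y; rewrite exp_Ropp, Rinv_inv, exp_ln; lra).
rewrite Ey, Et.
pose proof (@exp_ge_pow y k ltac:(lra) ltac:(unfold k; lia)) as HE.
assert (Hey := exp_pos y).
apply Rmult_le_reg_l with (exp y); [easy|]. rewrite <- Rmult_assoc, Rinv_r, Rmult_1_l by lra.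
apply Rle_trans with ((y / INR k) ^ k * eps); [|apply Rmult_le_compat_r; lra].
assert (Ek : (y / INR k) ^ k = y * y ^ l * / INR k ^ k).
{ unfold Rdiv. rewrite Rpow_mult_distr, pow_inv. reflexivity. }
rewrite Ek.
apply Rmult_le_reg_r with (INR k ^ k); [easy|].
replace (y * y ^ l * / INR k ^ k * eps * INR k ^ k) with (y ^ l * (y * eps)) by (field; lra).
apply Rmult_le_compat_l; [apply pow_le; lra|].
apply Rlt_le. apply (Rmult_lt_compat_r eps) in Hy; [|easy].
replace (INR k ^ k / eps * eps) with (INR k ^ k) in Hy by (field; lra). easy.
Qed.

Section Expn.
Variable N : nat.

Section OneSpace.
Variable V : NormedModule R_AbsRing.

Definition near0 (P : R -> Prop) : Prop := exists d, 0 < d /\ forall t, 0 < t < d -> P t.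

Lemma near0_and P Q : near0 P -> near0 Q -> near0 (fun t => P t /\ Q t).
Proof.
intros [d1 [H1 D1]] [d2 [H2 D2]]. exists (Rmin d1 d2). split; [now apply Rmin_glb_lt|].
intros t Ht. pose proof (Rmin_l d1 d2). pose proof (Rmin_r d1 d2). split; [apply D1; lra|apply D2; lra].
Qed.

Lemma near0_imp (P Q : R -> Prop) : (forall t, 0 < t -> P t -> Q t) -> near0 P -> near0 Q.
Proof. intros H [d [Hd D]]. exists d. split; [easy|]. intros t Ht. apply H; [lra|now apply D]. Qed.

Lemma near0_lt c : 0 < c -> near0 (fun t => t < c).
Proof. intros Hc. exists c. split; [easy|]. intros; lra. Qed.

Definition small (g : R -> V) : Prop := forall eps, 0 < eps -> near0 (fun t => norm (g t) <= eps * t ^ N).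
Definition bounded0 (g : R -> V) : Prop := exists M, near0 (fun t => norm (g t) <= M).

(** Functions with a finite logarithm-power expansion starting at [t^j], up to [o(t^N)]. Closure
    rules in place of explicit coefficients make sums and products accessible by induction. No
    logarithm is allowed at [t^0], so all members are bounded near 0. *)
Inductive expn (j : nat) : (R -> V) -> Prop :=
| expn_small g : small g -> expn j g
| expn_mono m l v : (j <= m)%nat -> (m = 0%nat -> l = 0%nat) ->
    expn j (fun t => scal (t ^ m * ln t ^ l) v)
| expn_plus g h : expn j g -> expn j h -> expn j (fun t => plus (g t) (h t))
| expn_ext g h : near0 (fun t => g t = h t) -> expn j g -> expn j h.

Lemma small_plus g h : small g -> small h -> small (fun t => plus (g t) (h t)).
Proof.
intros Hg Hh eps He. specialize (Hg (eps / 2) ltac:(lra)). specialize (Hh (eps / 2) ltac:(lra)).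
generalize (near0_and Hg Hh). apply near0_imp. intros t Ht [H1 H2].
apply (norm_plus_le H1 H2). lra.
Qed.

Lemma small_ext g h : near0 (fun t => g t = h t) -> small g -> small h.
Proof.
intros H Hg eps He. generalize (near0_and H (Hg eps He)). apply near0_imp. intros t _ [E Ht]. now rewrite <- E.
Qed.

Lemma small_O g M : near0 (fun t => norm (g t) <= M * t ^ (S N)) -> small g.
Proof.
intros H eps He. pose proof (Rabs_pos M) as HM.
generalize (near0_and H (near0_lt (c := eps / (Rabs M + 1)) ltac:(apply Rdiv_lt_0_compat; lra))).
apply near0_imp. intros t Ht [H1 H2]. eapply Rle_trans; [exact H1|]. simpl. rewrite <- Rmult_assoc.
apply Rmult_le_compat_r; [apply pow_le; lra|].
apply Rle_trans with ((Rabs M + 1) * (eps / (Rabs M + 1))); [|right; field; lra].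
pose proof (Rle_abs M). apply Rle_trans with ((Rabs M + 1) * t); nra.
Qed.

Lemma small_bounded g : small g -> bounded0 g.
Proof.
intros H. exists 1. generalize (near0_and (H 1 Rlt_0_1) (near0_lt Rlt_0_1)). apply near0_imp.
intros t Ht [H1 H2]. eapply Rle_trans; [exact H1|]. rewrite Rmult_1_l. rewrite <- (pow1 N). apply pow_incr. lra.
Qed.

Lemma mono_bounded m l : (m = 0%nat -> l = 0%nat) -> exists M, near0 (fun t => Rabs (t ^ m * ln t ^ l) <= M).
Proof.
intros H. destruct m as [|m].
- exists 1. rewrite (H eq_refl). exists 1. split; [lra|]. intros t Ht. simpl. rewrite Rmult_1_l, Rabs_R1. lra.
- exists 1. destruct (@t_ln_small l 1 Rlt_0_1) as [d [Hd D]]. exists d. split; [lra|].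
  intros t Ht. rewrite Rabs_mult, <- !RPow_abs, (Rabs_right t) by lra. simpl.
  replace (t * t ^ m * Rabs (ln t) ^ l) with (t ^ m * (t * Rabs (ln t) ^ l)) by ring.
  rewrite <- (Rmult_1_r 1). apply Rmult_le_compat.
  + apply pow_le; lra.
  + apply Rmult_le_pos; [lra|apply pow_le, Rabs_pos].
  + rewrite <- (pow1 m). apply pow_incr. lra.
  + now apply D.
Qed.

Lemma mono_small m l v : (N < m)%nat -> small (fun t => scal (t ^ m * ln t ^ l) v).
Proof.
intros Hm eps He. pose proof (norm_ge_0 v) as Hv.
destruct (@t_ln_small l (eps / (norm v + 1))) as [d [Hd D]]; [apply Rdiv_lt_0_compat; lra|].
exists d. split; [lra|]. intros t Ht. rewrite norm_scal_eq.
replace m with (S N + (m - S N))%nat by lia. rewrite pow_add. simpl pow.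
rewrite !Rabs_mult, <- !RPow_abs, (Rabs_right t) by lra.
specialize (D t Ht).
assert (0 <= t ^ (m - S N) <= 1).
{ split; [apply pow_le; lra|]. rewrite <- (pow1 (m - S N)). apply pow_incr. lra. }
assert (0 <= t ^ N) by (apply pow_le; lra).
assert (0 <= Rabs (ln t) ^ l) by (apply pow_le, Rabs_pos).
replace (t * t ^ N * t ^ (m - S N) * Rabs (ln t) ^ l * norm v) with
  (t ^ N * (t ^ (m - S N) * (t * Rabs (ln t) ^ l) * norm v)) by ring.
rewrite (Rmult_comm eps). apply Rmult_le_compat_l; [easy|].
apply Rle_trans with (1 * (eps / (norm v + 1)) * (norm v + 1)).
- apply Rmult_le_compat; try lra.
  + apply Rmult_le_pos; [lra|]. apply Rmult_le_pos; lra.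
  + apply Rmult_le_compat; try lra. apply Rmult_le_pos; lra.
- right. field. lra.
Qed.

Lemma bounded0_plus g h : bounded0 g -> bounded0 h -> bounded0 (fun t => plus (g t) (h t)).
Proof.
intros [M1 H1] [M2 H2]. exists (M1 + M2). generalize (near0_and H1 H2). apply near0_imp.
intros t _ [E1 E2]. exact (norm_plus_le E1 E2 (Rle_refl _)).
Qed.

Lemma expn_bounded j g : expn j g -> bounded0 g.
Proof.
induction 1 as [g H|m l v Hj Hm|g h _ IH1 _ IH2|g h H _ IH].
- now apply small_bounded.
- destruct (mono_bounded Hm) as [M HM]. exists (M * norm v). revert HM. apply near0_imp.
  intros t _ Ht. rewrite norm_scal_eq. apply Rmult_le_compat_r; [apply norm_ge_0|easy].
- now apply bounded0_plus.
- destruct IH as [M HM]. exists M. generalize (near0_and H HM). apply near0_imp. intros t _ [E Ht]. now rewrite <- E.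
Qed.

Lemma expn_weaken j j' g : (j' <= j)%nat -> expn j g -> expn j' g.
Proof.
intros Hj. induction 1 as [g H|m l v H1 H2|g h _ IH1 _ IH2|g h H _ IH].
- now apply expn_small.
- apply expn_mono; [lia|easy].
- now apply expn_plus.
- now apply (expn_ext H).
Qed.

Lemma expn_eq j g h : (forall t, 0 < t -> g t = h t) -> expn j g -> expn j h.
Proof. intros H. apply expn_ext. exists 1. split; [lra|]. intros; apply H; lra. Qed.

Lemma expn_scal j g r : expn j g -> expn j (fun t => scal (r : R) (g t)).
Proof.
induction 1 as [g H|m l v H1 H2|g h _ IH1 _ IH2|g h H _ IH].
- apply expn_small. intros eps He. pose proof (Rabs_pos r).
  specialize (H (eps / (Rabs r + 1)) ltac:(apply Rdiv_lt_0_compat; lra)). revert H. apply near0_imp.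
  intros t Ht H. rewrite norm_scal_eq.
  apply Rle_trans with ((Rabs r + 1) * (eps / (Rabs r + 1) * t ^ N)); [|right; field; lra].
  apply Rmult_le_compat; try lra. apply norm_ge_0.
- apply (expn_eq (g := fun t => scal (t ^ m * ln t ^ l) (scal r v))); [intros; vec V|now apply expn_mono].
- apply (expn_eq (g := fun t => plus (scal r (g t)) (scal r (h t)))); [intros; vec V|now apply expn_plus].
- apply (expn_ext (g := fun t => scal r (g t))); [|easy]. revert H. apply near0_imp. intros t _ E. now rewrite E.
Qed.

Lemma expn_minus j g h : expn j g -> expn j h -> expn j (fun t => minus (g t) (h t)).
Proof.
intros Hg Hh. apply (expn_eq (g := fun t => plus (g t) (scal (-1) (h t)))); [intros; vec V|].
apply expn_plus; [easy|now apply expn_scal].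
Qed.

Lemma expn_zero j : expn j (fun _ => zero).
Proof.
apply expn_small. intros eps He. exists 1. split; [lra|]. intros t Ht. rewrite norm_zero.
apply Rmult_le_pos; [lra|apply pow_le; lra].
Qed.

Lemma expn_const (v : V) : expn 0 (fun _ => v).
Proof. apply (expn_eq (g := fun t => scal (t ^ 0 * ln t ^ 0) v)); [intros; simpl; vec V|now apply expn_mono]. Qed.

Lemma expn_sum j (f : nat -> R -> V) m k : (forall i, (m <= i <= k)%nat -> expn j (f i)) ->
  expn j (fun t => sum_n_m (fun i => f i t) m k).
Proof.
intros H. induction k as [|k IH].
- destruct m as [|m].
  + apply (expn_eq (g := f 0%nat)); [intros; now rewrite sum_n_n|apply H; lia].
  + apply (expn_eq (g := fun _ => zero)); [intros; now rewrite sum_n_m_zero by lia|apply expn_zero].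
- destruct (le_lt_dec m (S k)) as [L|L].
  + apply (expn_eq (g := fun t => plus (sum_n_m (fun i => f i t) m k) (f (S k) t))); [intros; now rewrite sum_n_Sm|].
    apply expn_plus; [apply IH; intros; apply H; lia|apply H; lia].
  + apply (expn_eq (g := fun _ => zero)); [intros; now rewrite sum_n_m_zero by lia|apply expn_zero].
Qed.

(** Beyond order [N] every monomial is already [o(t^N)], its logarithms being absorbed by a spare
    power of [t]. *)
Lemma expn_last j g : (N < j)%nat -> expn j g -> small g.
Proof.
intros Hj. induction 1 as [g H|m l v H1 H2|g h _ IH1 _ IH2|g h H _ IH].
- easy.
- apply mono_small; lia.
- now apply small_plus.
- now apply (small_ext H).
Qed.

Lemma expn_1_vanish g : expn 1 g -> forall eps, 0 < eps -> near0 (fun t => norm (g t) <= eps).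
Proof.
induction 1 as [g H|m l v H1 H2|g h _ IH1 _ IH2|g h H _ IH]; intros eps He.
- generalize (near0_and (H eps He) (near0_lt Rlt_0_1)). apply near0_imp.
  intros t Ht [Hb Hl]. eapply Rle_trans; [exact Hb|]. rewrite <- (Rmult_1_r eps) at 2. apply Rmult_le_compat_l; [lra|].
  rewrite <- (pow1 N). apply pow_incr. lra.
- pose proof (norm_ge_0 v). destruct (@t_ln_small l (eps / (norm v + 1))) as [d [Hd D]]; [apply Rdiv_lt_0_compat; lra|].
  exists d. split; [lra|]. intros t Ht. rewrite norm_scal_eq.
  destruct m as [|m]; [lia|]. simpl pow. rewrite !Rabs_mult, <- !RPow_abs, (Rabs_right t) by lra.
  specialize (D t Ht).
  assert (0 <= t ^ m <= 1) by (split; [apply pow_le; lra|rewrite <- (pow1 m); apply pow_incr; lra]).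
  assert (0 <= Rabs (ln t) ^ l) by (apply pow_le, Rabs_pos).
  apply Rle_trans with (1 * (eps / (norm v + 1)) * (norm v + 1)); [|right; field; lra].
  replace (t * t ^ m * Rabs (ln t) ^ l) with (t ^ m * (t * Rabs (ln t) ^ l)) by ring.
  apply Rmult_le_compat; try lra.
  + apply Rmult_le_pos; [lra|]. apply Rmult_le_pos; lra.
  + apply Rmult_le_compat; try lra. apply Rmult_le_pos; lra.
- generalize (near0_and (IH1 (eps / 2) ltac:(lra)) (IH2 (eps / 2) ltac:(lra))). apply near0_imp.
  intros t _ [A B]. apply (norm_plus_le A B). lra.
- generalize (near0_and H (IH eps He)). apply near0_imp. intros t _ [E Ht]. now rewrite <- E.
Qed.

Definition logpoly (d : nat) (Q : nat -> V) (t : R) : V := sum_n_m (fun l => scal (ln t ^ l) (Q l)) 0 d.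

Lemma sum_extend (f : nat -> V) d d' : (d <= d')%nat -> (forall l, (d < l)%nat -> f l = zero) ->
  sum_n_m f 0 d' = sum_n_m f 0 d.
Proof.
intros Hd H. induction Hd as [|d' Hd IH]; [easy|].
rewrite sum_n_Sm by lia. rewrite IH, H by lia. vec V.
Qed.

Lemma logpoly_extend d d' Q t : (d <= d')%nat -> (forall l, (d < l)%nat -> Q l = zero) ->
  logpoly d' Q t = logpoly d Q t.
Proof. intros Hd H. apply sum_extend; [easy|]. intros l Hl. rewrite H by easy. vec V. Qed.

Lemma logpoly_plus d Q1 Q2 t : logpoly d (fun l => plus (Q1 l) (Q2 l)) t = plus (logpoly d Q1 t) (logpoly d Q2 t).
Proof.
unfold logpoly. rewrite <- sum_n_m_plus. apply sum_n_m_ext. intros l. vec V.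
Qed.

(** The coefficient at [t^j] is read off the derivation of [expn]: a polynomial in [ln t], which is
    constant when [j = 0]. *)
Lemma expn_lead j g : expn j g -> exists d Q, (forall l, (d < l)%nat -> Q l = zero) /\
  (j = 0%nat -> d = 0%nat) /\ expn (S j) (fun t => minus (g t) (scal (t ^ j) (logpoly d Q t))).
Proof.
induction 1 as [g H|m l v H1 H2|g h _ IH1 _ IH2|g h H _ IH].
- exists 0%nat, (fun _ => zero). repeat split; trivial.
  apply (expn_eq (g := g)); [|now apply expn_small]. intros t Ht. unfold logpoly. rewrite sum_n_n. vec V.
- destruct (le_lt_eq_dec _ _ H1) as [Hl|<-].
  + exists 0%nat, (fun _ => zero). repeat split; trivial.
    apply (expn_eq (g := fun t => scal (t ^ m * ln t ^ l) v)); [|now apply expn_mono].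
    intros t Ht. unfold logpoly. rewrite sum_n_n. vec V.
  + pose (Q := fun i => if Nat.eqb i l then v else @zero V). exists l, Q. repeat split; trivial.
    * intros i Hi. unfold Q. destruct (Nat.eqb_spec i l); [lia|easy].
    * apply (expn_eq (g := fun _ => zero)); [|apply expn_zero]. intros t Ht.
      assert (E : logpoly l Q t = scal (ln t ^ l) v).
      { unfold logpoly, Q. destruct l as [|l]; [now rewrite sum_n_n|]. rewrite sum_n_Sm by lia.
        rewrite Nat.eqb_refl, (sum_n_m_ext_loc (G := V) _ (fun _ => zero)).
        - rewrite sum_n_m_const_zero. vec V.
        - intros i Hi. destruct (Nat.eqb_spec i (S l)); [lia|vec V]. }
      rewrite E. vec V.
- destruct IH1 as [d1 [Q1 [A1 [B1 C1]]]], IH2 as [d2 [Q2 [A2 [B2 C2]]]].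
  exists (max d1 d2), (fun l => plus (Q1 l) (Q2 l)). repeat split.
  + intros l Hl. rewrite A1, A2 by lia. vec V.
  + intros Hj. rewrite B1, B2 by easy. easy.
  + apply (expn_eq (g := fun t => plus (minus (g t) (scal (t ^ j) (logpoly d1 Q1 t))) (minus (h t) (scal (t ^ j) (logpoly d2 Q2 t)))));
      [|now apply expn_plus].
    intros t Ht. rewrite logpoly_plus, (logpoly_extend (d := d1) (d' := max d1 d2)), (logpoly_extend (d := d2) (d' := max d1 d2)) by (trivial; lia).
    vec V.
- destruct IH as [d [Q [A [B C]]]]. exists d, Q. repeat split; trivial.
  apply (expn_ext (g := fun t => minus (g t) (scal (t ^ j) (logpoly d Q t)))); [|easy].
  revert H. apply near0_imp. intros t _ E. now rewrite E.
Qed.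

(** Equality of leading terms: [g0] represents [g] modulo order [j + 1]. Working modulo higher order
    allows leading terms to be multiplied factor by factor. *)
Definition lead (j : nat) (g g0 : R -> V) : Prop := expn j g0 /\ expn (S j) (fun t => minus (g t) (g0 t)).

Lemma lead_expn j g g0 : lead j g g0 -> expn j g.
Proof.
intros [H1 H2]. apply (expn_eq (g := fun t => plus (minus (g t) (g0 t)) (g0 t))); [intros; vec V|].
apply expn_plus; [|easy]. apply (expn_weaken (j := S j)); [lia|easy].
Qed.

Lemma lead_plus j g g0 h h0 : lead j g g0 -> lead j h h0 ->
  lead j (fun t => plus (g t) (h t)) (fun t => plus (g0 t) (h0 t)).
Proof.
intros [A1 A2] [B1 B2]. split; [now apply expn_plus|].
apply (expn_eq (g := fun t => plus (minus (g t) (g0 t)) (minus (h t) (h0 t)))); [intros; vec V|now apply expn_plus].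
Qed.

Lemma lead_minus j g g0 h h0 : lead j g g0 -> lead j h h0 ->
  lead j (fun t => minus (g t) (h t)) (fun t => minus (g0 t) (h0 t)).
Proof.
intros [A1 A2] [B1 B2]. split; [now apply expn_minus|].
apply (expn_eq (g := fun t => minus (minus (g t) (g0 t)) (minus (h t) (h0 t)))); [intros; vec V|now apply expn_minus].
Qed.

Lemma lead_sum j (f f0 : nat -> R -> V) m k : (forall i, (m <= i <= k)%nat -> lead j (f i) (f0 i)) ->
  lead j (fun t => sum_n_m (fun i => f i t) m k) (fun t => sum_n_m (fun i => f0 i t) m k).
Proof.
intros H. split; [apply expn_sum; intros; now apply H|].
apply (expn_eq (g := fun t => sum_n_m (fun i => minus (f i t) (f0 i t)) m k)).
- intros t Ht. symmetry. apply sum_n_m_minus.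
- apply expn_sum. intros; now apply H.
Qed.

Lemma lead_refl j g : expn j g -> lead j g g.
Proof. intros H. split; [easy|]. apply (expn_eq (g := fun _ => zero)); [intros; vec V|apply expn_zero]. Qed.

Lemma lead_eq j g g' g0 g0' : (forall t, 0 < t -> g t = g' t) -> (forall t, 0 < t -> g0 t = g0' t) ->
  lead j g g0 -> lead j g' g0'.
Proof.
intros H1 H2 [A B]. split; [now apply (expn_eq H2)|]. refine (expn_eq _ B). intros t Ht. now rewrite H1, H2.
Qed.

Lemma lead_absorb j g g0 h : lead j g g0 -> expn (S j) h -> lead j (fun t => plus (g t) (h t)) g0.
Proof.
intros [A B] H. split; [easy|]. apply (expn_eq (g := fun t => plus (minus (g t) (g0 t)) (h t))); [intros; vec V|now apply expn_plus].
Qed.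

Lemma lead_near j g g' g0 : near0 (fun t => g t = g' t) -> lead j g g0 -> lead j g' g0.
Proof.
intros H [A B]. split; [easy|]. refine (expn_ext _ B). revert H. apply near0_imp. intros t _ E. now rewrite E.
Qed.

(** At order 0 logarithms are excluded, so the leading coefficient is a constant, and a constant
    leading term must be the limit. *)
Lemma lead_0_limit g y : expn 0 g -> (forall eps, 0 < eps -> near0 (fun t => norm (minus (g t) y) <= eps)) ->
  lead 0 g (fun _ => y).
Proof.
intros Hg Hy. split; [apply expn_const|].
destruct (expn_lead Hg) as [d [Q [_ [Hd HE]]]]. rewrite (Hd eq_refl) in HE.
assert (HE' : expn 1 (fun t => minus (g t) (Q 0%nat))).
{ refine (expn_eq _ HE). intros t Ht. unfold logpoly. rewrite sum_n_n. simpl. vec V. }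
assert (E : Q 0%nat = y); [|now rewrite <- E].
assert (Hn : norm (minus (Q 0%nat) y) <= 0).
{ apply le_epsilon. intros eps He. rewrite Rplus_0_l.
  destruct (near0_and (expn_1_vanish HE' (eps := eps / 2) ltac:(lra)) (Hy (eps / 2) ltac:(lra))) as [dd [Hdd H]].
  destruct (H (dd / 2) ltac:(lra)) as [H1 H2].
  apply (norm_dist_le (y := g (dd / 2)) (a := eps / 2) (b := eps / 2)); [now rewrite norm_minus_sym|easy|lra]. }
assert (E0 : minus (Q 0%nat) y = zero) by (apply norm_eq_zero; pose proof (norm_ge_0 (minus (Q 0%nat) y)); lra).
replace (Q 0%nat) with (plus (minus (Q 0%nat) y) y) by vec V. rewrite E0. vec V.
Qed.

Lemma small_scal (phi : R -> R) g M : near0 (fun t => Rabs (phi t) <= M) -> small g -> small (fun t => scal (phi t) (g t)).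
Proof.
intros Hp Hg eps He. pose proof (Rabs_pos M).
generalize (near0_and Hp (Hg (eps / (Rabs M + 1)) ltac:(apply Rdiv_lt_0_compat; lra))). apply near0_imp.
intros t Ht [H1 H2]. rewrite norm_scal_eq.
apply Rle_trans with ((Rabs M + 1) * (eps / (Rabs M + 1) * t ^ N)); [|right; field; lra].
apply Rmult_le_compat; [apply Rabs_pos|apply norm_ge_0| |easy]. pose proof (Rle_abs M). lra.
Qed.

End OneSpace.

(** When one factor is [o(t^N)], boundedness of the other suffices; here the exclusion of logarithms
    at [t^0] pays off. *)
Lemma expn_prod (V : NormedModule R_AbsRing) j1 j2 (phi : R -> R) (g : R -> V) :
  expn (V := R_NormedModule) j1 phi -> expn j2 g -> expn (j1 + j2) (fun t => scal (phi t) (g t)).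
Proof.
intros Hp Hg. destruct (expn_bounded Hg) as [Mg HMg].
induction Hp as [phi H|m l r H1 H2|phi psi _ IH1 _ IH2|phi psi H _ IH].
- apply expn_small. intros eps He. pose proof (Rabs_pos Mg).
  generalize (near0_and (H (eps / (Rabs Mg + 1)) ltac:(apply Rdiv_lt_0_compat; lra)) HMg). apply near0_imp.
  intros t Ht [E1 E2]. rewrite norm_scal_eq.
  apply Rle_trans with ((eps / (Rabs Mg + 1) * t ^ N) * (Rabs Mg + 1)); [|right; field; lra].
  apply Rmult_le_compat; [apply Rabs_pos|apply norm_ge_0|exact E1|]. pose proof (Rle_abs Mg). lra.
- clear HMg. induction Hg as [g Hg|m' l' v H1' H2'|g h _ IH1 _ IH2|g h H _ IH].
  + apply expn_small. destruct (mono_bounded H2) as [M HM].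
    apply (small_scal (M := M * Rabs r)); [|easy]. revert HM. apply near0_imp. intros t _ Ht.
    change (Rabs (t ^ m * ln t ^ l * r) <= M * Rabs r). rewrite Rabs_mult.
    apply Rmult_le_compat_r; [apply Rabs_pos|easy].
  + apply (expn_eq (g := fun t => scal (t ^ (m + m') * ln t ^ (l + l')) (scal r v))).
    * intros t Ht. rewrite !pow_add. change (scal (t ^ m * ln t ^ l) r) with (t ^ m * ln t ^ l * r). vec V.
    * apply expn_mono; lia.
  + apply (expn_eq (g := fun t => plus (scal (scal (t ^ m * ln t ^ l) r) (g t)) (scal (scal (t ^ m * ln t ^ l) r) (h t)))).
    * intros t Ht. vec V.
    * now apply expn_plus.
  + refine (expn_ext _ IH). revert H. apply near0_imp. intros t _ E. now rewrite E.
- apply (expn_eq (g := fun t => plus (scal (phi t) (g t)) (scal (psi t) (g t)))).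
  + intros t Ht. change (plus (phi t) (psi t)) with (phi t + psi t). vec V.
  + now apply expn_plus.
- refine (expn_ext _ IH). revert H. apply near0_imp. intros t _ E. now rewrite E.
Qed.

Lemma lead_prod (V : NormedModule R_AbsRing) j1 j2 (phi phi0 : R -> R) (g g0 : R -> V) :
  lead (V := R_NormedModule) j1 phi phi0 -> lead j2 g g0 ->
  lead (j1 + j2) (fun t => scal (phi t) (g t)) (fun t => scal (phi0 t) (g0 t)).
Proof.
intros Hp Hg. pose proof (lead_expn Hg) as HG. destruct Hp as [A1 A2], Hg as [B1 B2].
split; [now apply expn_prod|].
apply (expn_eq (g := fun t => plus (scal (phi t - phi0 t) (g t)) (scal (phi0 t) (minus (g t) (g0 t))))).
- intros t Ht. vec V.
- apply expn_plus.
  + exact (expn_prod A2 HG).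
  + replace (S (j1 + j2)) with (j1 + S j2)%nat by lia. now apply expn_prod.
Qed.

(** * Powers and logarithms of a curve [t * b t] *)

Notation Rlead := (lead (V := R_NormedModule)).
Notation Rexpn := (expn (V := R_NormedModule)).

Lemma Rlead_mult j1 j2 f f0 g g0 : Rlead j1 f f0 -> Rlead j2 g g0 ->
  Rlead (j1 + j2) (fun t => f t * g t) (fun t => f0 t * g0 t).
Proof. intros Hf Hg. exact (lead_prod (V := R_NormedModule) Hf Hg). Qed.

Lemma Rlead_pow f f0 k : Rlead 0 f f0 -> Rlead 0 (fun t => f t ^ k) (fun t => f0 t ^ k).
Proof.
intros H. induction k as [|k IH]; simpl.
- apply lead_refl. apply (expn_const (V := R_NormedModule) 1).
- exact (Rlead_mult H IH).
Qed.

Lemma Rexpn_mono j m l : (j <= m)%nat -> (m = 0%nat -> l = 0%nat) -> Rexpn j (fun t => t ^ m * ln t ^ l).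
Proof.
intros H1 H2. apply (expn_eq (V := R_NormedModule) (g := fun t => scal (t ^ m * ln t ^ l) 1)).
- intros t Ht. change (t ^ m * ln t ^ l * 1 = t ^ m * ln t ^ l). ring.
- now apply (expn_mono (V := R_NormedModule)).
Qed.

(** [ln (t * b) = ln t + ln b], where [ln b] has leading term [ln a]. The power [(ln t + ln b)^l] is
    unfolded one factor at a time. *)
Lemma Rlead_log_power p l (b : R -> R) a : 0 < a -> (p = 0%nat -> l = 0%nat) ->
  near0 (fun t => 0 < b t) -> Rlead 0 b (fun _ => a) -> Rlead 0 (fun t => ln (b t)) (fun _ => ln a) ->
  Rlead p (fun t => (t * b t) ^ p * ln (t * b t) ^ l) (fun t => (t * a) ^ p * (ln t + ln a) ^ l).
Proof.
intros Ha Hpl Hb Hlb Hln.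
(* The extra exponent [m] absorbs the factors [ln t] that the unfolding produces. *)
assert (H : forall l m, (p = 0%nat -> l = 0%nat /\ m = 0%nat) ->
  Rlead p (fun t => t ^ p * ln t ^ m * (ln t + ln (b t)) ^ l) (fun t => t ^ p * ln t ^ m * (ln t + ln a) ^ l)).
{ clear l Hpl. induction l as [|l IH]; intros m Hm.
  - simpl. apply (lead_eq (V := R_NormedModule) (g := fun t => t ^ p * ln t ^ m) (g0 := fun t => t ^ p * ln t ^ m));
      [intros; simpl; ring|intros; simpl; ring|]. apply lead_refl. apply Rexpn_mono; [lia|intros; now apply Hm].
  - apply (lead_eq (V := R_NormedModule)
      (g := fun t => t ^ p * ln t ^ (S m) * (ln t + ln (b t)) ^ l + ln (b t) * (t ^ p * ln t ^ m * (ln t + ln (b t)) ^ l))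
      (g0 := fun t => t ^ p * ln t ^ (S m) * (ln t + ln a) ^ l + ln a * (t ^ p * ln t ^ m * (ln t + ln a) ^ l))).
    + intros; simpl; ring.
    + intros; simpl; ring.
    + apply (lead_plus (V := R_NormedModule)); [apply IH; intros E; destruct (Hm E); lia|].
      apply (Rlead_mult (j1 := 0) Hln). apply IH. intros E; destruct (Hm E); lia. }
specialize (H l 0%nat ltac:(intros E; auto)).
pose proof (Rlead_mult H (Rlead_pow p Hlb)) as H2. rewrite Nat.add_0_r in H2.
apply (lead_near (V := R_NormedModule) (g := fun t => t ^ p * ln t ^ 0 * (ln t + ln (b t)) ^ l * b t ^ p)).
- revert Hb. apply near0_imp. intros t Ht Hb. rewrite ln_mult, Rpow_mult_distr by easy. simpl. ring.
- refine (lead_eq (V := R_NormedModule) _ _ H2); [easy|]. intros t Ht. simpl. rewrite Rpow_mult_distr. ring.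
Qed.

(** The derivative of the error is [(- y)^k / (1 + y)] by the geometric sum; the factor 2 comes from
    [1 + c >= 1 / 2] at the intermediate point. *)
Lemma ln_taylor k z : Rabs z <= 1 / 2 ->
  Rabs (ln (1 + z) - sum_n_m (fun m => (-1) ^ (S m) / INR m * z ^ m) 1 k) <= 2 * Rabs z ^ (S k).
Proof.
intros Hz.
assert (D : forall y, Rabs y <= Rabs z -> is_derive (fun y => ln (1 + y) - sum_n_m (fun m => (-1) ^ (S m) / INR m * y ^ m) 1 k) y ((- y) ^ k / (1 + y))).
{ intros y Hy. assert (Hy1 : 0 < 1 + y) by (assert (Rabs y <= 1 / 2) as Q by lra; apply Rabs_le_between in Q; lra).
  assert (D0 : is_derive (fun y => sum_n_m (fun m => (-1) ^ (S m) / INR m * y ^ m) 1 k) y (sum_n_m (fun m => (-1) ^ (S m) * y ^ (m - 1)) 1 k)).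
  { apply (is_derive_sum (V := R_NormedModule) (f := fun m y => (-1) ^ (S m) / INR m * y ^ m)). intros m Hm.
    auto_derive; [easy|]. replace (pred m) with (m - 1)%nat by lia. simpl ((-1) ^ S m). field. apply not_0_INR. lia. }
  replace ((- y) ^ k / (1 + y)) with (/ (1 + y) - sum_n_m (fun m => (-1) ^ (S m) * y ^ (m - 1)) 1 k).
  - apply (is_derive_minus (V := R_NormedModule)); [|easy]. auto_derive; [easy|]. field. lra.
  - assert (E : forall k, (1 + y) * sum_n_m (fun m => (-1) ^ (S m) * y ^ (m - 1)) 1 k = 1 - (- y) ^ k).
    { clear. induction k as [|k IH].
      - rewrite sum_n_m_zero by lia. change (@zero (Ring.AbelianMonoid R_Ring)) with 0. change ((1 + y) * 0 = 1 - 1). ring.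
      - rewrite sum_n_Sm by lia. change (plus ?a ?b) with (a + b). rewrite Rmult_plus_distr_l, IH.
        replace (S k - 1)%nat with k by lia. replace (- y) with (-1 * y) by ring. rewrite !Rpow_mult_distr. simpl. ring. }
    apply Rmult_eq_reg_l with (1 + y); [|lra]. rewrite Rmult_minus_distr_l, E. field. lra. }
destruct (MVT_gen (fun y => ln (1 + y) - sum_n_m (fun m => (-1) ^ (S m) / INR m * y ^ m) 1 k) 0 z (fun y => (- y) ^ k / (1 + y))) as [c [Hc E]].
- intros x Hx. apply D. unfold Rmin, Rmax in Hx. destruct Rle_dec; unfold Rabs; repeat destruct Rcase_abs; lra.
- intros x Hx. apply continuity_pt_filterlim.
  apply (ex_derive_continuous (V := R_NormedModule) (fun y => ln (1 + y) - sum_n_m (fun m => (-1) ^ (S m) / INR m * y ^ m) 1 k)).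
  eexists. apply D.
  unfold Rmin, Rmax in Hx. destruct Rle_dec; unfold Rabs; repeat destruct Rcase_abs; lra.
- cbv beta in E.
  assert (E0 : sum_n_m (fun m => (-1) ^ (S m) / INR m * 0 ^ m) 1 k = 0).
  { rewrite (sum_n_m_ext_loc (G := R_AbelianMonoid) _ (fun _ => 0)); [apply (sum_n_m_const_zero (G := R_AbelianMonoid))|].
    intros m Hm. rewrite pow_i by lia. apply Rmult_0_r. }
  rewrite E0, Rplus_0_r, ln_1, !Rminus_0_r in E. rewrite E.
  assert (Hcz : Rabs c <= Rabs z).
  { unfold Rmin, Rmax in Hc. destruct Rle_dec; unfold Rabs; repeat destruct Rcase_abs; lra. }
  assert (Hc1 : 1 / 2 <= 1 + c) by (assert (Rabs c <= 1 / 2) as Q by lra; apply Rabs_le_between in Q; lra).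
  rewrite Rabs_mult. unfold Rdiv. rewrite Rabs_mult, <- RPow_abs, Rabs_Ropp, (Rabs_right (/ (1 + c))) by (left; apply Rinv_0_lt_compat; lra).
  assert (H2 : / (1 + c) <= 2).
  { apply Rle_trans with (/ (1 / 2)); [apply Rinv_le_contravar; lra|lra]. }
  simpl pow. assert (0 < / (1 + c)) by (apply Rinv_0_lt_compat; lra).
  assert (Hk : 0 <= Rabs c ^ k <= Rabs z ^ k).
  { split; [apply pow_le, Rabs_pos|apply pow_incr; split; [apply Rabs_pos|easy]]. }
  pose proof (Rabs_pos z).
  replace (2 * (Rabs z * Rabs z ^ k)) with (Rabs z ^ k * 2 * Rabs z) by ring.
  apply Rmult_le_compat_r; [easy|]. apply Rmult_le_compat; lra.
Qed.

(** With [b = a (1 + z)] and [z] of order 1, the Taylor polynomial of degree [N] suffices, since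
    [z^(N+1)] is already [o(t^N)]. *)
Lemma Rlead_ln (b : R -> R) a : 0 < a -> Rlead 0 b (fun _ => a) ->
  near0 (fun t => 0 < b t) /\ Rlead 0 (fun t => ln (b t)) (fun _ => ln a).
Proof.
intros Ha [Hb1 Hb2].
pose (z := fun t => / a * (b t - a)).
assert (Hz : Rexpn 1 z) by exact (expn_scal (V := R_NormedModule) (/ a) Hb2).
assert (Hzs : near0 (fun t => Rabs (z t) <= 1 / 2)) by (apply (expn_1_vanish Hz); lra).
assert (Eb : forall t, b t = a * (1 + z t)) by (intros t; unfold z; field; lra).
assert (Hpos : near0 (fun t => 0 < 1 + z t)).
{ revert Hzs. apply near0_imp. intros t _ Q. apply Rabs_le_between in Q. lra. }
split.
- revert Hpos. apply near0_imp. intros t _ Q. rewrite Eb. now apply Rmult_lt_0_compat.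
- split; [apply (expn_const (V := R_NormedModule))|].
  assert (Hpow : forall m, Rexpn m (fun t => z t ^ m)).
  { induction m as [|m IH]; simpl; [apply (expn_const (V := R_NormedModule) 1)|].
    exact (expn_prod (V := R_NormedModule) Hz IH). }
  apply (expn_ext (V := R_NormedModule) (g := fun t => plus (sum_n_m (fun m => scal ((-1) ^ (S m) / INR m) (z t ^ m)) 1 N)
     (ln (1 + z t) - sum_n_m (fun m => (-1) ^ (S m) / INR m * z t ^ m) 1 N))).
  + revert Hpos. apply near0_imp. intros t _ Q. rewrite (Eb t), ln_mult by easy.
    change (sum_n_m (fun m => (-1) ^ (S m) / INR m * z t ^ m) 1 N + (ln (1 + z t) - sum_n_m (fun m => (-1) ^ (S m) / INR m * z t ^ m) 1 N)
      = ln a + ln (1 + z t) - ln a). ring.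
  + apply (expn_plus (V := R_NormedModule)).
    * apply (expn_sum (V := R_NormedModule) (f := fun m t => scal ((-1) ^ (S m) / INR m) (z t ^ m))). intros m Hm.
      apply (expn_scal (V := R_NormedModule)). apply (expn_weaken (j := m)); [lia|apply Hpow].
    * apply expn_small. intros eps He.
      pose proof (expn_last (Nat.lt_succ_diag_r N) (Hpow (S N))) as HS.
      generalize (near0_and Hzs (HS (eps / 2) ltac:(lra))). apply near0_imp. intros t Ht [Q1 Q2].
      eapply Rle_trans; [now apply ln_taylor|].
      change (Rabs (z t ^ S N) <= eps / 2 * t ^ N) in Q2. rewrite RPow_abs. lra.
Qed.

End Expn.

(** * Expansion of the differentiated equation *)

(** Here [ln 0 = 0] makes the value at [0] the limit. *)
Lemma log_power_cont m l T : (m = 0%nat -> l = 0%nat) ->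
  continuous_on (fun t => 0 <= t <= T) (fun t => t ^ m * ln t ^ l).
Proof.
intros H t Ht. destruct (Req_dec t 0) as [->|H0].
- destruct m as [|m].
  + rewrite (H eq_refl). apply (filterlim_ext (fun _ => 1)); [intros; simpl; ring|].
    replace (0 ^ 0 * ln 0 ^ 0) with 1 by (simpl; ring). apply filterlim_const.
  + apply (lim_norm (V := R_NormedModule)). intros eps He.
    destruct (@t_ln_small l (eps / 2)) as [d [Hd D]]; [lra|].
    apply locally_R. exists d. split; [lra|]. intros s Hs Hs'. rewrite Rminus_0_r in Hs.
    change (Rabs (s ^ S m * ln s ^ l - 0 ^ S m * ln 0 ^ l) < eps).
    rewrite pow_i, Rmult_0_l, Rminus_0_r by lia.
    destruct (Req_dec s 0) as [->|Hs0]; [rewrite pow_i, Rmult_0_l, Rabs_R0 by lia; easy|].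
    rewrite Rabs_right in Hs by lra. specialize (D s ltac:(lra)).
    rewrite Rabs_mult, <- !RPow_abs, (Rabs_right s) by lra. simpl.
    replace (s * s ^ m * Rabs (ln s) ^ l) with (s ^ m * (s * Rabs (ln s) ^ l)) by ring.
    apply Rle_lt_trans with (1 * (eps / 2)); [|lra].
    apply Rmult_le_compat; [apply pow_le; lra| | |easy].
    * apply Rmult_le_pos; [lra|apply pow_le, Rabs_pos].
    * rewrite <- (pow1 m). apply pow_incr. lra.
- eapply filterlim_filter_le_1; [apply filter_le_within|].
  apply (ex_derive_continuous (V := R_NormedModule) (fun t => t ^ m * ln t ^ l)). auto_derive. lra.
Qed.

Lemma log_power_bounded_closed m l : (m = 0%nat -> l = 0%nat) ->
  exists M d, 0 < d /\ 0 <= M /\ forall s, 0 <= s < d -> Rabs (s ^ m * ln s ^ l) <= M.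
Proof.
intros H. destruct (mono_bounded H) as [M [d [Hd D]]]. exists (Rmax M 1), d.
split; [easy|]. split; [eapply Rle_trans; [apply Rle_0_1|apply Rmax_r]|].
intros s Hs. destruct (Req_dec s 0) as [->|Hs0].
- eapply Rle_trans; [|apply Rmax_r]. destruct m as [|m].
  + rewrite (H eq_refl). simpl. rewrite Rmult_1_l, Rabs_R1. lra.
  + rewrite pow_i, Rmult_0_l, Rabs_R0 by lia. lra.
- eapply Rle_trans; [|apply Rmax_l]. apply D. lra.
Qed.

(** Antiderivative of [s^p (ln s)^l] obtained by repeated integration by parts, normalised to vanish
    at 0. *)
Fixpoint log_prim (p l : nat) (s : R) : R :=
  match l with
  | O => s ^ (S p) / INR (S p)
  | S l' => s ^ (S p) * ln s ^ l / INR (S p) - INR l / INR (S p) * log_prim p l' s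
  end.

Lemma log_prim_derive p l s : 0 < s -> is_derive (log_prim p l) s (s ^ p * ln s ^ l).
Proof.
intros Hs. assert (Hp : INR (S p) <> 0) by (apply not_0_INR; lia).
induction l as [|l IH]; cbn [log_prim].
- auto_derive; [easy|]. cbn [pred]. replace (ln s ^ 0) with 1 by easy.
  rewrite Rmult_1_r. rewrite Rmult_1_l. unfold Rdiv. field. easy.
- replace (s ^ p * ln s ^ S l) with
   ((s ^ p * ln s ^ S l + INR (S l) / INR (S p) * (s ^ p * ln s ^ l)) - INR (S l) / INR (S p) * (s ^ p * ln s ^ l)) by ring.
  apply (is_derive_minus (V := R_NormedModule) (fun s => s ^ S p * ln s ^ S l / INR (S p))
    (fun s => INR (S l) / INR (S p) * log_prim p l s)).
  + auto_derive; [easy|]. cbn [pred].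
    change (match p with 0%nat => 1 | S _ => INR p + 1 end) with (INR (S p)).
    change (match l with 0%nat => 1 | S _ => INR l + 1 end) with (INR (S l)).
    change (ln s ^ S l) with (ln s * ln s ^ l). field. split; [easy|lra].
  + exact (is_derive_scal (log_prim p l) s (INR (S l) / INR (S p)) _ IH).
Qed.

Lemma log_prim_0 p l : log_prim p l 0 = 0.
Proof.
induction l as [|l IH]; cbn [log_prim]; rewrite pow_i by lia; [unfold Rdiv; ring|].
rewrite IH. unfold Rdiv. ring.
Qed.

Lemma log_prim_cont p l T : continuous_on (fun t => 0 <= t <= T) (log_prim p l).
Proof.
induction l as [|l IH]; intros t Ht; cbn [log_prim].
- apply lim_Rmult; [|apply filterlim_const]. apply lim_pow.
  eapply filterlim_filter_le_1; [apply filter_le_within|apply filterlim_id].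
- apply lim_Rminus.
  + apply (lim_Rmult (f := fun s => s ^ S p * ln s ^ S l)); [|apply filterlim_const].
    now apply (@log_power_cont (S p) (S l) T).
  + apply lim_Rmult; [apply filterlim_const|now apply IH].
Qed.

(** The derivative of [log_prim] is known only for [s > 0], so integral and antiderivative are
    compared by [zero_derive_eq]; the clamp makes the integrand continuous everywhere. *)
Lemma RInt_log_power_0 p l y : (p = 0%nat -> l = 0%nat) -> 0 <= y ->
  is_RInt (fun s => s ^ p * ln s ^ l) 0 y (log_prim p l y).
Proof.
intros H Hy. set (f := fun s => s ^ p * ln s ^ l).
destruct (Req_dec y 0) as [->|Hy0].
{ rewrite log_prim_0. apply (is_RInt_point (V := R_NormedModule)). }
assert (Hy' : 0 < y) by lra.
pose (f' := fun s => f (clamp 0 y s)).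
assert (Hf' : forall s, continuous f' s) by (apply clamp_comp_cont; [lra|now apply log_power_cont]).
assert (Hex : forall s, ex_RInt f' 0 s) by (intros s; apply (ex_RInt_continuous (V := R_CompleteNormedModule)); intros; apply Hf').
assert (Hder : forall s, is_derive (fun s => RInt f' 0 s) s (f' s)).
{ intros s. apply (is_derive_RInt (V := R_NormedModule) f' (fun s => RInt f' 0 s) 0); [|apply Hf'].
  apply filter_forall. intros r. apply (RInt_correct (V := R_CompleteNormedModule)). apply Hex. }
assert (E : minus (RInt f' 0 y) (log_prim p l y) = 0).
{ apply (@zero_derive_eq y Hy' R_CompleteNormedModule (fun s => minus (RInt f' 0 s) (log_prim p l s))).
  - intros s Hs. apply (lim_minus (V := R_NormedModule)); [|now apply log_prim_cont].
    eapply filterlim_filter_le_1; [apply filter_le_within|].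
    apply (ex_derive_continuous (V := R_NormedModule) (fun s => RInt f' 0 s)). eexists. apply Hder.
  - intros s Hs.
    pose proof (is_derive_minus (V := R_NormedModule) _ _ _ _ _ (Hder s) (@log_prim_derive p l s (proj1 Hs))) as D.
    assert (Z : f' s = s ^ p * ln s ^ l) by (unfold f', f; now rewrite clamp_id by lra).
    rewrite Z, minus_eq_zero in D. exact D.
  - rewrite log_prim_0, (RInt_point (V := R_CompleteNormedModule)). change (0 - 0 = 0). ring.
  - lra. }
apply (is_RInt_ext (V := R_NormedModule) f').
- rewrite Rmin_left, Rmax_right by lra. intros s Hs. unfold f'. rewrite clamp_id; [easy|lra].
- replace (log_prim p l y) with (RInt f' 0 y) by (change (RInt f' 0 y - log_prim p l y = 0) in E; lra).
  apply (RInt_correct (V := R_CompleteNormedModule)). apply Hex.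
Qed.

Lemma RInt_log_power p l x y : (p = 0%nat -> l = 0%nat) -> 0 <= x <= y ->
  is_RInt (fun s => s ^ p * ln s ^ l) x y (log_prim p l y - log_prim p l x).
Proof.
intros H Hxy.
pose proof (is_RInt_swap (V := R_NormedModule) _ _ _ _ (@RInt_log_power_0 p l x H (proj1 Hxy))) as H1.
pose proof (@RInt_log_power_0 p l y H ltac:(lra)) as H2.
pose proof (is_RInt_Chasles (V := R_NormedModule) _ _ _ _ _ _ H1 H2) as H3.
replace (log_prim p l y - log_prim p l x) with (plus (opp (log_prim p l x)) (log_prim p l y)); [exact H3|].
change (- log_prim p l x + log_prim p l y = log_prim p l y - log_prim p l x). ring.
Qed.

Lemma is_RInt_sum {V : NormedModule R_AbsRing} (f : nat -> R -> V) l a b m k :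
  (forall i, (m <= i <= k)%nat -> is_RInt (f i) a b (l i)) ->
  is_RInt (fun s => sum_n_m (fun i => f i s) m k) a b (sum_n_m l m k).
Proof.
assert (Z : is_RInt (fun _ => @zero V) a b zero).
{ refine (eq_ind _ (fun z => is_RInt (fun _ => @zero V) a b z) (is_RInt_const a b (@zero V)) _ _). vec V. }
intros H. induction k as [|k IH].
- destruct m as [|m].
  + rewrite sum_n_n. apply (is_RInt_ext (f 0%nat)); [intros; now rewrite sum_n_n|apply H; lia].
  + rewrite sum_n_m_zero by lia. apply (is_RInt_ext (fun _ => zero)); [intros; now rewrite sum_n_m_zero by lia|exact Z].
- destruct (le_lt_dec m (S k)) as [L|L].
  + rewrite sum_n_Sm by easy.
    apply (is_RInt_ext (fun s => plus (sum_n_m (fun i => f i s) m k) (f (S k) s))); [intros; now rewrite sum_n_Sm|].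
    apply is_RInt_plus; [apply IH; intros; apply H; lia|apply H; lia].
  + rewrite sum_n_m_zero by lia. apply (is_RInt_ext (fun _ => zero)); [intros; now rewrite sum_n_m_zero by lia|exact Z].
Qed.

(** * Leading term of the differentiated operator on a logarithmic monomial *)

Section DvoltExpansion.
Variables (N : nat) (T : R) (n : nat) (al be da : nat -> R -> R).
Variables (V1 V2 : CompleteNormedModule R_AbsRing) (K K1 : nat -> R -> R -> V1 -> V2).
Hypothesis hT : 0 < T.
Hypothesis hn : (1 <= n)%nat.
Hypothesis al0 : forall t, al 0%nat t = 0.
Hypothesis aln : forall t, al n t = t.
Hypothesis al_chain : forall i t, (i < n)%nat -> 0 <= t <= T -> al i t <= al (S i) t.
Hypothesis al_be : forall i t, (i <= n)%nat -> 0 <= t <= T -> al i t = t * be i t.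
Hypothesis K_lin : forall i p, (1 <= i <= n)%nat -> sector T al i p -> is_linear (K i (fst p) (snd p)).
Hypothesis K_cont : forall i, (1 <= i <= n)%nat -> opcont (sector T al i) (K i).
Hypothesis K1_lin : forall i p, (1 <= i <= n)%nat -> sector T al i p -> is_linear (K1 i (fst p) (snd p)).
Hypothesis K1_cont : forall i, (1 <= i <= n)%nat -> opcont (sector T al i) (K1 i).
Variable Kc : nat -> nat -> nat -> V1 -> V2.
Hypothesis Kc_lin : forall i nu mu, (1 <= i <= n)%nat -> (nu + mu <= N)%nat -> is_linear (Kc i nu mu).

Definition kpoly (i : nat) (t s : R) (y : V1) : V2 :=
  sum_n_m (fun nu => sum_n_m (fun mu => scal (t ^ nu * s ^ mu) (Kc i nu mu y)) 0 (N - nu)) 0 N.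
Definition kpoly_dt (i : nat) (t s : R) (y : V1) : V2 :=
  sum_n_m (fun nu => sum_n_m (fun mu => scal (INR nu * t ^ (nu - 1) * s ^ mu) (Kc i nu mu y)) 0 (N - nu)) 0 N.

Hypothesis K_exp : forall i, (1 <= i <= n)%nat -> exists M, near0 (fun t => forall s y, sector T al i (t, s) ->
  norm (minus (K i t s y) (kpoly i t s y)) <= M * t ^ (S N) * norm y).
Hypothesis K1_exp : forall i, (1 <= i <= n)%nat -> exists M, near0 (fun t => forall s y, sector T al i (t, s) ->
  norm (minus (K1 i t s y) (kpoly_dt i t s y)) <= M * t ^ N * norm y).
Variable a : nat -> R.
Hypothesis a_pos : forall i, (1 <= i <= n)%nat -> 0 < a i.
Hypothesis da_exp : forall i, (1 <= i <= n - 1)%nat -> lead (V := R_NormedModule) N 0 (da i) (fun _ => a i).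
Hypothesis be_exp : forall i, (1 <= i <= n - 1)%nat -> lead (V := R_NormedModule) N 0 (be i) (fun _ => a i).
Hypothesis a_n : a n = 1.

Notation Rlead := (lead (V := R_NormedModule) N).
Notation Rexpn := (expn (V := R_NormedModule) N).
Notation cont0T := (continuous_on (fun t => 0 <= t <= T)).

Definition logmono (j l : nat) (v : V1) (t : R) : V1 := scal (t ^ j * ln t ^ l) v.

Lemma logmono_cont j l v : (j = 0%nat -> l = 0%nat) -> cont0T (logmono j l v).
Proof.
intros H t Ht. apply (lim_scal (V := V1)); [|apply filterlim_const].
now apply (@log_power_cont j l T).
Qed.

(** The curve is [t * be i t] with [be i] tending to [a i], so only its slope at 0 enters the
    leading term. *)
Lemma curve_log_power p l i : (1 <= i <= n)%nat -> (p = 0%nat -> l = 0%nat) ->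
  Rlead p (fun t => al i t ^ p * ln (al i t) ^ l) (fun t => (t * a i) ^ p * (ln t + ln (a i)) ^ l).
Proof.
intros Hi Hpl.
assert (HB : Rlead 0 (be i) (fun _ => a i)).
{ destruct (Nat.eq_dec i n) as [->|]; [|apply be_exp; lia].
  rewrite a_n. apply (lead_near (V := R_NormedModule) (g := fun _ => 1)).
  - exists T. split; [easy|]. intros t Ht. pose proof (@al_be n t (le_n n) ltac:(lra)) as E. rewrite aln in E.
    apply Rmult_eq_reg_l with t; lra.
  - apply lead_refl. exact (expn_const N (V := R_NormedModule) 1). }
destruct (Rlead_ln (a_pos Hi) HB) as [Hpos Hln].
pose proof (Rlead_log_power (a_pos Hi) Hpl Hpos HB Hln) as H.
refine (lead_near (V := R_NormedModule) _ H).
exists T. split; [easy|]. intros t Ht. rewrite (@al_be i t); [easy|lia|lra].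
Qed.

(** The two cases are the curves that bound sector [i], where the jumps are evaluated. The kernel
    polynomial along the curve supplies an expansion, and continuity at the origin its constant
    term. *)
Lemma K_curve i m v : (1 <= i <= n)%nat -> (1 <= m <= n)%nat -> (m = i \/ S m = i) ->
  lead N 0 (fun t => K i t (al m t) v) (fun _ => K i 0 0 v).
Proof.
intros Hi Hm Him.
assert (HS : forall t, 0 <= t <= T -> sector T al i (t, al m t)).
{ intros t Ht. assert (al (i - 1) t <= al i t) by (apply (al_mono (T := T) (n := n) al_chain); [lia|lia|easy]).
  split; simpl; [easy|]. destruct Him as [->|<-]; [lra|]. simpl in *. rewrite Nat.sub_0_r in *. lra. }
assert (HR : forall t, 0 <= t <= T -> 0 <= al m t <= t) by (intros; apply (al_range (T := T) (n := n) al0 aln al_chain); [lia|easy]).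
apply lead_0_limit.
- destruct (K_exp Hi) as [M HM].
  apply (expn_ext (g := fun t => plus (minus (K i t (al m t) v) (kpoly i t (al m t) v)) (kpoly i t (al m t) v))).
  { exists T. split; [easy|]. intros t Ht. vec V2. }
  apply expn_plus.
  + apply expn_small. apply (small_O (M := M * norm v)).
    generalize (near0_and HM (near0_lt hT)). apply near0_imp. intros t Ht [H1 H2].
    specialize (H1 (al m t) v (HS t ltac:(lra))). eapply Rle_trans; [exact H1|]. right.
    change (M * t ^ S N * @norm R_AbsRing V1 v = M * @norm R_AbsRing V1 v * t ^ S N). ring.
  + apply (expn_sum (f := fun nu t => sum_n_m (fun mu => scal (t ^ nu * al m t ^ mu) (Kc i nu mu v)) 0 (N - nu))).
    intros nu Hnu. apply (expn_sum (f := fun mu t => scal (t ^ nu * al m t ^ mu) (Kc i nu mu v))).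
    intros mu Hmu. apply (expn_prod (V := V2) (j1 := 0) (j2 := 0) (phi := fun t => t ^ nu * al m t ^ mu) (g := fun _ => Kc i nu mu v)); [|apply expn_const].
    apply (expn_prod (V := R_NormedModule) (j1 := 0) (j2 := 0) (phi := fun t => t ^ nu) (g := fun t => al m t ^ mu)).
    * apply (expn_eq (V := R_NormedModule) (g := fun t => t ^ nu * ln t ^ 0)); [intros; simpl; ring|].
      apply Rexpn_mono; [lia|easy].
    * apply (expn_weaken (j := mu)); [lia|].
      apply (expn_eq (V := R_NormedModule) (g := fun t => al m t ^ mu * ln (al m t) ^ 0)); [intros; simpl; ring|].
      apply (lead_expn (curve_log_power Hm (fun _ => eq_refl))).
- intros eps He.
  assert (H0 : sector T al i (0, 0)).
  { pose proof (HS 0 ltac:(lra)) as H. pose proof (HR 0 ltac:(lra)). replace (al m 0) with 0 in H by lra. exact H. }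
  destruct (@kernel_near T n al al0 aln al_chain V1 V2 K K_lin K_cont (fun _ => v) i 0 0 eps Hi
    (fun t _ => filterlim_const v) H0 He) as [d [Hd D]].
  exists (Rmin d T). split; [now apply Rmin_glb_lt|]. intros t Ht.
  pose proof (Rmin_l d T). pose proof (Rmin_r d T). pose proof (HR t ltac:(lra)).
  left. apply D; [apply HS; lra| |]; rewrite Rminus_0_r, Rabs_right; lra.
Qed.

(** Integration over an interval of length [O(t)] gains a power of [t], so the integrals do not
    reach the leading term. [K1] is replaced by its polynomial part, for which the integral is
    explicit. *)
Lemma integral_term i j l v : (1 <= i <= n)%nat -> (j = 0%nat -> l = 0%nat) ->
  expn N (S j) (fun t => RInt (fun s => K1 i t s (logmono j l v s)) (al (i - 1) t) (al i t)).
Proof.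
intros Hi Hjl.
assert (HR : forall m t, (m <= n)%nat -> 0 <= t <= T -> 0 <= al m t <= t)
 by (intros; now apply (al_range (T := T) (n := n) al0 aln al_chain)).
assert (HL : forall t, 0 <= t <= T -> al (i - 1) t <= al i t) by (intros; apply (al_mono (T := T) (n := n) al_chain); [lia|lia|easy]).
pose (Pr := fun (nu mu : nat) t => INR nu * t ^ (nu - 1) * (log_prim (mu + j) l (al i t) - log_prim (mu + j) l (al (i - 1) t))).
pose (Main := fun t => sum_n_m (fun nu => sum_n_m (fun mu => scal (Pr nu mu t) (Kc i nu mu v)) 0 (N - nu)) 0 N).
(* The recursion of [log_prim] is followed along the curve. Curve 0 is treated apart, since it has
   no positive slope. *)
assert (HPrim : forall p m, (m <= n)%nat -> (p = 0%nat -> l = 0%nat) -> Rexpn (S p) (fun t => log_prim p l (al m t))).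
{ intros p m Hm _. destruct m as [|m].
  - apply (expn_eq (V := R_NormedModule) (g := fun _ => zero)); [|apply expn_zero].
    intros t Ht. now rewrite al0, log_prim_0.
  - clear Hjl Pr Main. induction l as [|l' IH]; cbn [log_prim].
    + apply (expn_eq (V := R_NormedModule) (g := fun t => scal (/ INR (S p)) (al (S m) t ^ S p * ln (al (S m) t) ^ 0))).
      * intros t Ht. change (/ INR (S p) * (al (S m) t ^ S p * 1) = al (S m) t ^ S p / INR (S p)). unfold Rdiv. ring.
      * apply (expn_scal (V := R_NormedModule)). apply (lead_expn (@curve_log_power (S p) 0 (S m) ltac:(lia) ltac:(easy))).
    + apply (expn_minus (V := R_NormedModule)
        (g := fun t => al (S m) t ^ S p * ln (al (S m) t) ^ S l' / INR (S p))
        (h := fun t => INR (S l') / INR (S p) * log_prim p l' (al (S m) t))).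
      * apply (expn_eq (V := R_NormedModule) (g := fun t => scal (/ INR (S p)) (al (S m) t ^ S p * ln (al (S m) t) ^ S l'))).
        -- intros t Ht. change (/ INR (S p) * (al (S m) t ^ S p * ln (al (S m) t) ^ S l') = al (S m) t ^ S p * ln (al (S m) t) ^ S l' / INR (S p)).
           unfold Rdiv. ring.
        -- apply (expn_scal (V := R_NormedModule)). apply (lead_expn (@curve_log_power (S p) (S l') (S m) ltac:(lia) ltac:(easy))).
      * exact (expn_scal (V := R_NormedModule) (INR (S l') / INR (S p)) IH). }
assert (HMain : expn N (S j) Main).
{ apply (expn_sum (f := fun nu t => sum_n_m (fun mu => scal (Pr nu mu t) (Kc i nu mu v)) 0 (N - nu))).
  intros nu Hnu. apply (expn_sum (f := fun mu t => scal (Pr nu mu t) (Kc i nu mu v))). intros mu Hmu.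
  replace (S j) with (S j + 0)%nat by lia. apply (expn_prod (V := V2) (phi := Pr nu mu) (g := fun _ => Kc i nu mu v)); [|apply expn_const].
  apply (expn_prod (V := R_NormedModule) (j1 := 0) (j2 := S j) (phi := fun t => INR nu * t ^ (nu - 1))
    (g := fun t => log_prim (mu + j) l (al i t) - log_prim (mu + j) l (al (i - 1) t))).
  - apply (expn_scal (V := R_NormedModule) (g := fun t => t ^ (nu - 1)) (INR nu)).
    apply (expn_eq (V := R_NormedModule) (g := fun t => t ^ (nu - 1) * ln t ^ 0)); [intros; simpl; ring|].
    apply Rexpn_mono; [lia|easy].
  - apply (expn_weaken (j := S (mu + j))); [lia|].
    apply (expn_minus (V := R_NormedModule) (g := fun t => log_prim (mu + j) l (al i t)));
      apply HPrim; try lia; intros E; apply Hjl; lia. }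
apply (expn_ext (g := fun t => plus (minus (RInt (fun s => K1 i t s (logmono j l v s)) (al (i - 1) t) (al i t)) (Main t)) (Main t))).
{ exists T. split; [easy|]. intros t Ht. vec V2. }
apply expn_plus; [|easy].
(* The error is [O(t^N)] from the kernel, times a bounded monomial, times the length of the
   interval, hence [O(t^(N+1))]. *)
destruct (K1_exp Hi) as [M HM]. destruct (log_power_bounded_closed Hjl) as [Me [de [Hde [HMe De]]]].
apply expn_small. apply (small_O (M := Rabs M * (Me * norm v))).
generalize (near0_and HM (near0_and (near0_lt Hde) (near0_lt hT))). apply near0_imp. intros t Ht [H1 [H2 H3]].
assert (HI : is_RInt (fun s => minus (K1 i t s (logmono j l v s)) (kpoly_dt i t s (logmono j l v s))) (al (i - 1) t) (al i t)
  (minus (RInt (fun s => K1 i t s (logmono j l v s)) (al (i - 1) t) (al i t)) (Main t))).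
{ apply (is_RInt_minus (V := V2)).
  - apply (RInt_correct (V := V2)). apply (@ex_RInt_kernel T n al al0 aln al_chain V1 V2 K1 K1_lin K1_cont); [easy|now apply logmono_cont|lra].
  - apply (is_RInt_sum (V := V2) (f := fun nu s => sum_n_m (fun mu => scal (INR nu * t ^ (nu - 1) * s ^ mu) (Kc i nu mu (logmono j l v s))) 0 (N - nu))).
    intros nu Hnu. apply (is_RInt_sum (V := V2) (f := fun mu s => scal (INR nu * t ^ (nu - 1) * s ^ mu) (Kc i nu mu (logmono j l v s)))).
    intros mu Hmu.
    apply (is_RInt_ext (V := V2) (fun s => scal (scal (INR nu * t ^ (nu - 1)) (s ^ (mu + j) * ln s ^ l)) (Kc i nu mu v))).
    + intros s _. unfold logmono.
      assert (F : Kc i nu mu (scal (s ^ j * ln s ^ l) v) = scal (s ^ j * ln s ^ l) (Kc i nu mu v))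
        by exact (linear_scal _ (@Kc_lin i nu mu Hi ltac:(lia)) (s ^ j * ln s ^ l) v).
      rewrite F. change (scal (INR nu * t ^ (nu - 1)) (s ^ (mu + j) * ln s ^ l)) with (INR nu * t ^ (nu - 1) * (s ^ (mu + j) * ln s ^ l)).
      rewrite pow_add. vec V2.
    + apply (is_RInt_linear (V := R_CompleteNormedModule) (W := V2) (A := fun r : R => scal r (Kc i nu mu v))
        (f := fun s => scal (INR nu * t ^ (nu - 1)) (s ^ (mu + j) * ln s ^ l))); [exact (is_linear_scal_l (K := R_AbsRing) (V := V2) (Kc i nu mu v))|].
      apply (is_RInt_scal (V := R_NormedModule) (fun s => s ^ (mu + j) * ln s ^ l)).
      apply RInt_log_power; [intros E; apply Hjl; lia|]. split; [apply HR; [lia|lra]|apply HL; lra]. }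
pose proof (HR i t ltac:(lia) ltac:(lra)) as R1. pose proof (HR (i - 1)%nat t ltac:(lia) ltac:(lra)) as R2.
pose proof (@norm_ge_0 R_AbsRing V1 v) as Nv. assert (Htn : 0 <= t ^ N) by (apply pow_le; lra).
eapply Rle_trans.
- refine (norm_RInt_le_const _ _ _ _ (Rabs M * t ^ N * (Me * norm v)) (HL t ltac:(lra)) _ HI).
  intros s Hs. eapply Rle_trans; [apply H1; split; simpl; lra|].
  assert (E1 : norm (logmono j l v s) <= Me * norm v).
  { unfold logmono. rewrite (@norm_scal_eq V1). apply Rmult_le_compat_r; [easy|]. apply De. lra. }
  pose proof (@norm_ge_0 R_AbsRing V1 (logmono j l v s)) as E2.
  apply Rle_trans with (Rabs M * t ^ N * @norm R_AbsRing V1 (logmono j l v s)).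
  + apply Rmult_le_compat_r; [exact E2|]. apply Rmult_le_compat_r; [easy|apply Rle_abs].
  + apply Rmult_le_compat_l; [apply Rmult_le_pos; [apply Rabs_pos|easy]|exact E1].
- assert (0 <= Rabs M * t ^ N * (Me * @norm R_AbsRing V1 v)).
  { apply Rmult_le_pos; [apply Rmult_le_pos; [apply Rabs_pos|easy]|now apply Rmult_le_pos]. }
  apply Rle_trans with (t * (Rabs M * t ^ N * (Me * @norm R_AbsRing V1 v))).
  + apply Rmult_le_compat_r; [easy|lra].
  + right. simpl pow. change (t * (Rabs M * t ^ N * (Me * @norm R_AbsRing V1 v)) = Rabs M * (Me * @norm R_AbsRing V1 v) * (t * t ^ N)). ring.
Qed.

(** Leading term before the powers [(ln t + ln (a i))^l] are expanded; in this form it comes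
    directly out of the curves. *)
Definition charop (j l : nat) (v : V1) (t : R) : V2 :=
  plus (scal (t ^ j * ln t ^ l) (K n 0 0 v))
   (sum_n_m (fun i => scal (a i * ((t * a i) ^ j * (ln t + ln (a i)) ^ l)) (minus (K i 0 0 v) (K (S i) 0 0 v))) 1 (n - 1)).

(** At order [j] only the diagonal and the jumps survive: on curve [i] the monomial may be taken at
    [t * a i] and the kernels at the origin. *)
Lemma dvolt_logmono j l v : (j = 0%nat -> l = 0%nat) ->
  lead N j (dvolt n al da K K1 (logmono j l v)) (charop j l v).
Proof.
intros Hjl. unfold dvolt, charop.
apply (lead_absorb (g := fun t => plus (K n t t (logmono j l v t)) (sum_n_m (fun i => scal (da i t)
        (minus (K i t (al i t) (logmono j l v (al i t))) (K (S i) t (al i t) (logmono j l v (al i t))))) 1 (n - 1)))).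
2:{ apply (expn_sum (f := fun i t => RInt (fun s => K1 i t s (logmono j l v s)) (al (i - 1) t) (al i t))).
  intros i Hi. now apply integral_term. }
apply lead_plus.
- apply (lead_near (g := fun t => scal (t ^ j * ln t ^ l) (K n t (al n t) v))).
  + exists T. split; [easy|]. intros t Ht. rewrite aln.
    assert (HS : sector T al n (t, t)).
    { split; simpl; [lra|]. rewrite aln. pose proof (@al_range T n al al0 aln al_chain (n - 1) t ltac:(lia) ltac:(lra)). lra. }
    symmetry. exact (linear_scal _ (K_lin (conj hn (le_n n)) HS) (t ^ j * ln t ^ l) v).
  + pose proof (lead_prod (V := V2) (lead_refl (V := R_NormedModule) (Rexpn_mono N (le_n j) Hjl)) (@K_curve n n v ltac:(lia) ltac:(lia) (or_introl eq_refl))) as H.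
    rewrite Nat.add_0_r in H. exact H.
- apply (lead_sum (f := fun i t => scal (da i t) (minus (K i t (al i t) (logmono j l v (al i t))) (K (S i) t (al i t) (logmono j l v (al i t)))))
    (f0 := fun i t => scal (a i * ((t * a i) ^ j * (ln t + ln (a i)) ^ l)) (minus (K i 0 0 v) (K (S i) 0 0 v)))).
  intros i Hi.
  pose proof (Rlead_mult (j1 := 0) (da_exp Hi) (@curve_log_power j l i ltac:(lia) Hjl)) as H1.
  pose proof (lead_minus (@K_curve i i v ltac:(lia) ltac:(lia) (or_introl eq_refl)) (@K_curve (S i) i v ltac:(lia) ltac:(lia) (or_intror eq_refl))) as H2.
  pose proof (lead_prod (V := V2) H1 H2) as H. rewrite Nat.add_0_r in H.
  refine (lead_near _ H). exists T. split; [easy|]. intros t Ht.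
  pose proof (@jump_sector T n al al0 aln al_chain hn i t Hi ltac:(lra)) as [S1 [S2 _]].
  unfold logmono.
  assert (F1 : K i t (al i t) (scal (al i t ^ j * ln (al i t) ^ l) v) = scal (al i t ^ j * ln (al i t) ^ l) (K i t (al i t) v))
    by exact (linear_scal _ (@K_lin i (t, al i t) ltac:(lia) S1) (al i t ^ j * ln (al i t) ^ l) v).
  assert (F2 : K (S i) t (al i t) (scal (al i t ^ j * ln (al i t) ^ l) v) = scal (al i t ^ j * ln (al i t) ^ l) (K (S i) t (al i t) v))
    by exact (linear_scal _ (@K_lin (S i) (t, al i t) ltac:(lia) S2) (al i t ^ j * ln (al i t) ^ l) v).
  rewrite F1, F2. vec V2.
Qed.

End DvoltExpansion.

(** * Solving for the logarithm-power part *)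

Lemma binomial_pos n p : (p <= n)%nat -> 0 < Binomial.C n p.
Proof.
intros H. unfold Binomial.C. apply Rdiv_lt_0_compat; [apply INR_fact_lt_0|].
apply Rmult_lt_0_compat; apply INR_fact_lt_0.
Qed.

Lemma binomial_0_r n : Binomial.C n 0 = 1.
Proof. unfold Binomial.C. rewrite Nat.sub_0_r. simpl. field. apply INR_fact_neq_0. Qed.

Section DifferencePolynomials.
Variables (V1 V2 : NormedModule R_AbsRing) (B : nat -> V1 -> V2).
Hypothesis B_lin : forall m, is_linear (B m).

(** The image of [z^l v] under the operator [sum_m B_m (d/dz)^m / m!]. *)
Definition diffmono (l : nat) (v : V1) (z : R) : V2 :=
  sum_n_m (fun m => scal (Binomial.C l m * z ^ (l - m)) (B m v)) 0 l.

Definition diffpoly (d : nat) (P : nat -> V1) (z : R) : V2 := sum_n_m (fun l => diffmono l (P l) z) 0 d.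

Lemma diffmono_plus l v w z : diffmono l (plus v w) z = plus (diffmono l v z) (diffmono l w z).
Proof.
unfold diffmono. rewrite <- sum_n_m_plus. apply sum_n_m_ext. intros m.
rewrite (linear_plus _ (B_lin m)). vec V2.
Qed.

Lemma diffmono_zero l z : diffmono l zero z = zero.
Proof.
unfold diffmono. etransitivity; [|exact (sum_n_m_const_zero (G := V2) 0 l)]. apply sum_n_m_ext. intros m.
rewrite (linear_zero _ (B_lin m)). vec V2.
Qed.

Lemma diffpoly_extend d d' P z : (d <= d')%nat -> (forall l, (d < l)%nat -> P l = zero) ->
  diffpoly d' P z = diffpoly d P z.
Proof.
intros Hd H. apply (sum_extend (V := V2)); [easy|]. intros l Hl. rewrite H by easy. apply diffmono_zero.
Qed.

Definition attained (q : R -> V2) : Prop :=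
  exists d P, (forall l, (d < l)%nat -> P l = zero) /\ forall z, diffpoly d P z = q z.

Lemma attained_plus q1 q2 : attained q1 -> attained q2 -> attained (fun z => plus (q1 z) (q2 z)).
Proof.
intros [d1 [P1 [A1 E1]]] [d2 [P2 [A2 E2]]]. exists (max d1 d2), (fun l => plus (P1 l) (P2 l)). split.
- intros l Hl. rewrite A1, A2 by lia. vec V1.
- intros z. rewrite <- E1, <- E2.
  rewrite <- (diffpoly_extend (d := d1) (d' := max d1 d2)), <- (diffpoly_extend (d := d2) (d' := max d1 d2)) by (trivial; lia).
  unfold diffpoly. rewrite <- sum_n_m_plus. apply sum_n_m_ext. intros l. apply diffmono_plus.
Qed.

Lemma attained_mono l v : attained (diffmono l v).
Proof.
pose (P := fun i => if Nat.eqb i l then v else @zero V1). exists l, P. split.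
- intros i Hi. unfold P. destruct (Nat.eqb_spec i l); [lia|easy].
- intros z. unfold diffpoly. assert (E : P l = v) by (unfold P; now rewrite Nat.eqb_refl).
  destruct l as [|l]; [now rewrite sum_n_n, E|]. rewrite sum_n_Sm by lia. rewrite E.
  rewrite (sum_n_m_ext_loc (G := V2) _ (fun _ => zero)).
  + rewrite sum_n_m_const_zero. vec V2.
  + intros i Hi. unfold P. destruct (Nat.eqb_spec i (S l)); [lia|]. apply diffmono_zero.
Qed.

(** Polynomials of degree less than [d], in a form suited to induction: solvability for lower
    monomials passes to them directly. *)
Inductive below (d : nat) : (R -> V2) -> Prop :=
| below_zero : below d (fun _ => zero)
| below_mono i w : (i < d)%nat -> below d (fun z => scal (z ^ i) w)
| below_plus q1 q2 : below d q1 -> below d q2 -> below d (fun z => plus (q1 z) (q2 z))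
| below_eq q1 q2 : (forall z, q1 z = q2 z) -> below d q1 -> below d q2.

Lemma attained_eq q1 q2 : (forall z, q1 z = q2 z) -> attained q1 -> attained q2.
Proof. intros H [d [P [A E]]]. exists d, P. split; [easy|]. intros z. now rewrite E. Qed.

Lemma below_attained d q : (forall i w, (i < d)%nat -> attained (fun z => scal (z ^ i) w)) -> below d q -> attained q.
Proof.
intros H. induction 1 as [|i w Hi|q1 q2 _ I1 _ I2|q1 q2 E _ I].
- refine (attained_eq _ (attained_mono 0 zero)). apply diffmono_zero.
- now apply H.
- now apply attained_plus.
- exact (attained_eq E I).
Qed.

Lemma below_scal d q r : below d q -> below d (fun z => scal (r : R) (q z)).
Proof.
induction 1 as [|i w Hi|q1 q2 _ I1 _ I2|q1 q2 E _ I].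
- apply (below_eq (q1 := fun _ => zero)); [intros; vec V2|apply below_zero].
- apply (below_eq (q1 := fun z => scal (z ^ i) (scal r w))); [intros; vec V2|now apply below_mono].
- apply (below_eq (q1 := fun z => plus (scal r (q1 z)) (scal r (q2 z)))); [intros; vec V2|now apply below_plus].
- apply (below_eq (q1 := fun z => scal r (q1 z))); [intros; now rewrite E|easy].
Qed.

(** The terms with fewer than [p] derivatives carry a factor [B m v = zero], so the degree drops
    from [d + p] to [d]. *)
Lemma diffmono_leading d p v : (forall m, (m < p)%nat -> B m v = zero) ->
  below d (fun z => minus (diffmono (d + p) v z) (scal (Binomial.C (d + p) p * z ^ d) (B p v))).
Proof.
intros H. unfold diffmono.
assert (Hk : forall k, (p + k <= d + p)%nat -> below d (fun z =>
  minus (sum_n_m (fun m => scal (Binomial.C (d + p) m * z ^ (d + p - m)) (B m v)) 0 (p + k)) (scal (Binomial.C (d + p) p * z ^ d) (B p v)))).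
{ induction k as [|k IH]; intros Hk.
  - apply (below_eq (q1 := fun _ => zero)); [|apply below_zero]. intros z. rewrite Nat.add_0_r.
    assert (E : forall m, (m < p)%nat -> sum_n_m (fun m => scal (Binomial.C (d + p) m * z ^ (d + p - m)) (B m v)) 0 m = zero).
    { intros m Hm. etransitivity; [|exact (sum_n_m_const_zero (G := V2) 0 m)]. apply sum_n_m_ext_loc. intros i Hi.
      rewrite H by lia. vec V2. }
    destruct p as [|p']; [rewrite sum_n_n, Nat.add_0_r, Nat.sub_0_r; vec V2|].
    rewrite sum_n_Sm, E by lia. replace (d + S p' - S p')%nat with d by lia. vec V2.
  - apply (below_eq (q1 := fun z => plus (minus (sum_n_m (fun m => scal (Binomial.C (d + p) m * z ^ (d + p - m)) (B m v)) 0 (p + k))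
      (scal (Binomial.C (d + p) p * z ^ d) (B p v))) (scal (Binomial.C (d + p) (p + S k)) (scal (z ^ (d - S k)) (B (p + S k)%nat v))))).
    + intros z. replace (p + S k)%nat with (S (p + k)) by lia. rewrite sum_n_Sm by lia.
      replace (d + p - S (p + k))%nat with (d - S k)%nat by lia. vec V2.
    + apply below_plus; [apply IH; lia|]. apply below_scal. apply below_mono. lia. }
specialize (Hk d ltac:(lia)). replace (p + d)%nat with (d + p)%nat in Hk by lia. exact Hk.
Qed.

Variable p : nat.
Hypothesis B_onto : forall y, exists v w, (forall m, (m < p)%nat -> B m w = zero) /\ y = plus (B 0 v) (B p w).

(** Strong induction on the degree. With [y = B 0 v + B p w], the images of [z^d v] and of a
    multiple of [z^(d+p) w] add up to [z^d y] plus terms of lower degree. *)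
Lemma attained_all d w : attained (fun z => scal (z ^ d) w).
Proof.
revert w. induction (lt_wf d) as [d _ IH]. intros y.
destruct (B_onto y) as [v [w [Hw Hy]]].
(* Compensates the binomial coefficient that [p] differentiations of [z^(d+p)], divided by [p!],
   produce. *)
pose (w' := scal (/ Binomial.C (d + p) p) w).
assert (HC : Binomial.C (d + p) p <> 0) by (apply Rgt_not_eq; apply binomial_pos; lia).
assert (Hw' : forall m, B m w' = scal (/ Binomial.C (d + p) p) (B m w)).
{ intros m. exact (linear_scal _ (B_lin m) (/ Binomial.C (d + p) p) w). }
pose proof (@diffmono_leading d 0 v ltac:(lia)) as L1.
assert (Hw0 : forall m, (m < p)%nat -> B m w' = zero).
{ intros m Hm. rewrite Hw', Hw by easy. vec V2. }
pose proof (@diffmono_leading d p w' Hw0) as L2.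
pose proof (below_attained (fun i w Hi => IH i Hi w) (below_scal (-1) (below_plus L1 L2))) as L3.
refine (attained_eq _ (attained_plus (attained_plus (attained_mono (d + 0) v) (attained_mono (d + p) w')) L3)).
intros z. cbv beta. rewrite Hy, Hw'. rewrite binomial_0_r. vec V2; easy.
Qed.

Lemma attained_poly d Q : attained (fun z => sum_n_m (fun l => scal (z ^ l) (Q l)) 0 d).
Proof.
induction d as [|d IH].
- apply (attained_eq (q1 := fun z => scal (z ^ 0) (Q 0%nat))); [intros; now rewrite sum_n_n|apply attained_all].
- apply (attained_eq (q1 := fun z => plus (sum_n_m (fun l => scal (z ^ l) (Q l)) 0 d) (scal (z ^ S d) (Q (S d)))));
   [intros; now rewrite sum_n_Sm by lia|]. apply attained_plus; [easy|apply attained_all].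
Qed.

End DifferencePolynomials.

Section Solve.
Variables (N : nat) (T : R) (V1 V2 : CompleteNormedModule R_AbsRing).
Variables (A : (R -> V1) -> R -> V2) (Bm : nat -> nat -> V1 -> V2).
Notation cont0T := (continuous_on (fun t => 0 <= t <= T)).
Hypothesis hT : 0 < T.
Hypothesis A_plus : forall (x y : R -> V1) t, cont0T x -> cont0T y -> 0 < t < T ->
  A (fun s => plus (x s) (y s)) t = plus (A x t) (A y t).
Hypothesis Bm_lin : forall j m, is_linear (Bm j m).
Hypothesis A_lead : forall j l v, (j = 0%nat -> l = 0%nat) ->
  lead N j (A (logmono j l v)) (fun t => scal (t ^ j) (diffmono (Bm j) l v (ln t))).

(** Coefficients [X j l] of [t^j (ln t)^l], with no logarithm at [t^0]. *)
Definition admissible (d : nat) (X : nat -> nat -> V1) : Prop :=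
  (forall j l, (d < l)%nat -> X j l = zero) /\ (forall l, (0 < l)%nat -> X 0%nat l = zero).

Definition lpsum (d : nat) (X : nat -> nat -> V1) (t : R) : V1 :=
  sum_n_m (fun j => scal (t ^ j) (logpoly d (X j) t)) 0 N.

Lemma lpsum_extend d d' X t : (d <= d')%nat -> admissible d X -> lpsum d' X t = lpsum d X t.
Proof.
intros Hd [H _]. apply sum_n_m_ext. intros j. rewrite (logpoly_extend (V := V1) (d := d) (d' := d')); [easy|easy|].
intros l. apply H.
Qed.

Lemma admissible_extend d d' X : (d <= d')%nat -> admissible d X -> admissible d' X.
Proof. intros Hd [H1 H2]. split; [|easy]. intros j l Hl. apply H1. lia. Qed.

Lemma lpsum_plus d X Y t : lpsum d (fun j l => plus (X j l) (Y j l)) t = plus (lpsum d X t) (lpsum d Y t).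
Proof.
unfold lpsum. rewrite <- sum_n_m_plus. apply sum_n_m_ext. intros j.
rewrite (logpoly_plus (V := V1)). vec V1.
Qed.

Lemma admissible_plus d X Y : admissible d X -> admissible d Y -> admissible d (fun j l => plus (X j l) (Y j l)).
Proof.
intros [A1 A2] [B1 B2]. split.
- intros j l Hl. rewrite A1, B1 by easy. vec V1.
- intros l Hl. rewrite A2, B2 by easy. vec V1.
Qed.

Lemma cont_sum (f : nat -> R -> V1) m k : (forall i, (m <= i <= k)%nat -> cont0T (f i)) ->
  cont0T (fun t => sum_n_m (fun i => f i t) m k).
Proof. intros H t Ht. apply (lim_sum (V := V1)). intros i Hi. now apply H. Qed.

Lemma lpsum_logmono d X t : lpsum d X t = sum_n_m (fun j => sum_n_m (fun l => logmono j l (X j l) t) 0 d) 0 N.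
Proof.
unfold lpsum, logpoly. apply sum_n_m_ext. intros j. rewrite (scal_sum_n_m (W := V1)).
apply sum_n_m_ext. intros l. unfold logmono. vec V1.
Qed.

Lemma logmono_admissible_cont d X j l : admissible d X -> cont0T (logmono j l (X j l)).
Proof.
intros [_ H]. destruct j as [|j]; [|now apply logmono_cont].
destruct l as [|l]; [now apply logmono_cont|]. rewrite H by lia.
intros t Ht. apply (filterlim_ext (fun _ => zero)); [intros; unfold logmono; vec V1|].
replace (logmono 0 (S l) zero t) with (@zero V1) by (unfold logmono; vec V1). apply filterlim_const.
Qed.

Lemma lpsum_cont d X : admissible d X -> cont0T (lpsum d X).
Proof.
intros H t Ht. rewrite lpsum_logmono.
apply (filterlim_ext (fun t => sum_n_m (fun j => sum_n_m (fun l => logmono j l (X j l) t) 0 d) 0 N));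
  [intros; now rewrite lpsum_logmono|].
revert t Ht. apply cont_sum. intros j _. apply cont_sum. intros l _. now apply (logmono_admissible_cont (d := d)).
Qed.

Lemma A_zero t : 0 < t < T -> A (fun _ => zero) t = zero.
Proof.
intros Ht. pose (z := fun _ : R => @zero V1).
assert (Hz : cont0T z) by exact (fun s _ => filterlim_const (@zero V1)).
assert (E : A (fun s => plus (z s) (z s)) t = A z t) by (f_equal; apply functional_extensionality; intros; unfold z; vec V1).
rewrite A_plus in E by easy. fold z.
transitivity (minus (plus (A z t) (A z t)) (A z t)); [vec V2|]. rewrite E. vec V2.
Qed.

Definition single (j d : nat) (P : nat -> V1) (t : R) : V1 := sum_n_m (fun l => logmono j l (P l) t) 0 d.

Lemma single_cont j d P : (j = 0%nat -> d = 0%nat) -> cont0T (single j d P).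
Proof. intros H. apply cont_sum. intros l Hl. apply logmono_cont. intros E. specialize (H E). lia. Qed.

Lemma A_single j d P : (j = 0%nat -> d = 0%nat) ->
  lead N j (A (single j d P)) (fun t => scal (t ^ j) (diffpoly (Bm j) d P (ln t))).
Proof.
unfold single, diffpoly. intros H. induction d as [|d IH].
- apply (lead_near (g := A (logmono j 0 (P 0%nat)))).
  + exists T. split; [easy|]. intros t Ht. f_equal. apply functional_extensionality. intros s. now rewrite sum_n_n.
  + refine (lead_eq _ _ (@A_lead j 0 (P 0%nat) (fun _ => eq_refl))); [easy|]. intros t Ht. now rewrite sum_n_n.
- assert (Hj : j <> 0%nat) by (intros E; specialize (H E); lia).
  apply (lead_near (g := fun t => plus (A (fun t => sum_n_m (fun l => logmono j l (P l) t) 0 d) t) (A (logmono j (S d) (P (S d))) t))).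
  + exists T. split; [easy|]. intros t Ht. rewrite <- A_plus; [|apply cont_sum; intros; now apply logmono_cont|now apply logmono_cont|lra].
    f_equal. apply functional_extensionality. intros s. now rewrite sum_n_Sm by lia.
  + refine (lead_eq _ _ (lead_plus (IH ltac:(easy)) (@A_lead j (S d) (P (S d)) ltac:(easy)))); [easy|].
    intros t Ht. rewrite sum_n_Sm by lia. vec V2.
Qed.

Definition put (j : nat) (P : nat -> V1) (i l : nat) : V1 := if Nat.eqb i j then P l else zero.

Lemma lpsum_put j d P t : (j <= N)%nat -> lpsum d (put j P) t = single j d P t.
Proof.
intros Hj. rewrite lpsum_logmono. unfold single.
assert (Z : forall i, i <> j -> sum_n_m (fun l => logmono i l (put j P i l) t) 0 d = zero).
{ intros i Hi. etransitivity; [|exact (sum_n_m_const_zero (G := V1) 0 d)]. apply sum_n_m_ext. intros l.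
  unfold put, logmono. destruct (Nat.eqb_spec i j); [easy|]. vec V1. }
assert (E : sum_n_m (fun l => logmono j l (put j P j l) t) 0 d = sum_n_m (fun l => logmono j l (P l) t) 0 d).
{ apply sum_n_m_ext. intros l. unfold put. now rewrite Nat.eqb_refl. }
assert (H : forall M, sum_n_m (fun i => sum_n_m (fun l => logmono i l (put j P i l) t) 0 d) 0 M =
  if Nat.leb j M then sum_n_m (fun l => logmono j l (P l) t) 0 d else zero).
{ induction M as [|M IH].
  - rewrite sum_n_n. destruct (Nat.leb_spec j 0); [|apply Z; lia]. replace j with 0%nat in * by lia. exact E.
  - rewrite sum_n_Sm, IH by lia. destruct (Nat.leb_spec j M), (Nat.leb_spec j (S M)); try lia.
    + rewrite Z by lia. vec V1.
    + replace (S M) with j by lia. rewrite E. vec V1.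
    + rewrite Z by lia. vec V1. }
rewrite H. now rewrite (proj2 (Nat.leb_le j N)).
Qed.

Hypothesis B_onto : forall j, (j <= N)%nat -> exists p, forall y, exists v w,
  (forall m, (m < p)%nat -> Bm j m w = zero) /\ y = plus (Bm j 0%nat v) (Bm j p w).
Hypothesis B0_onto : forall y, exists v, y = Bm 0%nat 0%nat v.

Lemma diffpoly_onto j d Q : (j <= N)%nat -> (j = 0%nat -> d = 0%nat) -> exists d' P,
  (j = 0%nat -> d' = 0%nat) /\ (forall l, (d' < l)%nat -> P l = zero) /\
  forall t, diffpoly (Bm j) d' P (ln t) = logpoly d Q t.
Proof.
intros Hj Hd. destruct (Nat.eq_dec j 0) as [->|Hj0].
- rewrite (Hd eq_refl). destruct (B0_onto (Q 0%nat)) as [v Hv].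
  exists 0%nat, (fun l => if Nat.eqb l 0 then v else zero). repeat split; trivial.
  + intros l Hl. destruct (Nat.eqb_spec l 0); [lia|easy].
  + intros t. unfold diffpoly, diffmono, logpoly. rewrite !sum_n_n. simpl Nat.eqb. cbv iota.
    rewrite <- Hv, binomial_0_r. vec V2.
- destruct (B_onto Hj) as [p Hp]. destruct (attained_poly (Bm_lin j) Hp d Q) as [d' [P [HP E]]].
  exists d', P. repeat split; [easy|easy|]. intros t. now rewrite E.
Qed.

(** Coefficients are determined from [t^j] upwards, each step moving the residual from order [j] to [j + 1]. *)
Lemma solve_expn j g : (j <= S N)%nat -> expn N j g -> exists d X, admissible d X /\
  (forall i l, (i < j)%nat -> X i l = zero) /\
  small N (fun t => minus (A (lpsum d X) t) (g t)).
Proof.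
remember (S N - j)%nat as k eqn:Hk. revert j Hk g. induction k as [|k IH]; intros j Hk g Hj Hg.
(* At [j = N + 1] the right-hand side is already [o(t^N)], and no coefficient is left to choose. *)
- exists 0%nat, (fun _ _ => zero). split; [now split|]. split; [easy|].
  apply (small_ext (g := fun t => scal (-1) (g t))).
  + exists T. split; [easy|]. intros t Ht.
    replace (lpsum 0 (fun _ _ => zero)) with (fun _ : R => @zero V1).
    * rewrite A_zero by easy. vec V2.
    * apply functional_extensionality. intros s. unfold lpsum. symmetry.
      etransitivity; [|exact (sum_n_m_const_zero (G := V1) 0 N)]. apply sum_n_m_ext. intros i. unfold logpoly. rewrite sum_n_n. vec V1.
  + apply (small_scal (phi := fun _ => -1) (M := 1)).
    * exists 1. split; [lra|]. intros. rewrite Rabs_left; lra.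
    * apply (expn_last (j := j)); [lia|easy].
- destruct (expn_lead Hg) as [d [Q [_ [Hd HQ]]]].
  destruct (@diffpoly_onto j d Q ltac:(lia) Hd) as [d1 [P [Hd1 [HP HE]]]].
  pose proof (A_single P Hd1) as [_ HA].
  assert (Hg' : expn N (S j) (fun t => minus (g t) (A (single j d1 P) t))).
  { apply (expn_eq (g := fun t => minus (minus (g t) (scal (t ^ j) (logpoly d Q t)))
      (minus (A (single j d1 P) t) (scal (t ^ j) (diffpoly (Bm j) d1 P (ln t)))))).
    - intros t Ht. rewrite HE. vec V2.
    - now apply expn_minus. }
  destruct (IH (S j) ltac:(lia) _ ltac:(lia) Hg') as [d2 [X [HX [HX0 HS]]]].
  assert (HPa : admissible d1 (put j P)).
  { split.
    - intros i l Hl. unfold put. destruct (Nat.eqb_spec i j); [now apply HP|easy].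
    - intros l Hl. unfold put. destruct (Nat.eqb_spec 0 j) as [E|]; [|easy]. apply HP. rewrite Hd1; lia. }
  exists (max d1 d2), (fun i l => plus (put j P i l) (X i l)). split.
  { apply admissible_plus; [apply (admissible_extend (d := d1))|apply (admissible_extend (d := d2))]; trivial; lia. }
  split.
  { intros i l Hi. rewrite HX0 by lia. unfold put. destruct (Nat.eqb_spec i j); [lia|]. vec V1. }
  refine (small_ext _ HS). exists T. split; [easy|]. intros t Ht.
  replace (lpsum (max d1 d2) (fun i l => plus (put j P i l) (X i l))) with (fun s => plus (single j d1 P s) (lpsum d2 X s)).
  + rewrite A_plus; [vec V2|now apply single_cont|now apply lpsum_cont|easy].
  + apply functional_extensionality. intros s. rewrite lpsum_plus.
    rewrite (lpsum_extend (d := d1) (d' := max d1 d2)), (lpsum_extend (d := d2) (d' := max d1 d2)) by (trivial; lia).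
    rewrite lpsum_put by lia. easy.
Qed.

(** The leading term of the image of [t^j (ln t)^l v] vanishes, so the residual has order [j + 1]
    and is removed by coefficients beyond [j]. The coefficient at [t^j] therefore stays
    [(ln t)^l v], which later separates the parameters. *)
Lemma homogeneous_solution j l v : (j <= N)%nat -> (j = 0%nat -> l = 0%nat) ->
  (forall m, (m <= l)%nat -> Bm j m v = zero) -> exists d Y, admissible d Y /\
  (forall i m, (i < j)%nat -> Y i m = zero) /\
  (forall m, Y j m = if Nat.eqb m l then v else zero) /\
  small N (A (lpsum d Y)).
Proof.
intros Hj Hjl Hv. pose (P := fun m => if Nat.eqb m l then v else @zero V1).
destruct (A_single (j := j) (d := l) P Hjl) as [_ HA].
assert (E0 : forall z, diffpoly (Bm j) l P z = zero).
{ intros z. unfold diffpoly. etransitivity; [|exact (sum_n_m_const_zero (G := V2) 0 l)]. apply sum_n_m_ext_loc. intros i Hi.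
  unfold P. destruct (Nat.eqb_spec i l) as [->|]; [|now apply (diffmono_zero (Bm_lin j))].
  unfold diffmono. etransitivity; [|exact (sum_n_m_const_zero (G := V2) 0 l)]. apply sum_n_m_ext_loc. intros m Hm.
  rewrite Hv by lia. vec V2. }
assert (HA' : expn N (S j) (fun t => scal (-1) (A (single j l P) t))).
{ apply expn_scal. refine (expn_eq _ HA). intros t Ht. rewrite E0. vec V2. }
destruct (@solve_expn (S j) _ ltac:(lia) HA') as [d [X [HX [HX0 HS]]]].
assert (HPa : admissible l (put j P)).
{ split.
  - intros i m Hm. unfold put, P. destruct (Nat.eqb_spec i j); [|easy]. destruct (Nat.eqb_spec m l); [lia|easy].
  - intros m Hm. unfold put, P. destruct (Nat.eqb_spec 0 j) as [E|]; [|easy]. destruct (Nat.eqb_spec m l); [|easy].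
    specialize (Hjl (eq_sym E)). lia. }
exists (max l d), (fun i m => plus (put j P i m) (X i m)). split.
{ apply admissible_plus; [apply (admissible_extend (d := l))|apply (admissible_extend (d := d))]; trivial; lia. }
split; [|split].
- intros i m Hi. rewrite HX0 by lia. unfold put. destruct (Nat.eqb_spec i j); [lia|]. vec V1.
- intros m. rewrite HX0 by lia. unfold put. rewrite Nat.eqb_refl. fold (P m). vec V1.
- refine (small_ext _ HS). exists T. split; [easy|]. intros t Ht.
  replace (lpsum (max l d) (fun i m => plus (put j P i m) (X i m))) with (fun s => plus (single j l P s) (lpsum d X s)).
  + rewrite A_plus; [vec V2|now apply single_cont|now apply lpsum_cont|easy].
  + apply functional_extensionality. intros s. rewrite lpsum_plus.
    rewrite (lpsum_extend (d := l) (d' := max l d)), (lpsum_extend (d := d) (d' := max l d)) by (trivial; lia).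
    now rewrite lpsum_put by lia.
Qed.

End Solve.

(** * Linear systems and determinants *)

Lemma group_cancel {G : AbelianGroup} (a y : G) : y = plus (plus a y) (opp a).
Proof. rewrite (plus_comm a y), <- plus_assoc, plus_opp_r, plus_zero_r. reflexivity. Qed.

Section LinearAlgebra.
Variable K : Ring.
Hypothesis K_comm : forall x y : K, mult x y = mult y x.
Hypothesis K_nontrivial : @one K <> zero.
Hypothesis K_inv : forall x : K, x <> zero -> exists y, mult y x = one.

(* The operations are renamed since [ring] needs a syntactically unique carrier. *)
Let kT : Type := Ring.sort K.
Let k0 : kT := zero.
Let k1 : kT := one.
Let kadd (x y : kT) : kT := plus x y.
Let kmul (x y : kT) : kT := mult x y.
Let ksub (x y : kT) : kT := minus x y.
Let kopp (x : kT) : kT := opp x.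
Let katom (x : kT) : kT := x.

Lemma K_ring : ring_theory k0 k1 kadd kmul ksub kopp eq.
Proof.
split; intros.
- exact (plus_zero_l (G := K) x).
- exact (plus_comm (G := K) x y).
- exact (plus_assoc (G := K) x y z).
- exact (mult_one_l (K := K) x).
- exact (K_comm x y).
- exact (mult_assoc (K := K) x y z).
- exact (mult_distr_r (K := K) x y z).
- reflexivity.
- exact (plus_opp_r (G := K) x).
Qed.
Add Ring Kring : K_ring.
Ltac krebuild t :=
  match t with
  | @plus _ ?a ?b => let a' := krebuild a in let b' := krebuild b in constr:(kadd a' b')
  | @minus _ ?a ?b => let a' := krebuild a in let b' := krebuild b in constr:(ksub a' b')
  | @opp _ ?a => let a' := krebuild a in constr:(kopp a')
  | @mult _ ?a ?b => let a' := krebuild a in let b' := krebuild b in constr:(kmul a' b')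
  | @zero _ => constr:(k0)
  | @one _ => constr:(k1)
  | _ => constr:(katom t)
  end.
Ltac kring := match goal with |- @eq _ ?a ?b =>
  let a' := krebuild a in let b' := krebuild b in change (@eq kT a' b'); ring end.

Lemma K_integral (x y : K) : mult x y = zero -> x <> zero -> y = zero.
Proof.
intros H Hx. destruct (K_inv Hx) as [x' Hx'].
rewrite <- (mult_one_l y), <- Hx', <- mult_assoc, H. apply mult_zero_r.
Qed.

(** Sums over lists, so that a pivot index can be taken out of the middle. *)
Fixpoint lsum {G : AbelianMonoid} (f : nat -> G) (L : list nat) : G :=
  match L with nil => zero | l :: L => plus (f l) (lsum f L) end.

Lemma lsum_app {G : AbelianMonoid} (f : nat -> G) L1 L2 : lsum f (L1 ++ L2) = plus (lsum f L1) (lsum f L2).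
Proof. induction L1 as [|l L1 IH]; simpl; [now rewrite plus_zero_l|]. now rewrite IH, plus_assoc. Qed.

Lemma lsum_ext {G : AbelianMonoid} (f g : nat -> G) L : (forall l, In l L -> f l = g l) -> lsum f L = lsum g L.
Proof.
induction L as [|l L IH]; intros H; simpl; [easy|]. rewrite H by now left. f_equal. apply IH. intros; apply H. now right.
Qed.

Lemma lsum_zero {G : AbelianMonoid} (f : nat -> G) L : (forall l, In l L -> f l = zero) -> lsum f L = zero.
Proof.
induction L as [|l L IH]; intros H; simpl; [easy|]. rewrite (H l) by now left. rewrite IH by (intros; apply H; now right). apply plus_zero_l.
Qed.

Lemma lsum_plus {G : AbelianMonoid} (f g : nat -> G) L : lsum (fun l => plus (f l) (g l)) L = plus (lsum f L) (lsum g L).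
Proof. induction L as [|l L IH]; simpl; [now rewrite plus_zero_l|]. rewrite IH. apply plus_swap. Qed.

Lemma lsum_mult (c : K) (f : nat -> K) L : lsum (fun l => mult c (f l)) L = mult c (lsum f L).
Proof. induction L as [|l L IH]; simpl; [now rewrite mult_zero_r|]. now rewrite IH, mult_distr_l. Qed.

Lemma lsum_seq {G : AbelianMonoid} (f : nat -> G) r : sum_n_m f 1 r = lsum f (seq 1 r).
Proof.
induction r as [|r IH]; [apply sum_n_m_zero; lia|].
rewrite sum_n_Sm, seq_S, lsum_app, IH by lia. simpl. now rewrite plus_zero_r.
Qed.

(** Gaussian elimination, by induction on the equations: [I] lists them, [L] lists the unknowns. A
    nonzero entry of the first row serves as pivot; a row of zeros imposes no condition. *)
Lemma homogeneous_system (I L : list nat) (A : nat -> nat -> K) : NoDup L -> (length I < length L)%nat ->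
  exists d : nat -> K, (exists l, In l L /\ d l <> zero) /\
    forall i, In i I -> lsum (fun l => mult (A i l) (d l)) L = zero.
Proof.
revert L A. induction I as [|i0 I IH]; intros L A HL Hlen.
- destruct L as [|l L]; [simpl in Hlen; lia|]. exists (fun _ => one). split; [|easy].
  exists l. split; [now left|exact K_nontrivial].
- destruct (classic (exists l0, In l0 L /\ A i0 l0 <> zero)) as [[l0 [Hl0 Hp]]|Hno].
  + destruct (in_split _ _ Hl0) as [L1 [L2 E]]. subst L.
    destruct (K_inv Hp) as [q Hq].
    (* Rows reduced by the pivot row, so that the unknown [l0] drops out. *)
    pose (A' := fun i l : nat => minus (A i l) (mult (mult (A i l0) q) (A i0 l))).
    destruct (IH (L1 ++ L2) A') as [d' [[l1 [Hl1 Hd1]] Hd']].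
    { now apply NoDup_remove_1 in HL. }
    { rewrite length_app in *. simpl in Hlen. lia. }
    assert (Hnotin : ~ In l0 (L1 ++ L2)) by now apply NoDup_remove_2 in HL.
    pose (s0 := lsum (fun l => mult (A i0 l) (d' l)) (L1 ++ L2)).
    (* Back substitution: the pivot equation determines the unknown [l0]. *)
    pose (d := fun l => if Nat.eqb l l0 then opp (mult q s0) else d' l).
    assert (Hd : forall l, In l (L1 ++ L2) -> d l = d' l).
    { intros l Hl. unfold d. destruct (Nat.eqb_spec l l0); [subst; easy|easy]. }
    assert (Hd0 : d l0 = opp (mult q s0)) by (unfold d; now rewrite Nat.eqb_refl).
    assert (Hsum : forall i, lsum (fun l => mult (A i l) (d l)) (L1 ++ l0 :: L2) =
      plus (mult (A i l0) (opp (mult q s0))) (lsum (fun l => mult (A i l) (d' l)) (L1 ++ L2))).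
    { intros i. rewrite lsum_app. simpl. rewrite Hd0.
      rewrite (lsum_ext (f := fun l => mult (A i l) (d l)) (g := fun l => mult (A i l) (d' l)) (L := L1)),
        (lsum_ext (f := fun l => mult (A i l) (d l)) (g := fun l => mult (A i l) (d' l)) (L := L2)), lsum_app.
      - rewrite !plus_assoc. f_equal. apply plus_comm.
      - intros l Hl. rewrite Hd; [easy|apply in_or_app; now right].
      - intros l Hl. rewrite Hd; [easy|apply in_or_app; now left]. }
    exists d. split.
    * exists l1. split; [apply in_app_or in Hl1; apply in_or_app; simpl; tauto|]. now rewrite Hd.
    * intros i [<-|Hi]; rewrite Hsum.
      -- fold s0. replace (mult (A i0 l0) (opp (mult q s0))) with (opp (mult (mult q (A i0 l0)) s0)) by kring.
         rewrite Hq. kring.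
      -- assert (E : lsum (fun l => mult (A i l) (d' l)) (L1 ++ L2) =
           plus (lsum (fun l => mult (A' i l) (d' l)) (L1 ++ L2)) (mult (mult (A i l0) q) s0)).
         { unfold s0. rewrite <- lsum_mult, <- lsum_plus. apply lsum_ext. intros l _. unfold A'. kring. }
         rewrite E, Hd' by easy. kring.
  + destruct (IH L A HL ltac:(simpl in Hlen; lia)) as [d [Hd1 Hd2]].
    exists d. split; [easy|]. intros i [<-|Hi]; [|now apply Hd2].
    apply lsum_zero. intros l Hl. replace (A i0 l) with (@zero K); [apply mult_zero_l|].
    apply NNPP. intros Hn. apply Hno. exists l. split; [easy|congruence].
Qed.

(** * Dimension counting modulo a subspace *)

Section Modules.
Variable V : ModuleSpace K.
Variable S : V -> Prop.
Hypothesis S_plus : forall x y, S x -> S y -> S (plus x y).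
Hypothesis S_scal : forall c x, S x -> S (scal (c : K) x).

Lemma S_lsum (f : nat -> V) L : S zero -> (forall l, In l L -> S (f l)) -> S (lsum f L).
Proof.
intros H0. induction L as [|l L IH]; intros H; simpl; [easy|]. apply S_plus; [apply H; now left|apply IH; intros; apply H; now right].
Qed.

Lemma lsum_scal (c : K) (f : nat -> V) L : lsum (fun l => scal c (f l)) L = scal c (lsum f L).
Proof. induction L as [|l L IH]; simpl; [now rewrite scal_zero_r|]. now rewrite IH, scal_distr_l. Qed.

Lemma lsum_scal_l (f : nat -> K) (v : V) L : lsum (fun l => scal (f l) v) L = scal (lsum f L) v.
Proof. induction L as [|l L IH]; simpl; [now rewrite scal_zero_l|]. now rewrite IH, scal_distr_r. Qed.

Lemma lsum_exchange {G : AbelianMonoid} (f : nat -> nat -> G) L1 L2 :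
  lsum (fun i => lsum (f i) L2) L1 = lsum (fun l => lsum (fun i => f i l) L1) L2.
Proof.
induction L1 as [|i L1 IH]; simpl.
- symmetry. now apply lsum_zero.
- now rewrite IH, lsum_plus.
Qed.

(** Independence in the quotient by [S]. Taking [S] to be the zero space compares bases; taking it
    to be the range of an operator handles codimensions. *)
Definition independent (r : nat) (w : nat -> V) : Prop :=
  forall c : nat -> K, S (sum_n_m (fun i => scal (c i) (w i)) 1 r) -> forall i, (1 <= i <= r)%nat -> c i = zero.

(** Steinitz bound: with more vectors than generators, the homogeneous system for their coordinates
    has a nontrivial solution, that is, a relation modulo [S]. *)
Lemma independent_le_span r q (w z : nat -> V) : S zero -> independent r w ->
  (forall i, (1 <= i <= r)%nat -> exists s (c : nat -> K), S s /\ w i = plus s (sum_n_m (fun l => scal (c l) (z l)) 1 q)) ->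
  (r <= q)%nat.
Proof.
intros H0 Hind Hspan. apply Nat.nlt_ge. intros Hlt.
assert (HA : forall i, exists a : V * (nat -> K), (1 <= i <= r)%nat ->
  S (fst a) /\ w i = plus (fst a) (sum_n_m (fun l => scal (snd a l) (z l)) 1 q)).
{ intros i. destruct (classic (1 <= i <= r)%nat) as [Hi|Hi].
  - destruct (Hspan i Hi) as [s [c H]]. now exists (s, c).
  - exists (zero, fun _ => zero). easy. }
destruct (choice _ HA) as [a Ha].
destruct (@homogeneous_system (seq 1 q) (seq 1 r) (fun l i => snd (a i) l)) as [d [[i0 [Hi0 Hd0]] Hd]].
{ apply seq_NoDup. } { now rewrite !length_seq. }
apply Hd0. apply in_seq in Hi0. apply (Hind d); [|lia].
rewrite lsum_seq.
replace (lsum (fun i => scal (d i) (w i)) (seq 1 r)) with (lsum (fun i => scal (d i) (fst (a i))) (seq 1 r)).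
- apply S_lsum; [easy|]. intros i Hi. apply in_seq in Hi. apply S_scal. apply Ha. lia.
- transitivity (plus (lsum (fun i => scal (d i) (fst (a i))) (seq 1 r)) (lsum (fun i => lsum (fun l => scal (mult (snd (a i) l) (d i)) (z l)) (seq 1 q)) (seq 1 r))).
  + rewrite lsum_exchange. rewrite (lsum_zero (f := fun l => lsum _ _)); [now rewrite plus_zero_r|].
    intros l Hl. rewrite lsum_scal_l, (Hd l Hl). apply scal_zero_l.
  + rewrite <- lsum_plus. apply lsum_ext. intros i Hi. apply in_seq in Hi.
    destruct (Ha i ltac:(lia)) as [_ E]. rewrite E, scal_distr_l. f_equal.
    rewrite lsum_seq, <- lsum_scal. apply lsum_ext. intros l _. rewrite scal_assoc. f_equal. apply K_comm.
Qed.

(** Otherwise [y] could be added to the family, giving [r + 1] independent vectors in a quotient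
    spanned by [r]. *)
Lemma independent_spans r (w z : nat -> V) y : S zero -> independent r w ->
  (forall x, exists s (c : nat -> K), S s /\ x = plus s (sum_n_m (fun l => scal (c l) (z l)) 1 r)) ->
  exists s (c : nat -> K), S s /\ y = plus s (sum_n_m (fun l => scal (c l) (w l)) 1 r).
Proof.
intros H0 Hind Hspan. apply NNPP. intros Hno.
assert (Datatypes.S r <= r)%nat; [|lia].
pose (w' := fun i => if Nat.eqb i (Datatypes.S r) then y else w i).
apply (independent_le_span (w := w') (z := z)); trivial. intros c Hc.
rewrite sum_n_Sm in Hc by lia.
assert (E1 : w' (Datatypes.S r) = y) by (unfold w'; now rewrite Nat.eqb_refl).
rewrite E1 in Hc.
rewrite (sum_n_m_ext_loc _ (fun i => scal (c i) (w i))) in Hc.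
2:{ intros i Hi. unfold w'. destruct (Nat.eqb_spec i (Datatypes.S r)); [lia|easy]. }
assert (Hc0 : c (Datatypes.S r) = zero).
{ apply NNPP. intros Hn. destruct (K_inv Hn) as [q Hq]. apply Hno.
  set (x := sum_n_m (fun i => scal (c i) (w i)) 1 r) in *.
  exists (scal q (plus x (scal (c (Datatypes.S r)) y))), (fun i => opp (mult q (c i))). split; [now apply S_scal|].
  rewrite scal_distr_l, scal_assoc, Hq, scal_one.
  replace (sum_n_m (fun l => scal (opp (mult q (c l))) (w l)) 1 r) with (opp (scal q x)).
  - exact (group_cancel (G := V) (scal q x) y).
  - unfold x. rewrite !lsum_seq, <- lsum_scal, <- (scal_opp_one (K := K)), <- lsum_scal.
    apply lsum_ext. intros l _. rewrite !scal_assoc. f_equal. kring. }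
intros i Hi. destruct (Nat.eq_dec i (Datatypes.S r)) as [->|Hi']; [easy|].
apply Hind; [|lia]. rewrite Hc0, scal_zero_l, plus_zero_r in Hc. exact Hc.
Qed.

End Modules.

(** * Determinants defined by expansion along the first row *)

Notation kdet := (det (K := K)).
Definition minor (A : nat -> nat -> K) (l i m : nat) : K := A (S i) (if Nat.ltb m l then m else S m).

Lemma det_S r A : kdet (S r) A =
  sum_n_m (fun l => mult (mult (pow_n (opp one) (S l)) (A 1%nat l)) (kdet r (minor A l))) 1 (S r).
Proof. reflexivity. Qed.

Lemma det_ext r A B : (forall i l, (1 <= i <= r)%nat -> (1 <= l <= r)%nat -> A i l = B i l) -> kdet r A = kdet r B.
Proof.
revert A B. induction r as [|r IH]; intros A B H; [easy|]. rewrite !det_S.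
apply sum_n_m_ext_loc. intros l Hl. rewrite H by lia. f_equal. apply IH. intros i m Hi Hm.
unfold minor. apply H; [lia|]. destruct (Nat.ltb_spec m l); lia.
Qed.

Definition setcol (A : nat -> nat -> K) (q : nat) (v : nat -> K) (i l : nat) : K :=
  if Nat.eqb l q then v i else A i l.

Lemma minor_setcol_same A q v i m : minor (setcol A q v) q i m = minor A q i m.
Proof.
unfold minor, setcol. destruct (Nat.ltb_spec m q).
- destruct (Nat.eqb_spec m q); [lia|easy].
- destruct (Nat.eqb_spec (S m) q); [lia|easy].
Qed.

Lemma minor_setcol_other A q v l i m : l <> q ->
  minor (setcol A q v) l i m = setcol (minor A l) (if Nat.ltb q l then q else q - 1) (fun i => v (S i)) i m.
Proof.
intros Hl. unfold minor, setcol.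
destruct (Nat.ltb_spec q l), (Nat.ltb_spec m l);
repeat match goal with |- context [Nat.eqb ?x ?y] => destruct (Nat.eqb_spec x y) end; lia || easy.
Qed.

(** Induction through the expansion. In the term of column [q] the linear entry is the factor from
    the first row and the minor lacks the column; in all other terms the column survives in the
    minor, shifted by one if it lies to the right of the deleted one. *)
Lemma det_linear r A q c v w : (1 <= q <= r)%nat ->
  kdet r (setcol A q (fun i => plus (v i) (mult c (w i)))) =
  plus (kdet r (setcol A q v)) (mult c (kdet r (setcol A q w))).
Proof.
revert A q v w. induction r as [|r IH]; intros A q v w Hq; [lia|].
rewrite !det_S, <- (sum_n_m_mult_l (K := K)), <- sum_n_m_plus. apply sum_n_m_ext_loc. intros l Hl.
destruct (Nat.eq_dec l q) as [->|Hlq].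
- rewrite !(det_ext (A := minor (setcol A q _) q) (B := minor A q)) by (intros; apply minor_setcol_same).
  unfold setcol. rewrite Nat.eqb_refl. kring.
- rewrite !(det_ext (A := minor (setcol A q _) l)) with (1 := fun i m _ _ => minor_setcol_other A _ i m Hlq).
  rewrite IH by (destruct (Nat.ltb_spec q l); lia).
  assert (E : forall v, setcol A q v 1%nat l = A 1%nat l).
  { intros v'. unfold setcol. destruct (Nat.eqb_spec l q); easy. }
  rewrite !E. kring.
Qed.

Lemma sum_two (f : nat -> K) r p : (1 <= p)%nat -> (S p <= r)%nat ->
  (forall l, (1 <= l <= r)%nat -> l <> p -> l <> S p -> f l = zero) -> sum_n_m f 1 r = plus (f p) (f (S p)).
Proof.
intros H1 H2 H.
rewrite (sum_n_m_Chasles f 1 (S p) r) by lia.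
rewrite sum_n_Sm by lia.
assert (E1 : sum_n_m f (S (S p)) r = zero).
{ rewrite <- (sum_n_m_const_zero (G := K) (S (S p)) r). apply sum_n_m_ext_loc. intros l Hl. apply H; lia. }
assert (E2 : sum_n_m f 1 p = f p).
{ destruct p as [|p']; [lia|]. rewrite sum_n_Sm by lia.
  rewrite (sum_n_m_ext_loc f (fun _ => zero)), sum_n_m_const_zero by (intros; apply H; lia). apply plus_zero_l. }
rewrite E1, E2, plus_zero_r. easy.
Qed.

(** The terms of the two equal columns have equal minors and opposite signs; every other minor still
    has two equal adjacent columns. *)
Lemma det_adjacent r A p : (1 <= p)%nat -> (S p <= r)%nat -> (forall i, A i p = A i (S p)) -> kdet r A = zero.
Proof.
revert A p. induction r as [|r IH]; intros A p Hp Hpr HA; [lia|].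
assert (Z : forall l, (1 <= l <= S r)%nat -> l <> p -> l <> S p -> kdet r (minor A l) = zero).
{ intros l Hl H1 H2. destruct (Nat.lt_ge_cases l p).
  - apply (IH (minor A l) (p - 1)%nat); [lia|lia|]. intros i. unfold minor.
    rewrite (proj2 (Nat.ltb_ge (p - 1) l)), (proj2 (Nat.ltb_ge (S (p - 1)) l)) by lia.
    replace (S (p - 1)) with p by lia. apply HA.
  - apply (IH (minor A l) p); [lia|lia|]. intros i. unfold minor.
    rewrite (proj2 (Nat.ltb_lt p l)), (proj2 (Nat.ltb_lt (S p) l)) by lia. apply HA. }
rewrite det_S, (sum_two (p := p)); [|easy|easy|intros l Hl H1 H2; rewrite Z by easy; apply mult_zero_r].
rewrite (det_ext (A := minor A (S p)) (B := minor A p)).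
- rewrite HA. simpl pow_n. kring.
- intros i m _ _. unfold minor.
  destruct (Nat.ltb_spec m (S p)), (Nat.ltb_spec m p); try lia; try easy.
  replace m with p by lia. apply HA.
Qed.

Definition swapcol (A : nat -> nat -> K) (p i l : nat) : K :=
  if Nat.eqb l p then A i (S p) else if Nat.eqb l (S p) then A i p else A i l.

(** Polarisation: with [u + v] in both columns the determinant vanishes, and its expansion leaves
    the two mixed terms, which must be opposite. *)
Lemma det_swap r A p : (1 <= p)%nat -> (S p <= r)%nat -> kdet r (swapcol A p) = opp (kdet r A).
Proof.
intros Hp Hpr.
pose (D := fun u v => kdet r (setcol (setcol A p u) (S p) v)).
assert (Dsame : forall u, D u u = zero).
{ intros u. unfold D. apply (det_adjacent (p := p)); trivial. intros i. unfold setcol.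
  destruct (Nat.eqb_spec p (S p)); [lia|]. now rewrite !Nat.eqb_refl. }
assert (Dr : forall u v w, D u (fun i => plus (v i) (mult one (w i))) = plus (D u v) (mult one (D u w))).
{ intros u v w. unfold D. apply det_linear. lia. }
assert (Dcomm : forall u v, D u v = kdet r (setcol (setcol A (S p) v) p u)).
{ intros u v. apply det_ext. intros i l _ _. unfold setcol.
  destruct (Nat.eqb_spec l (S p)), (Nat.eqb_spec l p); try lia; easy. }
assert (Dl : forall u v w, D (fun i => plus (u i) (mult one (v i))) w = plus (D u w) (mult one (D v w))).
{ intros u v w. rewrite !Dcomm. apply det_linear. lia. }
pose (u := fun i => A i p). pose (v := fun i => A i (S p)).
pose proof (Dsame (fun i => plus (u i) (mult one (v i)))) as H.
rewrite Dl, !Dr, !Dsame in H.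
assert (E1 : D u v = kdet r A).
{ apply det_ext. intros i l _ _. unfold setcol, u, v. destruct (Nat.eqb_spec l (S p)) as [->|]; [easy|].
  destruct (Nat.eqb_spec l p) as [->|]; easy. }
assert (E2 : D v u = kdet r (swapcol A p)).
{ apply det_ext. intros i l _ _. unfold setcol, swapcol, u, v.
  destruct (Nat.eqb_spec l (S p)), (Nat.eqb_spec l p); try lia; easy. }
rewrite <- E1, <- E2.
replace (D v u) with (plus (plus (plus zero (mult one (D u v))) (mult one (plus (D v u) (mult one zero)))) (opp (D u v))) by kring.
rewrite <- (plus_zero_l (opp (D u v))) at 2. f_equal. exact H.
Qed.

(** Adjacent exchanges bring the two columns together, one for each unit of distance. *)
Lemma det_equal_columns r A p k : (1 <= p)%nat -> (p + S k <= r)%nat -> (forall i, A i p = A i (p + S k)%nat) ->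
  kdet r A = zero.
Proof.
revert A. induction k as [|k IH]; intros A Hp Hr HA.
- apply (det_adjacent (p := p)); [easy|lia|]. intros i. rewrite HA. f_equal. lia.
- assert (E : kdet r (swapcol A (p + S k)) = zero).
  { apply IH; [easy|lia|]. intros i. unfold swapcol. rewrite Nat.eqb_refl.
    destruct (Nat.eqb_spec p (p + S k)); [lia|]. destruct (Nat.eqb_spec p (S (p + S k))); [lia|].
    rewrite HA. f_equal. lia. }
  rewrite det_swap in E by lia. rewrite <- (opp_opp (kdet r A)), E. kring.
Qed.

Lemma det_equal_columns' r A p q : (1 <= p <= r)%nat -> (1 <= q <= r)%nat -> p <> q -> (forall i, A i p = A i q) ->
  kdet r A = zero.
Proof.
intros Hp Hq Hpq HA. destruct (Nat.lt_ge_cases p q).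
- apply (det_equal_columns (p := p) (k := q - p - 1)); [lia|lia|]. intros i. rewrite HA. f_equal. lia.
- apply (det_equal_columns (p := q) (k := p - q - 1)); [lia|lia|]. intros i. rewrite <- HA. f_equal. lia.
Qed.

(** Cramer's argument: column [q] is replaced by the combination of all columns with coefficients
    [d], which is zero. By multilinearity only [d q] times the determinant is left, since the other
    terms have two equal columns. *)
Lemma det_columns r A (d : nat -> K) : kdet r A <> zero ->
  (forall i, (1 <= i <= r)%nat -> sum_n_m (fun l => mult (A i l) (d l)) 1 r = zero) ->
  forall l, (1 <= l <= r)%nat -> d l = zero.
Proof.
intros Hdet Hd q Hq. apply NNPP. intros Hn. apply Hdet.
apply (K_integral (x := d q)); [|easy].
assert (Hlin : forall L, (forall l, In l L -> (1 <= l <= r)%nat) ->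
  kdet r (setcol A q (fun i => lsum (fun l => mult (A i l) (d l)) L)) =
  lsum (fun l => mult (d l) (kdet r (setcol A q (fun i => A i l)))) L).
{ induction L as [|l L IH]; intros HL.
  (* A zero column equals [0 + (-1) 0], so linearity makes the determinant vanish. *)
  - simpl. pose proof (@det_linear r A q (opp one) (fun _ => zero) (fun _ => zero) Hq) as E.
    rewrite (det_ext (B := setcol A q (fun _ => zero))) in E.
    + rewrite E. kring.
    + intros i l _ _. unfold setcol. destruct (Nat.eqb_spec l q); [kring|easy].
  - simpl. rewrite <- IH by (intros; apply HL; now right).
    rewrite (det_ext (B := setcol A q (fun i => plus (lsum (fun l => mult (A i l) (d l)) L) (mult (d l) (A i l))))).
    + rewrite det_linear by easy. apply plus_comm.
    + intros i m _ _. unfold setcol. destruct (Nat.eqb_spec m q); [|easy]. rewrite plus_comm. f_equal. apply K_comm. }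
specialize (Hlin (seq 1 r) (fun l Hl => ltac:(apply in_seq in Hl; lia))).
assert (E1 : kdet r (setcol A q (fun i => lsum (fun l => mult (A i l) (d l)) (seq 1 r))) = zero).
{ pose proof (@det_linear r A q (opp one) (fun _ => zero) (fun _ => zero) Hq) as E.
  rewrite (det_ext (B := setcol A q (fun _ => zero))).
  - rewrite (det_ext (B := setcol A q (fun _ => zero))) in E; [rewrite E; kring|].
    intros i l _ _. unfold setcol. destruct (Nat.eqb_spec l q); [kring|easy].
  - intros i l Hi _. unfold setcol. destruct (Nat.eqb_spec l q); [|easy]. rewrite <- lsum_seq. now apply Hd. }
rewrite E1 in Hlin. rewrite Hlin.
assert (Hin : In q (seq 1 r)) by (apply in_seq; lia).
destruct (in_split _ _ Hin) as [L1 [L2 E]]. pose proof (seq_NoDup r 1) as HND. rewrite E in HND |- *.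
apply NoDup_remove_2 in HND.
assert (HL : forall l, In l (L1 ++ L2) -> mult (d l) (kdet r (setcol A q (fun i => A i l))) = zero).
{ intros l Hl. assert (Hlq : l <> q) by (intros ->; easy).
  assert (Hlr : In l (seq 1 r)) by (rewrite E; apply in_app_or in Hl; apply in_or_app; simpl; tauto).
  apply in_seq in Hlr.
  rewrite (det_equal_columns' (p := l) (q := q)); [apply mult_zero_r|lia|easy|easy|].
  intros i. unfold setcol. rewrite Nat.eqb_refl. destruct (Nat.eqb_spec l q); easy. }
rewrite lsum_app. simpl.
rewrite (lsum_zero (L := L1)), (lsum_zero (L := L2)) by (intros; apply HL; apply in_or_app; auto).
rewrite plus_zero_l, plus_zero_r. f_equal. apply det_ext. intros i l _ _. unfold setcol.
destruct (Nat.eqb_spec l q) as [->|]; easy.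
Qed.

(** Reduced to columns without transposing: if [c i0] is nonzero, the other [r - 1] rows have a
    common nonzero solution [d], and the relation among the rows makes it annihilate row [i0] as
    well, against [det_columns]. *)
Lemma det_rows r A (c : nat -> K) : kdet r A <> zero ->
  (forall l, (1 <= l <= r)%nat -> sum_n_m (fun i => mult (c i) (A i l)) 1 r = zero) ->
  forall i, (1 <= i <= r)%nat -> c i = zero.
Proof.
intros Hdet Hc i0 Hi0. apply NNPP. intros Hn.
assert (Hin : In i0 (seq 1 r)) by (apply in_seq; lia).
destruct (in_split _ _ Hin) as [L1 [L2 E]].
destruct (@homogeneous_system (L1 ++ L2) (seq 1 r) A (seq_NoDup r 1)) as [d [[l [Hl Hd0]] Hd]].
{ rewrite E, !length_app. simpl. lia. }
apply Hd0. apply in_seq in Hl. apply (det_columns Hdet); [|lia].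
intros i Hi. rewrite lsum_seq.
destruct (Nat.eq_dec i i0) as [->|Hii].
2:{ apply Hd. assert (Hin' : In i (seq 1 r)) by (apply in_seq; lia). rewrite E in Hin'.
  apply in_app_or in Hin'. apply in_or_app. simpl in Hin'. destruct Hin' as [|[|]]; [now left|congruence|now right]. }
apply (K_integral (x := c i0)); [|easy].
transitivity (lsum (fun i => mult (c i) (lsum (fun l => mult (A i l) (d l)) (seq 1 r))) (seq 1 r)).
- set (g := fun i => mult (c i) _). change (g i0 = lsum g (seq 1 r)). rewrite E, lsum_app. simpl.
  rewrite (lsum_zero (f := g) (L := L1)), (lsum_zero (f := g) (L := L2)).
  + now rewrite plus_zero_l, plus_zero_r.
  + intros l' Hl'. unfold g. rewrite Hd by (apply in_or_app; now right). apply mult_zero_r.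
  + intros l' Hl'. unfold g. rewrite Hd by (apply in_or_app; now left). apply mult_zero_r.
- transitivity (lsum (fun i => lsum (fun l => mult (mult (c i) (A i l)) (d l)) (seq 1 r)) (seq 1 r)).
  + apply lsum_ext. intros i' _. rewrite <- lsum_mult. apply lsum_ext. intros l' _. kring.
  + rewrite lsum_exchange. apply lsum_zero. intros l' Hl'. apply in_seq in Hl'.
    transitivity (mult (lsum (fun i => mult (c i) (A i l')) (seq 1 r)) (d l')).
    * rewrite K_comm, <- lsum_mult. apply lsum_ext. intros; apply K_comm.
    * rewrite <- lsum_seq, Hc by lia. apply mult_zero_l.
Qed.

End LinearAlgebra.

(** * Uniqueness of logarithm-power expansions *)

Section Coefficients.
Variable V : CompleteNormedModule R_AbsRing.

Lemma vanish_eq0 (y : V) : (forall eps, 0 < eps -> norm y <= eps) -> y = zero.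
Proof.
intros H. apply (@norm_eq_zero R_AbsRing V). apply Rle_antisym; [|apply (@norm_ge_0 R_AbsRing V)].
apply le_epsilon. intros eps He. rewrite Rplus_0_l. now apply H.
Qed.

Lemma ln_large M : near0 (fun t => t < 1 /\ M < - ln t).
Proof.
exists (exp (- Rabs M)). split; [apply exp_pos|]. intros t Ht.
assert (Hl : ln t < - Rabs M) by (rewrite <- (ln_exp (- Rabs M)); apply ln_increasing; lra).
pose proof (Rabs_pos M). pose proof (Rle_abs M). split; [|lra].
apply Rnot_le_lt. intros H1. assert (ln 1 <= ln t); [|rewrite ln_1 in *; lra].
destruct H1 as [H1|<-]; [left; apply ln_increasing; lra|lra].
Qed.

(** As [- ln t] tends to infinity the top power dominates, so its coefficient vanishes; the lower
    ones follow by induction. *)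
Lemma logpoly_vanish d (Q : nat -> V) :
  (forall eps, 0 < eps -> near0 (fun t => norm (logpoly d Q t) <= eps)) ->
  forall l, (l <= d)%nat -> Q l = zero.
Proof.
induction d as [|d IH]; intros H.
- intros l Hl. replace l with 0%nat by lia. apply vanish_eq0. intros eps He.
  destruct (H eps He) as [dd [Hdd D]]. specialize (D (dd / 2) ltac:(lra)).
  unfold logpoly in D. rewrite sum_n_n in D. simpl pow in D.
  replace (Q 0%nat) with (scal 1 (Q 0%nat)) by (vec V). exact D.
- assert (Htop : Q (S d) = zero).
  { apply vanish_eq0. intros eps He.
    pose (b := sum_n_m (fun l => norm (Q l)) 0 d).
    assert (Hb : 0 <= b).
    { apply Rle_trans with (sum_n_m (fun _ => 0) 0 d); [right; symmetry; apply (sum_n_m_const_zero (G := R_AbelianMonoid))|].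
      apply sum_n_m_Rle. intros; apply (@norm_ge_0 R_AbsRing V). }
    (* Beyond this threshold the lower terms, bounded by [z^d b], amount to at most half of
       [z^(d+1) eps]. *)
    destruct (near0_and (H (eps / 2) ltac:(lra)) (@ln_large (Rmax 1 (2 * b / eps)))) as [dd [Hdd D]].
    destruct (D (dd / 2) ltac:(lra)) as [D1 [D2 D3]]. set (t := dd / 2) in *. set (z := - ln t) in *.
    assert (Z1 : 1 < z) by (eapply Rle_lt_trans; [apply Rmax_l|exact D3]).
    assert (Z2 : 2 * b / eps < z) by (eapply Rle_lt_trans; [apply Rmax_r|exact D3]).
    assert (Rz : Rabs (ln t) = z) by (unfold z; rewrite Rabs_left; unfold z in Z1; lra).
    assert (B1 : norm (logpoly d Q t) <= z ^ d * b).
    { unfold logpoly. eapply Rle_trans; [apply (@norm_sum_n_m R_AbsRing V)|].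
      apply Rle_trans with (sum_n_m (fun l => mult (K := R_Ring) (z ^ d) (norm (Q l))) 0 d).
      - apply sum_n_m_Rle. intros l Hl. rewrite (@norm_scal_eq V), <- RPow_abs, Rz.
        apply Rmult_le_compat_r; [apply (@norm_ge_0 R_AbsRing V)|]. apply Rle_pow; [lra|lia].
      - rewrite (sum_n_m_mult_l (K := R_Ring)). apply Rle_refl. }
    assert (E : scal (ln t ^ S d) (Q (S d)) = minus (logpoly (S d) Q t) (logpoly d Q t)).
    { unfold logpoly. rewrite sum_n_Sm by lia. vec V. }
    assert (B2 : z ^ S d * norm (Q (S d)) <= eps / 2 + z ^ d * b).
    { replace (z ^ S d * norm (Q (S d))) with (norm (scal (ln t ^ S d) (Q (S d)))).
      - rewrite E. exact (norm_minus_le D1 B1 (Rle_refl _)).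
      - rewrite (@norm_scal_eq V), <- RPow_abs, Rz. easy. }
    assert (Hzd : 1 <= z ^ d) by (apply pow_R1_Rle; lra).
    apply Rmult_le_reg_l with (z ^ S d); [apply pow_lt; lra|].
    eapply Rle_trans; [exact B2|]. simpl pow.
    apply Rmult_lt_compat_r with (r := eps) in Z2; [|easy].
    replace (2 * b / eps * eps) with (2 * b) in Z2 by (field; lra).
    apply Rle_trans with (z ^ d * (eps / 2) + z ^ d * b).
    - apply Rplus_le_compat_r. rewrite <- (Rmult_1_l (eps / 2)) at 1. apply Rmult_le_compat_r; lra.
    - replace (z * z ^ d * eps) with (z ^ d * (z * eps)) by ring. rewrite <- Rmult_plus_distr_l.
      apply Rmult_le_compat_l; [lra|]. nra. }
  intros l Hl. destruct (Nat.eq_dec l (S d)) as [->|]; [easy|]. apply IH; [|lia].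
  intros eps He. generalize (H eps He). apply near0_imp. intros t _ Ht.
  unfold logpoly in Ht. rewrite sum_n_Sm, Htop in Ht by lia.
  replace (logpoly d Q t) with (plus (logpoly d Q t) (scal (ln t ^ S d) (@zero V))) by (vec V). exact Ht.
Qed.

(** Once the coefficients below [j] vanish, division by [t^j] leaves the polynomial at [t^j] plus
    terms of order 1, and since [j < Ns] the assumed bound makes the whole tend to 0. *)
Lemma lpsum_coef_zero N d (W : nat -> nat -> V) Ns : (Ns <= S N)%nat ->
  (exists M, near0 (fun t => norm (lpsum N d W t) <= M * t ^ Ns)) ->
  forall j, (j < Ns)%nat -> forall l, (l <= d)%nat -> W j l = zero.
Proof.
intros HN [M HM] j. induction (lt_wf j) as [j _ IH]. intros Hj.
apply logpoly_vanish.
pose (rest := fun t => sum_n_m (fun i => scal (t ^ (i - j)) (logpoly d (W i) t)) (S j) N).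
(* Only vanishing at 0 matters here, so the expansion is taken with error [o(t^0)]. *)
assert (Hrest : expn 0 1 rest).
{ apply (expn_sum (f := fun i t => scal (t ^ (i - j)) (logpoly d (W i) t))). intros i Hi.
  apply (expn_eq (g := fun t => sum_n_m (fun l => scal (t ^ (i - j) * ln t ^ l) (W i l)) 0 d)).
  - intros t Ht. unfold logpoly. rewrite (scal_sum_n_m (W := V)). apply sum_n_m_ext. intros l. vec V.
  - apply (expn_sum (f := fun l t => scal (t ^ (i - j) * ln t ^ l) (W i l))). intros l Hl.
    apply expn_mono; lia. }
assert (E : forall t, 0 < t -> lpsum N d W t = scal (t ^ j) (plus (logpoly d (W j) t) (rest t))).
{ intros t Ht. unfold lpsum. rewrite (sum_n_m_Chasles (G := V) _ 0 j N) by lia.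
  assert (E1 : sum_n_m (fun i => scal (t ^ i) (logpoly d (W i) t)) 0 j = scal (t ^ j) (logpoly d (W j) t)).
  { assert (Z : forall i, (i < j)%nat -> scal (t ^ i) (logpoly d (W i) t) = zero).
    { intros i Hi. replace (logpoly d (W i) t) with (@zero V); [vec V|].
      unfold logpoly. symmetry. etransitivity; [|exact (sum_n_m_const_zero (G := V) 0 d)].
      apply sum_n_m_ext_loc. intros l Hl. rewrite IH by lia. vec V. }
    destruct j as [|j']; [now rewrite sum_n_n|]. rewrite sum_n_Sm by lia.
    rewrite (sum_n_m_ext_loc (G := V) _ (fun _ => zero) 0 j') by (intros i Hi; apply Z; lia).
    rewrite sum_n_m_const_zero. vec V. }
  unfold rest.
  transitivity (plus (scal (t ^ j) (logpoly d (W j) t)) (sum_n_m (fun i => scal (t ^ i) (logpoly d (W i) t)) (S j) N));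
    [f_equal; exact E1|].
  transitivity (plus (scal (t ^ j) (logpoly d (W j) t)) (scal (t ^ j) (sum_n_m (fun i => scal (t ^ (i - j)) (logpoly d (W i) t)) (S j) N))); [|vec V].
  f_equal. rewrite (scal_sum_n_m (W := V)). apply sum_n_m_ext_loc. intros i Hi.
  replace (t ^ i) with (t ^ j * t ^ (i - j)) by (rewrite <- pow_add; f_equal; lia). vec V. }
intros eps He. pose proof (Rabs_pos M).
generalize (near0_and HM (near0_and (expn_1_vanish Hrest (eps := eps / 2) ltac:(lra))
  (near0_lt (c := Rmin 1 (eps / 2 / (Rabs M + 1))) ltac:(apply Rmin_glb_lt; [lra|apply Rdiv_lt_0_compat; lra])))).
apply near0_imp. intros t Ht [H1 [H2 H3]].
pose proof (Rmin_l 1 (eps / 2 / (Rabs M + 1))). pose proof (Rmin_r 1 (eps / 2 / (Rabs M + 1))).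
rewrite E in H1 by easy. set (y := plus (logpoly d (W j) t) (rest t)) in *.
assert (Hy : norm y <= eps / 2).
{ change (norm (scal (t ^ j) y) <= M * t ^ Ns) in H1. rewrite (@norm_scal_eq V) in H1. rewrite Rabs_right in H1 by (apply Rle_ge, pow_le; lra).
  assert (Hp : 0 < t ^ j) by now apply pow_lt.
  apply Rmult_le_reg_l with (t ^ j); [easy|]. eapply Rle_trans; [exact H1|].
  replace Ns with (j + S (Ns - j - 1))%nat by lia. rewrite pow_add. simpl pow.
  rewrite <- Rmult_assoc, (Rmult_comm M), Rmult_assoc. apply Rmult_le_compat_l; [lra|].
  assert (0 <= t ^ (Ns - j - 1) <= 1).
  { split; [apply pow_le; lra|]. rewrite <- (pow1 (Ns - j - 1)). apply pow_incr. lra. }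
  pose proof (Rle_abs M).
  apply Rle_trans with ((Rabs M + 1) * (eps / 2 / (Rabs M + 1) * 1)); [|right; field; lra].
  apply Rle_trans with (Rabs M * (t * t ^ (Ns - j - 1))).
  - apply Rmult_le_compat_r; [|lra]. apply Rmult_le_pos; lra.
  - apply Rmult_le_compat; try lra; [apply Rmult_le_pos; lra|]. apply Rmult_le_compat; lra. }
replace (logpoly d (W j) t) with (minus y (rest t)) by (unfold y; vec V).
apply (norm_minus_le (V := V) Hy H2). lra.
Qed.

End Coefficients.

(** * The characteristic operator on logarithmic polynomials *)

Lemma sum_binomial {V : NormedModule R_AbsRing} l x y (s : R) (w : V) :
  sum_n_m (fun m => scal (Binomial.C l m * y ^ (l - m)) (scal (s * x ^ m) w)) 0 l = scal (s * (y + x) ^ l) w.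
Proof.
transitivity (scal (sum_n_m (fun m => s * (Binomial.C l m * x ^ m * y ^ (l - m))) 0 l) w).
- rewrite (linear_sum_n_m (U := R_NormedModule) (W := V) (A := fun r : R => scal r w)).
  + apply sum_n_m_ext. intros m. vec V.
  + exact (is_linear_scal_l (K := R_AbsRing) (V := V) w).
- f_equal. rewrite (Rplus_comm y x), binomial.
  rewrite <- (sum_n_Reals (fun i => Binomial.C l i * x ^ i * y ^ (l - i))).
  exact (sum_n_m_mult_l (K := R_Ring) s (fun m => Binomial.C l m * x ^ m * y ^ (l - m)) 0 l).
Qed.

Section CharacteristicOperator.
Variables (V1 V2 : CompleteNormedModule R_AbsRing) (n : nat) (K : nat -> R -> R -> V1 -> V2) (a : nat -> R).

(** The diagonal term of [B(j)] does not depend on [j], so it is present only in the derivative of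
    order 0. *)
Definition only0 (m : nat) (y : V2) : V2 := if Nat.eqb m 0 then y else zero.

(** The [m]-th derivative of [B] at the integer [j]. *)
Definition charder (j m : nat) (v : V1) : V2 :=
  plus (only0 m (K n 0 0 v))
   (sum_n_m (fun i => scal (a i ^ S j * ln (a i) ^ m) (minus (K i 0 0 v) (K (S i) 0 0 v))) 1 (n - 1)).

(** Binomial expansion of [(ln t + ln (a i))^l]; the coefficients [a_i^(1+j) (ln a_i)^m] are the
    derivatives of [a_i^(1+j)] in [j]. *)
Lemma charop_diffmono j l v t : charop n K a j l v t = scal (t ^ j) (diffmono (charder j) l v (ln t)).
Proof.
unfold charop, diffmono, charder. generalize (n - 1)%nat as q.
assert (E0 : sum_n_m (fun m => scal (Binomial.C l m * ln t ^ (l - m)) (only0 m (K n 0 0 v))) 0 l = scal (ln t ^ l) (K n 0 0 v)).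
{ assert (Z : forall k, sum_n_m (fun m => scal (Binomial.C l m * ln t ^ (l - m)) (only0 m (K n 0 0 v))) 0 k = scal (ln t ^ l) (K n 0 0 v)).
  { induction k as [|k IH].
    - rewrite sum_n_n. unfold only0. simpl Nat.eqb. cbv iota. rewrite binomial_0_r, Nat.sub_0_r. vec V2.
    - rewrite sum_n_Sm, IH by lia. unfold only0. simpl Nat.eqb. cbv iota. vec V2. }
  apply Z. }
induction q as [|q IH].
- rewrite sum_n_m_zero by lia.
  transitivity (scal (t ^ j) (scal (ln t ^ l) (K n 0 0 v))); [vec V2|]. f_equal. rewrite <- E0. apply sum_n_m_ext. intros m.
  rewrite sum_n_m_zero by lia. vec V2.
- rewrite sum_n_Sm by lia.
  match goal with |- plus ?x (plus ?y ?z) = _ => transitivity (plus (plus x y) z); [vec V2|] end.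
  rewrite IH.
  set (w := minus (K (S q) 0 0 v) (K (S (S q)) 0 0 v)).
  rewrite (Rpow_mult_distr t (a (S q)) j).
  transitivity (scal (t ^ j) (plus (sum_n_m (fun m => scal (Binomial.C l m * ln t ^ (l - m))
     (plus (only0 m (K n 0 0 v)) (sum_n_m (fun i => scal (a i ^ S j * ln (a i) ^ m) (minus (K i 0 0 v) (K (S i) 0 0 v))) 1 q))) 0 l)
    (sum_n_m (fun m => scal (Binomial.C l m * ln t ^ (l - m)) (scal (a (S q) ^ S j * ln (a (S q)) ^ m) w)) 0 l))).
  + rewrite (sum_binomial (V := V2)). simpl pow. vec V2.
  + f_equal. rewrite <- sum_n_m_plus. apply sum_n_m_ext. intros m. rewrite (sum_n_Sm (G := V2)) by lia. fold w. vec V2.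
Qed.

Lemma charder_lin j m : (1 <= n)%nat -> (forall i, (1 <= i <= n)%nat -> is_linear (K i 0 0)) -> is_linear (charder j m).
Proof.
intros Hn HK. unfold charder. apply (linear_plus_fun (V := V1) (W := V2)).
- unfold only0. destruct (Nat.eqb m 0); [apply HK; lia|exact (is_linear_zero (K := R_AbsRing) (U := V1) (V := V2))].
- apply (linear_sum_fun (V := V1) (W := V2) (A := fun i v => scal (a i ^ S j * ln (a i) ^ m) (minus (K i 0 0 v) (K (S i) 0 0 v)))).
  intros i Hi. apply (linear_scal_fun (V := V1) (W := V2)). apply (linear_minus_fun (V := V1) (W := V2)); apply HK; lia.
Qed.

End CharacteristicOperator.

(** * Expansions of continuously differentiable data *)

Lemma C1_elim {V : NormedModule R_AbsRing} a b (f df : R -> V) t : is_C1_on a b f df -> a <= t <= b ->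
  forall eps, 0 < eps -> exists d, 0 < d /\ forall s, a <= s <= b -> Rabs (s - t) < d ->
  norm (minus (minus (f s) (f t)) (scal (s - t) (df t))) <= eps * Rabs (s - t).
Proof.
intros [H _] Ht eps He. destruct (H t Ht) as [_ HD].
assert (HL : is_filter_lim (within (fun s => a <= s <= b) (locally t)) t).
{ intros P HP. unfold within. revert HP. apply filter_imp. auto. }
specialize (HD t HL (mkposreal eps He)). unfold within in HD. apply locally_R in HD.
destruct HD as [d [Hd HD]]. exists d. split; [easy|]. intros s Hs Hst. exact (HD s Hst Hs).
Qed.

Lemma C1_derive {V : NormedModule R_AbsRing} a b (f df : R -> V) t : is_C1_on a b f df -> a < t < b ->
  is_derive f t (df t).
Proof.
intros H Ht. apply is_derive_intro. intros eps He.
destruct (C1_elim H (t := t) ltac:(lra) He) as [d [Hd D]].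
exists (Rmin d (Rmin (t - a) (b - t))). split; [repeat apply Rmin_glb_lt; lra|]. intros s Hs.
pose proof (Rmin_l d (Rmin (t - a) (b - t))). pose proof (Rmin_r d (Rmin (t - a) (b - t))).
pose proof (Rmin_l (t - a) (b - t)). pose proof (Rmin_r (t - a) (b - t)).
apply D; [|lra]. apply Rabs_def2 in Hs. lra.
Qed.

Lemma C1_continuous {V : NormedModule R_AbsRing} a b (f df : R -> V) : is_C1_on a b f df ->
  continuous_on (fun t => a <= t <= b) f.
Proof.
intros H t Ht. apply lim_norm. intros eps He.
destruct (C1_elim H Ht Rlt_0_1) as [d [Hd D]]. pose proof (norm_ge_0 (df t)).
apply locally_R. exists (Rmin d (eps / (norm (df t) + 2))). split; [apply Rmin_glb_lt; [easy|apply Rdiv_lt_0_compat; lra]|].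
intros s Hs Hs'. pose proof (Rmin_l d (eps / (norm (df t) + 2))). pose proof (Rmin_r d (eps / (norm (df t) + 2))).
specialize (D s Hs' ltac:(lra)).
assert (E : norm (minus (f s) (f t)) <= 1 * Rabs (s - t) + Rabs (s - t) * norm (df t)).
{ apply (norm_near D). rewrite norm_scal_eq. lra. }
eapply Rle_lt_trans; [exact E|].
apply Rle_lt_trans with (Rabs (s - t) * (norm (df t) + 1)); [lra|].
apply Rle_lt_trans with (eps / (norm (df t) + 2) * (norm (df t) + 1)); [apply Rmult_le_compat_r; lra|].
apply Rlt_le_trans with (eps / (norm (df t) + 2) * (norm (df t) + 2)); [|right; field; lra].
apply Rmult_lt_compat_l; [apply Rdiv_lt_0_compat; lra|lra].
Qed.

Lemma scaled_limit_small N {V : NormedModule R_AbsRing} (g p : R -> V) c :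
  filterlim (fun t => scal (/ t ^ N) (minus (g t) (p t))) (at_right 0) (locally c) ->
  small N (fun t => minus (minus (g t) (p t)) (scal (t ^ N) c)).
Proof.
intros H eps He. pose proof (proj1 (lim_norm _ _) H eps He) as H1. apply at_right_R in H1.
destruct H1 as [d [Hd D]]. exists d. split; [easy|]. intros t Ht. specialize (D t ltac:(lra)).
assert (Hp : 0 < t ^ N) by (apply pow_lt; lra).
replace (minus (minus (g t) (p t)) (scal (t ^ N) c)) with (scal (t ^ N) (minus (scal (/ t ^ N) (minus (g t) (p t))) c)) by (vec V; now apply Rgt_not_eq).
rewrite norm_scal_eq, Rabs_right by lra. rewrite Rmult_comm. apply Rmult_le_compat_r; [lra|left; exact D].
Qed.

(** The limit turns the remainder into the monomial [c t^N] plus [o(t^N)]; a mere [O(t^N)] would not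
    yield an expansion of this class. *)
Lemma scaled_limit_expn N {V : NormedModule R_AbsRing} (g p : R -> V) c : expn N 0 p ->
  filterlim (fun t => scal (/ t ^ N) (minus (g t) (p t))) (at_right 0) (locally c) -> expn N 0 g.
Proof.
intros Hp H.
apply (expn_eq (g := fun t => plus (plus (minus (minus (g t) (p t)) (scal (t ^ N) c)) (scal (t ^ N * ln t ^ 0) c)) (p t))).
- intros t Ht. simpl. vec V.
- apply expn_plus; [|easy]. apply expn_plus; [apply expn_small; now apply scaled_limit_small|apply expn_mono; [lia|easy]].
Qed.

Lemma continuous_on_near0 {V : NormedModule R_AbsRing} T (g : R -> V) : 0 < T -> continuous_on (fun t => 0 <= t <= T) g ->
  forall eps, 0 < eps -> near0 (fun t => norm (minus (g t) (g 0)) <= eps).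
Proof.
intros hT Hg eps He. destruct (@continuous_on_approx T V g 0 eps Hg ltac:(lra) He) as [d [Hd D]].
exists (Rmin d T). split; [now apply Rmin_glb_lt|]. intros t Ht. pose proof (Rmin_l d T). pose proof (Rmin_r d T).
left. apply D; [lra|]. rewrite Rminus_0_r, Rabs_right; lra.
Qed.

Section CurveExpansion.
Variables (N : nat) (T : R) (al da : R -> R) (c : nat -> R) (c0 : R).
Hypothesis hT : 0 < T.
Hypothesis al_C1 : is_C1_on (V := R_NormedModule) 0 T al da.
Hypothesis al_0 : al 0 = 0.
Hypothesis da_lim : filterlim (fun t => (da t - sum_n_m (fun nu => c nu * (INR nu * t ^ (nu - 1))) 1 N) / t ^ N)
  (at_right 0) (locally c0).
Notation Rexpn := (expn (V := R_NormedModule) N).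

Let p (t : R) : R := sum_n_m (fun nu => c nu * (INR nu * t ^ (nu - 1))) 1 N.

Lemma da_lim' : filterlim (fun t => scal (/ t ^ N) (minus (da t : R_NormedModule) (p t))) (at_right 0) (locally (c0 : R_NormedModule)).
Proof.
refine (filterlim_ext _ _ _ da_lim). intros t.
change ((da t - p t) / t ^ N = / t ^ N * (da t - p t)). unfold Rdiv. ring.
Qed.

Lemma poly_expn (k : nat -> R) : Rexpn 0 (fun t => sum_n_m (fun nu => k nu * t ^ (nu - 1)) 1 N).
Proof.
apply (expn_sum (V := R_NormedModule) (f := fun nu t => k nu * t ^ (nu - 1))). intros nu Hnu.
apply (expn_scal (V := R_NormedModule) (g := fun t => t ^ (nu - 1)) (k nu)).
apply (expn_eq (V := R_NormedModule) (g := fun t => t ^ (nu - 1) * ln t ^ 0)); [intros; simpl; ring|].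
apply Rexpn_mono; [lia|easy].
Qed.

(** The constant term of the expansion is identified by continuity of the derivative at 0. *)
Lemma da_lead : lead (V := R_NormedModule) N 0 da (fun _ => da 0).
Proof.
apply lead_0_limit.
- apply (scaled_limit_expn (V := R_NormedModule) (p := p) (c := c0)); [|exact da_lim'].
  apply (expn_eq (V := R_NormedModule) (g := fun t => sum_n_m (fun nu => (c nu * INR nu) * t ^ (nu - 1)) 1 N)); [|apply poly_expn].
  intros t Ht. apply sum_n_m_ext. intros nu. apply Rmult_assoc.
- apply (continuous_on_near0 (V := R_NormedModule) hT). apply al_C1.
Qed.

(** Integrating the expansion of the derivative by the mean value theorem gives the curve up to
    [o(t^(N+1))], and division by [t] leaves [o(t^N)]. The coefficient [c0 / INR (S N)] arises from
    integrating [c0 t^N]. *)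
Lemma curve_remainder : small (V := R_NormedModule) N
  (fun t => al t / t - sum_n_m (fun nu => c nu * t ^ (nu - 1)) 1 N - c0 / INR (S N) * t ^ N).
Proof.
assert (HN : INR (S N) <> 0) by (apply not_0_INR; lia).
pose (r := fun t => al t - (sum_n_m (fun nu => c nu * t ^ nu) 1 N + c0 / INR (S N) * t ^ S N)).
assert (Dr : forall t, 0 < t < T -> is_derive r t (da t - (p t + c0 * t ^ N))).
{ intros t Ht. apply (is_derive_minus (V := R_NormedModule)); [now apply (C1_derive al_C1)|].
  apply (is_derive_plus (V := R_NormedModule)).
  - apply (is_derive_sum (V := R_NormedModule) (f := fun nu t => c nu * t ^ nu)). intros nu Hnu.
    auto_derive; [easy|]. replace (pred nu) with (nu - 1)%nat by lia. ring.
  - auto_derive; [easy|]. change (match N with 0%nat => 1 | S _ => INR N + 1 end) with (INR (S N)). cbn [pred]. field. easy. }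
assert (r0 : r 0 = 0).
{ unfold r. rewrite al_0, pow_i by lia.
  rewrite (sum_n_m_ext_loc (G := R_AbelianMonoid) _ (fun _ => 0)).
  - rewrite (sum_n_m_const_zero (G := R_AbelianMonoid)). change (0 - (0 + c0 / INR (S N) * 0) = 0). ring.
  - intros nu Hnu. rewrite pow_i by lia. apply Rmult_0_r. }
assert (Cr : continuous_on (fun t => 0 <= t <= T) r).
{ intros t Ht. apply lim_Rminus; [exact (C1_continuous al_C1 Ht)|].
  eapply filterlim_filter_le_1; [apply filter_le_within|].
  apply (ex_derive_continuous (V := R_NormedModule) (fun t => sum_n_m (fun nu => c nu * t ^ nu) 1 N + c0 / INR (S N) * t ^ S N)).
  apply (ex_derive_plus (V := R_NormedModule) (fun t => sum_n_m (fun nu => c nu * t ^ nu) 1 N)).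
  - eexists. apply (is_derive_sum (V := R_NormedModule) (f := fun nu t => c nu * t ^ nu) (l := fun nu => c nu * (INR nu * t ^ (nu - 1)))).
    intros nu Hnu. auto_derive; [easy|]. replace (pred nu) with (nu - 1)%nat by lia. ring.
  - auto_derive. easy. }
pose proof (scaled_limit_small (V := R_NormedModule) da_lim') as HS.
intros eps He. destruct (near0_and (HS eps He) (near0_lt hT)) as [d [Hd D]].
assert (B : forall t, 0 < t < d -> Rabs (r t) <= t * (eps * t ^ N)).
{ intros t Ht. destruct (D t Ht) as [_ HtT].
  apply le_epsilon. intros e' He'.
  destruct (@continuous_on_approx T R_NormedModule r 0 e' Cr ltac:(lra) He') as [d' [Hd' D']].
  (* The derivative of [r] is known only inside the interval, so the mean value theorem starts at a
     point [s > 0] where [r] is as small as desired. *)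
  pose (s := Rmin (t / 2) (d' / 2)).
  assert (Hs : 0 < s /\ s < t /\ s < d').
  { unfold s. pose proof (Rmin_l (t / 2) (d' / 2)). pose proof (Rmin_r (t / 2) (d' / 2)).
    assert (0 < Rmin (t / 2) (d' / 2)) by (apply Rmin_glb_lt; lra). lra. }
  specialize (D' s ltac:(lra)). rewrite r0, Rminus_0_r, Rabs_right in D' by lra. specialize (D' ltac:(lra)).
  change (Rabs (r s - 0) < e') in D'. rewrite Rminus_0_r in D'.
  destruct (MVT_gen r s t (fun t => da t - (p t + c0 * t ^ N))) as [x [Hx E]].
  - intros x Hx. rewrite Rmin_left, Rmax_right in Hx by lra. apply Dr. lra.
  - intros x Hx. rewrite Rmin_left, Rmax_right in Hx by lra. apply continuity_pt_filterlim.
    apply (ex_derive_continuous (V := R_NormedModule)). eexists. apply Dr. lra.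
  - rewrite Rmin_left, Rmax_right in Hx by lra.
    destruct (D x ltac:(lra)) as [Dx _]. change (Rabs (da x - p x - x ^ N * c0) <= eps * x ^ N) in Dx.
    assert (Hxt : x ^ N <= t ^ N) by (apply pow_incr; lra).
    assert (E2 : Rabs (r t - r s) <= t * (eps * t ^ N)).
    { rewrite E, Rabs_mult, (Rabs_right (t - s)), Rmult_comm by lra.
      apply Rmult_le_compat; [lra|apply Rabs_pos|lra|].
      replace (da x - (p x + c0 * x ^ N)) with (da x - p x - x ^ N * c0) by ring.
      eapply Rle_trans; [exact Dx|]. apply Rmult_le_compat_l; lra. }
    replace (r t) with ((r t - r s) + r s) by ring. eapply Rle_trans; [apply Rabs_triang|]. lra. }
exists d. split; [easy|]. intros t Ht. specialize (B t Ht).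
assert (E : al t / t - sum_n_m (fun nu => c nu * t ^ (nu - 1)) 1 N - c0 / INR (S N) * t ^ N = r t / t).
{ unfold r.
  assert (E1 : sum_n_m (fun nu => c nu * t ^ nu) 1 N = t * sum_n_m (fun nu => c nu * t ^ (nu - 1)) 1 N).
  { rewrite <- (sum_n_m_mult_l (K := R_Ring) t (fun nu => c nu * t ^ (nu - 1))). apply sum_n_m_ext_loc. intros nu Hnu.
    change (c nu * t ^ nu = t * (c nu * t ^ (nu - 1))). replace nu with (S (nu - 1)) at 2 by lia. simpl. ring. }
  rewrite E1. simpl pow. field. split; [easy|lra]. }
change (Rabs (al t / t - sum_n_m (fun nu => c nu * t ^ (nu - 1)) 1 N - c0 / INR (S N) * t ^ N) <= eps * t ^ N).
rewrite E. unfold Rdiv. rewrite Rabs_mult, (Rabs_right (/ t)) by (left; apply Rinv_0_lt_compat; lra).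
apply Rmult_le_reg_r with t; [lra|]. rewrite Rmult_assoc, Rinv_l, Rmult_1_r by lra. lra.
Qed.

Lemma quotient_lead (be : R -> R) : (forall t, 0 < t -> be t = al t / t) ->
  (forall eps, 0 < eps -> near0 (fun t => Rabs (be t - da 0) <= eps)) ->
  lead (V := R_NormedModule) N 0 be (fun _ => da 0).
Proof.
intros Hb Hl. apply lead_0_limit; [|exact Hl].
apply (expn_eq (V := R_NormedModule) (g := fun t => plus (plus
  (al t / t - sum_n_m (fun nu => c nu * t ^ (nu - 1)) 1 N - c0 / INR (S N) * t ^ N)
  (sum_n_m (fun nu => c nu * t ^ (nu - 1)) 1 N)) (scal (c0 / INR (S N)) (t ^ N * ln t ^ 0)))).
- intros t Ht. rewrite Hb by easy.
  change (al t / t - sum_n_m (fun nu => c nu * t ^ (nu - 1)) 1 N - c0 / INR (S N) * t ^ N + sum_n_m (fun nu => c nu * t ^ (nu - 1)) 1 N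
    + c0 / INR (S N) * (t ^ N * 1) = al t / t). ring.
- apply (expn_plus (V := R_NormedModule)); [apply (expn_plus (V := R_NormedModule)); [apply expn_small, curve_remainder|apply poly_expn]|].
  apply (expn_scal (V := R_NormedModule)). apply Rexpn_mono; [lia|easy].
Qed.

End CurveExpansion.

(** * The data of the theorem over the real scalars *)

Section RealScalarsOfData.
Context {k : scalar_field}.

Lemma scal_of_real_comm (E : ModuleSpace (scalars k)) (c : scalars k) (r : R) (x : E) :
  scal c (rscal r x) = rscal r (scal c x).
Proof.
unfold rscal. rewrite !scal_assoc. f_equal. destruct k; [apply Rmult_comm|apply Cmult_comm].
Qed.

(** Bridge between the two structures: operators over [scalars k] become accessible to the real
    analysis above. *)
Lemma linear_realify {E1 E2 : CompleteNormedModule (scalars k)} (A : E1 -> E2) : is_linear A ->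
  is_linear (K := R_AbsRing) (U := realify E1) (V := realify E2) A.
Proof.
intros [H1 H2 H3]. split; [exact H1| |exact H3]. intros r x. exact (H2 (of_real k r) x).
Qed.

Lemma linear_scal_k {E : CompleteNormedModule (scalars k)} (c : scalars k) :
  is_linear (K := R_AbsRing) (U := realify E) (V := realify E) (fun x : E => scal c x).
Proof.
split.
- intros x y. exact (scal_distr_l c x y).
- intros r x. exact (scal_of_real_comm c r x).
- exists (abs c + 1). split; [pose proof (abs_ge_0 c); lra|]. intros x.
  eapply Rle_trans; [exact (norm_scal c x)|]. pose proof (norm_ge_0 x).
  change (abs c * @norm _ E x <= (abs c + 1) * @norm _ E x). apply Rmult_le_compat_r; [easy|lra].
Qed.

Lemma opnorm_bound_k {E1 E2 : CompleteNormedModule (scalars k)} (A : E1 -> E2) :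
  is_linear (K := R_AbsRing) (U := realify E1) (V := realify E2) A ->
  forall x, norm (A x) <= opnorm A * norm x.
Proof. intros HA x. exact (opnorm_bound (V := realify E1) (W := realify E2) HA x). Qed.

End RealScalarsOfData.

Section Data.
Variables (k : scalar_field) (E1 E2 : CompleteNormedModule (scalars k)).
Variables (T : R) (n : nat) (alpha dalpha : nat -> R -> R) (K K1 : nat -> R -> R -> E1 -> E2).
Variables (Kninv : R -> E2 -> E1) (eps T' : R) (Ns : nat).
Hypothesis hT : 0 < T.
Hypothesis hn : (1 <= n)%nat.
Hypothesis halpha : curves_ok T n alpha dalpha.
Hypothesis hK : kernels_ok T n alpha K K1.
Hypothesis hD : condition_D T n alpha dalpha K Kninv eps T' Ns.

Notation V1 := (realify E1).
Notation V2 := (realify E2).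

(** Completes the derivatives to the curves 0 and [n], for which [curves_ok] prescribes none. *)
Definition dal (i : nat) (t : R) : R := if Nat.eqb i 0 then 0 else if Nat.eqb i n then 1 else dalpha i t.
(** Difference quotient at 0 completed by its limit; it takes the place of [be]. *)
Definition bal (i : nat) (t : R) : R := if Req_EM_T t 0 then dal i 0 else alpha i t / t.

Lemma hT' : 0 < T' <= T.
Proof. apply hD. Qed.

Lemma alpha_0 t : alpha 0%nat t = 0.
Proof. apply halpha. Qed.
Lemma alpha_n t : alpha n t = t.
Proof. apply halpha. Qed.

Lemma alpha_C1 i : (i <= n)%nat -> is_C1_on (V := R_NormedModule) 0 T (alpha i) (dal i).
Proof.
intros Hi.
assert (HA : forall (g : R -> R) c, (forall t, g t = t * c) -> is_C1_on (V := R_NormedModule) 0 T g (fun _ => c)).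
{ intros g c Hg. split; [|intros t Ht; apply filterlim_const].
  intros t Ht. split; [apply (is_linear_scal_l (K := R_AbsRing) (V := R_NormedModule))|]. intros x Hx e.
  apply filter_forall. intros y. rewrite !Hg.
  assert (E : minus (minus (y * c) (x * c)) (scal (minus y x) c) = 0)
    by (change (y * c - x * c - (y - x) * c = 0); ring).
  apply Rle_trans with 0; [right; rewrite <- (norm_zero (V := R_NormedModule)); apply f_equal; exact E|].
  apply Rmult_le_pos; [left; apply cond_pos|apply (norm_ge_0 (V := R_NormedModule))]. }
unfold dal. destruct (Nat.eqb_spec i 0) as [->|H0]; [|destruct (Nat.eqb_spec i n) as [->|Hn]].
- apply HA. intros t. rewrite alpha_0. ring.
- apply HA. intros t. rewrite alpha_n. ring.
- apply halpha. lia.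
Qed.

Lemma alpha_strict i t : (i < n)%nat -> 0 < t < T -> alpha i t < alpha (S i) t.
Proof.
intros Hi Ht. destruct halpha as [_ [_ [_ [Hc _]]]]. destruct (Hc t Ht) as [C1 C2].
destruct (Nat.eq_dec i 0) as [H0|H0], (Nat.eq_dec (S i) n) as [Hn|Hn]; try rewrite H0 in *; try rewrite alpha_0.
- replace 1%nat with n by lia. rewrite alpha_n. lra.
- apply C1. lia.
- rewrite Hn, alpha_n. apply C1. lia.
- apply C2. lia.
Qed.

Lemma alpha_cont i : (i <= n)%nat -> continuous_on (fun t => 0 <= t <= T) (alpha i).
Proof. intros Hi. exact (C1_continuous (alpha_C1 Hi)). Qed.

Lemma alpha_at_0 i : (i <= n)%nat -> alpha i 0 = 0.
Proof.
intros Hi. destruct (Nat.eq_dec i 0) as [->|]; [apply alpha_0|].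
destruct (Nat.eq_dec i n) as [->|]; [apply alpha_n|]. apply halpha. lia.
Qed.

Lemma alpha_chain i t : (i < n)%nat -> 0 <= t <= T -> alpha i t <= alpha (S i) t.
Proof.
intros Hi Ht.
(* [norm x <= x] expresses that [x] is nonnegative in the form that [norm_le_closure] handles. *)
assert (H : norm (alpha (S i) t - alpha i t : R_NormedModule) <= alpha (S i) t - alpha i t).
{ apply (@norm_le_closure T hT R_NormedModule (fun t => alpha (S i) t - alpha i t) (fun t => alpha (S i) t - alpha i t)); trivial.
  - intros s Hs. apply lim_Rminus; apply alpha_cont; trivial; lia.
  - intros s Hs. apply lim_Rminus; apply alpha_cont; trivial; lia.
  - intros s Hs. pose proof (alpha_strict Hi Hs). right. apply Rabs_right. lra. }
pose proof (Rabs_pos (alpha (S i) t - alpha i t)).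
change (Rabs (alpha (S i) t - alpha i t) <= alpha (S i) t - alpha i t) in H. lra.
Qed.

(** The hypotheses hold on closures of regions, whereas the analysis works on sectors. Nodes with
    interior [t'] and [th'] approximate every point of a sector, even where a slice degenerates. *)
Lemma sector_closure i p : (1 <= i <= n)%nat -> sector T alpha i p -> closure (region T alpha i) p.
Proof.
intros Hi. destruct p as [t s]. intros [Ht Hs] P HP; simpl in Ht, Hs.
apply locally_R2 in HP. destruct HP as [d [Hd HP]].
assert (exists th, 0 <= th <= 1 /\ s = node T alpha i t th) as [th [Hth Es]].
{ destruct (Req_dec (alpha (i - 1) t) (alpha i t)) as [E|E].
  - exists 0. split; [lra|]. rewrite node_eq by lra. lra.
  - exists ((s - alpha (i - 1) t) / (alpha i t - alpha (i - 1) t)).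
    assert (H : 0 <= (s - alpha (i - 1) t) / (alpha i t - alpha (i - 1) t) <= 1).
    { split; [apply Rdiv_le_0_compat; lra|apply Rle_div_l; lra]. }
    split; [easy|]. rewrite node_eq by easy. field; lra. }
pose proof (proj1 (lim_norm (V := R_NormedModule) _ _) (@node_jcont T n alpha hT alpha_cont i Hi t th) d Hd) as HN.
apply locally_R2 in HN. destruct HN as [d' [Hd' HN]].
destruct (@interior_point T hT t (Rmin d d') Ht ltac:(now apply Rmin_glb_lt)) as [t' [Ht' Htt]].
destruct (@interior_point 1 Rlt_0_1 th d' Hth Hd') as [th' [Hth' Htht]].
exists (t', node T alpha i t' th'). split.
- assert (Hst : alpha (i - 1) t' < alpha i t') by (replace i with (S (i - 1)) at 2 by lia; apply alpha_strict; [lia|easy]).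
  split; simpl; [lra|]. rewrite node_eq by lra. split; nra.
- apply HP; [eapply Rlt_le_trans; [exact Htt|apply Rmin_l]|]. rewrite Es.
  apply (HN t' th'); [|easy]. eapply Rlt_le_trans; [exact Htt|apply Rmin_r].
Qed.

Lemma sector_restrict i p : sector T' alpha i p -> sector T alpha i p.
Proof. pose proof hT'. intros [H1 H2]. split; [lra|easy]. Qed.

Lemma opcont_restrict {V W : NormedModule R_AbsRing} (D D' : R * R -> Prop) (A : R -> R -> V -> W) :
  (forall p, D' p -> D p) -> opcont D A -> opcont D' A.
Proof.
intros HD HA p Hp e He. destruct (HA p (HD p Hp) e He) as [d [Hd H]]. exists d. split; [easy|].
intros q Hq. apply H. now apply HD.
Qed.

Lemma K_real_lin i p : (1 <= i <= n)%nat -> sector T' alpha i p -> is_linear (U := V1) (V := V2) (K i (fst p) (snd p)).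
Proof.
intros Hi Hp. apply linear_realify. apply (hK Hi). apply sector_closure; [easy|]. now apply sector_restrict.
Qed.
Lemma K1_real_lin i p : (1 <= i <= n)%nat -> sector T' alpha i p -> is_linear (U := V1) (V := V2) (K1 i (fst p) (snd p)).
Proof.
intros Hi Hp. apply linear_realify. apply (hK Hi). apply sector_closure; [easy|]. now apply sector_restrict.
Qed.
Lemma K_real_cont i : (1 <= i <= n)%nat -> opcont (V := V1) (W := V2) (sector T' alpha i) (K i).
Proof.
intros Hi. apply (opcont_restrict (D := closure (region T alpha i))).
- intros p Hp. apply sector_closure; [easy|]. now apply sector_restrict.
- destruct (hK Hi) as [HL [HC _]]. apply op_continuous_on_opcont; [|exact HC].
  intros p Hp. apply linear_realify. now apply HL.
Qed.
Lemma K1_real_cont i : (1 <= i <= n)%nat -> opcont (V := V1) (W := V2) (sector T' alpha i) (K1 i).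
Proof.
intros Hi. apply (opcont_restrict (D := closure (region T alpha i))).
- intros p Hp. apply sector_closure; [easy|]. now apply sector_restrict.
- destruct (hK Hi) as [HL [_ [HC _]]]. apply op_continuous_on_opcont; [|exact HC].
  intros p Hp. apply linear_realify. now apply HL.
Qed.

Lemma region_open i t s : (1 <= i <= n)%nat -> region T alpha i (t, s) -> exists d, 0 < d /\
  forall r, Rabs (r - t) < d -> region T alpha i (r, s).
Proof.
intros Hi [Ht Hs]; simpl in Ht, Hs.
destruct (@continuous_on_approx T R_NormedModule (alpha (i - 1)) t (s - alpha (i - 1) t) (@alpha_cont (i - 1) ltac:(lia)) ltac:(lra) ltac:(lra)) as [d1 [Hd1 D1]].
destruct (@continuous_on_approx T R_NormedModule (alpha i) t (alpha i t - s) (@alpha_cont i ltac:(lia)) ltac:(lra) ltac:(lra)) as [d2 [Hd2 D2]].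
exists (Rmin (Rmin d1 d2) (Rmin t (T - t))). split; [repeat apply Rmin_glb_lt; lra|].
intros r Hr.
pose proof (Rmin_l (Rmin d1 d2) (Rmin t (T - t))). pose proof (Rmin_r (Rmin d1 d2) (Rmin t (T - t))).
pose proof (Rmin_l d1 d2). pose proof (Rmin_r d1 d2). pose proof (Rmin_l t (T - t)). pose proof (Rmin_r t (T - t)).
assert (Hr0 : 0 < r < T) by (apply Rabs_def2 in Hr; lra).
specialize (D1 r ltac:(lra) ltac:(lra)). specialize (D2 r ltac:(lra) ltac:(lra)).
change (Rabs (alpha (i - 1) r - alpha (i - 1) t) < s - alpha (i - 1) t) in D1.
change (Rabs (alpha i r - alpha i t) < alpha i t - s) in D2.
apply Rabs_def2 in D1. apply Rabs_def2 in D2. split; simpl; lra.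
Qed.

Lemma region_sector i t s : region T alpha i (t, s) -> sector T alpha i (t, s).
Proof. intros [H1 H2]; simpl in *. split; simpl; lra. Qed.

(** A derivative in operator norm is in particular a derivative at each vector: the error at [x] is
    at most [opnorm Q] times the norm of [x]. *)
Lemma K_real_der i t s x : (1 <= i <= n)%nat -> 0 < t < T' -> alpha (i - 1) t < s < alpha i t ->
  is_derive (V := V2) (fun t => K i t s x) t (K1 i t s x).
Proof.
intros Hi Ht Hs. pose proof hT'.
assert (HR : region T alpha i (t, s)) by (split; simpl; lra).
destruct (hK Hi) as [HL [_ [_ HD]]]. specialize (HD t s HR).
destruct (region_open Hi HR) as [d1 [Hd1 D1]].
assert (HLr : forall r, Rabs (r - t) < d1 -> is_linear (U := V1) (V := V2) (K i r s) ).
{ intros r Hr. apply linear_realify. apply (HL (r, s)). apply sector_closure; [easy|]. now apply region_sector, D1. }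
assert (HL1 : is_linear (U := V1) (V := V2) (K1 i t s)).
{ apply linear_realify. apply (HL (t, s)). apply sector_closure; [easy|]. now apply region_sector. }
apply (is_derive_intro (V := V2)). intros e He.
pose proof (@norm_ge_0 R_AbsRing V1 x) as Nx.
pose proof (proj1 (lim_norm (V := R_NormedModule) _ _) HD (e / (@norm R_AbsRing V1 x + 1)) ltac:(apply Rdiv_lt_0_compat; lra)) as H1.
unfold locally', within in H1. apply locally_R in H1. destruct H1 as [d2 [Hd2 D2]].
exists (Rmin d1 d2). split; [now apply Rmin_glb_lt|]. intros r Hr.
pose proof (Rmin_l d1 d2). pose proof (Rmin_r d1 d2).
set (h := r - t) in *.
destruct (Req_dec h 0) as [Hz|Hz].
{ assert (r = t) as -> by (unfold h in Hz; lra). rewrite Hz, Rabs_R0, Rmult_0_r.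
  right. transitivity (@norm R_AbsRing V2 zero); [apply f_equal; vec (realify E2)|apply norm_zero]. }
specialize (D2 h). rewrite Rminus_0_r in D2. specialize (D2 ltac:(lra) Hz).
replace (t + h) with r in D2 by (unfold h; ring).
pose (Q := fun y : E1 => minus (rscal (/ h) (minus (K i r s y) (K i t s y))) (K1 i t s y)).
assert (HQ : is_linear (U := V1) (V := V2) Q).
{ apply (linear_minus_fun (V := V1) (W := V2)); [|exact HL1].
  apply (linear_scal_fun (V := V1) (W := V2) (/ h) (A := fun y => minus (K i r s y) (K i t s y))).
  apply (linear_minus_fun (V := V1) (W := V2)); apply HLr; [fold h; lra|rewrite Rminus_diag, Rabs_R0; easy]. }
fold Q in D2. change (Rabs (opnorm Q - 0) < e / (@norm R_AbsRing V1 x + 1)) in D2.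
rewrite Rminus_0_r in D2. pose proof (Rle_abs (opnorm Q)) as HA.
pose proof (opnorm_bound_k HQ x) as HB.
assert (HB' : @norm R_AbsRing V2 (Q x) <= e).
{ eapply Rle_trans; [exact HB|]. change (opnorm Q * @norm R_AbsRing V1 x <= e).
  apply Rle_trans with (e / (@norm R_AbsRing V1 x + 1) * (@norm R_AbsRing V1 x + 1)); [|right; field; lra].
  apply Rle_trans with (e / (@norm R_AbsRing V1 x + 1) * @norm R_AbsRing V1 x).
  - apply Rmult_le_compat_r; lra.
  - apply Rmult_le_compat_l; [left; apply Rdiv_lt_0_compat; lra|lra]. }
apply Rle_trans with (@norm R_AbsRing V2 (scal h (Q x : V2))).
- right. apply f_equal. unfold Q.
  change (minus (minus (K i r s x : V2) (K i t s x)) (scal h (K1 i t s x : V2)) =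
    scal h (minus (scal (/ h) (minus (K i r s x : V2) (K i t s x))) (K1 i t s x : V2))). vec (realify E2); easy.
- rewrite (@norm_scal_eq V2), Rmult_comm. apply Rmult_le_compat_r; [apply Rabs_pos|exact HB'].
Qed.

Lemma alpha_der i t : (i <= n)%nat -> 0 < t < T' -> is_derive (alpha i) t (dal i t).
Proof. intros Hi Ht. pose proof hT'. apply (C1_derive (alpha_C1 Hi)). lra. Qed.

Lemma cont_restrict {V : UniformSpace} (g : R -> V) :
  continuous_on (fun t => 0 <= t <= T) g -> continuous_on (fun t => 0 <= t <= T') g.
Proof.
intros H t Ht. pose proof hT'. specialize (H t ltac:(lra)). intros P HP. specialize (H P HP).
unfold filtermap, within in *. revert H. apply filter_imp. intros s Hs Hs'. apply Hs. lra.
Qed.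

Lemma alpha_cont' i : (i <= n)%nat -> continuous_on (fun t => 0 <= t <= T') (alpha i).
Proof. intros Hi. now apply cont_restrict, alpha_cont. Qed.
Lemma dal_cont i : (i <= n)%nat -> continuous_on (fun t => 0 <= t <= T') (dal i).
Proof. intros Hi. apply cont_restrict. apply (alpha_C1 Hi). Qed.
Lemma alpha_chain' i t : (i < n)%nat -> 0 <= t <= T' -> alpha i t <= alpha (S i) t.
Proof. intros Hi Ht. pose proof hT'. apply alpha_chain; [easy|lra]. Qed.
Lemma alpha_strict' i t : (i < n)%nat -> 0 < t < T' -> alpha i t < alpha (S i) t.
Proof. intros Hi Ht. pose proof hT'. apply alpha_strict; [easy|lra]. Qed.
Lemma dal_0 t : dal 0 t = 0.
Proof. easy. Qed.
Lemma dal_n t : dal n t = 1.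
Proof. unfold dal. destruct (Nat.eqb_spec n 0); [lia|]. now rewrite Nat.eqb_refl. Qed.
Lemma dal_mid i t : (1 <= i <= n - 1)%nat -> dal i t = dalpha i t.
Proof. intros Hi. unfold dal. destruct (Nat.eqb_spec i 0); [lia|]. destruct (Nat.eqb_spec i n); [lia|easy]. Qed.

Lemma alpha_bal i t : (i <= n)%nat -> 0 <= t <= T' -> alpha i t = t * bal i t.
Proof.
intros Hi Ht. unfold bal. destruct (Req_EM_T t 0) as [->|H0]; [rewrite alpha_at_0 by easy; ring|]. field. easy.
Qed.

Lemma bal_limit i e : (i <= n)%nat -> 0 < e -> exists d, 0 < d /\
  forall t, 0 <= t <= T -> t < d -> Rabs (bal i t - dal i 0) <= e.
Proof.
intros Hi He. destruct (C1_elim (alpha_C1 Hi) (t := 0) ltac:(lra) He) as [d [Hd D]].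
exists d. split; [easy|]. intros t Ht Htd. unfold bal. destruct (Req_EM_T t 0) as [->|H0].
- rewrite Rminus_diag, Rabs_R0. lra.
- assert (Ht0 : 0 < t) by lra.
  specialize (D t Ht ltac:(rewrite Rminus_0_r, Rabs_right; lra)).
  change (Rabs (alpha i t - alpha i 0 - (t - 0) * dal i 0) <= e * Rabs (t - 0)) in D.
  rewrite alpha_at_0, !Rminus_0_r, (Rabs_right t) in D by (trivial; lra).
  replace (alpha i t / t - dal i 0) with ((alpha i t - t * dal i 0) * / t) by (field; easy).
  rewrite Rabs_mult, (Rabs_right (/ t)) by (left; now apply Rinv_0_lt_compat).
  apply Rmult_le_reg_r with t; [easy|]. rewrite Rmult_assoc, Rinv_l, Rmult_1_r by easy. exact D.
Qed.

Lemma bal_cont i : (i <= n)%nat -> continuous_on (fun t => 0 <= t <= T') (bal i).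
Proof.
intros Hi t Ht. pose proof hT'. destruct (Req_dec t 0) as [->|H0].
- apply (lim_norm (V := R_NormedModule)). intros e He.
  destruct (@bal_limit i (e / 2) Hi ltac:(lra)) as [d [Hd D]].
  apply locally_R. exists d. split; [easy|]. intros s Hs Hs'. rewrite Rminus_0_r in Hs.
  rewrite Rabs_right in Hs by lra. replace (bal i 0) with (dal i 0) by (unfold bal; destruct (Req_EM_T 0 0); easy).
  eapply Rle_lt_trans; [exact (D s ltac:(lra) Hs)|]. lra.
- assert (Loc : within (fun t => 0 <= t <= T') (locally t) (fun s => alpha i s * / s = bal i s)).
  { apply locally_R. exists t. split; [lra|]. intros s Hs Hs'. apply Rabs_def2 in Hs. unfold bal.
    destruct (Req_EM_T s 0); [lra|easy]. }
  apply (filterlim_ext_loc (fun s => alpha i s * / s)); [exact Loc|].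
  replace (bal i t) with (alpha i t * / t) by (unfold bal; destruct (Req_EM_T t 0); easy).
  apply lim_Rmult; [now apply alpha_cont'|].
  eapply filterlim_filter_le_1; [apply filter_le_within|]. now apply continuous_Rinv.
Qed.

Lemma Kninv_real t : 0 <= t <= T' -> is_bounded_inverse (U := V1) (V := V2) (K n t t) (Kninv t).
Proof.
intros Ht. destruct hD as [_ [_ [_ [_ [HI _]]]]]. destruct (HI t Ht) as [H1 H2].
split; [now apply linear_realify|exact H2].
Qed.

Lemma bal_le i t : (1 <= i <= n - 1)%nat -> 0 < t <= T' -> 0 <= bal i t <= eps.
Proof.
intros Hi Ht. pose proof hT'. destruct hD as [_ [_ [_ [Hb _]]]]. unfold bal.
destruct (Req_EM_T t 0); [lra|]. split; [|now apply Hb].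
apply Rdiv_le_0_compat; [|lra]. apply (@al_range T' n alpha alpha_0 alpha_n alpha_chain'); [lia|lra].
Qed.

Lemma jump_lin i t : (1 <= i <= n - 1)%nat -> 0 <= t <= T' ->
  is_linear (U := V1) (V := V1) (fun y => Kninv t (jump alpha K i t y)).
Proof.
intros Hi Ht. destruct (@jump_sector T' n alpha alpha_0 alpha_n alpha_chain' hn i t Hi Ht) as [S1 [S2 _]].
apply (is_linear_comp (U := V1) (V := V2) (W := V1) (jump alpha K i t)); [|apply (Kninv_real Ht)].
apply (linear_minus_fun (V := V1) (W := V2)); [exact (@K_real_lin i (t, alpha i t) ltac:(lia) S1)|exact (@K_real_lin (S i) (t, alpha i t) ltac:(lia) S2)].
Qed.

(** For exponents [m >= Ns] the weights only shrink, as [bal i t] lies in [[0, eps]] with [eps < 1].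
    Exponents beyond [Ns] serve to show that [B(j)] is injective there. *)
Lemma contraction_real : exists q, 0 <= q < 1 /\ forall m, (Ns <= m)%nat -> forall t, 0 < t < T' -> exists c : nat -> R,
  (forall i (y : V1), (1 <= i <= n - 1)%nat -> 0 <= c i /\
     norm (Kninv t (minus (K i t (alpha i t) y : V2) (K (S i) t (alpha i t) y)) : V1) <= c i * norm y) /\
  sum_n_m (fun i => Rabs (dal i t) * bal i t ^ m * c i) 1 (n - 1) <= q.
Proof.
destruct hD as [He [_ [_ [_ [_ [q [Hq HQ]]]]]]].
(* The constant of (D) is made nonnegative, as the fixed-point argument asks. *)
exists (Rmax q 0). split; [split; [apply Rmax_r|apply Rmax_lub_lt; lra]|].
intros m Hm t Ht. exists (fun i => opnorm (fun y => Kninv t (jump alpha K i t y))).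
assert (Ho : forall i, (1 <= i <= n - 1)%nat -> 0 <= opnorm (fun y => Kninv t (jump alpha K i t y))).
{ intros i Hi. exact (opnorm_ge_0 (V := V1) (W := V1) (@jump_lin i t Hi ltac:(lra))). }
split.
- intros i y Hi. split; [now apply Ho|]. exact (opnorm_bound_k (@jump_lin i t Hi ltac:(lra)) y).
- eapply Rle_trans; [|apply Rmax_l]. eapply Rle_trans; [|exact (HQ t Ht)].
  rewrite <- (sum_n_m_mult_l (K := R_Ring) (eps ^ Ns)).
  apply sum_n_m_Rle. intros i Hi. rewrite dal_mid by easy. pose proof (@bal_le i t Hi ltac:(lra)) as Hb.
  assert (Hp : 0 <= bal i t ^ m <= eps ^ Ns).
  { split; [apply pow_le; lra|]. apply Rle_trans with (eps ^ m); [now apply pow_incr|].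
    replace m with (Ns + (m - Ns))%nat by lia. rewrite pow_add. rewrite <- (Rmult_1_r (eps ^ Ns)) at 2.
    apply Rmult_le_compat_l; [apply pow_le; lra|]. rewrite <- (pow1 (m - Ns)). apply pow_incr. lra. }
  change (Rabs (dalpha i t) * bal i t ^ m * opnorm (fun y => Kninv t (jump alpha K i t y)) <=
    eps ^ Ns * (Rabs (dalpha i t) * opnorm (fun y => Kninv t (jump alpha K i t y)))).
  replace (eps ^ Ns * (Rabs (dalpha i t) * opnorm (fun y => Kninv t (jump alpha K i t y)))) with
    (Rabs (dalpha i t) * eps ^ Ns * opnorm (fun y => Kninv t (jump alpha K i t y))) by ring.
  apply Rmult_le_compat_r; [now apply Ho|]. apply Rmult_le_compat_l; [apply Rabs_pos|easy].
Qed.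

Lemma dal_0_pos i : (1 <= i <= n)%nat -> 0 < dal i 0.
Proof.
intros Hi. destruct (Nat.eq_dec i n) as [->|]; [rewrite dal_n; lra|]. rewrite dal_mid by lia.
destruct halpha as [_ [_ [_ [_ [H _]]]]]. apply (H i). lia.
Qed.

(** * Expansions of the data and of the differentiated operator *)

Section Expansions.
Variables (N : nat) (Kc : nat -> nat -> nat -> E1 -> E2) (f df : R -> E2) (fc : nat -> E2) (ac : nat -> nat -> R).
Hypothesis hf : is_C1_on (V := V2) 0 T f df.
Hypothesis hB : condition_B T n alpha K f N Kc fc ac.
Hypothesis hBd : condition_B_differentiable T n alpha dalpha K1 df N Kc fc ac.

Lemma Kc_real_lin i nu mu : (1 <= i <= n)%nat -> (nu + mu <= N)%nat -> is_linear (U := V1) (V := V2) (Kc i nu mu).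
Proof. intros Hi H. apply linear_realify. now apply hB. Qed.

(* The bounds are given on the open regions and extend to their closures by continuity. *)
Lemma expansion_closure (A : nat -> R -> R -> V1 -> V2) (P : R -> R -> V1 -> V2) i q M :
  (1 <= i <= n)%nat ->
  (forall i p, (1 <= i <= n)%nat -> sector T' alpha i p -> is_linear (A i (fst p) (snd p))) ->
  (forall i, (1 <= i <= n)%nat -> opcont (sector T' alpha i) (A i)) ->
  (forall t s, is_linear (P t s)) -> (forall t y s, continuous (fun s => P t s y) s) ->
  within (region T alpha i) (locally (0, 0)) (fun p =>
       opnorm (fun y => minus (A i (fst p) (snd p) y) (P (fst p) (snd p) y)) <= M * (fst p + snd p) ^ q) ->
  exists M', near0 (fun t => forall s y, sector T' alpha i (t, s) -> norm (minus (A i t s y) (P t s y)) <= M' * t ^ q * norm y).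
Proof.
intros Hi HL HC HP HPc HW. unfold within in HW. apply locally_R2 in HW. destruct HW as [d [Hd HW]].
pose proof hT' as HT'.
(* On a sector [s <= t], hence [(t + s)^q <= 2^q t^q]. *)
exists (Rabs M * 2 ^ q), (Rmin d T'). split; [apply Rmin_glb_lt; lra|].
intros t Ht s y HS. pose proof (Rmin_l d T'). pose proof (Rmin_r d T').
assert (Hst : alpha (i - 1) t < alpha i t) by (replace i with (S (i - 1)) at 2 by lia; apply alpha_strict'; [lia|lra]).
destruct (@node_surj T' n alpha i t s Hi ltac:(lra) Hst (proj2 HS)) as [th [Hth Es]].
assert (Hnode : forall th, 0 < th < 1 -> region T alpha i (t, node T' alpha i t th)).
{ intros r Hr. split; simpl; [lra|]. rewrite node_eq by lra. split; nra. }
assert (Hnr : forall th, 0 <= node T' alpha i t th <= t).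
{ intros r. pose proof (@node_sector T' n alpha (proj1 HT') alpha_chain' i t r Hi) as HSr. rewrite clamp_id in HSr by lra.
  pose proof (@sector_range T' n alpha alpha_0 alpha_n alpha_chain' i t _ Hi HSr). lra. }
rewrite Es.
(* The slice at [t] is parametrised by [[0, 1]], and interior parameters give points of the open
   region. *)
apply (@norm_le_closure 1 Rlt_0_1 V2 (fun th => minus (A i t (node T' alpha i t th) y) (P t (node T' alpha i t th) y))
  (fun _ => Rabs M * 2 ^ q * t ^ q * @norm R_AbsRing V1 y)); trivial.
- apply (continuous_on_pointwise (U := R_UniformSpace) (V := V2)). intros r _.
  apply (lim_minus (V := V2)).
  + pose proof (@jcont_section V2 _ t r (@slice_jcont T' n alpha (proj1 HT') alpha_0 alpha_n alpha_cont' alpha_chain' V1 V2 A HL HC (fun _ => y) i Hi (fun t _ => filterlim_const y))) as J.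
    unfold slice in J. rewrite clamp_id in J by lra. exact J.
  + apply (continuous_comp_lim (f := node T' alpha i t) (g := fun s => P t s y)); [|apply HPc].
    exact (@jcont_section R_CompleteNormedModule _ t r (@node_jcont T' n alpha (proj1 HT') alpha_cont' i Hi)).
- intros r Hr. apply filterlim_const.
- intros r Hr. specialize (HW t (node T' alpha i t r)). pose proof (Hnr r) as Hr1.
  specialize (HW ltac:(rewrite Rminus_0_r, Rabs_right; lra) ltac:(rewrite Rminus_0_r, Rabs_right; lra) (Hnode r Hr)).
  simpl in HW.
  assert (HSr : sector T' alpha i (t, node T' alpha i t r)).
  { pose proof (@node_sector T' n alpha (proj1 HT') alpha_chain' i t r Hi) as HSr. rewrite clamp_id in HSr by lra. exact HSr. }
  assert (HQ : is_linear (U := V1) (V := V2) (fun y => minus (A i t (node T' alpha i t r) y) (P t (node T' alpha i t r) y))).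
  { apply (linear_minus_fun (V := V1) (W := V2)); [exact (HL i _ Hi HSr)|apply HP]. }
  eapply Rle_trans; [exact (opnorm_bound (V := V1) (W := V2) HQ y)|].
  apply Rmult_le_compat_r; [apply (@norm_ge_0 R_AbsRing V1)|]. eapply Rle_trans; [exact HW|].
  rewrite Rmult_assoc, <- Rpow_mult_distr.
  apply Rle_trans with (Rabs M * (t + node T' alpha i t r) ^ q).
  + apply Rmult_le_compat_r; [apply pow_le; lra|apply Rle_abs].
  + apply Rmult_le_compat_l; [apply Rabs_pos|]. apply pow_incr. lra.
Qed.

Lemma K_real_exp i : (1 <= i <= n)%nat -> exists M, near0 (fun t => forall s y, sector T' alpha i (t, s) ->
  norm (minus (K i t s y : V2) (kpoly (V1 := V1) (V2 := V2) N Kc i t s y)) <= M * t ^ (S N) * @norm R_AbsRing V1 y).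
Proof.
intros Hi. destruct hB as [HKc [_ [HE _]]]. destruct (HE i Hi) as [M HM].
apply (@expansion_closure K (fun t s y => kpoly (V1 := V1) (V2 := V2) N Kc i t s y) i (S N) M Hi K_real_lin K_real_cont).
- intros t s. unfold kpoly.
  apply (linear_sum_fun (V := V1) (W := V2) (A := fun nu y => sum_n_m (fun mu => scal (t ^ nu * s ^ mu) (Kc i nu mu y : V2)) 0 (N - nu))). intros nu Hnu.
  apply (linear_sum_fun (V := V1) (W := V2) (A := fun mu y => scal (t ^ nu * s ^ mu) (Kc i nu mu y : V2))). intros mu Hmu.
  apply (linear_scal_fun (V := V1) (W := V2)). apply Kc_real_lin; [easy|lia].
- intros t y s. unfold kpoly.
  apply (lim_sum (V := V2) (f := fun nu s => sum_n_m (fun mu => scal (t ^ nu * s ^ mu) (Kc i nu mu y : V2)) 0 (N - nu))). intros nu _.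
  apply (lim_sum (V := V2) (f := fun mu s => scal (t ^ nu * s ^ mu) (Kc i nu mu y : V2))). intros mu _.
  apply (lim_scal (V := V2)); [|apply filterlim_const]. apply lim_Rmult; [apply filterlim_const|]. apply lim_pow, filterlim_id.
- replace (S N) with (N + 1)%nat by lia. exact HM.
Qed.

Lemma K1_real_exp i : (1 <= i <= n)%nat -> exists M, near0 (fun t => forall s y, sector T' alpha i (t, s) ->
  norm (minus (K1 i t s y : V2) (kpoly_dt (V1 := V1) (V2 := V2) N Kc i t s y)) <= M * t ^ N * @norm R_AbsRing V1 y).
Proof.
intros Hi. destruct hBd as [HE _]. destruct (HE i Hi) as [M HM].
apply (@expansion_closure K1 (fun t s y => kpoly_dt (V1 := V1) (V2 := V2) N Kc i t s y) i N M Hi K1_real_lin K1_real_cont).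
- intros t s. unfold kpoly_dt.
  apply (linear_sum_fun (V := V1) (W := V2) (A := fun nu y => sum_n_m (fun mu => scal (INR nu * t ^ (nu - 1) * s ^ mu) (Kc i nu mu y : V2)) 0 (N - nu))). intros nu Hnu.
  apply (linear_sum_fun (V := V1) (W := V2) (A := fun mu y => scal (INR nu * t ^ (nu - 1) * s ^ mu) (Kc i nu mu y : V2))). intros mu Hmu.
  apply (linear_scal_fun (V := V1) (W := V2)). apply Kc_real_lin; [easy|lia].
- intros t y s. unfold kpoly_dt.
  apply (lim_sum (V := V2) (f := fun nu s => sum_n_m (fun mu => scal (INR nu * t ^ (nu - 1) * s ^ mu) (Kc i nu mu y : V2)) 0 (N - nu))). intros nu _.
  apply (lim_sum (V := V2) (f := fun mu s => scal (INR nu * t ^ (nu - 1) * s ^ mu) (Kc i nu mu y : V2))). intros mu _.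
  apply (lim_scal (V := V2)); [|apply filterlim_const]. apply lim_Rmult; [apply filterlim_const|]. apply lim_pow, filterlim_id.
- exact HM.
Qed.

Lemma alpha_C1_mid i : (1 <= i <= n - 1)%nat -> is_C1_on (V := R_NormedModule) 0 T (alpha i) (dal i).
Proof. intros Hi. apply alpha_C1. lia. Qed.

Lemma dal_limit i : (1 <= i <= n - 1)%nat -> exists c : R, filterlim
  (fun t => (dal i t - sum_n_m (fun nu => ac i nu * (INR nu * t ^ (nu - 1))) 1 N) / t ^ N) (at_right 0) (locally c).
Proof.
intros Hi. destruct hBd as [_ [_ H]]. destruct (H i Hi) as [c Hc]. exists c.
refine (filterlim_ext _ _ _ Hc). intros t. now rewrite dal_mid.
Qed.

Lemma dal_exp i : (1 <= i <= n - 1)%nat -> lead (V := R_NormedModule) N 0 (dal i) (fun _ => dal i 0).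
Proof. intros Hi. destruct (dal_limit Hi) as [c Hc]. exact (da_lead hT (alpha_C1_mid Hi) Hc). Qed.

Lemma bal_exp i : (1 <= i <= n - 1)%nat -> lead (V := R_NormedModule) N 0 (bal i) (fun _ => dal i 0).
Proof.
intros Hi. destruct (dal_limit Hi) as [c Hc].
apply (quotient_lead hT (alpha_C1_mid Hi) (@alpha_at_0 i ltac:(lia)) Hc).
- intros t Ht. unfold bal. destruct (Req_EM_T t 0); [lra|easy].
- intros e He. destruct (@bal_limit i e ltac:(lia) He) as [d [Hd D]].
  exists (Rmin d T). split; [now apply Rmin_glb_lt|]. intros t Ht. pose proof (Rmin_l d T). pose proof (Rmin_r d T). apply D; lra.
Qed.

Lemma df_exp : expn (V := V2) N 0 df.
Proof.
destruct hBd as [_ [[c Hc] _]].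
apply (scaled_limit_expn (V := V2) (p := f_poly_dt N fc) (c := c)); [|exact Hc].
apply (expn_sum (V := V2) (f := fun nu t => scal (INR nu * t ^ (nu - 1)) (fc nu : V2))). intros nu Hnu.
apply (expn_eq (V := V2) (g := fun t => scal (t ^ (nu - 1) * ln t ^ 0) (scal (INR nu) (fc nu : V2)))).
- intros t Ht. simpl pow. vec (realify E2).
- apply expn_mono; [lia|easy].
Qed.

Lemma dvolt_lead j l (v : V1) : (j = 0%nat -> l = 0%nat) ->
  lead (V := V2) N j (dvolt (V1 := V1) (V2 := V2) n alpha dal K K1 (logmono j l v))
   (fun t => scal (t ^ j) (diffmono (V1 := V1) (V2 := V2) (charder (V1 := V1) (V2 := V2) n K (fun i => dal i 0) j) l v (ln t))).
Proof.
intros Hjl.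
pose proof (@dvolt_logmono N T' n alpha bal dal V1 V2 K K1 (proj1 hT') hn alpha_0 alpha_n alpha_chain' alpha_bal
  K_real_lin K_real_cont K1_real_lin K1_real_cont Kc Kc_real_lin K_real_exp K1_real_exp (fun i => dal i 0) dal_0_pos
  dal_exp bal_exp (dal_n 0) j l v Hjl) as H.
refine (lead_eq (V := V2) _ _ H); [easy|]. intros t Ht. apply (charop_diffmono (V1 := V1) (V2 := V2)).
Qed.

Notation A := (dvolt (V1 := V1) (V2 := V2) n alpha dal K K1).
Notation cont' := (continuous_on (fun t => 0 <= t <= T')).

Lemma dvolt_plus (x y : R -> V1) t : cont' x -> cont' y -> 0 < t < T' ->
  A (fun s => plus (x s) (y s)) t = plus (A x t) (A y t).
Proof.
intros Hx Hy Ht.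
assert (Hxy : cont' (fun s => plus (x s) (y s))).
{ intros s Hs. apply (lim_plus (V := V1)); [now apply Hx|now apply Hy]. }
pose proof (@dvolt_minus T' n alpha bal (proj1 hT') alpha_0 alpha_n alpha_cont' alpha_chain' V1 V2 dal K K1 K_real_lin
  K_real_cont K1_real_lin K1_real_cont hn Kninv Kninv_real bal_cont alpha_bal _ y t Hxy Hy ltac:(lra)) as E.
assert (E' : A x t = minus (A (fun s => plus (x s) (y s)) t) (A y t)).
{ etransitivity; [|exact E]. apply (f_equal (fun g => A g t)). apply functional_extensionality. intros s. vec (realify E1). }
rewrite E'. vec (realify E2).
Qed.

Lemma linear_at_0 i : (1 <= i <= n)%nat -> is_linear (K i 0 0).
Proof.
intros Hi. pose proof hT'. apply (proj1 (hK Hi) (0, 0)). apply sector_closure; [easy|].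
split; simpl; [lra|]. rewrite !alpha_at_0 by lia. lra.
Qed.

Lemma K_lin i p : (1 <= i <= n)%nat -> sector T' alpha i p -> is_linear (K i (fst p) (snd p)).
Proof. intros Hi Hp. apply (hK Hi). apply sector_closure; [easy|]. now apply sector_restrict. Qed.
Lemma K1_lin i p : (1 <= i <= n)%nat -> sector T' alpha i p -> is_linear (K1 i (fst p) (snd p)).
Proof. intros Hi Hp. apply (hK Hi). apply sector_closure; [easy|]. now apply sector_restrict. Qed.

Lemma scal_sum_k {E : CompleteNormedModule (scalars k)} (c : scalars k) (g : nat -> E) a b :
  scal c (sum_n_m g a b) = sum_n_m (fun i => scal c (g i)) a b.
Proof. exact (linear_sum_n_m (U := realify E) (W := realify E) g a b (linear_scal_k c)). Qed.

(** The parameters range over [scalars k], so homogeneity over the reals is not enough for forming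
    combinations. *)
Lemma dvolt_scal (c : scalars k) (y : R -> V1) t : cont' y -> 0 < t < T' ->
  A (fun s => scal c (y s : E1)) t = scal c (A y t : E2).
Proof.
intros Hy Ht. unfold dvolt.
assert (E1' : K n t t (scal c (y t : E1)) = scal c (K n t t (y t))).
{ apply (@K_lin n (t, t)); [lia|]. apply (@diag_sector T' n alpha alpha_0 alpha_n alpha_chain' hn t). lra. }
assert (E2' : sum_n_m (fun i => scal (dal i t) (minus (K i t (alpha i t) (scal c (y (alpha i t) : E1)) : V2)
    (K (S i) t (alpha i t) (scal c (y (alpha i t) : E1))))) 1 (n - 1) =
  scal c (sum_n_m (fun i => scal (dal i t) (minus (K i t (alpha i t) (y (alpha i t)) : V2)
    (K (S i) t (alpha i t) (y (alpha i t))))) 1 (n - 1) : E2)).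
{ etransitivity; [|symmetry; exact (scal_sum_k (E := E2) c _ _ _)]. apply sum_n_m_ext_loc. intros i Hi.
  destruct (@jump_sector T' n alpha alpha_0 alpha_n alpha_chain' hn i t Hi ltac:(lra)) as [S1 [S2 _]].
  rewrite (linear_scal _ (@K_lin i (t, alpha i t) ltac:(lia) S1)), (linear_scal _ (@K_lin (S i) (t, alpha i t) ltac:(lia) S2)).
  change (rscal (dal i t) (minus (scal c (K i t (alpha i t) (y (alpha i t)))) (scal c (K (S i) t (alpha i t) (y (alpha i t))))) =
    scal c (rscal (dal i t) (minus (K i t (alpha i t) (y (alpha i t))) (K (S i) t (alpha i t) (y (alpha i t)))))).
  rewrite scal_of_real_comm. apply (f_equal (rscal (dal i t))). symmetry.
  exact (scal_minus_distr_l (V := E2) c _ _). }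
assert (E3' : sum_n_m (fun i => RInt (V := V2) (fun s => K1 i t s (scal c (y s : E1))) (alpha (i - 1) t) (alpha i t)) 1 n =
  scal c (sum_n_m (fun i => RInt (V := V2) (fun s => K1 i t s (y s)) (alpha (i - 1) t) (alpha i t)) 1 n : E2)).
{ etransitivity; [|symmetry; exact (scal_sum_k (E := E2) c _ _ _)]. apply sum_n_m_ext_loc. intros i Hi.
  transitivity (RInt (V := V2) (fun s => scal c (K1 i t s (y s))) (alpha (i - 1) t) (alpha i t)).
  - apply (RInt_ext (V := V2)). intros s Hs. apply (@K1_lin i (t, s) Hi). split; simpl; [lra|].
    pose proof (@alpha_chain' (i - 1) t ltac:(lia) ltac:(lra)) as Hc. replace (S (i - 1)) with i in Hc by lia.
    rewrite Rmin_left, Rmax_right in Hs by easy. lra.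
  - apply (RInt_linear (V := V2) (W := V2) (A := fun z => scal c (z : E2))); [apply linear_scal_k|].
    apply (@ex_RInt_kernel T' n alpha alpha_0 alpha_n alpha_chain' V1 V2 K1 K1_real_lin K1_real_cont); [easy|easy|lra]. }
etransitivity; [|symmetry; exact (scal_distr_l (V := E2) c _ _)].
refine (f_equal2 (@plus E2) _ E3').
etransitivity; [|symmetry; exact (scal_distr_l (V := E2) c _ _)].
exact (f_equal2 (@plus E2) E1' E2').
Qed.

(** * The characteristic operator at integers and its singular points *)

Notation Bm := (charder (V1 := V1) (V2 := V2) n K (fun i => dal i 0)).

(** Each derivative in [j] multiplies [a^(1+j)] by [ln a]. The formula is proved for all real [j] at
    once, as the next differentiation requires. *)
Lemma vderive_n_B m y : vderive_n (V := V2) (fun j => B n dalpha K j y) m = fun j =>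
  plus (only0 (V2 := V2) m (K n 0 0 y)) (sum_n_m (fun i => scal (Rpower (dalpha i 0) (1 + j) * ln (dalpha i 0) ^ m)
    (minus (K i 0 0 y : V2) (K (S i) 0 0 y))) 1 (n - 1)).
Proof.
induction m as [|m IH]; apply functional_extensionality; intros j.
- unfold B. simpl vderive_n. apply (f_equal (@plus V2 (K n 0 0 y))). apply sum_n_m_ext. intros i.
  simpl pow. rewrite Rmult_1_r. easy.
- simpl vderive_n. rewrite IH. unfold vderive.
  assert (HD : is_derive (V := V2) (fun j => plus (only0 (V2 := V2) m (K n 0 0 y))
    (sum_n_m (fun i => scal (Rpower (dalpha i 0) (1 + j) * ln (dalpha i 0) ^ m)
    (minus (K i 0 0 y : V2) (K (S i) 0 0 y))) 1 (n - 1))) j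
    (plus (only0 (V2 := V2) (S m) (K n 0 0 y)) (sum_n_m (fun i => scal (Rpower (dalpha i 0) (1 + j) * ln (dalpha i 0) ^ S m)
    (minus (K i 0 0 y : V2) (K (S i) 0 0 y))) 1 (n - 1)))).
  { apply (is_derive_plus (V := V2)); [apply (is_derive_const (V := V2))|].
    apply (is_derive_sum (V := V2) (f := fun i j => scal (Rpower (dalpha i 0) (1 + j) * ln (dalpha i 0) ^ m)
      (minus (K i 0 0 y : V2) (K (S i) 0 0 y)))).
    intros i _. apply (is_derive_scal_l (V := V2) (fun j => Rpower (dalpha i 0) (1 + j) * ln (dalpha i 0) ^ m)).
    unfold Rpower. auto_derive; [easy|]. simpl pow. ring. }
  apply (@iota_unique R_AbsRing V2); [|exact HD]. intros l Hl. exact (is_derive_uniq (V := V2) Hl HD).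
Qed.

Lemma B_deriv_eq m j y : B_deriv n dalpha K m (INR j) y = Bm j m y.
Proof.
unfold B_deriv. rewrite vderive_n_B. unfold charder. apply f_equal. apply sum_n_m_ext_loc. intros i Hi.
pose proof (@dal_0_pos i ltac:(lia)) as Hp. rewrite (dal_mid _ Hi) in *.
replace (1 + INR j) with (INR (S j)) by (rewrite S_INR; ring). now rewrite Rpower_pow.
Qed.

Lemma B_eq j y : B n dalpha K (INR j) y = Bm j 0 y.
Proof. exact (B_deriv_eq 0 j y). Qed.

Lemma Bm_lin j m : is_linear (U := V1) (V := V2) (Bm j m).
Proof. apply (charder_lin (V1 := V1) (V2 := V2)); [exact hn|]. intros i Hi. apply linear_realify. now apply linear_at_0. Qed.

Lemma Bm_lin_k j m : is_linear (U := E1) (V := E2) (Bm j m).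
Proof.
destruct (Bm_lin j m) as [H1 _ H3]. split; [exact H1| |exact H3].
intros c y. unfold charder, only0.
etransitivity; [|symmetry; exact (scal_distr_l (V := E2) c _ _)]. refine (f_equal2 (@plus E2) _ _).
- destruct (Nat.eqb m 0); [exact (linear_scal _ (@linear_at_0 n ltac:(lia)) c y)|]. symmetry. exact (scal_zero_r (V := E2) c).
- etransitivity; [|symmetry; exact (scal_sum_k (E := E2) c _ _ _)]. apply sum_n_m_ext_loc. intros i Hi.
  rewrite (linear_scal _ (@linear_at_0 i ltac:(lia))), (linear_scal _ (@linear_at_0 (S i) ltac:(lia))).
  etransitivity; [|symmetry; exact (scal_of_real_comm (E := E2) c _ _)]. apply (f_equal (rscal _)).
  symmetry. exact (scal_minus_distr_l (V := E2) c _ _).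
Qed.

Lemma scalars_comm (x y : scalars k) : mult x y = mult y x.
Proof. destruct k; [apply Rmult_comm|apply Cmult_comm]. Qed.
Lemma scalars_nontrivial : @one (scalars k) <> zero.
Proof.
destruct k; [exact R1_neq_R0|]. intros H. apply (f_equal fst) in H. exact (R1_neq_R0 H).
Qed.
Lemma scalars_inv (x : scalars k) : x <> zero -> exists y, mult y x = one.
Proof.
destruct k; intros H.
- exists (/ x). now apply Rinv_l.
- exists (Cinv x). now apply Cinv_l.
Qed.

Lemma linear_sum_k {F G : NormedModule (scalars k)} (L : F -> G) (g : nat -> F) a b : is_linear L ->
  L (sum_n_m g a b) = sum_n_m (fun i => L (g i)) a b.
Proof.
intros HL. destruct (le_lt_dec a b) as [H|H].
- induction b as [|b IH].
  + replace a with 0%nat by lia. now rewrite !sum_n_n.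
  + destruct (Nat.eq_dec a (S b)) as [->|Ha]; [now rewrite !sum_n_n|].
    rewrite !sum_n_Sm by lia. rewrite (linear_plus _ HL). f_equal. apply IH. lia.
- rewrite !sum_n_m_zero by lia. exact (linear_zero _ HL).
Qed.

Lemma singular_null j p v : singular_fredholm_point n dalpha K (INR j) p -> null_space (B n dalpha K (INR j)) v ->
  forall m, (m < p)%nat -> Bm j m v = zero.
Proof.
intros [_ [_ [_ [Hder _]]]] Hv m Hm. rewrite <- B_deriv_eq. destruct m as [|m]; [exact Hv|]. apply (Hder (S m)); [lia|easy].
Qed.

Lemma null_space_closed {F G : NormedModule (scalars k)} (L : F -> G) (c : nat -> scalars k) (g : nat -> F) r : is_linear L ->
  (forall i, (1 <= i <= r)%nat -> L (g i) = zero) -> L (sum_n_m (fun i => scal (c i) (g i)) 1 r) = zero.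
Proof.
intros HL H. rewrite (linear_sum_k _ _ _ HL). etransitivity; [|exact (sum_n_m_const_zero (G := G) 1 r)].
apply sum_n_m_ext_loc. intros i Hi. rewrite (linear_scal _ HL), H by easy. exact (scal_zero_r (V := G) (c i)).
Qed.

Lemma basis_size {F : NormedModule (scalars k)} (S : F -> Prop) r q e g :
  is_basis S r e -> is_basis S q g -> (r <= q)%nat.
Proof.
intros [H1 [H2 _]] [_ [_ G3]].
apply (@independent_le_span (scalars k) scalars_comm scalars_nontrivial scalars_inv F (fun x => x = zero)) with (w := e) (z := g).
- intros x y -> ->. exact (plus_zero_l (G := F) zero).
- intros c x ->. exact (scal_zero_r (V := F) c).
- easy.
- exact H2.
- intros i Hi. destruct (G3 (e i) (H1 i Hi)) as [c Hc]. exists zero, c. split; [easy|].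
  rewrite Hc at 1. symmetry. exact (plus_zero_l (G := F) _).
Qed.

(* At a singular point of index [p], [B^(p)] maps the null space of [B] onto a complement of the range of [B]. *)
Lemma singular_onto j p : singular_fredholm_point n dalpha K (INR j) p -> forall y : E2, exists v w : E1,
  (forall m, (m < p)%nat -> Bm j m w = zero) /\ y = plus (Bm j 0 v) (Bm j p w).
Proof.
intros Hs y. pose proof (fun v => @singular_null j p v Hs) as Hnull.
destruct Hs as [Hp [[HL [_ [r0 [[e He] [z [_ Hz2]]]]]] [_ [_ [r [phi [psi [Hphi [Hpsi Hdet]]]]]]]]].
(* [r0] is also the codimension of the range, so the vectors [w i] are exactly as many as a
   complement of the range needs. *)
assert (r0 = r) as ->.
{ apply Nat.le_antisymm; [exact (basis_size He Hphi)|exact (basis_size Hphi He)]. }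
set (BB := B n dalpha K (INR j)) in *.
pose (w := fun i => Bm j p (phi i)).
(* Each [psi l] annihilates the range; applied to a relation modulo the range it gives one equation
   of a linear system whose matrix has nonzero determinant. *)
assert (Hw : independent (V := E2) (range BB) r w).
{ intros c [x Hx]. apply (det_rows scalars_comm scalars_nontrivial scalars_inv (c := c) Hdet).
  intros l Hl. destruct Hpsi as [Hpsi _]. destruct (Hpsi l Hl) as [Lpsi Zpsi].
  assert (E : sum_n_m (fun i => psi l (scal (c i) (w i : E2))) 1 r = zero).
  { rewrite <- (Zpsi x). etransitivity; [symmetry; exact (linear_sum_k (F := E2) (fun i => scal (c i) (w i : E2)) 1 r Lpsi)|].
    apply (f_equal (psi l)). exact Hx. }
  etransitivity; [|exact E].
  apply sum_n_m_ext. intros i. etransitivity; [|symmetry; exact (linear_scal _ Lpsi (c i) (w i))].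
  unfold w. now rewrite B_deriv_eq. }
destruct (@independent_spans (scalars k) scalars_comm scalars_nontrivial scalars_inv E2 (range BB)) with (r := r) (w := w) (z := z) (y := y)
  as [s [c [[v Hv] E]]].
- intros x1 x2 [v1 ->] [v2 ->]. exists (plus v1 v2). symmetry. apply (linear_plus _ HL).
- intros c x1 [v1 ->]. exists (scal c v1). symmetry. apply (linear_scal _ HL).
- exists zero. symmetry. exact (linear_zero _ HL).
- exact Hw.
- exact Hz2.
- exists v, (sum_n_m (fun i => scal (c i) (phi i)) 1 r). split.
  + intros m Hm. apply (null_space_closed (F := E1) (G := E2)); [apply Bm_lin_k|].
    intros i Hi. apply Hnull; [now apply Hphi|easy].
  + rewrite E. rewrite Hv. unfold BB. rewrite B_eq. refine (f_equal (plus _) _).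
    etransitivity; [|symmetry; exact (linear_sum_k (F := E1) (G := E2) _ 1 r (Bm_lin_k j p))].
    apply sum_n_m_ext. intros i. symmetry. apply (linear_scal _ (Bm_lin_k j p)).
Qed.

Variables (nu : nat) (js ks rs : nat -> nat).
Hypothesis hC : condition_C n dalpha K N nu js ks rs.
Hypothesis hB0 : has_bounded_inverse (B n dalpha K 0).

(** A regular point takes [p = 0] and [w = zero]; a singular one takes its index for [p]. *)
Lemma Bm_onto j : (j <= N)%nat -> exists p, forall y : V2, exists v w : V1,
  (forall m, (m < p)%nat -> Bm j m w = zero) /\ y = plus (Bm j 0 v) (Bm j p w).
Proof.
intros Hj. destruct hC as [H1 [_ H3]]. destruct (H3 j Hj) as [[Bi [Hlin [_ Hi]]]|[i [Hi <-]]].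
- exists 0%nat. intros y. exists (Bi y), zero. split; [intros; lia|].
  assert (E : Bm j 0 zero = (zero : V2)) by exact (linear_zero _ (Bm_lin j 0)).
  rewrite E, <- B_eq, Hi. vec (realify E2).
- exists (ks i). exact (singular_onto (proj1 (proj2 (H1 i Hi)))).
Qed.

Lemma Bm_0_onto (y : V2) : exists v : V1, y = Bm 0 0 v.
Proof. destruct hB0 as [Bi [_ [_ Hi]]]. exists (Bi y). rewrite <- B_eq. symmetry. apply Hi. Qed.

(* For [j >= Ns], condition (D) makes [B j - K_n(0, 0)] a strict contraction relative to [K_n(0, 0)]. *)
Lemma null_space_trivial j (y : E1) : (Ns <= j)%nat -> Bm j 0 y = zero -> y = zero.
Proof.
intros Hj Hy. pose proof hT' as HT'. destruct contraction_real as [q [Hq Hc]]. specialize (Hc j Hj).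
(* On this constant function [Lw] at [t = 0] is [Kninv 0] applied to [B(j) y - K n 0 0 y], which is
   [- y] when [B(j) y] vanishes. *)
pose (u := fun _ : R => y : V1).
assert (Hu : cont' u) by exact (fun s _ => filterlim_const (y : V1)).
assert (HN : norm (Lw (V1 := V1) (V2 := V2) n alpha bal dal K Kninv j u 0) <= q * @norm R_AbsRing V1 y).
{ apply (@norm_le_closure T' (proj1 HT') V1 (Lw (V1 := V1) (V2 := V2) n alpha bal dal K Kninv j u)
    (fun _ => q * @norm R_AbsRing V1 y)); [| |intros t Ht|lra].
  - exact (@Lw_cont T' n alpha bal alpha_0 alpha_n alpha_cont' alpha_chain' V1 V2 dal K K_real_lin K_real_cont hn Kninv
      Kninv_real bal_cont dal_cont j u Hu).
  - intros t _. apply filterlim_const.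
  - apply (@Lw_bound T' n alpha bal alpha_0 alpha_n alpha_chain' V1 V2 dal K hn Kninv Kninv_real alpha_bal j q Hc u t _ Ht).
    intros s _. apply Rle_refl. }
destruct (@Kninv_real 0 ltac:(lra)) as [L0 [I1 _]].
assert (E : Lw (V1 := V1) (V2 := V2) n alpha bal dal K Kninv j u 0 = opp (y : V1)).
{ unfold Lw. rewrite <- (I1 (opp (y : V1))). apply f_equal.
  assert (EB : sum_n_m (fun i => scal (dal i 0 * bal i 0 ^ j) (minus (K i 0 (alpha i 0) (u (alpha i 0)) : V2)
     (K (S i) 0 (alpha i 0) (u (alpha i 0))))) 1 (n - 1) = opp (K n 0 0 y : V2)).
  { unfold charder in Hy. set (Sm := sum_n_m _ 1 (n - 1)) in Hy.
    transitivity Sm.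
    - apply sum_n_m_ext_loc. intros i Hi. unfold u. rewrite alpha_at_0 by lia.
      replace (bal i 0) with (dal i 0) by (unfold bal; destruct (Req_EM_T 0 0); easy).
      apply (f_equal (fun r => scal r _)). simpl. ring.
    - unfold only0 in Hy. simpl in Hy. transitivity (minus (plus (K n 0 0 y : V2) Sm) (K n 0 0 y)); [vec (realify E2)|].
      rewrite Hy. vec (realify E2). }
  etransitivity; [exact EB|]. symmetry. exact (linear_opp _ _ (linear_realify (@linear_at_0 n ltac:(lia)))). }
rewrite E, (@norm_opp R_AbsRing V1) in HN.
apply (@norm_eq_zero R_AbsRing V1). pose proof (@norm_ge_0 R_AbsRing V1 y) as Ny.
apply Rle_antisym; [|easy]. nra.
Qed.

Lemma singular_lt i : (1 <= i <= nu)%nat -> (js i < Ns)%nat.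
Proof.
intros Hi. apply Nat.nle_gt. intros H. destruct hC as [H1 _].
destruct (H1 i Hi) as [_ [[_ [_ [[y [Hy Hy0]] _]]] _]]. apply Hy0. apply (null_space_trivial H). rewrite <- B_eq. exact Hy.
Qed.

(** * Independent logarithm-power sums annihilated up to [o(t^N)] *)

Lemma sum_append {G : AbelianMonoid} (g : nat -> G) r m :
  sum_n_m g 1 (r + m) = plus (sum_n_m g 1 r) (sum_n_m (fun a => g (r + a)%nat) 1 m).
Proof.
induction m as [|m IH].
- rewrite Nat.add_0_r, (sum_n_m_zero (fun a => g (r + a)%nat)) by lia. now rewrite plus_zero_r.
- rewrite Nat.add_succ_r, !sum_n_Sm by lia. rewrite IH, Nat.add_succ_r. symmetry. apply plus_assoc.
Qed.

(** Invariant of the construction while level [j] is in progress: nothing stands below [t^j], and at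
    [t^j] the powers of [ln t] from [l] on are still free. Independence is measured by coefficients
    below [Ns], those that a solution can be shown to determine. *)
Definition kernel_family (j l m : nat) (Y : nat -> nat -> nat -> E1) : Prop :=
  (forall a, (1 <= a <= m)%nat -> exists d, admissible (V1 := V1) d (Y a) /\ small (V := V2) N (A (lpsum (V1 := V1) N d (Y a)))) /\
  (forall a, (1 <= a <= m)%nat -> (forall i q, (i < j)%nat -> Y a i q = zero) /\ (forall q, (l <= q)%nat -> Y a j q = zero)) /\
  (forall e : nat -> scalars k,
    (forall i q, (i < Ns)%nat -> sum_n_m (fun a => scal (e a) (Y a i q)) 1 m = zero) ->
    forall a, (1 <= a <= m)%nat -> e a = zero).

(* The new members have coefficient [phi b] at [t^j (ln t)^l], where the old ones have none. *)
Lemma kernel_family_extend j l m r (phi : nat -> E1) Y : (j < Ns)%nat -> (Ns <= N)%nat -> j <> 0%nat ->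
  is_basis (null_space (B n dalpha K (INR j))) r phi ->
  (forall b q, (1 <= b <= r)%nat -> (q <= l)%nat -> Bm j q (phi b) = zero) ->
  kernel_family j l m Y -> exists Y', kernel_family j (S l) (r + m) Y'.
Proof.
intros Hj HN Hj0 [_ [Hind _]] Hphi [HY1 [HY2 HY3]].
assert (HZ : forall b, exists Z : nat -> nat -> E1, (1 <= b <= r)%nat ->
  (exists d, admissible (V1 := V1) d Z /\ small (V := V2) N (A (lpsum (V1 := V1) N d Z))) /\
  (forall i q, (i < j)%nat -> Z i q = zero) /\ (forall q, Z j q = if Nat.eqb q l then phi b else zero)).
{ intros b. destruct (classic (1 <= b <= r)%nat) as [Hb|Hb]; [|exists (fun _ _ => zero); easy].
  destruct (@homogeneous_solution N T' V1 V2 A Bm (proj1 hT') dvolt_plus Bm_lin dvolt_lead Bm_onto Bm_0_onto j l (phi b))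
    as [d [Z [HZ1 [HZ2 [HZ3 HZ4]]]]]; [lia|lia|intros q Hq; now apply Hphi|].
  exists Z. intros _. split; [now exists d|easy]. }
destruct (choice _ HZ) as [Z HZ']. clear HZ.
exists (fun a => if Nat.leb a r then Z a else Y (a - r)%nat).
assert (Hnew : forall a, (1 <= a <= r + m)%nat -> (a <= r)%nat /\ (1 <= a <= r)%nat \/ (r < a)%nat /\ (1 <= a - r <= m)%nat) by (intros; lia).
split; [|split].
- intros a Ha. destruct (Hnew a Ha) as [[H1 H2]|[H1 H2]].
  + rewrite (proj2 (Nat.leb_le a r)) by easy. now apply HZ'.
  + rewrite (proj2 (Nat.leb_gt a r)) by easy. now apply HY1.
- intros a Ha. destruct (Hnew a Ha) as [[H1 H2]|[H1 H2]].
  + rewrite (proj2 (Nat.leb_le a r)) by easy. destruct (HZ' a H2) as [_ [Z1 Z2]]. split; [easy|].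
    intros q Hq. rewrite Z2. destruct (Nat.eqb_spec q l); [lia|easy].
  + rewrite (proj2 (Nat.leb_gt a r)) by easy. destruct (HY2 _ H2) as [Y1 Y2]. split; [easy|]. intros q Hq. apply Y2. lia.
- intros e He.
  assert (Hsum : forall i q, sum_n_m (fun a => scal (e a) ((if Nat.leb a r then Z a else Y (a - r)%nat) i q)) 1 (r + m) =
    plus (sum_n_m (fun a => scal (e a) (Z a i q)) 1 r) (sum_n_m (fun a => scal (e (r + a)%nat) (Y a i q)) 1 m)).
  { intros i q. etransitivity; [exact (sum_append (G := E1) _ r m)|]. refine (f_equal2 (@plus E1) _ _).
    - apply sum_n_m_ext_loc. intros a Ha. now rewrite (proj2 (Nat.leb_le a r)) by lia.
    - apply sum_n_m_ext_loc. intros a Ha. rewrite (proj2 (Nat.leb_gt (r + a) r)) by lia.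
      now replace (r + a - r)%nat with a by lia. }
  (* At [t^j (ln t)^l] only the new members have coefficients, and these are the independent vectors
     [phi b]. *)
  assert (H1 : forall a, (1 <= a <= r)%nat -> e a = zero).
  { apply Hind. specialize (He j l Hj). rewrite Hsum in He.
    assert (E1' : sum_n_m (fun a => scal (e (r + a)%nat) (Y a j l)) 1 m = zero).
    { etransitivity; [|exact (sum_n_m_const_zero (G := E1) 1 m)]. apply sum_n_m_ext_loc. intros a Ha.
      rewrite (proj2 (HY2 a Ha)) by lia. exact (scal_zero_r (V := E1) _). }
    rewrite E1' in He. etransitivity; [|exact He]. etransitivity; [|symmetry; exact (plus_zero_r (G := E1) _)].
    apply sum_n_m_ext_loc. intros a Ha. destruct (HZ' a Ha) as [_ [_ Z2]]. now rewrite Z2, Nat.eqb_refl. }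
  (* With the new parameters gone, the relation is one among the old members. *)
  assert (H2 : forall a, (1 <= a <= m)%nat -> e (r + a)%nat = zero).
  { apply (HY3 (fun a => e (r + a)%nat)). intros i q Hi. specialize (He i q Hi). rewrite Hsum in He.
    etransitivity; [|exact He]. etransitivity; [symmetry; exact (plus_zero_l (G := E1) _)|].
    refine (f_equal2 (@plus E1) _ eq_refl).
    etransitivity; [symmetry; exact (sum_n_m_const_zero (G := E1) 1 r)|]. apply sum_n_m_ext_loc. intros a Ha.
    rewrite H1 by easy. symmetry. exact (scal_zero_l (V := E1) _). }
  intros a Ha. destruct (Hnew a Ha) as [[_ Ha']|[Ha' Ha'']]; [now apply H1|].
  replace a with (r + (a - r))%nat by lia. now apply H2.
Qed.

(** Ensures that no free term [t^j (ln t)^l phi] puts a logarithm at [t^0]. *)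
Lemma not_singular_0 i : (1 <= i <= nu)%nat -> js i <> 0%nat.
Proof.
intros Hi E. destruct hC as [H1 _]. destruct (H1 i Hi) as [_ [[_ [_ [[y [Hy Hy0]] _]]] _]].
rewrite E in Hy. destruct hB0 as [Bi [HL [HI _]]]. apply Hy0. rewrite <- (HI y).
unfold null_space in Hy. simpl INR in Hy. rewrite Hy. exact (linear_zero _ HL).
Qed.

(** At a singular point every power of [ln t] below the index contributes one member for each basis
    vector of the null space. *)
Lemma kernel_family_singular i q m Y : (Ns <= N)%nat -> (1 <= i <= nu)%nat -> (q <= ks i)%nat ->
  kernel_family (js i) 0 m Y -> exists Y', kernel_family (js i) q (rs i * q + m) Y'.
Proof.
intros HN Hi Hq HY. pose proof (singular_lt Hi) as Hlt. pose proof (not_singular_0 Hi) as H0.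
destruct hC as [H1 _]. destruct (H1 i Hi) as [_ [Hs [phi Hphi]]].
induction q as [|q IH].
- rewrite Nat.mul_0_r. now exists Y.
- destruct (IH ltac:(lia)) as [Y' HY'].
  replace (rs i * S q + m)%nat with (rs i + (rs i * q + m))%nat by lia.
  apply (@kernel_family_extend (js i) q (rs i * q + m) (rs i) phi Y'); trivial.
  intros b q' Hb Hq'. apply (singular_null Hs); [now apply Hphi|lia].
Qed.

(** Number of parameters due to the singular points from [j] upwards. *)
Definition weight (j : nat) : nat :=
  list_sum (map (fun i => if Nat.leb j (js i) then (rs i * ks i)%nat else 0%nat) (seq 1 nu)).

Lemma list_sum_zero (g : nat -> nat) L : (forall i, In i L -> g i = 0%nat) -> list_sum (map g L) = 0%nat.
Proof.
induction L as [|x L IH]; simpl; intros H; [easy|]. rewrite H by now left. rewrite IH; [easy|]. intros i Hi. apply H. now right.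
Qed.

Lemma list_sum_unique (g : nat -> nat) i L : NoDup L -> In i L -> (forall l, In l L -> l <> i -> g l = 0%nat) ->
  list_sum (map g L) = g i.
Proof.
induction L as [|x L IH]; simpl; intros Hd Hi H; [easy|]. inversion Hd as [|? ? Hx Hd' ]; subst.
destruct Hi as [->|Hi].
- rewrite list_sum_zero; [lia|]. intros l Hl. apply H; [now right|]. intros ->. easy.
- rewrite (H x) by (try (now left); intros ->; easy). simpl. apply IH; trivial. intros l Hl. apply H. now right.
Qed.

Lemma list_sum_plus (g h : nat -> nat) L :
  list_sum (map (fun i => g i + h i)%nat L) = (list_sum (map g L) + list_sum (map h L))%nat.
Proof. induction L as [|x L IH]; simpl; [easy|]. rewrite IH. lia. Qed.

Lemma weight_S j : weight j = (list_sum (map (fun i => if Nat.eqb (js i) j then (rs i * ks i)%nat else 0%nat) (seq 1 nu)) + weight (S j))%nat.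
Proof.
unfold weight. rewrite <- list_sum_plus. f_equal. apply map_ext. intros i.
destruct (Nat.leb_spec j (js i)), (Nat.eqb_spec (js i) j), (Nat.leb_spec (S j) (js i)); lia.
Qed.

(** Levels are treated downwards from [Ns]: new leading coefficients then sit where all earlier
    members vanish, so independence is triangular. *)
Lemma kernel_family_exists j : (Ns <= N)%nat -> (j <= Ns)%nat -> exists l Y, kernel_family j l (weight j) Y.
Proof.
intros HN Hj. replace j with (Ns - (Ns - j))%nat by lia. set (h := (Ns - j)%nat).
assert (Hh : (h <= Ns)%nat) by (unfold h; lia). clearbody h. clear j Hj. induction h as [|h IH].
(* All singular points lie below [Ns], so the family starts empty. *)
- exists 0%nat, (fun _ _ _ => zero). rewrite Nat.sub_0_r. replace (weight Ns) with 0%nat.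
  + split; [|split]; intros; lia.
  + symmetry. apply list_sum_zero. intros i Hi. apply in_seq in Hi.
    pose proof (@singular_lt i ltac:(lia)). destruct (Nat.leb_spec Ns (js i)); [lia|easy].
- destruct (IH ltac:(lia)) as [l [Y [HY1 [HY2 HY3]]]]. set (j := (Ns - S h)%nat).
  replace (Ns - h)%nat with (S j) in * by (unfold j; lia).
  (* The members found so far start at [S j] or later, so at level [j] no power of [ln t] is in use
     yet. *)
  assert (HY : kernel_family j 0 (weight (S j)) Y).
  { split; [easy|split; [|easy]]. intros a Ha. destruct (HY2 a Ha) as [Z _]. split; intros; apply Z; lia. }
  rewrite weight_S. destruct (classic (exists i, (1 <= i <= nu)%nat /\ js i = j)) as [[i [Hi Ei]]|Hno].
  + rewrite (list_sum_unique (i := i)).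
    * rewrite Ei, Nat.eqb_refl. exists (ks i). rewrite <- Ei in HY |- *. exact (kernel_family_singular HN Hi (Nat.le_refl _) HY).
    * apply seq_NoDup.
    * apply in_seq. lia.
    * intros i' Hi' Hne. apply in_seq in Hi'. destruct (Nat.eqb_spec (js i') j) as [E|]; [|easy]. exfalso. apply Hne.
      destruct hC as [_ [Hinj _]]. apply Hinj; [lia|lia|congruence].
  + rewrite list_sum_zero; [exists 0%nat, Y; exact HY|]. intros i Hi. apply in_seq in Hi.
    destruct (Nat.eqb_spec (js i) j) as [E|]; [|easy]. exfalso. apply Hno. exists i. split; [lia|easy].
Qed.

(** * Solutions depending on the parameters *)

Hypothesis hN : (Ns <= N)%nat.
Hypothesis hf0 : f 0 = zero.
Notation smallN := (small (V := V2) N).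

Lemma small_scal_k (c : scalars k) (g : R -> E2) : smallN g -> smallN (fun t => scal c (g t)).
Proof.
intros H e He. pose proof (abs_ge_0 c) as Hc.
destruct (H (e / (abs c + 1))) as [d [Hd D]]; [apply Rdiv_lt_0_compat; lra|].
exists d. split; [easy|]. intros t Ht. eapply Rle_trans; [exact (norm_scal c (g t))|].
apply Rle_trans with ((abs c + 1) * (e / (abs c + 1) * t ^ N)); [|right; field; lra].
apply Rmult_le_compat; [easy|apply (@norm_ge_0 R_AbsRing V2)|lra|exact (D t Ht)].
Qed.

Lemma lpsum_scal_k d (c : scalars k) (X : nat -> nat -> E1) t :
  lpsum (V1 := V1) N d (fun j l => scal c (X j l)) t = scal c (lpsum (V1 := V1) N d X t : E1).
Proof.
unfold lpsum, logpoly. etransitivity; [|symmetry; exact (scal_sum_k (E := E1) c _ _ _)].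
apply sum_n_m_ext. intros j. etransitivity; [|symmetry; exact (scal_of_real_comm (E := E1) c _ _)].
apply (f_equal (rscal (V := E1) (t ^ j))). etransitivity; [|symmetry; exact (scal_sum_k (E := E1) c _ _ _)].
apply sum_n_m_ext. intros l. symmetry. exact (scal_of_real_comm (E := E1) c _ _).
Qed.

Definition comb (m : nat) (c : nat -> scalars k) (Y : nat -> nat -> nat -> E1) (j l : nat) : E1 :=
  sum_n_m (fun a => scal (c a) (Y a j l)) 1 m.

Lemma comb_kernel d m c Y :
  (forall a, (1 <= a <= m)%nat -> admissible (V1 := V1) d (Y a) /\ smallN (A (lpsum (V1 := V1) N d (Y a)))) ->
  admissible (V1 := V1) d (comb m c Y) /\ smallN (A (lpsum (V1 := V1) N d (comb m c Y))).
Proof.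
pose proof hT' as HT'. induction m as [|m IH]; intros H.
- assert (E : comb 0 c Y = fun _ _ => @zero V1).
  { apply functional_extensionality; intros j. apply functional_extensionality; intros l. exact (sum_n_m_zero (G := E1) _ 1 0 ltac:(lia)). }
  rewrite E. split; [easy|]. intros e He. exists T'. split; [easy|]. intros t Ht.
  assert (E0 : A (lpsum (V1 := V1) N d (fun _ _ => zero)) t = zero).
  { assert (EL : lpsum (V1 := V1) N d (fun _ _ => zero) = fun _ : R => @zero V1).
    { apply functional_extensionality; intros s. unfold lpsum, logpoly.
      etransitivity; [|exact (sum_n_m_const_zero (G := V1) 0 N)]. apply sum_n_m_ext. intros j.
      etransitivity; [|exact (scal_zero_r (V := V1) (s ^ j))]. apply (f_equal (scal (s ^ j))).
      etransitivity; [|exact (sum_n_m_const_zero (G := V1) 0 d)]. apply sum_n_m_ext. intros l. exact (scal_zero_r (V := V1) _). }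
    rewrite EL. exact (A_zero (V1 := V1) (V2 := V2) dvolt_plus Ht). }
  rewrite E0. eapply Rle_trans; [right; exact (@norm_zero R_AbsRing V2)|].
  apply Rmult_le_pos; [lra|]. apply pow_le. lra.
- destruct IH as [H1 H2]; [intros a Ha; apply H; lia|]. destruct (H (S m) ltac:(lia)) as [H3 H4].
  assert (E : comb (S m) c Y = fun j l => plus (comb m c Y j l : V1) (scal (c (S m)) (Y (S m) j l))).
  { apply functional_extensionality; intros j. apply functional_extensionality; intros l.
    exact (sum_n_Sm (G := E1) _ 1 m ltac:(lia)). }
  assert (H5 : admissible (V1 := V1) d (fun j l => scal (c (S m)) (Y (S m) j l))).
  { destruct H3 as [H3 H3']. split.
    - intros j l Hl. rewrite H3 by easy. exact (scal_zero_r (V := E1) _).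
    - intros l Hl. rewrite H3' by easy. exact (scal_zero_r (V := E1) _). }
  rewrite E. split; [now apply (admissible_plus (V1 := V1))|].
  apply (small_ext (V := V2) (g := fun t => plus (A (lpsum (V1 := V1) N d (comb m c Y)) t)
    (scal (c (S m)) (A (lpsum (V1 := V1) N d (Y (S m))) t : E2)))).
  + exists T'. split; [easy|]. intros t Ht.
    rewrite <- dvolt_scal by (trivial; now apply (lpsum_cont (V1 := V1))).
    transitivity (plus (A (lpsum (V1 := V1) N d (comb m c Y)) t) (A (lpsum (V1 := V1) N d (fun j l => scal (c (S m)) (Y (S m) j l))) t)).
    { apply f_equal. apply (f_equal (fun g => A g t)). apply functional_extensionality. intros s. symmetry. apply lpsum_scal_k. }
    rewrite <- dvolt_plus by (trivial; now apply (lpsum_cont (V1 := V1))).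
    apply (f_equal (fun g => A g t)). apply functional_extensionality. intros s. symmetry. apply (lpsum_plus N (V1 := V1)).
  + apply (small_plus (V := V2)); [easy|]. now apply small_scal_k.
Qed.

Lemma F_eq (x : R -> E1) t : F n alpha dalpha K K1 df x t = minus (A x t : V2) (df t).
Proof.
unfold F, dvolt. apply (f_equal (fun z => minus z (df t))). refine (f_equal2 (@plus E2) _ eq_refl).
apply (f_equal (plus (K n t t (x t)))). apply sum_n_m_ext_loc. intros i Hi. now rewrite dal_mid.
Qed.

Lemma solution_exists d (X : nat -> nat -> E1) : admissible (V1 := V1) d X ->
  smallN (fun t => minus (A (lpsum (V1 := V1) N d X) t : V2) (df t)) ->
  let xh := log_power_sum N d X in
  exists u : R -> E1,
  is_solution n alpha K f T' (fun t => plus (xh t) (rscal (t ^ Ns) (u t))) /\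
  cont' u /\
  (forall v y : R -> E1, cont' v -> is_solution n alpha K f T' y ->
    (forall t, 0 < t <= T' -> y t = plus (xh t) (rscal (t ^ Ns) (v t))) ->
    forall t, 0 <= t <= T' -> v t = u t) /\
  (exists u_, successive_approximations n alpha dalpha K K1 df Kninv T' Ns xh u_ /\
    uniform_limit_on (fun t => 0 <= t <= T') u_ u).
Proof.
intros HX HS xh. pose proof hT' as HT'. destruct contraction_real as [q [Hq Hc]].
assert (Hxh : cont' (xh : R -> V1)) by exact (@lpsum_cont N T' V1 d X HX).
(* For [t < 1] and [Ns <= N] a bound by [e t^N] is also one by [e t^Ns]. *)
assert (Hres : forall e, 0 < e -> exists d, 0 < d /\ forall t, 0 < t < d -> t <= T' ->
  norm (minus (A xh t : V2) (df t)) <= e * t ^ Ns).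
{ intros e He. destruct (HS e He) as [b [Hb D]]. exists (Rmin b 1). split; [apply Rmin_glb_lt; lra|].
  intros t Ht _. pose proof (Rmin_l b 1). pose proof (Rmin_r b 1).
  eapply Rle_trans; [exact (D t ltac:(lra))|]. apply Rmult_le_compat_l; [lra|].
  replace N with (Ns + (N - Ns))%nat by lia. rewrite pow_add. rewrite <- (Rmult_1_r (t ^ Ns)) at 2.
  apply Rmult_le_compat_l; [apply pow_le; lra|]. rewrite <- (pow1 (N - Ns)). apply pow_incr. lra. }
assert (Hf : cont' (f : R -> V2)) by exact (cont_restrict (C1_continuous hf)).
assert (Hdf : cont' (df : R -> V2)) by exact (cont_restrict (proj2 hf)).
assert (Hder : forall t, 0 < t < T' -> is_derive (V := V2) f t (df t)) by (intros t Ht; apply (C1_derive hf); lra).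
destruct (@weighted_solution T' n alpha bal (proj1 HT') alpha_0 alpha_n alpha_cont' alpha_chain' V1 V2 dal K K1
  alpha_strict' alpha_der K_real_lin K_real_cont K1_real_lin K1_real_cont K_real_der hn dal_0 dal_n Kninv Kninv_real
  bal_cont alpha_bal dal_cont Ns q Hq (Hc Ns (Nat.le_refl _)) f df xh Hf Hder hf0 Hdf Hxh Hres)
  as [u [Hu [Hsol [Huniq [u_ [Hu1 [Hu2 [Hu3 Hu4]]]]]]]].
assert (Hgam : forall t, gamma n alpha dalpha K K1 df Kninv Ns xh t =
  gam (V1 := V1) (V2 := V2) n alpha dal K K1 Kninv Ns df xh t).
{ intros t. unfold gamma, gam. now rewrite F_eq. }
exists u. repeat split.
- exact (@power_part_cont T' V1 Ns xh Hxh u Hu).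
- exact Hsol.
- exact Hu.
- intros v y Hv [Hy1 Hy2] Hyv. exact (Huniq v y Hv Hy1 Hy2 Hyv).
- exists u_. split; [|exact Hu4]. split; [exact Hu1|]. split.
  + intros t Ht. rewrite Hgam. now apply Hu2.
  + intros m t Ht. rewrite Hgam. etransitivity; [exact (Hu3 m t Ht)|].
    refine (f_equal (fun z => plus (opp z) _) _). unfold Zw. rewrite clamp_id by lra. refine (f_equal2 (@plus E1) _ _).
    * rewrite (@Lw_eq T' n alpha bal V1 V2 dal K hn Kninv alpha_bal) by easy. unfold L_op. apply f_equal.
      apply sum_n_m_ext_loc. intros i Hi. now rewrite dal_mid.
    * exact (proj2 (@Kw_eq T' n alpha bal alpha_0 alpha_n alpha_chain' V1 V2 K K1 K_real_cont K1_real_lin K1_real_cont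
        hn Kninv Kninv_real alpha_bal Ns (u_ m) t (Hu1 m) Ht)).
Qed.

(** The sums are built separately, with different bounds on the power of [ln t], while the expansion
    with parameters uses a single bound. *)
Lemma common_degree (P : nat -> nat -> Prop) m : (forall a d d', (d <= d')%nat -> P a d -> P a d') ->
  (forall a, (1 <= a <= m)%nat -> exists d, P a d) -> exists d, forall a, (1 <= a <= m)%nat -> P a d.
Proof.
intros HP. induction m as [|m IH]; intros H; [exists 0%nat; intros; lia|].
destruct IH as [d1 H1]; [intros a Ha; apply H; lia|]. destruct (H (S m) ltac:(lia)) as [d2 H2].
exists (Nat.max d1 d2). intros a Ha. destruct (Nat.eq_dec a (S m)) as [->|Hne].
- apply (HP _ d2); [lia|easy].
- apply (HP _ d1); [lia|]. apply H1. lia.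
Qed.

Definition with_parameters (m : nat) (X0 : nat -> nat -> E1) (Y : nat -> nat -> nat -> E1) (c : nat -> scalars k) (j l : nat) : E1 :=
  plus (X0 j l) (comb m c Y j l).

Lemma coefficients_exist : exists d X0 Y,
  (forall c, admissible (V1 := V1) d (with_parameters (weight 0) X0 Y c) /\
     smallN (fun t => minus (A (lpsum (V1 := V1) N d (with_parameters (weight 0) X0 Y c)) t : V2) (df t))) /\
  (forall e, (forall i q, (i < Ns)%nat -> comb (weight 0) e Y i q = zero) ->
     forall a, (1 <= a <= weight 0)%nat -> e a = zero).
Proof.
destruct (kernel_family_exists hN (Nat.le_0_l Ns)) as [l [Y [HY1 [_ HY3]]]]. set (m := weight 0) in *.
destruct (@solve_expn N T' V1 V2 A Bm (proj1 hT') dvolt_plus Bm_lin dvolt_lead Bm_onto Bm_0_onto 0 df ltac:(lia) df_exp)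
  as [d0 [X0 [HX1 [_ HX2]]]].
(* The condition [d0 <= d] makes [Nat.max d0 d1] equal to [d1] as soon as the family is not
   empty. *)
destruct (@common_degree (fun a d => (d0 <= d)%nat /\ admissible (V1 := V1) d (Y a) /\
  smallN (A (lpsum (V1 := V1) N d (Y a)))) m) as [d1 Hd1].
{ intros a d d' Hd [H0 [H1 H2]]. split; [lia|]. split; [exact (admissible_extend Hd H1)|].
  replace (lpsum (V1 := V1) N d' (Y a)) with (lpsum (V1 := V1) N d (Y a)); [easy|].
  apply functional_extensionality. intros t. symmetry. now apply lpsum_extend. }
{ intros a Ha. destruct (HY1 a Ha) as [d [H1 H2]]. exists (Nat.max d0 d). split; [lia|].
  split; [exact (admissible_extend (Nat.le_max_r d0 d) H1)|].
  replace (lpsum (V1 := V1) N (Nat.max d0 d) (Y a)) with (lpsum (V1 := V1) N d (Y a)); [easy|].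
  apply functional_extensionality. intros t. symmetry. apply lpsum_extend; [lia|easy]. }
set (d := Nat.max d0 d1).
assert (HYd : forall a, (1 <= a <= m)%nat -> admissible (V1 := V1) d (Y a) /\ smallN (A (lpsum (V1 := V1) N d (Y a)))).
{ intros a Ha. destruct (Hd1 a Ha) as [H0 [H1 H2]]. replace d with d1 by (unfold d; lia). easy. }
assert (HXd : admissible (V1 := V1) d X0) by exact (admissible_extend (Nat.le_max_l d0 d1) HX1).
assert (HXs : smallN (fun t => minus (A (lpsum (V1 := V1) N d X0) t : V2) (df t))).
{ replace (lpsum (V1 := V1) N d X0) with (lpsum (V1 := V1) N d0 X0); [exact HX2|].
  apply functional_extensionality. intros t. symmetry. apply lpsum_extend; [unfold d; lia|easy]. }
exists d, X0, Y. split; [|exact HY3].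
intros c. destruct (comb_kernel c HYd) as [C1 C2]. split; [exact (admissible_plus HXd C1)|].
apply (small_ext (V := V2) (g := fun t => plus (minus (A (lpsum (V1 := V1) N d X0) t : V2) (df t))
  (A (lpsum (V1 := V1) N d (comb m c Y)) t))); [|now apply (small_plus (V := V2))].
exists T'. split; [apply hT'|]. intros t Ht.
transitivity (minus (plus (A (lpsum (V1 := V1) N d X0) t) (A (lpsum (V1 := V1) N d (comb m c Y)) t) : V2) (df t)); [vec (realify E2)|].
rewrite <- dvolt_plus by (trivial; now apply (lpsum_cont (V1 := V1))).
apply (f_equal (fun g => minus (A g t : V2) (df t))). apply functional_extensionality. intros s. symmetry.
apply (lpsum_plus N (V1 := V1)).
Qed.

Lemma plus_minus_cancel {G : AbelianGroup} (x y : G) : x = plus y (minus x y).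
Proof. unfold minus. rewrite (plus_comm x), plus_assoc, plus_opp_r. symmetry. apply plus_zero_l. Qed.

Lemma comb_difference m c c' Y j l : comb m c Y j l = plus (comb m c' Y j l) (comb m (fun a => minus (c a) (c' a)) Y j l).
Proof.
unfold comb. etransitivity; [|exact (sum_n_m_plus (G := E1) _ _ 1 m)]. apply sum_n_m_ext. intros a.
etransitivity; [|exact (scal_distr_r (V := E1) _ _ _)]. apply (f_equal (fun z => scal z (Y a j l))).
exact (plus_minus_cancel (G := scalars k) (c a) (c' a)).
Qed.

(* Two expansions whose solutions agree differ by [O(t^Ns)], so they have the same coefficients below [t^Ns]. *)
Lemma parameters_determined d m X0 Y c c' (u u' : R -> E1) :
  (forall c, admissible (V1 := V1) d (with_parameters m X0 Y c)) ->
  cont' (u : R -> V1) -> cont' (u' : R -> V1) ->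
  (forall t, 0 < t <= T' -> plus (log_power_sum N d (with_parameters m X0 Y c) t) (rscal (t ^ Ns) (u t)) =
     plus (log_power_sum N d (with_parameters m X0 Y c') t) (rscal (t ^ Ns) (u' t))) ->
  forall i q, (i < Ns)%nat -> comb m (fun a => minus (c a) (c' a)) Y i q = zero.
Proof.
intros Hadm Hu Hu' Heq i q Hi. pose proof hT' as HT'. set (W := comb m (fun a => minus (c a) (c' a)) Y).
assert (EX : with_parameters m X0 Y c = fun j l => plus (with_parameters m X0 Y c' j l : V1) (W j l)).
{ apply functional_extensionality; intros j. apply functional_extensionality; intros l. unfold with_parameters.
  rewrite comb_difference with (c' := c'). exact (plus_assoc (G := E1) _ _ _). }
destruct (le_lt_dec q d) as [Hq|Hq].
- destruct (continuous_on_bound (V := V1) Hu) as [M HM]. destruct (continuous_on_bound (V := V1) Hu') as [M' HM'].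
  apply (@lpsum_coef_zero V1 N d W Ns ltac:(lia)); [|easy|easy].
  exists (M + M'), T'. split; [easy|]. intros t Ht.
  (* Equality of the two solutions makes the difference of their expansions [t^Ns] times a bounded
     function. *)
  assert (EW : lpsum (V1 := V1) N d W t = scal (t ^ Ns) (minus (u' t : V1) (u t))).
  { specialize (Heq t ltac:(lra)). rewrite EX in Heq.
    pose proof (lpsum_plus N (V1 := V1) d (with_parameters m X0 Y c') W t) as EP.
    set (p := lpsum (V1 := V1) N d (with_parameters m X0 Y c') t) in *.
    change (plus (lpsum (V1 := V1) N d (fun j l => plus (with_parameters m X0 Y c' j l : V1) (W j l)) t) (scal (t ^ Ns) (u t : V1)) =
      plus p (scal (t ^ Ns) (u' t : V1))) in Heq.
    rewrite EP in Heq.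
    transitivity (minus (minus (plus (plus p (lpsum (V1 := V1) N d W t)) (scal (t ^ Ns) (u t : V1))) (scal (t ^ Ns) (u t : V1))) p); [vec (realify E1)|].
    rewrite Heq. vec (realify E1). }
  rewrite EW, (@norm_scal_eq V1), Rabs_right by (apply Rle_ge, pow_le; lra). rewrite Rmult_comm.
  apply Rmult_le_compat_r; [apply pow_le; lra|]. apply (norm_minus_le (V := V1) (HM' t ltac:(lra)) (HM t ltac:(lra))). lra.
(* Beyond the power [d] of [ln t] both expansions have zero coefficients by admissibility. *)
- transitivity (minus (with_parameters m X0 Y c i q : V1) (with_parameters m X0 Y c' i q)).
  + rewrite EX. change (W i q = minus (plus (with_parameters m X0 Y c' i q : V1) (W i q)) (with_parameters m X0 Y c' i q)). vec (realify E1).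
  + destruct (Hadm c) as [H1 _], (Hadm c') as [H2 _]. rewrite H1, H2 by easy. exact (minus_eq_zero (G := V1) zero).
Qed.

End Expansions.

End Data.

Unset Implicit Arguments.

Theorem theorem2
  (k : scalar_field) (E1 E2 : CompleteNormedModule (scalars k))
  (T : R) (hT : 0 < T) (n : nat) (hn : (1 <= n)%nat)
  (alpha dalpha : nat -> R -> R) (halpha : curves_ok T n alpha dalpha)
  (K K1 : nat -> R -> R -> E1 -> E2) (hK : kernels_ok T n alpha K K1)
  (Kninv : R -> E2 -> E1)
  (hKninv : forall t, 0 <= t <= T -> is_bounded_inverse (K n t t) (Kninv t))
  (f df : R -> E2) (hf : is_C1_on (V := realify E2) 0 T f df) (hf0 : f 0 = zero)
  (N : nat) (Kc : nat -> nat -> nat -> E1 -> E2) (fc : nat -> E2)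
  (ac : nat -> nat -> R)
  (hB : condition_B T n alpha K f N Kc fc ac)
  (hBd : condition_B_differentiable T n alpha dalpha K1 df N Kc fc ac)
  (nu : nat) (js ks rs : nat -> nat)
  (hC : condition_C n dalpha K N nu js ks rs)
  (eps T' : R) (Ns : nat) (hD : condition_D T n alpha dalpha K Kninv eps T' Ns)
  (hN : (Ns <= N)%nat)
  (hB0 : has_bounded_inverse (B n dalpha K 0)) :
  let m := list_sum (map (fun i => (rs i * ks i)%nat) (seq 1 nu)) in
  exists (d : nat) (X0 : nat -> nat -> E1) (Y : nat -> nat -> nat -> E1),
  let X (c : nat -> scalars k) (j l : nat) : E1 :=
    plus (X0 j l) (sum_n_m (fun a => scal (c a) (Y a j l)) 1 m) in
  let xhat (c : nat -> scalars k) : R -> E1 := log_power_sum N d (X c) in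
  exists x u : (nat -> scalars k) -> R -> E1,
  (forall c,
     is_solution n alpha K f T' (x c) /\
     continuous_on (fun t => 0 <= t <= T') (u c) /\
     (forall t, 0 < t <= T' ->
        x c t = plus (xhat c t) (rscal (t ^ Ns) (u c t))) /\
     (forall v y : R -> E1,
        continuous_on (fun t => 0 <= t <= T') v ->
        is_solution n alpha K f T' y ->
        (forall t, 0 < t <= T' ->
           y t = plus (xhat c t) (rscal (t ^ Ns) (v t))) ->
        forall t, 0 <= t <= T' -> v t = u c t) /\
     (exists u_ : nat -> R -> E1,
        successive_approximations n alpha dalpha K K1 df Kninv T' Ns (xhat c) u_ /\
        uniform_limit_on (fun t => 0 <= t <= T') u_ (u c)) /\
     (exists M, at_right 0 (fun t =>
        norm (minus (x c t) (xhat c t)) <= M * t ^ Ns))) /\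
  (forall c c',
     (forall t, 0 <= t <= T' -> x c t = x c' t) ->
     forall a, (1 <= a <= m)%nat -> c a = c' a).
Proof.
intros m. pose proof (hT' hD) as HT'.
(* The number [weight 0] is [m] by computation, since the test [Nat.leb 0 (js i)] reduces to
   [true]. *)
destruct (coefficients_exist hT hn halpha hK hD hf hB hBd hC hB0 hN) as [d [X0 [Y [HX HY]]]].
exists d, X0, Y. intros X xhat.
(* Choice over all parameter vectors [c] selects the remainders [u c]. *)
destruct (choice _ (fun c => solution_exists hT hn halpha hK hD hf hN hf0 (proj1 (HX c)) (proj2 (HX c)))) as [u Hu].
exists (fun c t => plus (xhat c t) (rscal (t ^ Ns) (u c t))), u. split.
- intros c. destruct (Hu c) as [H1 [H2 [H3 H4]]]. repeat split; try easy.
  + apply H1.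
  + apply H1.
  + destruct (continuous_on_bound (V := realify E1) H2) as [M HM]. exists M.
    apply at_right_R. exists T'. split; [easy|]. intros t Ht.
    apply Rle_trans with (norm (rscal (t ^ Ns) (u c t))).
    * right. apply f_equal. symmetry. exact (group_cancel (xhat c t) (rscal (t ^ Ns) (u c t))).
    * eapply Rle_trans; [apply norm_rscal|]. rewrite Rabs_right by (apply Rle_ge, pow_le; lra). rewrite Rmult_comm.
      apply Rmult_le_compat_r; [apply pow_le; lra|]. apply HM. lra.
- intros c c' E a Ha.
  (* Equal solutions have equal coefficients below [Ns], and by [HY] these determine the
     parameters. *)
  assert (Z : minus (c a) (c' a) = zero).
  { apply (HY (fun a => minus (c a) (c' a))); [|exact Ha].
    apply (parameters_determined hn hD hN (d := d) (X0 := X0) (u := u c) (u' := u c')).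
    - intros c0. apply HX.
    - apply Hu.
    - apply Hu.
    - intros t Ht. apply (E t). lra. }
  rewrite (plus_minus_cancel (c a) (c' a)), Z. apply plus_zero_r.
Qed.
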